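(* Let $H$ be a real separable Hilbert space of dimension $d\in\mathbb N\cup\{\infty\}$, let $G$ be a group of Möbius transformations of $\hat H$, and let $\mathbf K$ and $\mathbf L$ denote the limit set and the radial limit set of $G$. If $d=\infty$, assume additionally that $\mathbf K$ is compact. Let $\delta=\mathrm{HD}(\mathbf L)$ and $k=\mathrm{TD}(\mathbf K)$, assume $k\ge 1$, and assume $$\mathcal H^\delta(\mathbf K\setminus\mathbf L)=0$$ (which holds, e.g., if $\mathrm{HD}(\mathbf L)<\mathrm{HD}(\mathbf K)$). Then either $\delta>k$, or $\mathbf K$ is a generalized $k$-sphere.
   Context: All sets and measures are Borel. $\mathcal H^s$ denotes $s$-dimensional Hausdorff measure, $\mathrm{HD}$ Hausdorff dimension, $\mathrm{TD}$ topological (covering) dimension. $\hat H=H\cup\{\infty\}$. A Möbius transformation of $\hat H$ is a composition of (extended) similarities of $H$ and inversions $x\mapsto a+r^2(x-a)/\|x-a\|^2$. Every Möbius transformation $g$ has a unique Poincaré extension $\hat g$, a Möbius transformation of $\widehat{\mathbb R\oplus H}$ restricting to $g$ on $\hat H$ and preserving the upper half-space $\mathbb H=(0,\infty)\times H$ (a model of hyperbolic space). Let $\mathbf 0=(1,0)\in\mathbb H$ and let $\mathrm{ht}:\mathbb H\to(0,\infty)$ be projection to the first coordinate. The limit set is $\mathbf K=\{x\in\hat H:\exists g_n\in G,\ \hat g_n(\mathbf 0)\to x\}$. The radial limit set $\mathbf L\subset\mathbf K$ is the set of $p\in\mathbf K$ for which there exist $g_n\in G$ and a constant $C$ with $\hat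 g_n(\mathbf 0)\to p$ and $\|\hat g_n(\mathbf 0)-p\|\le C\,\mathrm{ht}(\hat g_n(\mathbf 0))$ for all $n$. A subset of $\hat H$ is a generalized $k$-sphere if it is either a $k$-dimensional affine subspace of $H$ (together with $\infty$) or a round $k$-dimensional sphere contained in a $(k+1)$-dimensional affine subspace of $H$.
   Formalization: The parenthetical ''which holds, e.g., if HD(L)<HD(K)'' is dropped because it is false: then HD(K\L)=HD(K)>δ, so H^δ(K\L)=∞. H is taken to be R^d or ℓ², to which every real separable Hilbert space of dimension d is isometric. *)

(* Defs.v *)
(* The real separable Hilbert space of
   dimension d (d : option nat, None = infinity) is modelled concretely as
   the space of square-summable real sequences supported in the first d
   coordinates (ell^2 if d = None, R^d otherwise); every real separable
   Hilbert space of dimension d is isometric to this model. *)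
From HB Require Import structures.
From mathcomp Require Import all_boot all_order all_algebra.
From mathcomp Require Import all_classical all_reals all_analysis.
Set Implicit Arguments. Unset Strict Implicit. Unset Printing Implicit Defensive.
Import Order.TTheory GRing.Theory Num.Theory.
Local Open Scope classical_set_scope.
Local Open Scope ring_scope.

Section Mobius.
Context {R : realType}.

Definition sqn (x : nat -> R) : \bar R := (\sum_(0 <= i <oo) ((x i) ^+ 2)%:E)%E.

Definition in_H (d : option nat) (x : nat -> R) : Prop :=
  (sqn x < +oo)%E /\ (forall n, d = Some n -> forall i, (n <= i)%N -> x i = 0).

Definition Hpt (d : option nat) := {x : nat -> R | in_H d x}.

(** \hat H = H u {oo}, with None = oo *)
Definition hat (d : option nat) := option (Hpt d).

Definition nrm (x : nat -> R) : R := Num.sqrt (fine (sqn x)).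

Definition vsub (x y : nat -> R) : nat -> R := fun i => x i - y i.

Definition chordal (d : option nat) (p q : hat d) : R :=
  match p, q with
  | Some x, Some y => 2 * nrm (vsub (sval x) (sval y)) /
      (Num.sqrt (1 + nrm (sval x) ^+ 2) * Num.sqrt (1 + nrm (sval y) ^+ 2))
  | Some x, None | None, Some x => 2 / Num.sqrt (1 + nrm (sval x) ^+ 2)
  | None, None => 0
  end.

Definition is_ext_sim (d : option nat) (f : hat d -> hat d) : Prop :=
  f None = None /\
  (forall x, exists y, f (Some x) = Some y) /\
  (forall y, exists x, f (Some x) = Some y) /\
  exists lam : R, 0 < lam /\
    forall x y x' y', f (Some x) = Some x' -> f (Some y) = Some y' ->
      nrm (vsub (sval x') (sval y')) = lam * nrm (vsub (sval x) (sval y)).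

Definition is_inversion (d : option nat) (f : hat d -> hat d) : Prop :=
  exists (a : Hpt d) (r : R), 0 < r /\
    f None = Some a /\ f (Some a) = None /\
    forall x : Hpt d, sval x <> sval a -> exists y : Hpt d, f (Some x) = Some y /\
      forall i, sval y i = sval a i + r ^+ 2 * (sval x i - sval a i)
                                / nrm (vsub (sval x) (sval a)) ^+ 2.

Inductive mobius (d : option nat) : (hat d -> hat d) -> Prop :=
| mob_sim f : is_ext_sim f -> mobius f
| mob_inv f : is_inversion f -> mobius f
| mob_comp f g : mobius f -> mobius g -> mobius (f \o g).

Definition mobius_group (d : option nat) (G : set (hat d -> hat d)) : Prop :=
  (forall g, G g -> mobius g) /\ G id /\
  (forall g h, G g -> G h -> G (g \o h)) /\
  (forall g, G g -> exists h, G h /\ h \o g = id /\ g \o h = id).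

(** R (+) H_d is identified with H_(d+1), coordinate 0 being the R-factor *)
Definition dsucc (d : option nat) : option nat := omap S d.

Definition embeds (d : option nat) (p : hat d) (q : hat (dsucc d)) : Prop :=
  match p, q with
  | None, None => True
  | Some x, Some y => sval y 0%N = 0 /\ forall i, sval y i.+1 = sval x i
  | _, _ => False
  end.

Definition upper (d : option nat) (q : hat (dsucc d)) : Prop :=
  match q with Some y => 0 < sval y 0%N | None => False end.

Definition ht (d : option nat) (q : hat (dsucc d)) : R :=
  match q with Some y => sval y 0%N | None => 0 end.

Definition origin (d : option nat) (q : hat (dsucc d)) : Prop :=
  exists y, q = Some y /\ sval y 0%N = 1 /\ forall i, sval y i.+1 = 0.

Definition poincare_ext (d : option nat) (g : hat d -> hat d)
    (gh : hat (dsucc d) -> hat (dsucc d)) : Prop :=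
  mobius gh /\ (forall q, upper q <-> upper (gh q)) /\
  (forall p q, embeds p q -> embeds (g p) (gh q)).

Definition hconv (d : option nat) (u : nat -> hat d) (p : hat d) : Prop :=
  forall eps : R, 0 < eps -> exists N, forall n, (N <= n)%N -> chordal (u n) p < eps.

Definition limit_set (d : option nat) (G : set (hat d -> hat d)) : set (hat d) :=
  [set p | exists (gs : nat -> hat d -> hat d)
                  (ghs : nat -> hat (dsucc d) -> hat (dsucc d))
                  (o q : hat (dsucc d)),
     origin o /\ embeds p q /\
     (forall n, G (gs n) /\ poincare_ext (gs n) (ghs n)) /\
     hconv (fun n => ghs n o) q].

Definition radial_set (d : option nat) (G : set (hat d -> hat d)) : set (hat d) :=
  [set p | limit_set G p /\ exists x : Hpt d, p = Some x /\
     exists (gs : nat -> hat d -> hat d)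
            (ghs : nat -> hat (dsucc d) -> hat (dsucc d))
            (o q : hat (dsucc d)) (C : R),
     origin o /\ embeds p q /\
     (forall n, G (gs n) /\ poincare_ext (gs n) (ghs n)) /\
     hconv (fun n => ghs n o) q /\
     forall n, exists y z, ghs n o = Some y /\ q = Some z /\
        nrm (vsub (sval y) (sval z)) <= C * ht (ghs n o)].

Definition diam (d : option nat) (U : set (hat d)) : \bar R :=
  ereal_sup [set r | exists x y, U x /\ U y /\ r = (chordal x y)%:E].

Definition hterm (d : option nat) (s : R) (U : set (hat d)) : \bar R :=
  if `[< U = set0 >] then 0%E else ((fine (diam U)) `^ s)%:E.

Definition hcontent (d : option nat) (s eps : R) (A : set (hat d)) : \bar R :=
  ereal_inf [set S | exists U : nat -> set (hat d),
     A `<=` \bigcup_i U i /\ (forall i, (diam (U i) <= eps%:E)%E) /\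
     S = (\sum_(0 <= i <oo) hterm s (U i))%E].

Definition hmeasure (d : option nat) (s : R) (A : set (hat d)) : \bar R :=
  ereal_sup [set hcontent s eps A | eps in [set e : R | 0 < e]].

Definition HD (d : option nat) (A : set (hat d)) : \bar R :=
  ereal_inf [set s%:E | s in [set s : R | 0 <= s /\ hmeasure s A = 0%E]].

Definition hopen (d : option nat) (O : set (hat d)) : Prop :=
  forall x, O x -> exists e : R, 0 < e /\ forall y, chordal x y < e -> O y.

Definition hcompact (d : option nat) (K : set (hat d)) : Prop :=
  forall (I : Type) (W : I -> set (hat d)), (forall i, hopen (W i)) ->
    K `<=` \bigcup_i W i ->
    exists (m : nat) (f : 'I_m -> I), forall x, K x -> exists j, W (f j) x.

Definition relopen (d : option nat) (A V : set (hat d)) : Prop :=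
  V `<=` A /\ forall x, V x -> exists e : R, 0 < e /\
    forall y, A y -> chordal x y < e -> V y.

Definition covdim_le (d : option nat) (A : set (hat d)) (n : nat) : Prop :=
  forall (m : nat) (W : 'I_m -> set (hat d)),
    (forall i, relopen A (W i)) -> A `<=` \bigcup_i W i ->
    exists (m' : nat) (V : 'I_m' -> set (hat d)),
      (forall j, relopen A (V j)) /\ A `<=` \bigcup_j V j /\
      (forall j, exists i, V j `<=` W i) /\
      forall f : 'I_n.+2 -> 'I_m', injective f ->
        ~ (exists x, A x /\ forall t, V (f t) x).

Definition top_dim_eq (d : option nat) (A : set (hat d)) (k : nat) : Prop :=
  covdim_le A k /\ forall n, (n < k)%N -> ~ covdim_le A n.

Definition lin_indep (d : option nat) (n : nat) (v : 'I_n -> Hpt d) : Prop :=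
  forall t : 'I_n -> R, (forall i, \sum_(j < n) t j * sval (v j) i = 0) ->
    forall j, t j = 0.

Definition in_affine (d : option nat) (n : nat) (b : Hpt d) (v : 'I_n -> Hpt d)
    (x : Hpt d) : Prop :=
  exists t : 'I_n -> R, forall i, sval x i = sval b i + \sum_(j < n) t j * sval (v j) i.

Definition gen_sphere (d : option nat) (K : set (hat d)) (k : nat) : Prop :=
  (exists (b : Hpt d) (v : 'I_k -> Hpt d), lin_indep v /\
     K = [set p | p = None \/ exists x, p = Some x /\ in_affine b v x]) \/
  (exists (c : Hpt d) (v : 'I_k.+1 -> Hpt d) (r : R), lin_indep v /\ 0 < r /\
     K = [set p | exists x, p = Some x /\ in_affine c v x /\
                            nrm (vsub (sval x) (sval c)) = r]).

End Mobius.

(* Main.v *)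
Require Import Defs.
From HB Require Import structures.
From mathcomp Require Import all_boot all_order all_algebra.
From mathcomp Require Import all_classical all_reals all_analysis.
From mathcomp Require Import measurable_realfun.
From mathcomp Require Import ring lra.
Set Implicit Arguments. Unset Strict Implicit. Unset Printing Implicit Defensive.
Import Order.TTheory GRing.Theory Num.Theory.
Import numFieldNormedType.Exports.
Local Open Scope classical_set_scope.
Local Open Scope ring_scope.

(** Suppose HD(L) <= k. An element [g] of the group whose orbit point [g o]
    approaches a radial point [p] acts near [p] as a zoom: in the chordal metric it
    is, up to an explicit conformal factor, a similarity that blows a small
    neighbourhood of [p] up to definite size.

    Measure. If the set of points that can be zoomed with a fixed constant had
    infinite H^k-measure near two points, finitely many zooms would form an
    iterated function system whose limit set is radial of dimension > k.
    Hence K has finite H^k-measure away from one point, and a density argument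
    applies at almost every point of K.

    Segments. Inverting K at a point [xi] of K gives a closed set P(xi) on which
    zooms act as exact similarities. As K has topological dimension k, slicing
    P(xi) by k-1 generic functionals leaves, by Eilenberg's inequality, continua
    of finite length; almost everywhere on these P(xi) contains almost straight
    pieces, even transversally to any j < k directions in which P(xi) is already
    translation invariant.

    Flatness. Zooming along an ultrafilter turns these pieces into exact segments,
    then into rays in a common direction, then into lines, so that some P(xi)
    becomes invariant under one more direction. After k steps a last zoom makes
    some P(xi) an affine k-plane, and undoing the inversion shows that K is a
    generalized k-sphere. *)

(** A zoom contracts everything except a neighbourhood of its pole, the point that its inverse
    assigns to a fixed point far from the target. So of two separated balls at least one is
    contracted, but which one is not under control. This is why the iterated function system needs
    two points of infinite measure, and why H^k is shown finite only away from one point of K. The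
    identity behind everything is [zm_eq]: the conformal factor of a zoom is a product of a function
    of [u] and the same function of [v], and these factors cancel against the inversion at [xi].
    Hence zooms act on P(xi) exactly as similarities, and limits of the sets P(xi_n) are again of
    the form P(xi). In infinite dimension unit vectors need not have convergent subsequences.
    Compactness is therefore drawn from K alone: a direction is represented as a difference of two
    points of some P(xi), and its limit is obtained from the limits of those points. With one
    ultrafilter fixed throughout, all such limits exist at once. *)

Ltac posit := repeat first [assumption | apply: mulr_gt0 | apply: divr_gt0
  | apply: addr_gt0 | apply: exprn_gt0 | rewrite invr_gt0 | apply: ltr0Sn | done].

(** * Hausdorff measures by covers *)

Section Covers.
Context {R : realType}.

Definition pmetric (T : Type) (d : T -> T -> R) :=
  [/\ forall x, d x x = 0, forall x y, d x y = d y x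
    & forall x y z, d x z <= d x y + d y z].

Lemma pmetric_ge0 T (d : T -> T -> R) : pmetric d -> forall x y, 0 <= d x y.
Proof.
case=> d0 ds dt x y; have := dt x y x; rewrite d0 (ds y x) => h; lra.
Qed.

Definition cover_le (T : Type) (d : T -> T -> R) (k : nat) (A : set T) (dl M : R) :=
  exists (U : nat -> set T) (r : nat -> R),
  [/\ A `<=` \bigcup_i U i, forall i, 0 <= r i <= dl,
      forall i x y, U i x -> U i y -> d x y <= r i
    & forall n, \sum_(i < n) r i ^+ k <= M].

(* [Hle d k A M] says that the k-dimensional Hausdorff measure of [A] is at
   most [M]; bounding the partial sums avoids infinite series. *)
Definition Hle (T : Type) (d : T -> T -> R) (k : nat) (A : set T) (M : R) :=
  forall dl e : R, 0 < dl -> 0 < e -> cover_le d k A dl (M + e).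

Definition Hfin (T : Type) (d : T -> T -> R) (k : nat) (A : set T) :=
  exists M, Hle d k A M.

Definition Hnull (T : Type) (d : T -> T -> R) (k : nat) (A : set T) :=
  Hle d k A 0.

Section Basic.
Context (T : Type) (d : T -> T -> R) (k : nat) (k0 : (0 < k)%N).
Implicit Types A B : set T.

Lemma cover_le_sub A B (dl M N : R) : A `<=` B -> M <= N ->
  cover_le d k B dl M -> cover_le d k A dl N.
Proof.
move=> AB MN [U [r [h1 h2 h3 h4]]]; exists U, r; split => //.
  exact: subset_trans h1.
by move=> n; apply: le_trans MN.
Qed.

Lemma Hle_sub A B (M N : R) : A `<=` B -> M <= N -> Hle d k B M -> Hle d k A N.
Proof.
move=> AB MN h dl e dl0 e0; apply: cover_le_sub (h _ _ dl0 e0) => //.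
by rewrite lerD2r.
Qed.

Lemma Hfin_sub A B : A `<=` B -> Hfin d k B -> Hfin d k A.
Proof. by move=> AB [M h]; exists M; apply: Hle_sub h. Qed.

Lemma Hnull_sub A B : A `<=` B -> Hnull d k B -> Hnull d k A.
Proof. by move=> AB; apply: Hle_sub. Qed.

Lemma Hnull_fin A : Hnull d k A -> Hfin d k A.
Proof. by move=> h; exists 0. Qed.

Lemma cover_le_ge0 A dl M : cover_le d k A dl M -> 0 <= M.
Proof. by case=> U [r [_ _ _ /(_ 0%N)]]; rewrite big_ord0. Qed.

Lemma Hle_ge0 A M : Hle d k A M -> 0 <= M.
Proof.
move=> h; rewrite leNgt; apply/negP => M0.
have := @cover_le_ge0 A 1 (M + (- M / 2)).
have e0 : 0 < - M / 2 by lra.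
by move=> /(_ (h _ _ ltr01 e0)) ?; lra.
Qed.

Lemma Hle_lim A M : (forall N, M < N -> Hle d k A N) -> Hle d k A M.
Proof.
move=> h dl e dl0 e0; have e2 : 0 < e / 2 by lra.
have := h (M + e / 2) _ dl (e / 2) dl0 e2; rewrite -addrA -splitr; apply; lra.
Qed.

(** By [Hle_lim] the infimum of the admissible bounds is itself admissible; it is the Hausdorff
    measure as a real number. *)
Lemma Hval A : Hfin d k A -> exists2 a, Hle d k A a & forall b, b < a -> ~ Hle d k A b.
Proof.
move=> [M hM]; pose S : set R := [set a | Hle d k A a].
have S0 : lbound S 0 by move=> x; exact: Hle_ge0.
have Si : has_inf S by split; [exists M | exists 0].
exists (inf S).
  apply: Hle_lim => N /(inf_lt Si.1) [b Sb bN].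
  by apply: Hle_sub Sb => //; exact: ltW.
move=> b bS hb; have : inf S <= b by apply: ge_inf => //; case: Si.
by rewrite leNgt bS.
Qed.

(** The first [N] pairs of the enumeration are distinct and lie in a finite square, so a sum of
    nonnegative terms over them is at most the sum over that square. This merges a sequence of
    countable covers into one. *)
Lemma sum_unpickle (g : nat -> nat -> R) (N : nat) :
  (forall i j, 0 <= g i j) -> exists m,
  \sum_(n < N) (if pickle_inv n is Some p then g (p : nat * nat).1 p.2 else 0)
   <= \sum_(i < m) \sum_(j < m) g i j.
Proof.
move=> g0; pose s := pmap (pickle_inv : nat -> option (nat * nat)%type) (iota 0 N).
pose F (n : nat) := if pickle_inv n is Some p then g (p : nat * nat).1 p.2 else 0.
pose G (p : nat * nat) := g p.1 p.2.
have [m dom] : exists m, forall p : nat * nat, p \in s -> (p.1 < m)%N /\ (p.2 < m)%N.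
  exists (\max_(p <- s) maxn p.1 p.2).+1 => p ps; have : (maxn p.1 p.2 <= \max_(p <- s) maxn p.1 p.2)%N.
    by rewrite (big_rem p ps) /= leq_maxl.
  by rewrite geq_max => /andP[? ?]; rewrite !ltnS.
exists m; pose t := [seq (i, j) | i <- iota 0 m, j <- iota 0 m].
have mt (a b : nat) : (a < m)%N -> (b < m)%N -> (a, b) \in t.
  by move=> ha hb; apply/allpairsPdep; exists a, b; rewrite !mem_iota.
have E1 : \sum_(i < m) \sum_(j < m) g i j = \sum_(p <- t) G p.
  rewrite /t big_allpairs /=.
  rewrite -(big_mkord xpredT (fun i => \sum_(j < m) g i j)) /index_iota subn0.
  apply: eq_bigr => i _.
  by rewrite -(big_mkord xpredT (fun j => g i j)) /index_iota subn0.
have E2 : \sum_(n < N) F n = \sum_(p <- s) G p.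
  rewrite -(big_mkord xpredT F) /index_iota subn0 /s.
  elim: (iota 0 N) => [|a l IH]; first by rewrite !big_nil.
  rewrite big_cons IH /= /F /oapp; case: (pickle_inv a) => [p|] /=.
    by rewrite big_cons.
  by rewrite add0r.
rewrite -/(F _) E1 E2.
have us : uniq s by apply: (pmap_uniq (@pickle_invK _)); exact: iota_uniq.
have ut : uniq t by rewrite allpairs_uniq ?iota_uniq // => -[a b] [a' b'] _ _ [-> ->].
rewrite [leRHS](bigID (mem s)) /= -[leLHS]addr0 lerD //; last first.
  by apply: sumr_ge0 => p _; exact: g0.
rewrite -[leRHS]big_filter.
suff E : perm_eq s [seq x <- t | x \in s].
  by have -> : \sum_(p <- s) G p = \sum_(p <- [seq x <- t | x \in s]) G p by exact: perm_big.
apply: uniq_perm => //; first exact: filter_uniq.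
move=> p; rewrite mem_filter /=; case ps : (p \in s) => //=.
have [p1 p2] := dom p ps.
by case: p {ps} p1 p2 => a b p1 p2; rewrite mt.
Qed.

Lemma cover_le_bigcup (A : nat -> set T) (M : nat -> R) (dl N : R) :
  0 <= dl -> (forall j, cover_le d k (A j) dl (M j)) ->
  (forall n, \sum_(j < n) M j <= N) -> cover_le d k (\bigcup_j A j) dl N.
Proof.
move=> dl0 h hM.
have /choice[U /choice[r Hr]] := h.
exists (fun n => if pickle_inv n is Some p then U (p : nat * nat).1 p.2 else set0).
exists (fun n => if pickle_inv n is Some p then r (p : nat * nat).1 p.2 else 0).
split.
- move=> x [j _ Ajx]; have [h1 _ _ _] := Hr j; have [i _ Ui] := h1 _ Ajx.
  by exists (pickle (j, i)) => //; rewrite pickleK_inv.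
- move=> n; case: (pickle_inv n) => [[i j]|] /=; last by rewrite lexx.
  by have [_ + _ _] := Hr i; apply.
- move=> n x y; case: (pickle_inv n) => [[i j]|] //=.
  by have [_ _ + _] := Hr i; apply.
move=> n; have := @sum_unpickle (fun i j => r i j ^+ k) n.
case=> [i j|m hm].
  by have [_ /(_ j)/andP[? _] _ _] := Hr i; exact: exprn_ge0.
apply: le_trans (hM m); apply: le_trans (le_trans hm _); last first.
  by apply: ler_sum => i _; have [_ _ _ +] := Hr i; apply.
apply: ler_sum => i _; case: (pickle_inv i) => [p|] //=.
by rewrite expr0n; case: k k0.
Qed.

Lemma sum_geo (e : R) n : 0 <= e -> \sum_(j < n) e / 2 ^+ j.+1 <= e.
Proof.
move=> e0; suff -> : \sum_(j < n) e / 2 ^+ j.+1 = e - e / 2 ^+ n.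
  by rewrite lerBlDr lerDl divr_ge0 // exprn_ge0.
elim: n => [|n IH]; first by rewrite big_ord0 expr0 divr1 subrr.
rewrite big_ord_recr /= IH exprS; have : (2 : R) ^+ n != 0 by rewrite expf_neq0 // pnatr_eq0.
by move=> h; field.
Qed.

Lemma Hle_bigcup (A : nat -> set T) (M : nat -> R) (N : R) :
  (forall j, Hle d k (A j) (M j)) ->
  (forall n, \sum_(j < n) M j <= N) -> Hle d k (\bigcup_j A j) N.
Proof.
move=> h hM dl e dl0 e0.
apply: (@cover_le_bigcup A (fun j => M j + e / 2 ^+ j.+1)); first exact: ltW.
  by move=> j; apply: h => //; rewrite divr_gt0 // exprn_gt0.
by move=> n; rewrite big_split /=; apply: lerD; [exact: hM|apply: sum_geo; exact: ltW].
Qed.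

Lemma Hnull_bigcup (A : nat -> set T) :
  (forall j, Hnull d k (A j)) -> Hnull d k (\bigcup_j A j).
Proof. by move=> h; apply: (Hle_bigcup h) => n; rewrite big1. Qed.

Lemma Hle0 : Hle d k set0 0.
Proof.
move=> dl e dl0 e0; exists (fun=> set0), (fun=> 0); split => //.
  by move=> i; rewrite lexx ltW.
by move=> n; rewrite big1 ?add0r ?ltW // => i _; rewrite expr0n; case: k k0.
Qed.

Lemma HleU A B M N : Hle d k A M -> Hle d k B N -> Hle d k (A `|` B) (M + N).
Proof.
move=> hA hB.
have M0 := Hle_ge0 hA; have N0 := Hle_ge0 hB.
apply: (@Hle_sub _ (\bigcup_j (if j is 0 then A else if j is 1 then B else set0)) _ (M + N)) => //.
  by move=> x [Ax|Bx]; [exists 0%N|exists 1%N].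
apply: (@Hle_bigcup _ (fun j => if j is 0 then M else if j is 1 then N else 0)).
  by move=> [|[|j]] //; exact: Hle0.
move=> [|[|n]]; first by rewrite big_ord0 addr_ge0.
  by rewrite big_ord_recr big_ord0 /= add0r lerDl.
by rewrite !big_ord_recl /= big1 ?addr0.
Qed.

Lemma HfinU A B : Hfin d k A -> Hfin d k B -> Hfin d k (A `|` B).
Proof. by move=> [M hM] [N hN]; exists (M + N); exact: HleU. Qed.

Lemma HnullU A B : Hnull d k A -> Hnull d k B -> Hnull d k (A `|` B).
Proof. by move=> hA hB; rewrite /Hnull -(addr0 0); exact: HleU. Qed.

Lemma Hnull_diff A B : ~ Hnull d k A -> Hnull d k B -> ~ Hnull d k (A `\` B).
Proof.
move=> nA hB hAB; apply: nA; apply: Hnull_sub (HnullU hAB hB) => x Ax.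
by have [Bx|Bx] := pselect (B x); [right|left].
Qed.

Lemma Hnull_nonempty A : ~ Hnull d k A -> exists x, A x.
Proof.
move=> nA; apply: contrapT => h; apply: nA; apply: Hnull_sub Hle0 => x Ax.
by case: h; exists x.
Qed.

Lemma Hnull1 x : d x x = 0 -> Hnull d k [set x].
Proof.
move=> dx dl e dl0 e0; exists (fun=> [set x]), (fun=> 0); split.
- by move=> y ->; exists 0%N.
- by move=> i; rewrite lexx ltW.
- by move=> i y z -> ->; rewrite dx.
by move=> n; rewrite big1 ?add0r ?ltW // => i _; rewrite expr0n; case: k k0.
Qed.

(* Since [k > 0], a cover of small total cost consists of small sets. *)
Lemma HnullP A : Hnull d k A <->
  forall e : R, 0 < e -> exists dl, cover_le d k A dl e.
Proof.
split=> [h e e0|h dl e dl0 e0].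
  by exists 1; have := h 1 e ltr01 e0; rewrite add0r.
have m0 : 0 < Num.min e (dl ^+ k) by rewrite lt_min e0 exprn_gt0.
have [dl' [U [r [h1 h2 h3 h4]]]] := h _ m0; exists U, r; split => //.
  move=> i; have /andP[r0 _] := h2 i; rewrite r0 /=.
  rewrite -(@ler_pXn2r _ k) ?nnegrE ?(ltW dl0) //.
  apply: (@le_trans _ _ (Num.min e (dl ^+ k))); last by rewrite ge_min lexx orbT.
  apply: le_trans (h4 i.+1); rewrite big_ord_recr /= lerDr sumr_ge0 // => j _.
  by have /andP[? _] := h2 j; exact: exprn_ge0.
by move=> n; rewrite add0r; apply: le_trans (h4 n) _; rewrite ge_min lexx.
Qed.

Lemma nHnullP A : ~ Hnull d k A ->
  exists2 e : R, 0 < e & forall dl, ~ cover_le d k A dl e.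
Proof.
move=> /HnullP/existsNP[e /not_implyP[e0 he]]; exists e => // dl hc.
by apply: he; exists dl.
Qed.

Lemma nHnull_nHle A : ~ Hnull d k A -> exists2 e : R, 0 < e & ~ Hle d k A e.
Proof.
move=> /nHnullP[e e0 he]; exists (e / 2); first lra.
move=> /(_ 1 (e / 2) ltr01); rewrite -splitr => hc.
by apply: (he 1); apply: hc; lra.
Qed.

(** A cover of mesh below [s] has no member meeting both sets, so it splits into a cover of each.
    Lower bounds on the measure are expressed as failures of [Hle]. *)
Lemma Hle_superadd A B (a b s : R) : 0 < s ->
  (forall x y, A x -> B y -> s <= d x y) ->
  ~ Hle d k A a -> ~ Hle d k B b -> ~ Hle d k (A `|` B) (a + b).
Proof.
move=> s0 sep /existsNP[d1 /existsNP[e1 /not_implyP[d10 /not_implyP[e10 h1]]]].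
move=> /existsNP[d2 /existsNP[e2 /not_implyP[d20 /not_implyP[e20 h2]]]] h.
pose dl := Num.min (Num.min d1 d2) (s / 2).
have dl0 : 0 < dl by rewrite !lt_min d10 d20 divr_gt0.
have e0 : 0 < e1 + e2 by rewrite addr_gt0.
have [U [r [c1 c2 c3 c4]]] := h _ _ dl0 e0.
have dls : dl < s by apply: (@le_lt_trans _ _ (s / 2)); [rewrite ge_min lexx orbT|lra].
pose rA i := if `[< exists2 x, A x & U i x >] then r i else 0.
pose rB i := if `[< exists2 x, B x & U i x >] then r i else 0.
have dld1 : dl <= d1 by rewrite !ge_min lexx.
have dld2 : dl <= d2 by rewrite !ge_min lexx orbT.
have nA : exists n, ~ (\sum_(i < n) rA i ^+ k <= a + e1).
  apply/existsNP => hA; apply: h1; exists (fun i => U i `&` A), rA; split => //.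
  - by move=> x Ax; have [i _ Ui] := c1 x (or_introl Ax); exists i.
  - move=> i; rewrite /rA; case: asboolP => _; last by rewrite lexx ltW.
    by have /andP[-> /le_trans] := c2 i; apply.
  - move=> i x y [Ux Ax] [Uy Ay]; rewrite /rA asboolT; first exact: c3.
    by exists x.
have nB : exists n, ~ (\sum_(i < n) rB i ^+ k <= b + e2).
  apply/existsNP => hB; apply: h2; exists (fun i => U i `&` B), rB; split => //.
  - by move=> x Ax; have [i _ Ui] := c1 x (or_intror Ax); exists i.
  - move=> i; rewrite /rB; case: asboolP => _; last by rewrite lexx ltW.
    by have /andP[-> /le_trans] := c2 i; apply.
  - move=> i x y [Ux Ax] [Uy Ay]; rewrite /rB asboolT; first exact: c3.
    by exists x.
have [n /negP] := nA; have [m /negP] := nB; rewrite -!ltNge => hm hn.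
have r0 i : 0 <= r i by have /andP[] := c2 i.
have mono (f : nat -> R) p q : (forall i, 0 <= f i) -> (p <= q)%N ->
    \sum_(i < p) f i <= \sum_(i < q) f i.
  move=> f0 pq; rewrite -(subnKC pq) big_split_ord /= lerDl; exact: sumr_ge0.
have rA0 i : 0 <= rA i ^+ k by rewrite /rA; case: ifP => _; rewrite exprn_ge0.
have rB0 i : 0 <= rB i ^+ k by rewrite /rB; case: ifP => _; rewrite exprn_ge0.
have := c4 (maxn n m).
have : \sum_(i < maxn n m) rA i ^+ k + \sum_(i < maxn n m) rB i ^+ k
       <= \sum_(i < maxn n m) r i ^+ k.
  rewrite -big_split /=; apply: ler_sum => i _; rewrite /rA /rB.
  have z0 : (0 : R) ^+ k = 0 by rewrite expr0n; case: k k0.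
  case: asboolP => [[x Ax Ux]|_]; case: asboolP => [[y By Uy]|_];
    rewrite ?z0 ?addr0 ?add0r ?exprn_ge0 //.
  have := sep _ _ Ax By; have := c3 _ _ _ Ux Uy; have /andP[_] := c2 i; lra.
have := mono _ _ _ rA0 (leq_maxl n m); have := mono _ _ _ rB0 (leq_maxr n m).
lra.
Qed.

End Basic.

Lemma cover_le_image (T T' : Type) (d : T -> T -> R) (d' : T' -> T' -> R) (k : nat)
  (f : T -> T') (A : set T) (L dl M : R) : 0 <= L ->
  (forall x y, A x -> A y -> d' (f x) (f y) <= L * d x y) ->
  cover_le d k A dl M -> cover_le d' k (f @` A) (L * dl) (L ^+ k * M).
Proof.
move=> L0 hf [U [r [h1 h2 h3 h4]]].
exists (fun i => f @` (U i `&` A)), (fun i => L * r i); split.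
- by move=> _ [x Ax <-]; have [i _ Ui] := h1 x Ax; exists i => //; exists x.
- move=> i; have /andP[r0 rd] := h2 i; apply/andP; split; first exact: mulr_ge0.
  exact: ler_wpM2l.
- move=> i _ _ [x [Ux Ax] <-] [y [Uy Ay] <-]; apply: le_trans (hf _ _ Ax Ay) _.
  by apply: ler_wpM2l => //; exact: h3 Ux Uy.
move=> n; under eq_bigr do rewrite exprMn.
by rewrite -mulr_sumr ler_wpM2l // exprn_ge0.
Qed.

Lemma Hle_image (T T' : Type) (d : T -> T -> R) (d' : T' -> T' -> R) (k : nat)
  (f : T -> T') (A : set T) (L M : R) : 0 < L ->
  (forall x y, A x -> A y -> d' (f x) (f y) <= L * d x y) ->
  Hle d k A M -> Hle d' k (f @` A) (L ^+ k * M).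
Proof.
move=> L0 hf h dl e dl0 e0.
have Lk : 0 < L ^+ k by rewrite exprn_gt0.
have := h (dl / L) (e / L ^+ k) (divr_gt0 dl0 L0) (divr_gt0 e0 Lk).
move=> /(cover_le_image (ltW L0) hf).
by rewrite mulrDr !mulrA ![_ * _ / _]mulrAC !mulfV ?mul1r ?lt0r_neq0.
Qed.

Lemma Hnull_image (T T' : Type) (d : T -> T -> R) (d' : T' -> T' -> R) (k : nat)
  (f : T -> T') (A : set T) (L : R) : 0 < L ->
  (forall x y, A x -> A y -> d' (f x) (f y) <= L * d x y) ->
  Hnull d k A -> Hnull d' k (f @` A).
Proof.
by move=> L0 hf /(Hle_image L0 hf); rewrite mulr0.
Qed.

Lemma Hfin_image (T T' : Type) (d : T -> T -> R) (d' : T' -> T' -> R) (k : nat)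
  (f : T -> T') (A : set T) (L : R) : 0 < L ->
  (forall x y, A x -> A y -> d' (f x) (f y) <= L * d x y) ->
  Hfin d k A -> Hfin d' k (f @` A).
Proof.
by move=> L0 hf [M /(Hle_image L0 hf) h]; exists (L ^+ k * M).
Qed.

(* Greedy selection behind the Vitali covering lemma; [c] is the conflict
   relation, typically "the two sets meet". *)
Lemma greedy_selection (I : Type) (F : set I) (sz : I -> R) (c : I -> I -> Prop) (B : R) :
  (forall i, F i -> 0 < sz i <= B) ->
  (forall u : nat -> I, (forall n, F (u n)) ->
     (forall m n, (m < n)%N -> ~ c (u m) (u n)) ->
     forall e : R, 0 < e -> exists n, sz (u n) < e) ->
  exists s : nat -> option I,
  [/\ forall n i, s n = Some i -> F i,
      forall m n i j, (m < n)%N -> s m = Some i -> s n = Some j -> ~ c i j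
    & forall j, F j -> exists n i, [/\ s n = Some i, c i j & sz j <= 2 * sz i]].
Proof.
move=> hsz hdec.
pose av (l : seq I) := [set i | F i /\ forall a, List.In a l -> ~ c a i].
(* The pick is within a factor 2 of the largest available size; [None] means that nothing is
   available any more. *)
have pickP l : exists o : option I,
    if o is Some i then av l i /\ (forall j, av l j -> sz j <= 2 * sz i)
    else forall j, ~ av l j.
  have [[j0 avj]|nav] := pselect (exists j, av l j); last first.
    by exists None => j hj; apply: nav; exists j.
  pose S := sz @` av l.
  have S0 : S !=set0 by exists (sz j0), j0.
  have Sb : has_sup S.
    by split=> //; exists B => _ [i [Fi _] <-]; have /andP[] := hsz _ Fi.
  have sp : 0 < sup S.
    have /andP[p _] := hsz _ avj.1; apply: lt_le_trans p _.
    by apply: ub_le_sup; [case: Sb|exists j0].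
  have : sup S / 2 < sup S by lra.
  move=> /(sup_gt S0)[_ [i avi <-] hi]; exists (Some i); split => // j avj'.
  have : sz j <= sup S by apply: ub_le_sup; [case: Sb|exists j].
  lra.
have /choice[pick hpick] := pickP.
pose fix ls n : seq I := if n is n'.+1 then
  (if pick (ls n') is Some i then i :: ls n' else ls n') else [::].
pose s n := pick (ls n).
have lsin m n i : (m < n)%N -> s m = Some i -> List.In i (ls n).
  elim: n => // n IH; rewrite ltnS leq_eqVlt => /orP[/eqP ->|mn] sm /=.
    by rewrite -/(s n) sm; left.
  by case: (pick (ls n)) => [a|]; [right|]; exact: IH.
have inls n a : List.In a (ls n) -> exists2 m, (m < n)%N & s m = Some a.
  elim: n => //= n IH; case E : (pick (ls n)) => [b|].
    by move=> [<-|/IH[m mn sm]]; [exists n|exists m => //; exact: ltnW].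
  by move=> /IH[m mn sm]; exists m => //; exact: ltnW.
have sav n i : s n = Some i -> av (ls n) i.
  by move=> sn; have := hpick (ls n); rewrite -/(s n) sn => -[].
exists s; split.
- by move=> n i /sav[].
- by move=> m n i j mn sm /sav[_]; apply; exact: lsin sm.
(* An item without a conflict of comparable size stays available for ever, so every pick has at
   least half its size; this contradicts the decay of sizes. *)
move=> j Fj; apply: contrapT => hn.
have hn' n i : s n = Some i -> c i j -> 2 * sz i < sz j.
  move=> sn cij; rewrite ltNge; apply/negP => hle; apply: hn.
  by exists n, i.
have avj n : av (ls n) j.
  split=> // a /inls[m _]; elim/ltn_ind: m a => m IH a sm caj.
  have := hn' _ _ sm caj; have := hpick (ls m); rewrite -/(s m) sm => -[_ h].
  have : av (ls m) j by split=> // b /inls[m' mm' sm'] cb; exact: IH mm' _ sm' cb.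
  by move=> /h; lra.
have sS n : exists i, s n = Some i.
  case E : (s n) => [i|]; first by exists i.
  by have := hpick (ls n); rewrite -/(s n) E => /(_ j (avj n)).
have /choice[u hu] := sS.
have /andP[szj _] := hsz _ Fj.
have [|||n hn2] := hdec u _ _ (sz j / 2).
- by move=> n; have [] := sav _ _ (hu n).
- by move=> m n mn; have [_] := sav _ _ (hu n); apply; exact: lsin (hu m).
- lra.
have := hpick (ls n); rewrite -/(s n) hu => -[_ /(_ j (avj n))]; lra.
Qed.

End Covers.

(** * Limits along an ultrafilter *)

Definition free_ultra (U : set (set nat)) :=
  [/\ forall A B, U A -> U B -> U (A `&` B), forall A B, A `<=` B -> U A -> U B,
      ~ U set0, forall A, U A \/ U (~` A)
    & forall N, U [set n | (N <= n)%N]].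

Lemma free_ultra_exists : exists U, free_ultra U.
Proof.
pose F : set (set nat) := [set A | exists N, forall n, (N <= n)%N -> A n].
have FF : ProperFilter F.
  apply: Build_ProperFilter; first by move=> [N /(_ N (leqnn N))].
  split; first by exists 0%N.
  - move=> P Q [N hN] [M hM]; exists (maxn N M) => n; rewrite geq_max => /andP[? ?].
    by split; [exact: hN|exact: hM].
  - by move=> P Q PQ [N hN]; exists N => n /hN /PQ.
have [G [GU FG]] := ultraFilterLemma FF; exists G; split.
- by move=> A B GA GB; exact: filterI.
- by move=> A B AB; exact: filterS.
- exact: filter_not_empty.
- by move=> A; exact: in_ultra_setVsetC.
- by move=> N; apply: FG; exists N.
Qed.

Section Ultra.
Context {R : realType} (U : set (set nat)) (uU : free_ultra U).

Lemma uI A B : U A -> U B -> U (A `&` B).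
Proof. by case: uU => + _ _ _ _; apply. Qed.

Lemma uS A B : A `<=` B -> U A -> U B.
Proof. by case: uU => _ + _ _ _; apply. Qed.

Lemma uT : U setT.
Proof. by case: uU => _ uS' _ _ /(_ 0%N); apply: uS'. Qed.

Lemma uA (A : set nat) : (forall n, A n) -> U A.
Proof. by move=> h; apply: uS uT => n _; exact: h. Qed.

Lemma uC A : ~ U A -> U (~` A).
Proof. by move=> h; case: uU => _ _ _ /(_ A) []. Qed.

Lemma u_ge N : U [set n | (N <= n)%N].
Proof. by case: uU. Qed.

Lemma u_ex A : U A -> exists n, A n.
Proof.
move=> UA; apply: contrapT => h; case: uU => _ _ u0 _ _; apply: u0.
by apply: uS UA => n An; case: h; exists n.
Qed.

Lemma u_ex_ge A N : U A -> exists2 n, (N <= n)%N & A n.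
Proof. by move=> UA; have [n [? ?]] := u_ex (uI UA (u_ge N)); exists n. Qed.

Lemma u_inv (e : R) : 0 < e -> U [set n | n.+1%:R^-1 < e].
Proof.
move=> e0; apply: uS (u_ge (Num.truncn e^-1)) => n /= hn.
rewrite invf_plt ?posrE //; apply: lt_le_trans (truncnS_gt _) _.
by rewrite ler_nat ltnS.
Qed.

Lemma inv_lt (e : R) : 0 < e -> exists n, n.+1%:R^-1 < e.
Proof. by move/u_inv/u_ex. Qed.

Definition ucvg (T : Type) (d : T -> T -> R) (u : nat -> T) (x : T) :=
  forall e : R, 0 < e -> U [set n | d (u n) x < e].

(** Every sequence converges along the one fixed ultrafilter, so no subsequences are extracted and
    limits of several sequences are automatically compatible. *)
Definition ucompact (T : Type) (d : T -> T -> R) (K : set T) :=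
  forall u : nat -> T, (forall n, K (u n)) -> exists2 x, K x & ucvg d u x.

Section Metric.
Context (T : Type) (d : T -> T -> R) (pd : pmetric d).
Let d0 x : d x x = 0. Proof. by case: pd. Qed.
Let dC x y : d x y = d y x. Proof. by case: pd. Qed.
Let dT x y z : d x z <= d x y + d y z. Proof. by case: pd. Qed.
Let dge0 := pmetric_ge0 pd.

Lemma ucvg_cst x : ucvg d (fun=> x) x.
Proof. by move=> e e0; apply: uA => n /=; rewrite d0. Qed.

Lemma ucvg_dist u v x y : ucvg d u x -> ucvg d v y -> forall e : R, 0 < e ->
  U [set n | `|d (u n) (v n) - d x y| < e].
Proof.
move=> hu hv e e0; have e2 : 0 < e / 2 by lra.
apply: uS (uI (hu _ e2) (hv _ e2)) => n [/= h1 h2].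
have := dT (u n) x (v n); have := dT x y (v n); have := dT x (u n) y.
have := dT (u n) (v n) y; rewrite (dC x (u n)) (dC y (v n)) ltr_norml => *.
by apply/andP; split; lra.
Qed.

Context (K : set T) (cK : ucompact d K).

Lemma no_separated (u : nat -> T) (e : R) : 0 < e -> (forall n, K (u n)) ->
  ~ (forall m n, (m < n)%N -> e <= d (u m) (u n)).
Proof.
move=> e0 Ku h; have [x _ hx] := cK Ku; have e2 : 0 < e / 2 by lra.
have [m /= hm] := u_ex (hx _ e2).
have [n mn /= hn] := u_ex_ge m.+1 (hx _ e2).
by have := h _ _ mn; have := dT (u m) x (u n); rewrite (dC x); lra.
Qed.

Lemma finite_net (e : R) : 0 < e -> exists l : seq T,
  (forall x, List.In x l -> K x) /\ forall x, K x -> exists2 y, List.In y l & d x y < e.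
Proof.
move=> e0; apply: contrapT => hn.
pose good (l : seq T) := forall x, List.In x l -> K x.
have nx (l : {l | good l}) : exists x, K x /\ forall y, List.In y (sval l) -> e <= d x y.
  apply: contrapT => h; apply: hn; exists (sval l); split; first exact: (svalP l).
  move=> x Kx; apply: contrapT => h2; apply: h; exists x; split => // y ly.
  by rewrite leNgt; apply/negP => dxy; apply: h2; exists y.
have /choice[f hf] := nx.
have gnil : good [::] by [].
have gcons l : good (f l :: sval l).
  by move=> x [<-|lx]; [exact: (hf l).1|exact: (svalP l)].
pose fix ls n : {l | good l} := if n is n'.+1 then exist _ _ (gcons (ls n'))
  else exist _ _ gnil.
pose u n := f (ls n).
have inls m n : (m < n)%N -> List.In (u m) (sval (ls n)).
  elim: n => // n IH; rewrite ltnS leq_eqVlt => /orP[/eqP ->|mn] /=; first by left.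
  by right; exact: IH.
apply: (@no_separated u e e0) => [n|m n mn]; first exact: (hf _).1.
by rewrite dC; apply: (hf (ls n)).2; exact: inls.
Qed.

Lemma dense_seq x0 : K x0 -> exists D : nat -> T, (forall n, K (D n)) /\
  forall x (e : R), K x -> 0 < e -> exists n, d x (D n) < e.
Proof.
move=> Kx0; have h n : exists l : seq T, (forall x, List.In x l -> K x) /\
    forall x, K x -> exists2 y, List.In y l & d x y < n.+1%:R^-1.
  by apply: finite_net; rewrite invr_gt0.
have /choice[l hl] := h.
exists (fun m => if pickle_inv m is Some p then List.nth (p : nat * nat).2 (l p.1) x0 else x0).
split=> [m|x e Kx e0].
  case: (pickle_inv m) => // p; have [hp|hp] := List.nth_in_or_default p.2 (l p.1) x0.
    exact: (hl _).1 hp.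
  by rewrite hp.
have [n hn] := inv_lt e0; have [y ly dy] := (hl n).2 x Kx.
have [i [_ hi]] := List.In_nth _ _ x0 ly.
by exists (pickle (n, i)); rewrite pickleK_inv /= hi; exact: lt_trans hn.
Qed.

(** Call a point bad if [A] is outside the ideal [J] in all its neighbourhoods. If no point other
    than [x0] is bad, compactness puts [A] in [J] outside each ball about [x0]; otherwise there are
    two bad points. It is applied to the ideal of sets of finite measure and to that of null
    sets. *)
Lemma ideal_dichotomy (J : set (set T)) (A : set T) x00 : K x00 ->
  J set0 -> (forall B C, B `<=` C -> J C -> J B) ->
  (forall B C, J B -> J C -> J (B `|` C)) -> A `<=` K ->
  (exists2 x0, K x0 & forall e : R, 0 < e -> J (A `&` [set x | e <= d x x0])) \/
  exists x1 x2, [/\ K x1, K x2, 0 < d x1 x2,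
    forall r : R, 0 < r -> ~ J (A `&` [set x | d x x1 <= r])
    & forall r : R, 0 < r -> ~ J (A `&` [set x | d x x2 <= r])].
Proof.
move=> Kx00 J0 Js JU AK.
pose bad x := forall r : R, 0 < r -> ~ J (A `&` [set y | d y x <= r]).
have [[x1 [x2 [K1 K2 d12 b1 b2]]]|nb] := pselect (exists x1 x2, [/\ K x1, K x2, 0 < d x1 x2, bad x1 & bad x2]).
  by right; exists x1, x2.
left.
have [x0 [Kx0 hx0]] : exists x0, K x0 /\ forall x, K x -> 0 < d x x0 -> ~ bad x.
  have [[x0 [Kx0 b0]]|nb0] := pselect (exists x0, K x0 /\ bad x0).
    by exists x0; split=> // x Kx dx bx; apply: nb; exists x, x0.
  by exists x00; split=> // x Kx _ bx; apply: nb0; exists x.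
exists x0 => // eta eta0.
have [e [e0 he]] : exists e : R, 0 < e /\ forall x, K x -> eta <= d x x0 ->
    J (A `&` [set y | d y x <= e]).
  apply: contrapT => hn.
  have nx n : exists x, [/\ K x, eta <= d x x0 & ~ J (A `&` [set y | d y x <= n.+1%:R^-1])].
    apply: contrapT => h; apply: hn; exists n.+1%:R^-1; split; first by rewrite invr_gt0.
    by move=> x Kx hx; apply: contrapT => hJ; apply: h; exists x.
  have /choice[u hu] := nx.
  have [|x Kx hx] := cK (u := u); first by move=> n; case: (hu n).
  have dx : 0 < d x x0.
    have [n /= hn'] := u_ex (hx _ (divr_gt0 eta0 (ltr0n _ 2))).
    by have [_ h _] := hu n; have := dT (u n) x x0; lra.
  have /existsNP[r /not_implyP[r0 /contrapT hr]] := hx0 x Kx dx.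
  have r2 : 0 < r / 2 by lra.
  have [n [/= h1 h2]] := u_ex (uI (hx _ r2) (u_inv r2)).
  have [_ _] := hu n; apply; apply: (Js) hr => y [Ay /= hy]; split => //=.
  apply: le_trans (dT y (u n) x) _; rewrite (splitr r); apply: lerD; last exact: ltW.
  exact: le_trans hy (ltW h2).
have e2 : 0 < e / 2 by lra.
have [l [lK hl]] := finite_net e2.
suff : J (A `&` [set x | eta <= d x x0 /\ exists2 y, List.In y l & d x y < e / 2]).
  apply: (Js) => x [Ax /= hx]; split => //=; split => //.
  by apply: hl; exact: AK.
elim: l {lK hl} => [|y l IH].
  by apply: (Js) J0 => x [_ [_ []]].
apply: (Js) (JU _ _ IH (_ : J (A `&` [set x | eta <= d x x0 /\ d x y < e / 2]))) => [x|].
  move=> [Ax [hx [z [<-|lz] dz]]]; first by right.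
  by left; split=> //=; split=> //; exists z.
have [[x [Ax hx dx]]|nx] := pselect (exists x, [/\ A x, eta <= d x x0 & d x y < e / 2]).
  apply: (Js) (he x (AK _ Ax) hx) => z [Az [hz dz]]; split=> //=.
  by have := dT z y x; rewrite (dC y); lra.
by apply: (Js) J0 => x [Ax [hx dx]]; apply: nx; exists x.
Qed.

(** A compact set contains no infinite separated sequence, so pairwise disjoint balls become
    arbitrarily small; this is the decay that [greedy_selection] asks for. *)
Lemma dist_gt0_of_pairwise (u : nat -> T) (r : nat -> R) : (forall n, K (u n)) ->
  (forall m n, (m < n)%N -> r m + r n <= d (u m) (u n)) ->
  forall e : R, 0 < e -> exists n, r n < e.
Proof.
move=> Ku h e e0; apply: contrapT => hn.
have hr n : e <= r n by rewrite leNgt; apply/negP => hh; apply: hn; exists n.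
apply: (@no_separated u e e0 Ku) => m n mn.
by have := h _ _ mn; have := hr m; have := hr n; lra.
Qed.

Context (k : nat) (k0 : (0 < k)%N).

Lemma superadd_seq (A : nat -> set T) (a : nat -> R) :
  (forall n, exists2 s : R, 0 < s & forall i x y, (i < n)%N -> A i x -> A n y -> s <= d x y) ->
  (forall n (b : R), b < a n -> ~ Hle d k (A n) b) ->
  forall n (b : R), b < \sum_(i < n) a i ->
    ~ Hle d k [set x | exists2 i, (i < n)%N & A i x] b.
Proof.
move=> sep ha; elim=> [|n IH] b; first by rewrite big_ord0 => b0 /Hle_ge0; lra.
rewrite big_ord_recr /=; set S := \sum_(i < n) a i => hb hle.
pose g := (S + a n - b) / 2; have g0 : 0 < g by rewrite /g; lra.
have [s s0 hs] := sep n.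
have := @Hle_superadd R T d k k0 [set x | exists2 i, (i < n)%N & A i x] (A n)
  (S - g) (a n - g) s s0 _ (IH _ _) (ha _ _ _).
have -> : S - g + (a n - g) = b by rewrite /g; lra.
apply; [|by rewrite -/S; lra|lra|].
  by move=> x y [i ni Aix] Ay; exact: hs ni Aix Ay.
apply: Hle_sub hle => // x [[i ni Ai]|Ax]; last by exists n.
by exists i => //; exact: ltnW.
Qed.

Lemma Hle_fin_sub (A B : set T) : A `<=` B -> Hfin d k B ->
  exists2 a, Hle d k A a & forall b, b < a -> ~ Hle d k A b.
Proof. by move=> AB hB; apply: Hval; exact: Hfin_sub hB. Qed.

(* Lebesgue density. The third hypothesis says that [Bs] is disjoint from the
   closure of [Q]. *)
Lemma density (Bs Q : set T) (c : R) : 0 < c -> Hfin d k Bs -> Q `<=` K ->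
  (forall x, Bs x -> exists2 t : R, 0 < t & forall q, Q q -> t <= d x q) ->
  Hnull d k [set p | Q p /\ forall r0 : R, 0 < r0 -> exists r : R,
    [/\ 0 < r, r < r0 & ~ Hle d k (Bs `&` [set x | d x p <= r]) (c * r ^+ k)]].
Proof.
move=> c0 fB QK clo; set N := [set p | _]; apply: contrapT => nN.
have [e0 e00 he0] := nHnullP k0 nN.
pose near (t : R) := [set x | Bs x /\ exists2 q, Q q & d x q < t].
(* Every layer [near t] of [Bs] around [Q] turns out to have measure above [c2]: the selected balls
   have a total of [(12 * r) ^+ k] above [e0], and each of them carries mass above [c * r ^+ k]. *)
pose c2 := c * (e0 / 12 ^+ k) / 2.
have k12 : (0 : R) < 12 ^+ k by rewrite exprn_gt0.
have ce : 0 < c * (e0 / 12 ^+ k) by rewrite mulr_gt0 // divr_gt0.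
have c20 : 0 < c2 by rewrite /c2; lra.
have claim1 (t : R) : 0 < t -> ~ Hle d k (near t) c2.
  move=> t0.
  pose F := [set i : T * R | [/\ N i.1, 0 < i.2, i.2 < t
     & ~ Hle d k (Bs `&` [set x | d x i.1 <= i.2]) (c * i.2 ^+ k)]].
  (* Conflict at twice the sum of the radii keeps the selected balls a positive distance apart. A
     conflicting ball of at most twice the selected radius has its centre within 6 selected radii,
     whence covering sets of diameter 12 radii. *)
  pose cf (i j : T * R) := d i.1 j.1 <= 2 * (i.2 + j.2).
  have [||s [sF sc sd]] := @greedy_selection R _ F snd cf t.
  - by move=> i [_ h1 h2 _]; rewrite h1 ltW.
  - move=> u uF unc; apply: (@dist_gt0_of_pairwise (fst \o u) (snd \o u)).
      by move=> n; have [[/QK + _] _ _ _] := uF n.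
    move=> m n mn; have := unc m n mn; rewrite /cf /= => /negP; rewrite -ltNge.
    by have [_ ? _ _] := uF m; have [_ ? _ _] := uF n; lra.
  pose r n := if s n is Some i then i.2 else 0.
  have r0 n : 0 <= r n by rewrite /r; case E : (s n) => [i|] //; have [_ /ltW] := sF _ _ E.
  have rt n : r n <= t.
    by rewrite /r; case E : (s n) => [i|]; [have [_ _ /ltW] := sF _ _ E|exact: ltW].
  have [n hn] : exists n, e0 < \sum_(i < n) (12 * r i) ^+ k.
    apply: contrapT => hno; apply: (he0 (12 * t)).
    exists (fun n => if s n is Some i then [set x | d i.1 x <= 6 * i.2] else set0).
    exists (fun n => 12 * r n); split.
    - move=> p Np; have [rr [rr0 rrt hr]] := Np.2 t t0.
      have [|n [i [sn ci si]]] := sd (p, rr); first by split.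
      exists n => //; rewrite sn /=; move: ci si; rewrite /cf /=; lra.
    - by move=> n; rewrite mulr_ge0 //= ler_wpM2l.
    - move=> n x y; rewrite /r; case: (s n) => //= i hx hy.
      by have := dT x i.1 y; rewrite (dC x i.1); lra.
    - by move=> n; rewrite leNgt; apply/negP => h; apply: hno; exists n.
  pose A n := if s n is Some i then Bs `&` [set x | d x i.1 <= i.2] else set0.
  have sA := @superadd_seq A (fun n => c * r n ^+ k).
  apply: contra_not (sA _ _ n c2 _).
  - apply: Hle_sub => // x [i _]; rewrite /A; case E : (s i) => [[p rr]|] //= [Bx dx].
    by have [[Qp _] /= _ rt' _] := sF _ _ E; split => //; exists p => //; lra.
  - move=> m; rewrite /A; case E : (s m) => [[p rr]|]; last by exists 1.
    have [_ /= rr0 _ _] := sF _ _ E; exists rr => // i x y im.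
    case E' : (s i) => [[p' rr']|] //= [_ dx] [_ dy].
    have := sc _ _ _ _ im E' E; rewrite /cf /= => /negP; rewrite -ltNge.
    have [_ /= rr0' _ _] := sF _ _ E'.
    have := dT p' x p; have := dT x y p; rewrite (dC p' x); lra.
  - move=> m b; rewrite /A /r; case E : (s m) => [[p rr]|] /=.
      move=> hb hle; have [_ _ _ /=] := sF _ _ E; apply.
      by apply: Hle_sub hle => //; exact: ltW.
    by rewrite expr0n; case: k k0 => //= k' _ ; rewrite mulr0 => b0 /Hle_ge0; lra.
  - move: hn; under eq_bigr do rewrite exprMn.
    rewrite -!mulr_sumr mulrC -ltr_pdivrMr // => hn.
    apply: (@lt_trans _ _ (c * (e0 / 12 ^+ k))); first by rewrite /c2; lra.
    by rewrite ltr_pM2l.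
have nearS s t : s <= t -> near s `<=` near t.
  by move=> st x [Bx [q Qq hq]]; split => //; exists q => //; lra.
(* Some layer between two positive distances carries a fixed mass. Otherwise split [near t] into
   dyadic layers: those of even index are mutually separated, and so are the odd ones, so each of
   the two unions would have measure at most [c2 / 2], against [claim1]. *)
have claim2 (t : R) : 0 < t -> exists t' : R, [/\ 0 < t', t' < t &
    ~ Hle d k (near t `\` near t') (c2 / 2)].
  move=> t0; apply: contrapT => hn; apply: (claim1 t t0).
  have hn' (t' : R) : 0 < t' -> t' < t -> Hle d k (near t `\` near t') (c2 / 2).
    by move=> h1 h2; apply: contrapT => h3; apply: hn; exists t'.
  pose S n := near (t / 2 ^+ n) `\` near (t / 2 ^+ n.+1).
  have p2 n : (0 : R) < 2 ^+ n by rewrite exprn_gt0.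
  have tn0 n : 0 < t / 2 ^+ n by rewrite divr_gt0.
  have tnS n : t / 2 ^+ n.+1 = t / 2 ^+ n / 2.
    by rewrite exprS invfM mulrA mulrAC.
  have tnm m n : (m <= n)%N -> t / 2 ^+ n <= t / 2 ^+ m.
    by move=> mn; rewrite ler_pM2l // lef_pV2 ?posrE // ler_eXn2l // ltr1n.
  have SB n : S n `<=` Bs by move=> x [[]].
  have half p : Hle d k (\bigcup_n S (n.*2 + p)%N) (c2 / 2).
    have hv n := Hle_fin_sub (SB (n.*2 + p)%N) fB.
    have /choice[a ha] : forall n, exists a, Hle d k (S (n.*2 + p)%N) a /\
        forall b, b < a -> ~ Hle d k (S (n.*2 + p)%N) b.
      by move=> n; have [a h1 h2] := hv n; exists a.
    apply: (Hle_bigcup k0 (M := a)) => [n|n]; first by case: (ha n).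
    rewrite leNgt; apply/negP => hs.
    apply: (@superadd_seq (fun n => S (n.*2 + p)%N) a _ _ n (c2 / 2) hs).
    - move=> m; exists (t / 2 ^+ (m.*2 + p)%N) => // i x y im [[Bx _] nx] [[By [q Qq dq]] _].
      have h1 : t / 2 ^+ (i.*2 + p).+1 <= d x q.
        by rewrite leNgt; apply/negP => h; apply: nx; split => //; exists q.
      have h2 : t / 2 ^+ (m.*2 + p) <= t / 2 ^+ (i.*2 + p).+2.
        by apply: tnm; rewrite -!addSn -doubleS leq_add2r leq_double.
      by move: h2; rewrite (tnS (i.*2 + p).+1) => h2; have := dT x y q; lra.
    - by move=> m b; case: (ha m) => _; apply.
    have p0 : (0 < n.*2 + p + 1)%N by rewrite addn1.
    apply: Hle_sub (hn' (t / 2 ^+ (n.*2 + p + 1)%N) _ _) => //.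
    + move=> x [i ni Sx]; split.
        by apply: nearS Sx.1; have := tnm 0%N (i.*2 + p)%N (leq0n _); rewrite expr0 divr1.
      apply: contra_not Sx.2; apply: nearS; apply: tnm.
      by rewrite addn1 ltnS leq_add2r leq_double ltnW.
    + by rewrite ltr_pdivrMr // ltr_pMr // exprn_egt1 ?ltr1n // -lt0n.
  apply: (@Hle_sub R T d k _ ((\bigcup_n S (n.*2 + 0)%N) `|` (\bigcup_n S (n.*2 + 1)%N)) (c2 / 2 + c2 / 2)); last exact: HleU.
    move=> x [Bx [q Qq dq]].
    have [t1 t10 ht1] := clo x Bx.
    pose P n := `[< near (t / 2 ^+ n) x >].
    have [n hn0] : exists n, ~~ P n.
      have [n hn1] := inv_lt (divr_gt0 t10 t0); exists n; apply/asboolPn => -[_ [q' Qq' dq']].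
      have := ht1 _ Qq'; have : t / 2 ^+ n < t1; last lra.
      rewrite -ltr_pdivlMl // mulrC; apply: le_lt_trans hn1.
      rewrite lef_pV2 ?posrE // -natrX ler_nat; exact: ltn_expl.
    have P0 : P 0%N by apply/asboolP; rewrite expr0 divr1; split=> //; exists q.
    have [m hm] : exists m, P m && ~~ P m.+1.
      elim: n hn0 => [|n IH hn0]; first by rewrite P0.
      by case E : (P n); [exists n; rewrite E|apply: IH; rewrite E].
    move/andP: hm => [/asboolP h1 /asboolPn h2].
    have Sm : S m x by split.
    case: (boolP (odd m)) => om; [right|left]; exists m./2 => //.
      by rewrite addnC -[X in (X + _)%N](_ : nat_of_bool (odd m) = 1%N) ?odd_double_half // om.
    by rewrite addn0 even_halfK.
  by rewrite -splitr.
have /choice[nt hnt] : forall t : R, exists t' : R, 0 < t -> [/\ 0 < t', t' < t &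
    ~ Hle d k (near t `\` near t') (c2 / 2)].
  by move=> t; have [/claim2[t' h]|h] := pselect (0 < t); [exists t'|exists 0 => /h].
(* The halving separates successive layers, so enough of them add up to more than the finite measure
   of [Bs]. *)
pose tau n := iter n (fun t : R => nt t / 2) 1.
have tau0 n : 0 < tau n.
  by elim: n => [|n IH] //=; rewrite divr_gt0 //; case: (hnt _ IH).
have taum i n : (i < n)%N -> tau n <= nt (tau i) / 2.
  elim: n => // n IH; rewrite ltnS leq_eqVlt => /orP[/eqP -> //|/IH h].
  apply: le_trans h; rewrite /=; have [h1 h2 _] := hnt _ (tau0 n).
  by have := tau0 n; rewrite /tau /= in h1 h2 *; lra.
have [M hM] := fB.
pose n := (Num.truncn (M / (c2 / 2))).+1.
have hn : M < \sum_(i < n) (c2 / 2).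
  have -> : \sum_(i < n) (c2 / 2) = n%:R * (c2 / 2) by rewrite sumr_const card_ord mulr_natl.
  by rewrite -ltr_pdivrMr ?divr_gt0 //; exact: truncnS_gt.
apply: (@superadd_seq (fun n => near (tau n) `\` near (nt (tau n))) (fun=> c2 / 2) _ _ n M hn).
- move=> m; exists (tau m) => // i x y im [nx nx'] [[By [q Qq dq]] _].
  have h1 : nt (tau i) <= d x q.
    by rewrite leNgt; apply/negP => h; apply: nx'; split; [case: nx|exists q].
  by have := taum _ _ im; have := dT x y q; lra.
- move=> m b hb; have [_ _ h] := hnt _ (tau0 m); apply: contra_not h.
  by apply: Hle_sub => //; exact: ltW.
by apply: Hle_sub hM => // x [i _ [[]]].
Qed.

End Metric.
End Ultra.

(* Lower bound for covers of a self-similar tree: each covering set either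
   separates two first-level branches, and is then large, or lives in one. *)
Lemma tree_sum (R : realType) (T : Type) (d : T -> T -> R) (I : finType)
  (f : I -> T -> T) (r : I -> R) (B : set T) (x0 : T) (sep s rho : R) :
  B x0 -> (forall i x, B x -> B (f i x)) ->
  (forall i x y, B x -> B y -> r i * d x y <= d (f i x) (f i y)) ->
  0 < sep -> (forall i j x y, i != j -> B x -> B y -> sep <= d (f i x) (f j y)) ->
  (forall i, 0 < r i <= rho) -> 0 < s -> 1 <= \sum_i r i `^ s ->
  forall n J (V : 'I_J -> set T) (dd : 'I_J -> R) (P : pred 'I_J),
  (forall j, 0 <= dd j) -> (forall j x y, V j x -> V j y -> d x y <= dd j) ->
  (forall w : seq I, size w = n -> exists2 j, P j & V j (foldr f x0 w)) ->
  1 <= \sum_(j | P j) (Num.max (dd j / sep) (rho ^+ n)) `^ s.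
Proof.
move=> Bx0 fB flow sep0 fsep hr s0 hs; have p1 : (1 : R) `^ s = 1 by rewrite powR1.
(* The floor [rho ^+ n] makes the base case hold, where a set containing [x0] may have bound 0, and
   it survives rescaling because every ratio is at most [rho]. *)
elim=> [|n IH] J V dd P dd0 hdd hcov.
  have [j Pj _] := hcov [::] erefl; rewrite (bigD1 j) //= -[leLHS]addr0 lerD //.
    by rewrite -[leLHS]p1; apply: ge0_ler_powR;
      rewrite ?nnegrE ?(ltW s0) ?ler01 // le_max expr0 ?lexx ?ler01 ?orbT.
  by apply: sumr_ge0 => i _; exact: powR_ge0.
have evB w : B (foldr f x0 w) by elim: w => //= i w; exact: fB.
pose term j := (Num.max (dd j / sep) (rho ^+ n.+1)) `^ s.
pose touch i j := `[< exists2 w, size w = n & V j (f i (foldr f x0 w)) >].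
(* A set meeting two branches has bound at least [sep], so its term alone is at least 1. If there is
   none, each set lives in one branch, and the induction hypothesis applies to that branch rescaled
   by [r i]. *)
have [[j [i [i' [Pj ii' ti ti']]]]|nt] := pselect (exists j i i', [/\ P j, i != i', touch i j & touch i' j]).
  rewrite (bigD1 j) //= -[leLHS]addr0 lerD //; last first.
    by apply: sumr_ge0 => a _; exact: powR_ge0.
  rewrite -[leLHS]p1; apply: ge0_ler_powR; rewrite ?nnegrE ?(ltW s0) ?ler01 //.
    by rewrite le_max divr_ge0 // ltW.
  move/asboolP: ti => [w _ hw]; move/asboolP: ti' => [w' _ hw'].
  rewrite le_max ler_pdivlMr // mul1r; apply/orP; left.
  exact: le_trans (fsep _ _ _ _ ii' (evB w) (evB w')) (hdd _ _ _ hw hw').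
have sub i : r i `^ s <= \sum_(j | P j && touch i j) term j.
  have /andP[ri0 rirho] := hr i.
  pose V' j := [set x | B x /\ V j (f i x)].
  have h : 1 <= \sum_(j | P j && touch i j) Num.max (dd j / r i / sep) (rho ^+ n) `^ s.
    apply: (IH J V' (fun j => dd j / r i) (fun j => P j && touch i j)) =>
      [j|j x y [Bx Vx] [By Vy]|w sw].
    - by rewrite divr_ge0 // ltW.
    - rewrite ler_pdivlMr // mulrC; apply: le_trans (flow _ _ _ Bx By) _; exact: hdd Vx Vy.
    - have [|j Pj Vj] := hcov (i :: w); first by rewrite /= sw.
      exists j; last by split.
      by rewrite Pj /=; apply/asboolP; exists w.
  rewrite -[leLHS]mulr1; apply: (@le_trans _ _ (r i `^ s * \sum_(j | P j && touch i j)
    Num.max (dd j / r i / sep) (rho ^+ n) `^ s)).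
    by rewrite ler_wpM2l // powR_ge0.
  rewrite mulr_sumr; apply: ler_sum => j _.
  have h0 : 0 <= Num.max (dd j / r i / sep) (rho ^+ n).
    by rewrite le_max !divr_ge0 // ltW.
  rewrite -powRM //; last exact: ltW.
  apply: ge0_ler_powR; rewrite ?nnegrE ?(ltW s0) //.
  - by rewrite mulr_ge0 // ltW.
  - by rewrite le_max divr_ge0 // ltW.
  rewrite maxr_pMr ?(ltW ri0) //.
  rewrite ge_max !le_max; apply/andP; split; apply/orP.
    by left; rewrite mulrAC mulrCA mulfV ?mulr1 ?lt0r_neq0.
  right; rewrite exprS ler_wpM2r // exprn_ge0 //; apply: le_trans rirho; exact: ltW.
apply: le_trans hs _; apply: (@le_trans _ _ (\sum_i \sum_(j | P j && touch i j) term j)).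
  by apply: ler_sum => i _; exact: sub.
rewrite (exchange_big_dep P) /=; last by move=> i j _ /andP[].
apply: ler_sum => j Pj; rewrite Pj /=.
have [[i ti]|ni] := pselect (exists i, touch i j); last first.
  rewrite big1 ?powR_ge0 // => i ti; case: ni; exists i; exact: ti.
rewrite (bigD1 i) //= big1 ?addr0 // => i' /andP[ti' ii'].
by case: nt; exists j, i', i.
Qed.

(** * Zooms and iterated function systems *)

Section Zoom.
Context {R : realType} (U : set (set nat)) (uU : free_ultra U).
Context (T : Type) (d : T -> T -> R) (pd : pmetric d).
Hypothesis dsep : forall x y, d x y = 0 -> x = y.
Hypothesis d2 : forall x y, d x y <= 2.
Context (K : set T) (cK : ucompact U d K) (c0 : R) (c00 : 0 < c0).
Let d0 x : d x x = 0. Proof. by case: pd. Qed.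
Let dC x y : d x y = d y x. Proof. by case: pd. Qed.
Let dT x y z : d x z <= d x y + d y z. Proof. by case: pd. Qed.
Let dge0 := pmetric_ge0 pd.

Lemma dgt0 x y : x <> y -> 0 < d x y.
Proof. by move=> xy; rewrite lt_neqAle dge0 andbT eq_sym; apply/eqP => /dsep. Qed.

(* [g] and [h] are inverse bijections of [K]; in the application [m u] is the
   chordal distance from [u] to the image of the origin under the Poincaré
   extension of [g], and [kap] is comparable to the height of that image. *)
Record zmap (g h : T -> T) (kap : R) (m : T -> R) : Prop := ZMap {
  zm_g : forall u, K u -> K (g u);
  zm_h : forall u, K u -> K (h u);
  zm_gh : forall u, K u -> g (h u) = u;
  zm_hg : forall u, K u -> h (g u) = u;
  zm_kap : 0 < kap;
  zm_le2 : forall u, K u -> m u <= 2;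
  zm_low : forall u, K u -> kap <= c0 * m u;
  zm_sum : forall u v, K u -> K v -> d u v <= m u + m v;
  zm_lip : forall u v, K u -> K v -> m u <= m v + d u v;
  zm_eq : forall u v, K u -> K v -> d (h u) (h v) * (m u * m v) = kap * d u v }.

Lemma zm_gt0 g h kap m : zmap g h kap m -> forall u, K u -> 0 < m u.
Proof.
move=> z u Ku; have := zm_low z Ku; have := zm_kap z => k0 hk.
by rewrite -(pmulr_rgt0 _ c00); exact: lt_le_trans hk.
Qed.

Lemma zm_eqg g h kap m : zmap g h kap m -> forall u v, K u -> K v ->
  d u v * (m (g u) * m (g v)) = kap * d (g u) (g v).
Proof.
move=> z u v Ku Kv; have := zm_eq z (zm_g z Ku) (zm_g z Kv).
by rewrite !(zm_hg z).
Qed.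

Lemma zm_lowlip g h kap m : zmap g h kap m -> forall u v, K u -> K v ->
  kap / c0 ^+ 2 * d u v <= d (g u) (g v).
Proof.
move=> z u v Ku Kv; have k0 := zm_kap z.
have hm w : K w -> kap / c0 <= m w.
  by move=> Kw; rewrite ler_pdivrMr // mulrC; exact: zm_low z _ Kw.
rewrite -(ler_pM2l k0) -(zm_eqg z Ku Kv).
have -> : kap * (kap / c0 ^+ 2 * d u v) = d u v * ((kap / c0) * (kap / c0)).
  by rewrite expr2 invfM; ring.
apply: ler_wpM2l => //; have kc : 0 <= kap / c0 by rewrite divr_ge0 ?ltW.
by apply: ler_pM => //; apply: hm; exact: zm_g z _ _.
Qed.

Lemma zm_uplip g h kap m : zmap g h kap m -> forall u v, K u -> K v ->
  d (g u) (g v) <= 4 / kap * d u v.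
Proof.
move=> z u v Ku Kv; have k0 := zm_kap z.
rewrite -(ler_pM2l k0) -(zm_eqg z Ku Kv).
have -> : kap * (4 / kap * d u v) = d u v * (2 * 2) by field; rewrite lt0r_neq0.
apply: ler_wpM2l => //; have Kg := zm_g z.
by apply: ler_pM; rewrite ?(zm_le2 z) ?ltW ?(zm_gt0 z) //; exact: Kg.
Qed.

Context (Z : (T -> T) -> (T -> T) -> R -> (T -> R) -> Prop).
Hypothesis Zok : forall g h kap m, Z g h kap m -> zmap g h kap m.
Hypothesis Zcomp : forall g h kap m g' h' kap' m', Z g h kap m -> Z g' h' kap' m' ->
  exists kap'' m'', Z (g \o g') (h' \o h) kap'' m''.
Hypothesis Zlim : forall x (e : R), K x -> 0 < e ->
  exists g h kap m, [/\ Z g h kap m, kap < e & m x < e].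

(** In hyperbolic terms [m p < C * kap] puts the orbit point in a cone with vertex [p] and aperture
    governed by [C]. The aperture is recorded because the measure estimates need a fixed one. *)
Definition LC (C : R) := [set p | K p /\ forall e : R, 0 < e ->
  exists g h kap m, [/\ Z g h kap m, kap < e & m p < C * kap]].
Definition Lr := [set p | exists C, LC C p].

Definition clo (B : set T) := forall u x, K x -> U [set n | B (u n)] -> ucvg U d u x -> B x.

Lemma u_or A B : U (A `|` B) -> U A \/ U B.
Proof.
move=> h; have [|/(uC uU) nA] := pselect (U A); [by left|right].
by apply: (uS uU) (uI uU h nA) => n [[]].
Qed.

Lemma u_fin (W : finType) (P : W -> nat -> Prop) :
  U [set n | exists w, P w n] -> exists w, U [set n | P w n].
Proof.
move=> h; apply: contrapT => hn.
suff H (l : seq W) : U [set n | forall w, w \in l -> ~ P w n].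
  have [n [[w Pw] /(_ w (mem_enum _ w))]] := u_ex uU (uI uU h (H (enum W))).
  exact.
elim: l => [|a l IH]; first by apply: (uA uU).
have na : U (~` [set n | P a n]) by apply: (uC uU) => ha; apply: hn; exists a.
apply: (uS uU) (uI uU IH na) => n [/= h1 h2] w; rewrite inE => /orP[/eqP ->//|]; exact: h1.
Qed.

Lemma ulim_uniq u x y : ucvg U d u x -> ucvg U d u y -> x = y.
Proof.
move=> hx hy; apply: contrapT => /dgt0 h; have h2 : 0 < d x y / 2 by lra.
have [n [/= h1 h3]] := u_ex uU (uI uU (hx _ h2) (hy _ h2)).
by have := dT x (u n) y; rewrite (dC x (u n)); lra.
Qed.

Context (k : nat).

(* [Lr] plays the role of the radial limit set; this is HD(L) <= k. *)
Definition dim_le := forall s : R, k%:R < s -> forall e : R, 0 < e ->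
  exists (V : nat -> set T) (r : nat -> R), [/\ Lr `<=` \bigcup_i V i,
    forall i, 0 <= r i, forall i x y, V i x -> V i y -> d x y <= r i
    & forall n, \sum_(i < n) r i `^ s <= e].

Hypothesis k0 : (0 < k)%N.
Hypothesis dimL : dim_le.

(** The limit set of the system consists of points of [LC CC] for a single constant, so [dimL]
    covers it cheaply at every exponent above [k]. A sum of k-th powers of the ratios of at least 4
    leaves room to raise the exponent slightly and keep the sum above 1, and then [tree_sum] forbids
    cheap covers. *)
Lemma ifs_false (I : finType) (f h : I -> T -> T) (r : I -> R) (B Bp : set T)
  (q q' : T) (et : R) :
  (forall i, exists kap m, Z (f i) (h i) kap m) ->
  B `<=` Bp -> Bp `<=` K -> clo B ->
  0 < et -> (forall x y, B x -> K y -> ~ Bp y -> et <= d y x) ->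
  K q -> K q' -> q <> q' -> ~ B q -> ~ B q' ->
  (exists x y, [/\ B x, B y & x <> y]) ->
  (forall i x, Bp x -> B (f i x)) ->
  (forall i j x y, i != j -> Bp x -> Bp y -> f i x <> f j y) ->
  (forall i, 0 < r i) ->
  (forall i x y, K x -> K y -> r i * d x y <= d (f i x) (f i y)) ->
  (forall i x y, Bp x -> Bp y -> d (f i x) (f i y) <= d x y / 2) ->
  4 <= \sum_i r i ^+ k -> False.
Proof.
move=> fZ BBp BpK cB et0 hgap Kq Kq' qq' nBq nBq' [b0 [b1 [Bb0 Bb1 b01]]]
  fB fdis r0 flow fup hsum.
have BK : B `<=` K by apply: subset_trans BpK.
have db : 0 < d b0 b1 by exact: dgt0.
have dq : 0 < d q q' by exact: dgt0.
have fBB i x : B x -> B (f i x) by move=> /BBp; exact: fB.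
have r12 i : r i <= 1 / 2.
  have := le_trans (flow i _ _ (BK _ Bb0) (BK _ Bb1)) (fup i _ _ (BBp _ Bb0) (BBp _ Bb1)).
  by rewrite mulrC -ler_pdivlMl // => /le_trans; apply; rewrite mulKf ?lt0r_neq0 //; lra.
have [p hp] : exists p : nat, forall i, (1 / 2) ^+ p.+1 <= r i.
  pose rm := \big[Num.min/1]_i r i.
  have rm0 : 0 < rm by rewrite /rm; apply: lt_bigmin => // i _; exact: r0.
  have [p hp] := inv_lt uU rm0; exists p => i.
  apply: (@le_trans _ _ rm); last exact: bigmin_le_cond.
  apply: le_trans (ltW hp); rewrite div1r exprVn lef_pV2 ?posrE ?exprn_gt0 //.
  by rewrite -natrX ler_nat; apply: ltnW; exact: ltn_expl.
(* All ratios are at least [(1 / 2) ^+ p.+1], so raising the exponent by [p.+1%:R^-1] costs at most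
   a factor 2. *)
pose s : R := k%:R + p.+1%:R^-1.
have p0 : (0 : R) < p.+1%:R^-1 by rewrite invr_gt0.
have k1 : (1 : R) <= k%:R by rewrite ler1n.
have s1 : 1 < s by rewrite /s; apply: (le_lt_trans k1); rewrite ltrDl.
have s0 : 0 < s by exact: lt_trans ltr01 s1.
have ks : k%:R < s by rewrite /s ltrDl.
have hs : 1 <= \sum_i r i `^ s.
  apply: (@le_trans _ _ (\sum_i r i ^+ k / 2)).
    by rewrite -mulr_suml; lra.
  apply: ler_sum => i _; rewrite /s powRD; last by apply/implyP => _; rewrite lt0r_neq0.
  rewrite powR_mulrn ?(ltW (r0 i)) //; apply: ler_wpM2l; first by rewrite exprn_ge0 // ltW.
  have -> : 2^-1 = ((1 / 2) ^+ p.+1) `^ p.+1%:R^-1 :> R.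
    rewrite -powR_mulrn; last lra.
    by rewrite -powRrM mulfV ?pnatr_eq0 // powRr1 ?div1r ?invr_ge0.
  by apply: ge0_ler_powR; rewrite ?nnegrE ?(ltW p0) ?(ltW (r0 i)) ?exprn_ge0 //; lra.
pose fw (w : seq I) (x : T) := foldr f x w.
pose hw (w : seq I) (x : T) := foldl (fun x i => h i x) x w.
have wZ i w : exists kap m, Z (fw (i :: w)) (hw (i :: w)) kap m.
  elim: w i => [|j w IH] i; first exact: fZ.
  have [kap [m z]] := fZ i; have [kap' [m' z']] := IH j.
  exact: Zcomp z z'.
have fwB w x : B x -> B (fw w x) by move=> Bx; elim: w => //= i w; exact: fBB.
have fwup w x y : B x -> B y -> d (fw w x) (fw w y) <= (1 / 2) ^+ size w * d x y.
  move=> Bx By; elim: w => [|i w IH] /=; first by rewrite expr0 mul1r.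
  apply: le_trans (fup _ _ _ (BBp _ (fwB w _ Bx)) (BBp _ (fwB w _ By))) _.
  by rewrite exprS; move: IH; rewrite /fw; lra.
have hout i y : K y -> ~ B y -> K (h i y) /\ ~ Bp (h i y).
  move=> Ky nBy; have [kap [m /Zok z]] := fZ i; split; first exact: zm_h z _ Ky.
  by move=> /(fB i); rewrite (zm_gh z).
have hwout i w y : K y -> ~ B y -> K (hw (i :: w) y) /\ ~ Bp (hw (i :: w) y).
  elim: w i y => [|j w IH] i y Ky nBy; first exact: hout.
  have [h1 h2] := hout i y Ky nBy; apply: (IH j (h i y) h1) => /BBp; exact: h2.
pose Lam n := [set x | exists w b, [/\ size w = n, B b & x = fw w b]].
have LamS n : Lam n.+1 `<=` Lam n.
  move=> x [w [b [sw Bb ->]]]; case/lastP: w sw => // w i; rewrite size_rcons => -[sw].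
  by exists w, (f i b); split; rewrite ?/fw ?foldr_rcons //; exact: fBB.
have LamM m n : (m <= n)%N -> Lam n `<=` Lam m.
  elim: n => [|n IH]; first by rewrite leqn0 => /eqP ->.
  by rewrite leq_eqVlt => /orP[/eqP -> //|mn]; apply: subset_trans (IH mn).
have LamB n : Lam n `<=` B by move=> x [w [b [_ Bb ->]]]; exact: fwB.
(* The estimate [key] will give the ratio [4 / (et * d q q')]; the surplus makes the inequality
   strict. *)
pose CC : R := 8 / (et * d q q') + 1.
have LamL x : (forall n, Lam n x) -> LC CC x.
  move=> hx; split; first by apply: BK; exact: LamB 0%N x (hx _).
  move=> e e0; have [n hn] := inv_lt uU (divr_gt0 e0 (exprn_gt0 2 c00)).
  have [w [b [sw Bb xw]]] := hx n.+1; case: w sw xw => // i w [sw] xw.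
  have [kap [m z]] := wZ i w; have z' := Zok z; exists (fw (i :: w)), (hw (i :: w)), kap, m.
  split => //.
    have := zm_lowlip z' (BK _ Bb0) (BK _ Bb1) => hl.
    have := le_trans hl (fwup _ _ _ Bb0 Bb1); rewrite ler_pM2r // /= sw => hk.
    have : kap <= c0 ^+ 2 * (1 / 2) ^+ n.+1.
      by rewrite mulrC -ler_pdivrMr ?exprn_gt0.
    move=> hk'; apply: le_lt_trans hk' _; rewrite mulrC -ltr_pdivlMr ?exprn_gt0 //.
    apply: le_lt_trans hn; rewrite div1r exprVn lef_pV2 ?posrE ?exprn_gt0 //.
    by rewrite -natrX ler_nat; apply: ltnW; exact: ltn_expl.
  have Kx : K x by rewrite xw; apply: BK; exact: fwB.
  have hwx : hw (i :: w) x = b by rewrite xw; apply: zm_hg z' _ _; exact: BK.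
  have kap0 := zm_kap z'.
  (* Inverse words keep a point outside [B] outside [Bp], hence at distance at least [et] from [B].
     Used for whichever of [q], [q'] has the larger [m], this bounds [m x] by the height. *)
  have key y : K y -> ~ B y -> m x * m y * et <= 2 * kap.
    move=> Ky nBy; have [h1 h2] := hwout i w y Ky nBy.
    have := hgap b _ Bb h1 h2; rewrite -hwx => hd.
    have := zm_eq z' Ky Kx; have := d2 y x => dyx; have := dge0 y x => dyx0 E.
    have mx := zm_gt0 z' Kx; have my := zm_gt0 z' Ky.
    apply: (@le_trans _ _ (kap * d y x)); last by rewrite mulrC ler_wpM2r // ltW.
    by rewrite -E [leLHS]mulrC [m y * m x]mulrC ler_wpM2r // mulr_ge0 // ltW.
  have mx := zm_gt0 z' Kx.
  have [y [Ky nBy hy]] : exists y, [/\ K y, ~ B y & d q q' / 2 <= m y].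
    have := zm_sum z' Kq Kq' => hsm; have [h1|h1] := leP (d q q' / 2) (m q).
      by exists q.
    by exists q'; split => //; lra.
  have := key y Ky nBy => hk.
  have : m x * (d q q' / 2) * et <= 2 * kap.
    by apply: le_trans hk; rewrite ler_wpM2r ?(ltW et0) // ler_wpM2l // (ltW mx).
  move=> hk2; apply: (@le_lt_trans _ _ (4 / (et * d q q') * kap)).
    rewrite mulrAC ler_pdivlMr ?mulr_gt0 //; lra.
  rewrite ltr_pM2r // /CC; have : 0 < (et * d q q')^-1 by rewrite invr_gt0 mulr_gt0.
  lra.
have [sep sep0 hsep] : exists2 sep : R, 0 < sep &
    forall i j x y, i != j -> B x -> B y -> sep <= d (f i x) (f j y).
  apply: contrapT => hn.
  have hn' n : exists i j x y, [/\ i != j, B x, B y & d (f i x) (f j y) < n.+1%:R^-1].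
    apply: contrapT => h1; apply: hn; exists n.+1%:R^-1; first by rewrite invr_gt0.
    move=> i j x y ij Bx By; rewrite leNgt; apply/negP => h2; apply: h1.
    by exists i, j, x, y.
  have /choice[ii /choice[jj /choice[xx /choice[yy H]]]] := hn'.
  have [[i j] hij] : exists w : I * I, U [set n | (ii n, jj n) = w].
    by apply: u_fin; apply: (uA uU) => n; exists (ii n, jj n).
  have [|x Kx cx] := cK (u := xx); first by move=> n; apply: BK; case: (H n).
  have [|y Ky cy] := cK (u := yy); first by move=> n; apply: BK; case: (H n).
  have Bx : B x by apply: cB cx => //; apply: (uA uU) => n; case: (H n).
  have By : B y by apply: cB cy => //; apply: (uA uU) => n; case: (H n).
  have ij : i != j by have [n [<- <-]] := u_ex uU hij; case: (H n).
  have := fdis i j x y ij (BBp _ Bx) (BBp _ By) => /dgt0 h1.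
  have h4 : 0 < d (f i x) (f j y) / 4 by lra.
  have [n [[[[/= a1 a2] a3] a4] a5]] := u_ex uU (uI uU (uI uU (uI uU hij (cx _ h4)) (cy _ h4)) (u_inv uU h4)).
  have [_ Bxn Byn] := H n; rewrite a1 a2 => a6.
  have := fup i _ _ (BBp _ Bxn) (BBp _ Bx); have := fup j _ _ (BBp _ Byn) (BBp _ By).
  have := dT (f i x) (f i (xx n)) (f j y); have := dT (f i (xx n)) (f j (yy n)) (f j y).
  have := lt_trans a6 a5; rewrite (dC (f i x) (f i _)); lra.
(* With this choice the enlarged cover, measured in units of [sep], costs at most 1 / 4. *)
pose ee := sep `^ s / 8.
have sp0 : 0 < sep `^ s by rewrite powR_gt0.
have ee0 : 0 < ee by rewrite /ee; lra.
have [V [rr [Vcov rr0 Vd Vs]]] := dimL ks ee0.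
(* Strictly larger bounds at total extra cost [ee]: they leave room for the neighbourhoods [W j],
   finitely many of which cover some [Lam n]. *)
pose dd j := (rr j `^ s + ee / 2 ^+ j.+1) `^ s^-1.
have ej j : 0 < ee / 2 ^+ j.+1 by rewrite divr_gt0 // exprn_gt0.
have dds j : dd j `^ s = rr j `^ s + ee / 2 ^+ j.+1.
  by rewrite /dd -powRrM mulVf ?lt0r_neq0 // powRr1 // addr_ge0 ?powR_ge0 // ltW.
have ddr j : rr j < dd j.
  rewrite -(powRr1 (rr0 j)) -(mulfV (lt0r_neq0 s0)) powRrM /dd.
  by apply: gt0_ltr_powR; rewrite ?nnegrE ?invr_gt0 ?addr_ge0 ?powR_ge0 ?ltrDl // ltW.
pose W j := [set x | exists2 y, V j y & d x y < (dd j - rr j) / 2].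
have WW j x y : W j x -> W j y -> d x y <= dd j.
  move=> [x' Vx' hx] [y' Vy' hy]; have := Vd _ _ _ Vx' Vy'; have := dT x x' y.
  by have := dT x' y' y; rewrite (dC y' y); lra.
(* Compactness: points of [Lam n] escaping the first [n] sets have a limit, which lies in every
   [Lam n] because the initial word of each length, having finitely many values, is constant along
   the ultrafilter. *)
have [n0 hn0] : exists n, Lam n `<=` [set x | exists2 j, (j < n)%N & W j x].
  apply: contrapT => hn.
  have nx n : exists x, Lam n x /\ ~ exists2 j, (j < n)%N & W j x.
    by apply: contrapT => h1; apply: hn; exists n => x Lx; apply: contrapT => h2; apply: h1; exists x.
  have /choice[xx H] := nx.
  have [|x Kx cx] := cK (u := xx); first by move=> n; apply: BK; exact: LamB (H n).1.
  have Lx n : Lam n x.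
    pose P (w : n.-tuple I) m := exists2 b, B b & xx m = fw w b.
    have [w hw'] : exists w, U [set m | P w m].
      apply: u_fin; apply: (uS uU) (u_ge uU n) => m /= nm.
      have [w [b [sw Bb E]]] := LamM _ _ nm _ (H m).1.
      by move/eqP in sw; exists (Tuple sw), b.
    have [bb hbb] : exists bb : nat -> T, forall m, B (bb m) /\ (P w m -> xx m = fw w (bb m)).
      have : forall m, exists b, B b /\ (P w m -> xx m = fw w b).
        by move=> m; have [[b Bb E]|nP] := pselect (P w m); [exists b|exists b0].
      by move=> /choice[bb hbb]; exists bb.
    have [|b Kb cb] := cK (u := bb); first by move=> m; apply: BK; case: (hbb m).
    have Bb : B b by apply: cB cb => //; apply: (uA uU) => m; case: (hbb m).
    exists w, b; split; rewrite ?size_tuple //; apply: (ulim_uniq cx) => e e0.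
    apply: (uS uU) (uI uU hw' (cb _ e0)) => m [/= Pm hm]; rewrite ((hbb m).2 Pm).
    apply: le_lt_trans (fwup _ _ _ (hbb m).1 Bb) _; apply: le_lt_trans hm.
    by rewrite -[leRHS]mul1r ler_wpM2r // exprn_ile1 //; lra.
  have [j _ Vj] : (\bigcup_i V i) x by apply: Vcov; exists CC; exact: LamL.
  have dj : 0 < (dd j - rr j) / 2 by have := ddr j; lra.
  have [n jn /= hn1] := u_ex_ge uU j.+1 (cx _ dj).
  by have [_] := H n; apply; exists j => //; exists x.
pose J := n0.
(* A depth at which the floors of the [J] terms add up to less than 1 / 2. *)
have [n nn0 hn] : exists2 n, (n0 <= n)%N & J%:R * (1 / 2) ^+ n < 1 / 2 :> R.
  have h1 : (0 : R) < (J.*2.+1%:R)^-1 by rewrite invr_gt0.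
  have [n nn0 /= hn] := u_ex_ge uU n0 (u_inv uU h1); exists n => //.
  have h2 : (1 / 2 : R) ^+ n <= n.+1%:R^-1.
    rewrite div1r exprVn lef_pV2 ?posrE ?exprn_gt0 // -natrX ler_nat; exact: ltn_expl.
  have h3 := le_lt_trans h2 hn.
  have J0 : (0 : R) <= J%:R by [].
  have : J%:R * (1 / 2) ^+ n <= J%:R * (J.*2.+1%:R)^-1 :> R by rewrite ler_wpM2l // ltW.
  move=> /le_lt_trans; apply; rewrite ltr_pdivrMr //.
  have -> : J.*2.+1%:R = 2 * J%:R + 1 :> R by rewrite -natr1 -muln2 natrM mulrC.
  lra.
have : 1 <= \sum_(j < J) (Num.max (dd j / sep) ((1 / 2) ^+ n)) `^ s.
  apply: (@tree_sum R T d I f r B b0 sep s (1 / 2) Bb0 fBB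
    (fun i x y Bx By => flow i x y (BK _ Bx) (BK _ By)) sep0 hsep _ s0 hs n J
    (fun j => W j) (fun j => dd j) xpredT) => [i|j|j x y|w sw].
  - by rewrite r0 r12.
  - exact: powR_ge0.
  - exact: WW.
  - have [|j jn Wj] := hn0 (fw w b0); last by exists (Ordinal jn).
    by apply: LamM nn0 _ _; exists w, b0.
rewrite leNgt => /negP; apply.
have half1 : 0 <= (1 / 2 : R) ^+ n by rewrite exprn_ge0 //; lra.
apply: (@le_lt_trans _ _ (\sum_(j < J) (dd j `^ s / sep `^ s + (1 / 2) ^+ n))).
  apply: ler_sum => j _.
  have dj0 : 0 <= dd j / sep by rewrite divr_ge0 ?powR_ge0 ?ltW.
  have E : (dd j / sep) `^ s = dd j `^ s / sep `^ s.
    apply: (mulIf (lt0r_neq0 sp0)); rewrite divfK ?lt0r_neq0 //.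
    by rewrite -powRM ?(ltW sep0) // divfK ?lt0r_neq0.
  rewrite maxEle; case: ifP => _.
    rewrite -[leLHS]add0r lerD ?divr_ge0 ?powR_ge0 //.
    have hp' : (0 : R) < (1 / 2) ^+ n by rewrite exprn_gt0 //; lra.
    apply: ge1r_powR; last exact: ltW.
    by rewrite hp' exprn_ile1 //; lra.
  by rewrite E lerDl.
rewrite big_split /= -mulr_suml.
have -> : \sum_(j < J) (1 / 2) ^+ n = J%:R * (1 / 2) ^+ n :> R.
  by rewrite sumr_const card_ord mulr_natl.
have : (\sum_(j < J) dd j `^ s) / sep `^ s <= 2 * ee / sep `^ s.
  rewrite ler_wpM2r ?invr_ge0 ?(ltW sp0) //; under eq_bigr do rewrite dds.
  rewrite big_split /= (_ : 2 * ee = ee + ee); last by lra.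
  by apply: lerD; [exact: Vs|apply: sum_geo; exact: ltW].
have -> : 2 * ee / sep `^ s = 1 / 4 by rewrite /ee; field; rewrite lt0r_neq0.
by move=> h1; lra.
Qed.
End Zoom.

(** * Finiteness of the measure of the limit set *)

Section Finiteness.
Context {R : realType} (U : set (set nat)) (uU : free_ultra U).
Context (T : Type) (d : T -> T -> R) (pd : pmetric d).
Hypothesis dsep : forall x y, d x y = 0 -> x = y.
Hypothesis d2 : forall x y, d x y <= 2.
Context (K : set T) (cK : ucompact U d K) (c0 : R) (c00 : 0 < c0).
Let d0 x : d x x = 0. Proof. by case: pd. Qed.
Let dC x y : d x y = d y x. Proof. by case: pd. Qed.
Let dT x y z : d x z <= d x y + d y z. Proof. by case: pd. Qed.
Let dge0 := pmetric_ge0 pd.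
Context (Z : (T -> T) -> (T -> T) -> R -> (T -> R) -> Prop).
Hypothesis Zok : forall g h kap m, Z g h kap m -> zmap d K c0 g h kap m.
Hypothesis Zcomp : forall g h kap m g' h' kap' m', Z g h kap m -> Z g' h' kap' m' ->
  exists kap'' m'', Z (g \o g') (h' \o h) kap'' m''.
Hypothesis Zlim : forall x (e : R), K x -> 0 < e ->
  exists g h kap m, [/\ Z g h kap m, kap < e & m x < e].
Context (k : nat) (k0 : (0 < k)%N).
Hypothesis dimL : dim_le d K Z k.
Let LC := LC K Z.
Let dgt0 := dgt0 pd dsep.

(** The pole of the zoom is [h q], which [g] sends to [q], away from the target [x]. At distance
    [et] from the pole, [zm_eq] for [g u] and [q] bounds [m (g u)] by a multiple of the height. *)
Lemma pole_bound g h kap m x q (et : R) : zmap d K c0 g h kap m -> K x -> K q ->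
  0 < et -> 2 * m x <= d q x -> 0 < d q x ->
  forall u, K u -> et <= d u (h q) -> m (g u) <= 4 * kap / (et * d q x).
Proof.
move=> z Kx Kq et0 hm dqx u Ku hu.
have Kg := zm_g z Ku.
have := zm_eq z Kg Kq; rewrite (zm_hg z Ku) => E.
have mg := zm_gt0 c00 z Kg; have mq := zm_gt0 c00 z Kq.
have hq : d q x / 2 <= m q by have := zm_sum z Kq Kx; lra.
rewrite ler_pdivlMr ?mulr_gt0 //.
have h1 : et * (m (g u) * (d q x / 2)) <= d u (h q) * (m (g u) * m q).
  apply: ler_pM => //; rewrite ?(ltW et0) //; first by rewrite mulr_ge0 ?(ltW mg) //; lra.
  by rewrite ler_wpM2l // ltW.
have h2 : kap * d (g u) q <= kap * 2 by rewrite ler_wpM2l ?(ltW (zm_kap z)).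
move: h1; rewrite E; lra.
Qed.

(** The pole cannot be close to both of two sets that are [2 * et] apart, so one of them is sent
    close to [x]; which one depends on the zoom. *)
Lemma gamma_exists x q (th et : R) (B : bool -> set T) : K x -> K q -> x <> q -> 0 < th ->
  0 < et -> (forall b, B b `<=` K) -> (forall u v, B true u -> B false v -> 2 * et <= d u v) ->
  exists b g h kap m, Z g h kap m /\ forall u, B b u -> d (g u) x < th.
Proof.
move=> Kx Kq xq th0 et0 BK gap; have dqx : 0 < d q x by rewrite dC; exact: dgt0.
pose A : R := 4 / (et * d q x) + 1.
have ed : 0 < (et * d q x)^-1 by rewrite invr_gt0 mulr_gt0.
have A0 : 0 < A by rewrite /A; lra.
have e0 : 0 < Num.min (d q x / 2) (th / A) by rewrite lt_min !divr_gt0.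
have [g [h [kap [m [z hk hm]]]]] := Zlim Kx e0; have z' := Zok z.
move: hk hm; rewrite !lt_min => /andP[hk1 hk2] /andP[hm1 hm2].
have key u : K u -> et <= d u (h q) -> d (g u) x < th.
  move=> Ku hu; have := zm_sum z' (zm_g z' Ku) Kx.
  have := pole_bound z' Kx Kq et0 _ dqx Ku hu => /(_ _)h1.
  have h2 : 4 * kap / (et * d q x) + m x < th.
    apply: (@lt_le_trans _ _ (4 * (th / A) / (et * d q x) + th / A)).
      by rewrite ltrD // ltr_pM2r // ltr_pM2l.
    have E t : 4 * t / (et * d q x) + t = t * A by rewrite /A; ring.
    by rewrite E divfK ?lt0r_neq0.
  have := h1 _; lra.
have [h1|/existsNP[u1 /not_implyP[Bu1 hu1]]] := pselect (forall u, B true u -> et <= d u (h q)).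
  by exists true, g, h, kap, m; split=> // u Bu; apply: key (h1 _ Bu); exact: BK Bu.
exists false, g, h, kap, m; split=> // v Bv; apply: key; first exact: BK Bv.
have := gap _ _ Bu1 Bv; have := dT u1 (h q) v; move/negP: hu1; rewrite -ltNge (dC v); lra.
Qed.

(** At [h p] the conformal factor of [g] is at most of order [kap], and it stays so on a ball whose
    radius depends on [C] alone. *)
Lemma zoom_ball g h kap m p (C : R) : zmap d K c0 g h kap m -> K p -> 0 < C ->
  m p < C * kap -> forall v, K v -> d v (h p) <= 1 / (2 * C) ->
  d (g v) p <= C * kap /\ m (g v) <= 2 * C * kap.
Proof.
move=> z Kp C0 hm v Kv hv; have Kg := zm_g z Kv.
have := zm_eq z Kg Kp; rewrite (zm_hg z Kv) => E.
have mg := zm_gt0 c00 z Kg; have mp := zm_gt0 c00 z Kp; have kap0 := zm_kap z.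
have hl := zm_lip z Kg Kp.
have h1 : kap * d (g v) p <= kap * (m (g v) / 2).
  rewrite -E; apply: (@le_trans _ _ (1 / (2 * C) * (m (g v) * (C * kap)))).
    by apply: ler_pM; rewrite ?mulr_ge0 ?(ltW mg) ?(ltW mp) // ler_wpM2l ?(ltW mg) ?(ltW hm).
  rewrite le_eqVlt; apply/orP; left; apply/eqP; field; rewrite lt0r_neq0 //.
move: h1; rewrite ler_pM2l // => h1.
split; lra.
Qed.

Section TwoPoints.
Context (x1 x2 : T) (K1 : K x1) (K2 : K x2) (et : R) (et0 : 0 < et) (x12 : 8 * et <= d x1 x2).
Let ctr (b : bool) := if b then x1 else x2.
Let B b := [set x | K x /\ d x (ctr b) <= et].
Let Bp b := [set x | K x /\ d x (ctr b) <= 2 * et].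

(** A finite system of zooms from the ball about [ctr b] to the ball about [ctr a]. The two indices
    may differ because [gamma_exists] leaves no choice of the ball that is contracted. *)
Definition Big (a b : bool) (M : R) :=
  exists (I : finType) (f h : I -> T -> T) (r : I -> R),
  [/\ forall i, exists kap m, Z (f i) (h i) kap m,
      (forall i x, Bp b x -> B a (f i x)) /\
      (forall i j x y, i != j -> Bp b x -> Bp b y -> f i x <> f j y),
      (forall i, 0 < r i) /\ (forall i x y, K x -> K y -> r i * d x y <= d (f i x) (f i y)),
      forall i x y, Bp b x -> Bp b y -> d (f i x) (f i y) <= d x y / 2
    & M <= \sum_i r i ^+ k].

Lemma BBp b : B b `<=` Bp b.
Proof. by move=> x [Kx h]; split=> //; have := et0; lra. Qed.

Lemma Big_comp a b (M : R) : 0 <= M -> Big a b M -> Big b a 1 -> Big a a M.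
Proof.
move=> M0 [I [f [h [r [fZ [fB fd] [r0 fl] fu fs]]]]].
move=> [I' [f' [h' [r' [fZ' [fB' fd'] [r0' fl'] fu' fs']]]]].
have fB2 j x : Bp a x -> Bp b (f' j x) by move=> /(fB' j); exact: BBp.
exists (I * I')%type, (fun w => f w.1 \o f' w.2), (fun w => h' w.2 \o h w.1), (fun w => r w.1 * r' w.2).
split.
- by move=> [i j]; have [? [? z]] := fZ i; have [? [? z']] := fZ' j; exact: Zcomp z z'.
- split=> [[i j] x Bx|[i j] [i' j'] x y ne Bx By] /=; first by apply: fB; exact: fB2.
  have [ii|ii] := eqVneq i i'; last by apply: fd => //; exact: fB2.
  move=> E; have jj : j != j' by apply: contra ne => /eqP ->; rewrite ii.
  apply: (fd' j j' x y jj Bx By); move: E; rewrite -ii => E.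
  have [kap [m /Zok z]] := fZ i.
  have [KX _] := fB2 j x Bx; have [KY _] := fB2 j' y By.
  by rewrite -(zm_hg z KX) E (zm_hg z KY).
- split=> [[i j]|[i j] x y Kx Ky] /=; first exact: mulr_gt0.
  have [kap [m /Zok z]] := fZ' j.
  apply: le_trans (fl i _ _ (zm_g z Kx) (zm_g z Ky)).
  by rewrite -mulrA ler_wpM2l ?(ltW (r0 i)) // fl'.
- move=> [i j] x y Bx By /=; apply: le_trans (fu _ _ _ (fB2 _ _ Bx) (fB2 _ _ By)) _.
  have := fu' j x y Bx By; have := dge0 x y; lra.
apply: le_trans fs _; rewrite -[leLHS]mulr1.
apply: (@le_trans _ _ ((\sum_i r i ^+ k) * (\sum_j r' j ^+ k))).
  by apply: ler_wpM2l fs'; apply: sumr_ge0 => i _; rewrite exprn_ge0 // ltW.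
rewrite big_distrlr pair_bigA /=; apply: ler_sum => w _; by rewrite exprMn.
Qed.

Lemma Big_false a : Big a a 4 -> K (ctr (~~ a)) -> (exists x y, [/\ B a x, B a y & x <> y]) ->
  (exists q, [/\ K q, ~ B a q & q <> ctr (~~ a)]) -> False.
Proof.
move=> [I [f [h [r [fZ [fB fd] [r0 fl] fu fs]]]]] Kc hx [q [Kq nBq qc]].
apply: (ifs_false uU pd dsep d2 cK c00 Zok Zcomp k0 dimL (f := f) (h := h) (r := r)
  (B := B a) (Bp := Bp a) (q := ctr (~~ a)) (q' := q) (et := et)) => //.
- exact: BBp.
- by move=> x [].
- move=> u x Kx Bu cu; split=> //; rewrite leNgt; apply/negP => hlt.
  have e0 : 0 < d x (ctr a) - et by rewrite subr_gt0.
  have [n [/= [_ h1] h2]] := u_ex uU (uI uU Bu (cu _ e0)).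
  by have := dT x (u n) (ctr a); rewrite (dC x (u n)); lra.
- move=> x y [Kx hx'] Ky nBy; rewrite leNgt; apply/negP => h1; apply: nBy; split => //.
  by have := dT y x (ctr a); lra.
- by move=> E; apply: qc.
- move=> [_]; rewrite /ctr; case: (a) => /=; rewrite ?(dC x2); have := x12; have := et0; lra.
Qed.

(** Each point [p] of [LC C] near [ctr a] gets a composite map: one of finitely many zooms that
    bring a ball close to [h p], followed by the zoom at [p]. Its image lies within [C * kap] of
    [p]. Infinite measure yields disjoint images with a large total, and one of the two source balls
    receives half of it. *)
Lemma Big_of_infinite a (C : R) : 1 <= C ->
  (forall r : R, 0 < r -> ~ Hfin d k (LC C `&` [set x | d x (ctr a) <= r])) ->
  forall M : R, 0 <= M -> exists b, Big a b M.
Proof.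
move=> C1 hinf M M0; have C0 : 0 < C by lra.
have gap u v : Bp true u -> Bp false v -> 2 * et <= d u v.
  move=> [_ h1] [_ h2]; have := dT x1 u x2; have := dT u v x2.
  by move: h1 h2; rewrite /ctr /= (dC u x1); have := x12; have := et0; lra.
pose th : R := 1 / (2 * C); have th0 : 0 < th by rewrite divr_gt0 // mulr_gt0.
have th2 : 0 < th / 2 by lra.
have [l [lK hl]] := finite_net uU pd cK th2.
have gz z : exists w : bool * (T -> T) * (T -> T) * R, K z -> exists m,
    let: (b, g, h, kap) := w in Z g h kap m /\ forall u, Bp b u -> d (g u) z < th / 2.
  have [Kz|nK] := pselect (K z); last by exists (true, id, id, 0).
  have [q [Kq zq]] : exists q, K q /\ z <> q.
    have [E|?] := pselect (z = x1); [|by exists x1].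
    by exists x2; split => // E2; move: x12; rewrite -E -E2 d0; have := et0; lra.
  have [b [g [h [kap [m [hz hb]]]]]] := gamma_exists Kz Kq zq th2 et0 (fun b x (h : Bp b x) => h.1) gap.
  by exists (b, g, h, kap) => _; exists m.
have /choice[gam hgam] := gz.
have [c1 [c10 hc1]] : exists c1 : R, 0 < c1 /\ forall z, List.In z l -> c1 <= (gam z).2.
  elim: l lK {hl} => [|z l IH] lK; first by exists 1.
  have [|c [cp hc]] := IH; first by move=> x lx; apply: lK; right.
  have Kz : K z by apply: lK; left.
  have [m] := hgam z Kz; case E : (gam z) => [[[b g] h] kap] [/Zok/zm_kap kp _].
  exists (Num.min c kap); split; first by rewrite lt_min cp.
  move=> w [<-|lw]; first by rewrite E /= ge_min lexx orbT.
  by rewrite ge_min hc.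
(* Lower Lipschitz constant of the composites relative to [kap]: [zm_lowlip] is used twice, and [c1]
   bounds the heights of the finitely many first maps from below. *)
pose Q : R := c1 / c0 ^+ 4.
have Q0 : 0 < Q by rewrite divr_gt0 // exprn_gt0.
pose M' : R := 2 * M * ((12 * C) / Q) ^+ k.
have et2 : 0 < et / 2 by have := et0; lra.
have : ~ Hle d k (LC C `&` [set x | d x (ctr a) <= et / 2]) M'.
  by move=> h; apply: (hinf _ et2); exists M'.
move=> /existsNP[dl /existsNP[e' /not_implyP[dl0 /not_implyP[e'0 ncov]]]].
(* The three bounds serve, in this order, the mesh [dl] of the cover, the contraction by 1 / 2, and
   the inclusion of the images in the ball about [ctr a]. *)
pose kmax := Num.min (Num.min (dl / (12 * C)) (c1 / (32 * C ^+ 2))) (et / (2 * C)).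
have kmax0 : 0 < kmax by rewrite !lt_min !divr_gt0 // ?mulr_gt0 ?exprn_gt0 //.
pose F := [set i : T * R * bool * (T -> T) * (T -> T) |
  let: (p, kap, b, f, h) := i in
  [/\ LC C p, 0 < kap /\ kap < kmax, exists kp m, Z f h kp m,
      forall x, Bp b x -> d (f x) p <= C * kap /\ B a (f x)
    & (forall x y, K x -> K y -> kap * Q * d x y <= d (f x) (f y)) /\
      forall x y, Bp b x -> Bp b y -> d (f x) (f y) <= d x y / 2]].
pose pp (i : T * R * bool * (T -> T) * (T -> T)) := i.1.1.1.1.
pose sz (i : T * R * bool * (T -> T) * (T -> T)) := i.1.1.1.2.
pose cf (i j : T * R * bool * (T -> T) * (T -> T)) := d (pp i) (pp j) <= 2 * C * (sz i + sz j).
have item p : LC C p -> d p (ctr a) <= et / 2 -> exists2 i, F i & pp i = p.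
  move=> Lp dp; have [Kp /(_ _ kmax0)[g [h [kap [m [z hk hm]]]]]] := Lp.
  have z' := Zok z; have kap0 := zm_kap z'.
  have [y ly dy] := hl _ (zm_h z' Kp).
  have Ky := lK _ ly; have := hc1 _ ly; have [my] := hgam y Ky.
  case E : (gam y) => [[[b g1] h1] kap1] [z1 hb1] /= hc.
  have z1' := Zok z1; have kap10 := zm_kap z1'.
  move: (hk); rewrite !lt_min => /andP[/andP[hk1 hk2] hk3].
  have near x : Bp b x -> d (g1 x) (h p) <= th.
    by move=> /hb1 h2; have := dT (g1 x) y (h p); rewrite (dC y); lra.
  have zb x : Bp b x -> d (g (g1 x)) p <= C * kap /\ m (g (g1 x)) <= 2 * C * kap.
    move=> Bx; apply: (zoom_ball z' Kp C0 hm); [exact: (zm_g z1' Bx.1)|exact: near].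
  exists (p, kap, b, g \o g1, h1 \o h); last by [].
  split=> //.
  - by have [kp [m' ?]] := Zcomp z z1; exists kp, m'.
  - move=> x Bx; have [h2 _] := zb x Bx; split=> //.
    split; first exact: (zm_g z' (zm_g z1' Bx.1)).
    have h3 : C * kap <= et / 2.
      by move: hk3; rewrite ltr_pdivlMr ?mulr_gt0 //; lra.
    by have := dT (g (g1 x)) p (ctr a); rewrite /=; lra.
  split=> [x y' Kx Ky'|x y' Bx By] /=.
    apply: le_trans (zm_lowlip pd c00 z' (zm_g z1' Kx) (zm_g z1' Ky')).
    have := zm_lowlip pd c00 z1' Kx Ky' => hl1.
    apply: (@le_trans _ _ (kap / c0 ^+ 2 * (kap1 / c0 ^+ 2 * d x y'))); last first.
      by rewrite ler_wpM2l // divr_ge0 ?exprn_ge0 ?ltW.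
    rewrite /Q (_ : kap / _ * _ = kap * (kap1 / c0 ^+ 4) * d x y'); last first.
      by field; rewrite lt0r_neq0.
    by rewrite ler_wpM2r // ler_wpM2l ?(ltW kap0) // ler_wpM2r // invr_ge0 exprn_ge0 // ltW.
  have [_ m1] := zb _ Bx; have [_ m2] := zb _ By.
  have Kx := zm_g z1' Bx.1; have Ky' := zm_g z1' By.1.
  have E1 := zm_eqg z' Kx Ky'; have hup := zm_uplip pd c00 z1' Bx.1 By.1.
  rewrite -(ler_pM2l kap0) -E1.
  have mx0 := zm_gt0 c00 z' (zm_g z' Kx); have my0 := zm_gt0 c00 z' (zm_g z' Ky').
  apply: (@le_trans _ _ (4 / kap1 * d x y' * (2 * C * kap * (2 * C * kap)))).
    by apply: ler_pM => //; [rewrite mulr_ge0 // ltW|apply: ler_pM => //; exact: ltW].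
  rewrite [leLHS](_ : _ = kap * d x y' * (16 * C ^+ 2 * kap / kap1)); last by field; rewrite lt0r_neq0.
  rewrite [leRHS]mulrA; apply: ler_wpM2l; first by rewrite mulr_ge0 // ltW.
  rewrite ler_pdivrMr //.
  move: hk2; rewrite ltr_pdivlMr ?mulr_gt0 ?exprn_gt0 //; lra.
have [||s [sF sc sd]] := @greedy_selection R _ F sz cf kmax.
- by case=> [[[[p kap] b] f] h] [_ [h1 h2] _ _ _]; rewrite /sz /= h1 ltW.
- move=> u uF unc e e0.
  have [|||n hn] := @dist_gt0_of_pairwise R U uU T d pd K cK (pp \o u) (fun n => C * sz (u n)) _ _ (C * e).
  + by move=> n; have := uF n; rewrite /pp /=; case: (u n) => [[[[p kap] b] f] h] [[]].
  + move=> m n mn; have := unc m n mn; rewrite /cf => /negP; rewrite -ltNge /=.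
    have s0 j : 0 <= C * sz (u j).
      have := uF j; rewrite /sz; case: (u j) => [[[[p kap] b] f] h] [_ [/ltW h1 _] _ _ _].
      by rewrite mulr_ge0 // ltW.
    have := s0 m; have := s0 n; lra.
  + exact: mulr_gt0.
  by exists n; move: hn; rewrite ltr_pM2l.
pose rr n := if s n is Some i then sz i else 0.
have rr0 n : 0 <= rr n.
  rewrite /rr; case E : (s n) => [[[[[p kap] b] f] h]|] //.
  by have [_ [/ltW ? _] _ _ _] := sF _ _ E.
have rrm n : rr n <= kmax.
  rewrite /rr; case E : (s n) => [[[[[p kap] b] f] h]|]; last exact: ltW.
  by have [_ [_ /ltW ?] _ _ _] := sF _ _ E.
have [n hn] : exists n, M' < \sum_(i < n) (12 * C * rr i) ^+ k.
  apply: contrapT => hno; apply: ncov.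
  exists (fun n => if s n is Some i then [set x | d (pp i) x <= 6 * C * sz i] else set0).
  exists (fun n => 12 * C * rr n); split.
  - move=> p [Lp /= dp]; have [i Fi pi] := item p Lp dp.
    have [n [j [sn cj sj]]] := sd i Fi; exists n => //; rewrite sn /= -pi.
    move: cj; rewrite /cf => /le_trans; apply.
    have : C * sz i <= C * (2 * sz j) by rewrite ler_wpM2l // ltW.
    lra.
  - move=> n; rewrite !mulr_ge0 ?(ltW C0) //=.
    have : kmax <= dl / (12 * C) by rewrite !ge_min lexx.
    rewrite ler_pdivlMr ?mulr_gt0 // => h1; apply: le_trans h1; rewrite mulrC.
    by rewrite ler_wpM2r // mulr_ge0 // ltW.
  - move=> n x y; rewrite /rr; case: (s n) => //= i hx hy.
    by have := dT x (pp i) y; rewrite (dC x (pp i)); lra.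
  - move=> n; rewrite leNgt; apply/negP => h; apply: hno; exists n.
    by apply: lt_trans h; rewrite ltrDl.
have hn2 : 2 * M < \sum_(i < n) (rr i * Q) ^+ k.
  move: hn; rewrite /M' => hn.
  have E : \sum_(i < n) (12 * C * rr i) ^+ k = (12 * C / Q) ^+ k * \sum_(i < n) (rr i * Q) ^+ k.
    rewrite mulr_sumr; apply: eq_bigr => i _; rewrite -exprMn; congr (_ ^+ _).
    by field; rewrite lt0r_neq0.
  by move: hn; rewrite E mulrC ltr_pM2l // exprn_gt0 // divr_gt0 // mulr_gt0.
(* Only indices with a selected item enter [A b]; the default fills the others. *)
pose it (i : 'I_n) := if s i is Some j then j else (x1, 0, true, id, id).
pose A b := [set i : 'I_n | isSome (s i) && ((it i).1.1.2 == b)]%SET.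
have itS b i : i \in A b -> s i = Some (it i) /\ (it i).1.1.2 = b.
  by rewrite inE /it; case: (s i) => // j /= /eqP.
have split_sum : \sum_(i < n) (rr i * Q) ^+ k =
    \sum_(i in A true) (rr i * Q) ^+ k + \sum_(i in A false) (rr i * Q) ^+ k.
  rewrite (bigID (fun i : 'I_n => i \in A true)) /=; congr (_ + _).
  rewrite (bigID (fun i : 'I_n => i \in A false)) /= addrC big1 ?add0r.
    apply: eq_bigl => i; rewrite !inE /it; case: (s i) => [j|] //=.
    by case: (j.1.1.2).
  move=> i; rewrite !inE /it /rr; case: (s i) => [j|] /=; first by case: (j.1.1.2).
  by rewrite mul0r expr0n; case: k k0.
have [b hb] : exists b, M <= \sum_(i in A b) (rr i * Q) ^+ k.
  have [h1|h1] := leP M (\sum_(i in A true) (rr i * Q) ^+ k); first by exists true.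
  by exists false; move: hn2; rewrite split_sum; lra.
exists b; exists 'I_#|A b|, (fun i => (it (enum_val i)).1.2), (fun i => (it (enum_val i)).2),
  (fun i => sz (it (enum_val i)) * Q).
have Fi (i : 'I_#|A b|) : F (it (enum_val i)) /\ (it (enum_val i)).1.1.2 = b.
  by have [sE bE] := itS b _ (enum_valP i); split=> //; exact: sF sE.
split.
- by move=> i; have [] := Fi i; case: (it _) => [[[[p kap] b'] f] h] [].
- split=> [i x Bx|i j x y ij Bx By].
    have [] := Fi i; case: (it _) => [[[[p kap] b'] f] h] [_ _ _ hf _] /= E.
    by rewrite E in hf; case: (hf x Bx).
  have [Fi' Ei] := Fi i; have [Fj Ej] := Fi j.
  have ne : (enum_val i : nat) != enum_val j.
    by apply: contra ij => /eqP/val_inj/enum_val_inj ->.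
  have [sEi _] := itS b _ (enum_valP i); have [sEj _] := itS b _ (enum_valP j).
  have ncf : ~ cf (it (enum_val i)) (it (enum_val j)).
    move: ne; rewrite neq_ltn => /orP[h|h]; first exact: sc h sEi sEj.
    by move=> hc; apply: (sc _ _ _ _ h sEj sEi); move: hc; rewrite /cf dC [sz _ + _]addrC.
  move: Fi' Ei Fj Ej ncf.
  case: (it (enum_val i)) => [[[[p kap] b'] f] h] [_ [ka _] _ hf _] /= E.
  case: (it (enum_val j)) => [[[[p' kap'] b''] f'] h'] [_ [ka' _] _ hf' _] /= E' ncf Exy.
  rewrite E in hf; rewrite E' in hf'.
  have [h1 _] := hf x Bx; have [h2 _] := hf' y By; apply: ncf; rewrite /cf /pp /sz /=.
  have Ck : 0 < C * kap by exact: mulr_gt0.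
  have Ck' : 0 < C * kap' by exact: mulr_gt0.
  rewrite -Exy in h2; by have := dT p (f x) p'; rewrite (dC p (f x)); lra.
- split=> [i|i x y Kx Ky].
    have [] := Fi i; rewrite /sz; case: (it _) => [[[[p kap] b'] f] h] [_ [h1 _] _ _ _] _.
    exact: mulr_gt0.
  by have [] := Fi i; rewrite /sz; case: (it _) => [[[[p kap] b'] f] h] [_ _ _ _ [h1 _]] _; exact: h1.
- move=> i x y Bx By; have [] := Fi i; case: (it _) => [[[[p kap] b'] f] h] [_ _ _ _ [_ h1]] /= E.
  by rewrite E in h1; exact: h1.
apply: le_trans hb _; rewrite big_enum_val /=; apply: ler_sum => i _.
by have [sE _] := itS b _ (enum_valP i); rewrite /rr sE.
Qed.

(** A directed graph on two vertices with an incoming edge at each vertex has a loop or a cycle of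
    length 2; composing along it gives a system from a ball to itself. *)
Lemma two_infinite_false (C : R) : 1 <= C ->
  (forall a (r : R), 0 < r -> ~ Hfin d k (LC C `&` [set x | d x (ctr a) <= r])) -> False.
Proof.
move=> C1 hinf.
have hB a (M : R) : 0 <= M -> exists b, Big a b M by move=> M0; exact: (Big_of_infinite C1 (hinf a) M0).
have K' a : K (ctr a) by case: a.
have pts a : exists x y, [/\ B a x, B a y & x <> y].
  apply: contrapT => hn; apply: (hinf a et et0); apply: Hnull_fin.
  apply: (@Hnull_sub R T d k _ [set ctr a]); last exact: Hnull1.
  move=> x [[Kx _] /= dx] /=; apply: contrapT => xc; apply: hn; exists x, (ctr a).
  by split=> //; split=> //; rewrite d0 ltW.
have far a b x y : B a x -> B b y -> a != b -> x <> y.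
  move=> [_ h1] [_ h2] ab xy; move: h1 h2; rewrite -xy /ctr.
  have := dT x1 x x2; rewrite (dC x1 x); have := x12; have := et0; case: a ab; case: b => //= _; lra.
have fin a : Big a a 4 -> False.
  move=> h; apply: Big_false h (K' _) (pts a) _.
  have [x [y [Bx By xy]]] := pts (~~ a).
  have ne : a != ~~ a by case: (a).
  have [E|nE] := pselect (x = ctr (~~ a)).
    exists y; split; [by case: By|by move=> By'; exact: (far _ _ _ _ By' By ne)|].
    by move=> E2; apply: xy; rewrite E E2.
  by exists x; split; [case: Bx|move=> Bx'; exact: (far _ _ _ _ Bx' Bx ne)|].
have M4 a b (M : R) : 4 <= M -> Big a b M -> Big a b 4.
  move=> hM [I [f [h [r [h1 h2 h3 h4 h5]]]]]; exists I, f, h, r; split=> //.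
  exact: le_trans h5.
have M1 a b : Big a b 4 -> Big a b 1.
  move=> [I [f [h [r [h1 h2 h3 h4 h5]]]]]; exists I, f, h, r; split=> //.
  by apply: le_trans h5; lra.
have four : 0 <= 4 :> R by [].
have [b1 h1] := hB true 4 four; have [b2 h2] := hB false 4 four.
case: b1 h1 => h1; first exact: (fin true).
case: b2 h2 => h2; last exact: (fin false).
apply: (fin true); apply: (Big_comp four h1); exact: M1.
Qed.

End TwoPoints.

Lemma LC_mono (C C' : R) : C <= C' -> LC C `<=` LC C'.
Proof.
move=> CC' p [Kp h]; split=> // e e0; have [g [h' [kap [m [z h1 h2]]]]] := h e e0.
exists g, h', kap, m; split=> //; apply: lt_le_trans h2 _.
by rewrite ler_wpM2r // ltW // (zm_kap (Zok z)).
Qed.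

Lemma Lr_bigcup : Lr K Z `<=` \bigcup_n LC n.+1%:R.
Proof.
move=> p [C hC]; exists (Num.truncn C) => //; apply: LC_mono hC.
by apply: ltW; exact: truncnS_gt.
Qed.

Lemma LC_Hfin (C : R) x0 : K x0 -> exists2 xo, K xo & forall e : R, 0 < e ->
  Hfin d k (LC C `&` [set x | e <= d x xo]).
Proof.
move=> Kx0.
have [||||[xo Kxo h]|[x1 [x2 [K1 K2 d12 h1 h2]]]] :=
  ideal_dichotomy uU pd cK (J := Hfin d k) (A := LC (Num.max C 1)) Kx0.
- by apply: Hnull_fin; exact: Hle0.
- by move=> B B' BB'; exact: Hfin_sub.
- by move=> B B'; exact: HfinU.
- by move=> p [].
- exists xo => // e e0; apply: Hfin_sub (h e e0) => x [Lx hx]; split=> //.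
  by apply: LC_mono Lx; rewrite le_max lexx.
exfalso.
have e0 : 0 < d x1 x2 / 8 by rewrite divr_gt0.
apply: (@two_infinite_false x1 x2 K1 K2 (d x1 x2 / 8) e0 _ (Num.max C 1)).
- by rewrite mulrC divfK // pnatr_eq0.
- by rewrite le_max lexx orbT.
- by case.
Qed.

(* Conformality forces the cocycle F = m'(gam u) / (m u * om u) to be constant. *)
Lemma LC_inv g1 h1 kap1 m1 p (C : R) : Z g1 h1 kap1 m1 -> 0 < C -> LC C p ->
  (exists u v, [/\ K u, K v, u <> v & u <> p /\ v <> p]) -> LC (2 * C) (g1 p).
Proof.
move=> z1 C0 [Kp hp] [u [v [Ku Kv uv [up vp]]]].
have z1' := Zok z1.
pose om x : R := Num.sqrt kap1^-1 * m1 (g1 x).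
have k10 := zm_kap z1'.
have sq : Num.sqrt kap1^-1 ^+ 2 = kap1^-1 by rewrite sqr_sqrtr // invr_ge0 ltW.
have sk0 : 0 < Num.sqrt kap1^-1 by rewrite sqrtr_gt0 invr_gt0.
have om0 x : K x -> 0 < om x.
{ move=> Kx; apply: mulr_gt0 => //; apply: (zm_gt0 c00 z1'); exact: (zm_g z1' Kx).
}
have omE x y : K x -> K y -> d (g1 x) (g1 y) = om x * om y * d x y.
{ move=> Kx Ky; have E := zm_eqg z1' Kx Ky.
  have -> : om x * om y * d x y = Num.sqrt kap1^-1 ^+ 2 * (d x y * (m1 (g1 x) * m1 (g1 y))).
    by rewrite /om; ring.
  by rewrite sq E mulKf ?lt0r_neq0.
}
split; first exact: (zm_g z1' Kp).
move=> e e0.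
have dup := dgt0 up; have dp := omE u p Ku Kp.
have ou := om0 _ Ku; have op := om0 _ Kp; have ov := om0 _ Kv.
have e10 : 0 < Num.min (om u * d u p / (2 * C * (om u + om p))) (e / (4 * om p ^+ 2)).
{ rewrite lt_min; apply/andP; split; posit.
}
have [g [h [kap [m [z hk hm]]]]] := hp _ e10; have z' := Zok z.
have [kap2 [m2 z2]] := Zcomp z1 z; have z2' := Zok z2.
have kap0 := zm_kap z'; have kap20 := zm_kap z2'.
move: hk; rewrite lt_min => /andP[hk1 hk2].
have m0 x : K x -> 0 < m x by exact: (zm_gt0 c00 z').
have m20 x : K x -> 0 < m2 (g1 x).
{ move=> Kx; apply: (zm_gt0 c00 z2'); exact: (zm_g z1' Kx).
}
pose F x := m2 (g1 x) / (m x * om x).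
have mF x : K x -> m2 (g1 x) = F x * (m x * om x).
{ move=> Kx; rewrite /F divfK // mulf_neq0 ?lt0r_neq0 ?m0 ?om0 //.
}
have F0 x : K x -> 0 < F x.
{ move=> Kx; have := m0 _ Kx; have := om0 _ Kx; have := m20 _ Kx => *; rewrite /F; posit.
}
have FF x y : K x -> K y -> x <> y -> F x * F y * kap = kap2.
{ move=> Kx Ky /dgt0 dxy.
  have E1 := zm_eq z2' (zm_g z1' Kx) (zm_g z1' Ky).
  rewrite /= (zm_hg z1' Kx) (zm_hg z1' Ky) (omE _ _ Kx Ky) (mF x Kx) (mF y Ky) in E1.
  have E2 := zm_eq z' Kx Ky.
  have nz : om x * om y * d x y != 0.
    by have := om0 _ Kx; have := om0 _ Ky => *; rewrite lt0r_neq0 //; posit.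
  apply: (mulIf nz); rewrite -E1.
  transitivity (F x * F y * (om x * om y) * (kap * d x y)); first by ring.
  by rewrite -E2; ring.
}
have Fup : F u = F p.
{ have f2 := FF u v Ku Kv uv; have f3 := FF v p Kv Kp vp.
  have nk : kap != 0 by rewrite lt0r_neq0.
  have : F u * F v * kap = F v * F p * kap by rewrite f2 f3.
  move/(mulIf nk); rewrite [F u * _]mulrC; apply: mulfI; rewrite lt0r_neq0 ?F0 //.
}
(* It remains to compare the constant [f] with [om p]. The triangle inequalities for [m] and [m2] do
   so within a factor 2 once [m p] is small, and this factor is the loss from [C] to [2 * C]. *)
have Ek := FF u p Ku Kp up; rewrite Fup in Ek.
have Fp := F0 _ Kp; set f := F p in Ek Fp.
have mu := m0 _ Ku; have mp := m0 _ Kp.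
have l1 := zm_sum z' Ku Kp; have l2 := zm_lip z' Ku Kp.
have l3 := zm_sum z2' (zm_g z1' Ku) (zm_g z1' Kp).
have l4 := zm_lip z2' (zm_g z1' Ku) (zm_g z1' Kp).
rewrite dp (mF u Ku) (mF p Kp) Fup -/f in l3 l4.
have cond : m p * (om u + om p) <= om u * d u p / 2.
{ move: hk1; rewrite ltr_pdivlMr ?mulr_gt0 ?addr_gt0 // => hk1.
  have : m p * (om u + om p) <= C * kap * (om u + om p).
    by rewrite ler_wpM2r ?addr_ge0 ?ltW.
  lra.
}
have X0 : 0 < om u * d u p by exact: mulr_gt0.
have fl : om p / 2 <= f.
{ rewrite -(ler_pM2r X0).
  have : om u * om p * d u p <= f * (om u * (d u p + m p) + m p * om p).
    apply: le_trans l3 _; rewrite [leRHS](_ : _ = f * ((d u p + m p) * om u) + f * (m p * om p)); last by ring.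
    by rewrite lerD2r ler_wpM2l ?(ltW Fp) // ler_wpM2r ?(ltW ou) //; lra.
  have : f * (om u * (d u p + m p) + m p * om p) <= f * (2 * (om u * d u p)).
    by rewrite ler_wpM2l ?(ltW Fp) //; lra.
  lra.
}
have fu : f <= 2 * om p.
{ rewrite -(ler_pM2r X0).
  have : f * (om u * d u p / 2) <= f * (om u * (d u p - m p) - m p * om p).
    by rewrite ler_wpM2l ?(ltW Fp) //; lra.
  have : f * (om u * (d u p - m p) - m p * om p) <= om u * om p * d u p.
    have : f * ((d u p - m p) * om u) <= f * (m u * om u).
      by rewrite ler_wpM2l ?(ltW Fp) // ler_wpM2r ?(ltW ou) //; lra.
    lra.
  lra.
}
exists (g1 \o g), (h \o h1), kap2, m2; split=> //.
  rewrite -Ek; move: hk2; rewrite ltr_pdivlMr; last by posit.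
  move=> hk2.
  apply: le_lt_trans hk2.
  have : f * f <= 2 * om p * (2 * om p) by apply: ler_pM; rewrite ?(ltW Fp).
  by move=> hf; rewrite mulrC ler_wpM2l ?(ltW kap0) //; move: hf; rewrite expr2; lra.
rewrite (mF p Kp) -/f -Ek.
apply: (@lt_le_trans _ _ (f * (C * kap * om p))).
  by rewrite ltr_pM2l // ltr_pM2r.
rewrite [leRHS](_ : _ = f * (C * kap * (2 * f))); last by ring.
by rewrite ler_wpM2l ?(ltW Fp) // ler_wpM2l ?mulr_ge0 ?(ltW C0) ?(ltW kap0) //; lra.
Qed.

(** A fixed non-null piece of [A], kept away from the limit [xi] of the poles, is carried by the
    zooms into balls of radius [Rr * kap n] about [p]. Zooms are lower Lipschitz with constant
    comparable to [kap n], so the mass found there is comparable to the k-th power of the radius. *)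
Lemma zoom_mass p (C : R) (A Bs : set T) q : LC C p -> 0 < C -> K q -> q <> p ->
  A `<=` K -> ~ Hnull d k A ->
  (forall g h kap m x, Z g h kap m -> A x -> Bs (g x)) ->
  exists2 c : R, 0 < c & forall r0 : R, 0 < r0 -> exists r : R, [/\ 0 < r, r < r0
    & ~ Hle d k (Bs `&` [set x | d x p <= r]) (c * r ^+ k)].
Proof.
move=> [Kp hp] C0 Kq qp AK nA gA.
have dqp := dgt0 qp.
have e0 n : 0 < Num.min (d q p / (4 * C)) n.+1%:R^-1 by rewrite lt_min invr_gt0 divr_gt0 ?mulr_gt0 //=.
have Hn n := hp _ (e0 n).
have /choice[g /choice[h /choice[kap /choice[m H]]]] := Hn.
have [|xi Kxi cxi] := cK (u := fun n => h n q).
{ by move=> n; have [/Zok z _ _] := H n; exact: (zm_h z Kq).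
}
have [th th0 nAth] : exists2 th : R, 0 < th & ~ Hnull d k (A `&` [set x | th <= d x xi]).
{ apply: contrapT => hn; apply: nA.
  apply: (@Hnull_sub R T d k _ ([set xi] `|` \bigcup_n (A `&` [set x | n.+1%:R^-1 <= d x xi]))).
    move=> x Ax; have [->|/dgt0 xx] := pselect (x = xi); first by left.
    by right; have [n hn'] := inv_lt uU xx; exists n => //; split=> //=; exact: ltW.
  apply: HnullU => //; first exact: Hnull1.
  apply: Hnull_bigcup => // n; apply: contrapT => h'; apply: hn.
  by exists n.+1%:R^-1; rewrite ?invr_gt0.
}
have [ec ec0 nAc] := nHnull_nHle k0 nAth.
(* The bound of [pole_bound] at distance [th / 2] from the pole, plus [m p < C * kap]. *)
pose Rr : R := C + 8 / (th * d q p).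
have tq : 0 < th * d q p by exact: mulr_gt0.
have R0 : 0 < Rr by rewrite addr_gt0 // divr_gt0.
pose c : R := ec / (c0 ^+ 2 * Rr) ^+ k.
have cR0 : 0 < c0 ^+ 2 * Rr by rewrite mulr_gt0 // exprn_gt0.
exists c; first by rewrite divr_gt0 // exprn_gt0.
move=> r0 r00; have th2 : 0 < th / 2 by lra.
have r0R : 0 < r0 / Rr by rewrite divr_gt0.
have [n [/= hn1 hn2]] := u_ex uU (uI uU (cxi _ th2) (u_inv uU r0R)).
have [z + hm] := H n; rewrite lt_min => /andP[hk1 hk2]; have z' := Zok z.
have kap0 := zm_kap z'.
exists (Rr * kap n); split; first exact: mulr_gt0.
{ rewrite mulrC -ltr_pdivlMr //; exact: lt_trans hk2 hn2.
}
have small : 2 * m n p <= d q p.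
{ move: hk1; rewrite ltr_pdivlMr ?mulr_gt0 //; lra.
}
apply: contra_not nAc => hle.
pose A' := A `&` [set x | th <= d x xi].
have A'K x : A' x -> K x by move=> [/AK].
apply: (@Hle_sub R T d k _ ((h n) @` ((g n) @` A')) _ _ _ (lexx _)).
{ move=> x A'x; exists (g n x); first by exists x.
  exact: (zm_hg z' (A'K _ A'x)).
}
have -> : ec = (c0 ^+ 2 / kap n) ^+ k * (c * (Rr * kap n) ^+ k).
{ have E : (c0 ^+ 2 * Rr) ^+ k != 0 by rewrite expf_neq0 // lt0r_neq0.
  rewrite mulrCA -exprMn (_ : c0 ^+ 2 / kap n * _ = c0 ^+ 2 * Rr).
    by rewrite /c divfK.
  by field; rewrite lt0r_neq0.
}
apply: (@Hle_image R T T d d); first by rewrite divr_gt0 // exprn_gt0.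
{ move=> _ _ [x A'x <-] [y A'y <-]; rewrite (zm_hg z' (A'K _ A'x)) (zm_hg z' (A'K _ A'y)).
  have := zm_lowlip pd c00 z' (A'K _ A'x) (A'K _ A'y) => hl.
  rewrite mulrAC ler_pdivlMr // mulrC -ler_pdivrMl ?exprn_gt0 //.
  by rewrite (_ : c0 ^- 2 * (kap n * d x y) = kap n / c0 ^+ 2 * d x y) //; ring.
}
apply: Hle_sub hle => // _ [x A'x <-]; split; first by apply: (gA _ _ _ _ _ z); exact: A'x.1.
rewrite /=; have Kx := A'K _ A'x.
have dx : th / 2 <= d x (h n q).
{ by have := A'x.2; rewrite /=; have := dT x (h n q) xi; lra.
}
have := pole_bound z' Kp Kq th2 small dqp Kx dx => hpb.
have := zm_sum z' (zm_g z' Kx) Kp => hs.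
have E : 4 * kap n / (th / 2 * d q p) = 8 / (th * d q p) * kap n.
{ by field; rewrite !lt0r_neq0.
}
by rewrite /Rr; move: hpb; rewrite E; lra.
Qed.

(** [LC_Hfin] controls one aperture at a time, so it must be shown that a single aperture carries K
    up to a null set. The aperture [2 * C] does, because by [LC_inv] it contains all images of the
    non-null set [LC C]. *)
Lemma Hfin_away : Hnull d k (K `\` Lr K Z) -> (exists x0, K x0) ->
  exists2 xo, K xo & forall e : R, 0 < e -> Hfin d k (K `&` [set x | e <= d x xo]).
Proof.
move=> nul [x0 Kx0].
have [hC|] := pselect (forall n, Hnull d k (LC n.+1%:R)).
{ exists x0 => // e e0; apply: Hnull_fin.
  apply: Hnull_sub (HnullU k0 nul (Hnull_bigcup k0 hC)) => x [Kx _].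
  by have [/Lr_bigcup Lx|nLx] := pselect (Lr K Z x); [right|left].
}
move=> /existsNP[n0 nC0]; set C := n0.+1%:R in nC0.
have C0 : (0 : R) < C by rewrite /C ltr0Sn.
have [xo Kxo hxo] := LC_Hfin (2 * C) Kx0.
exists xo => // e e0.
suff nK : Hnull d k (K `\` LC (2 * C)).
{ apply: Hfin_sub (HfinU k0 (hxo e e0) (Hnull_fin nK)) => x [Kx hx].
  by have [Lx|nLx] := pselect (LC (2 * C) x); [left|right].
}
(* K \ L_2C is an F_sigma; a closed piece of positive measure would meet the
   quasi-invariant set L_2C with positive density, contradicting [density]. *)
pose Q (j : nat) (i : nat) := [set p | [/\ K p, i.+1%:R^-1 <= d p xo
  & forall g h kap m, Z g h kap m -> kap < j.+1%:R^-1 -> 2 * C * kap <= m p]].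
apply: (@Hnull_sub R T d k _ ([set xo] `|` \bigcup_j \bigcup_i Q j i)).
{ move=> p [Kp nL]; have [->|/dgt0 px] := pselect (p = xo); [by left|right].
  have /existsNP[e1 /not_implyP[e10 h1]] : ~ forall e : R, 0 < e ->
      exists g h kap m, [/\ Z g h kap m, kap < e & m p < 2 * C * kap].
    by move=> h; apply: nL.
  have [j hj] := inv_lt uU e10; have [i hi] := inv_lt uU px.
  exists j => //; exists i => //; split=> //; first exact: ltW.
  move=> g h kap m z hk; rewrite leNgt; apply/negP => h2; apply: h1.
  by exists g, h, kap, m; split=> //; exact: lt_trans hj.
}
apply: HnullU => //; first exact: Hnull1.
apply: Hnull_bigcup => // j; apply: Hnull_bigcup => // i; apply: contrapT => nQ.
pose i2 : R := i.+1%:R^-1 / 2.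
have ii : (0 : R) < i.+1%:R^-1 by rewrite invr_gt0.
have i20 : 0 < i2 by rewrite /i2 divr_gt0.
pose Bs := LC (2 * C) `&` [set x | i2 <= d x xo].
have Bfin : Hfin d k Bs by exact: hxo.
have QK : Q j i `<=` K by move=> p [].
(* The inequality [m x < 2 * C * kap] is an open condition on [x] by [zm_lip], and for this zoom it
   fails on all of [Q j i]. *)
have clos x : Bs x -> exists2 t : R, 0 < t & forall q, Q j i q -> t <= d x q.
{ move=> [[Kx Lx] _]; have j0 : (0 : R) < j.+1%:R^-1 by rewrite invr_gt0.
  have [g [h [kap [m [z hk hm]]]]] := Lx _ j0.
  exists (2 * C * kap - m x); first by rewrite subr_gt0.
  move=> q [Kq _ hq]; have := hq _ _ _ _ z hk; have := zm_lip (Zok z) Kq Kx; rewrite (dC q).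
  lra.
}
have dens n : Hnull d k [set p | Q j i p /\ forall r0 : R, 0 < r0 -> exists r : R,
    [/\ 0 < r, r < r0 & ~ Hle d k (Bs `&` [set x | d x p <= r]) (n.+1%:R^-1 * r ^+ k)]].
{ by apply: (density uU pd cK) => //; rewrite invr_gt0.
}
have [p hp] := Hnull_nonempty k0 (Hnull_diff k0 (Hnull_diff k0 nQ nul) (Hnull_bigcup k0 dens)).
have [[Qp nLp] nN] := hp; have [Kp pxo _] := Qp.
have /Lr_bigcup[c _ Lp] : Lr K Z p by apply: contrapT => h; apply: nLp.
(* [LC_inv] needs two points other than the one it is applied to; three distinct points of [LC C]
   provide them in every case. *)
have [u [v [Ku Kv uv]]] : exists u v, [/\ LC C u, LC C v & u <> v].
{ have [u Lu] := Hnull_nonempty k0 nC0.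
  have [v [Lv vu]] := Hnull_nonempty k0 (Hnull_diff k0 nC0 (Hnull1 k0 (d0 u))).
  by exists u, v; split=> // E; apply: vu; rewrite E.
}
have [w [Lw wu]] : exists w, LC C w /\ w <> u /\ w <> v.
{ have [w [[Lw wu] wv]] := Hnull_nonempty k0 (Hnull_diff k0 (Hnull_diff k0 nC0 (Hnull1 k0 (d0 u))) (Hnull1 k0 (d0 v))).
  by exists w; split.
}
have inv g h kap m x : Z g h kap m -> LC C x -> LC (2 * C) (g x).
{ move=> z Lx; apply: (LC_inv z C0 Lx).
  have [E|xu] := pselect (u = x).
    by exists v, w; split; [case: Kv|case: Lw|move=> E'; apply: wu.2|
      split=> E'; [apply: uv; rewrite E|apply: wu.1; rewrite E]].
  have [E|xv] := pselect (v = x).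
    by exists u, w; split; [case: Ku|case: Lw|move=> E'; apply: wu.1|
      split=> // E'; apply: wu.2; rewrite E].
  by exists u, v; split=> //; [case: Ku|case: Kv].
}
have [q [Kq qp]] : exists q, K q /\ q <> p.
{ have [E|up] := pselect (u = p); [exists v|exists u]; split; [by case: Kv| |by case: Ku|by []].
  by move=> E'; apply: uv; rewrite E.
}
have c1 : (0 : R) < c.+1%:R by rewrite ltr0Sn.
have LK : LC C `<=` K by move=> x [].
have [c2 c20 hc] := zoom_mass Lp c1 Kq qp LK nC0 inv.
have [n hn] := inv_lt uU c20.
apply: nN; exists n => //; split=> // r0 r00.
have m0 : 0 < Num.min r0 i2 by rewrite lt_min r00.
have [r [r1 r2 r3]] := hc _ m0; exists r; move: r2; rewrite lt_min => /andP[r2 r4].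
split=> //; apply: contra_not r3; apply: Hle_sub.
  move=> x [Lx /= dx]; split=> //; split=> //=.
  have := dT p x xo; rewrite (dC p x); move: pxo r4; rewrite /i2.
  move: (i.+1%:R^-1 : R) => a; lra.
by rewrite ler_wpM2r ?exprn_ge0 ?(ltW r1) ?(ltW hn).
Qed.

End Finiteness.

Lemma cover_leU (R : realType) (T : Type) (d : T -> T -> R) (k : nat) (A B : set T) (dl M N : R) :
  (0 < k)%N -> 0 <= dl -> cover_le d k A dl M -> cover_le d k B dl N ->
  cover_le d k (A `|` B) dl (M + N).
Proof.
move=> k0 dl0 hA hB; have M0 := cover_le_ge0 hA; have N0 := cover_le_ge0 hB.
have h0 : cover_le d k set0 dl 0.
{ exists (fun=> set0), (fun=> 0); split=> //; first by move=> i; rewrite lexx.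
  by move=> n; rewrite big1 // => i _; rewrite expr0n (gtn_eqF k0).
}
apply: (@cover_le_sub R T d k _ (\bigcup_j (if j is 0 then A else if j is 1 then B else set0)) dl (M + N)) => //.
  by move=> x [Ax|Bx]; [exists 0%N|exists 1%N].
apply: (@cover_le_bigcup _ _ _ _ k0 _ (fun j => if j is 0 then M else if j is 1 then N else 0)) => //.
  by move=> [|[|j]].
move=> [|[|n]]; first by rewrite big_ord0 addr_ge0.
  by rewrite big_ord_recr big_ord0 /= add0r lerDl.
by rewrite !big_ord_recl /= big1 ?addr0.
Qed.

(** Countable subadditivity of Lebesgue measure; every lower bound on one-dimensional Hausdorff
    measure below comes from here. *)
Lemma interval_cover (R : realType) (D M : R) (a r : nat -> R) :
  (forall i, 0 <= r i) -> (forall s : R, 0 <= s <= D -> exists i, a i <= s <= a i + r i) ->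
  (forall n, \sum_(i < n) r i <= M) -> 0 <= D -> D <= M.
Proof.
move=> r0 hc hM D0.
pose I0 : set R := `[0, D]%classic.
pose J i : set R := `[a i, (a i + r i)]%classic.
have : (lebesgue_measure I0 <= \sum_(0 <= i <oo) lebesgue_measure (J i))%E.
{ apply: measure_sigma_subadditive; [by move=> i; exact: measurable_itv|exact: measurable_itv|].
  move=> s; rewrite /I0 /= in_itv /= => hs; have [i hi] := hc s hs.
  by exists i => //; rewrite /J /= in_itv.
}
have E (x y : R) : x <= y -> lebesgue_measure (`[x, y]%classic : set R) = (y - x)%:E.
{ move=> xy; rewrite lebesgue_measure_itv /= lte_fin; case: ltP => // h.
  have -> : y = x by apply/eqP; rewrite eq_le xy h.
  by rewrite subrr.
}
rewrite /I0 E // subr0 => h.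
rewrite -lee_fin; apply: (le_trans h).
apply: lime_le; first by apply: is_cvg_nneseries => i _ _; exact: measure_ge0.
apply: nearW => n; rewrite big_mkord.
rewrite (eq_bigr (fun i : 'I_n => (r i)%:E)); last first.
  by move=> i _; rewrite /J E ?lerDl // addrC addKr.
rewrite sumEFin lee_fin; exact: hM.
Qed.

(** * Continua of finite length *)

Section Chains.
Context {R : realType} (U : set (set nat)) (uU : free_ultra U).
Context (T : Type) (d : T -> T -> R) (pd : pmetric d).
Let d0 x : d x x = 0. Proof. by case: pd. Qed.
Let dC x y : d x y = d y x. Proof. by case: pd. Qed.
Let dT x y z : d x z <= d x y + d y z. Proof. by case: pd. Qed.
Let dge0 := pmetric_ge0 pd.

Inductive chain (A : set T) (e : R) (x : T) : T -> Prop :=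
| chain0 : A x -> chain A e x x
| chainS y z : chain A e x y -> A z -> d y z <= e -> chain A e x z.

(** In a compact set, being joined by [e]-chains for every [e] amounts to lying in a common
    connected component. This form passes to limits without mention of open sets. *)
Definition cc (A : set T) x y := forall e : R, 0 < e -> chain A e x y.
Definition conn (A : set T) := forall x y, A x -> A y -> cc A x y.

Lemma chain_l (A : set T) e x y : chain A e x y -> A x.
Proof. by elim. Qed.

Lemma chain_r (A : set T) e x y : chain A e x y -> A y.
Proof. by elim. Qed.

Lemma chain_sub A B (e e' : R) x y : A `<=` B -> e <= e' -> chain A e x y -> chain B e' x y.
Proof.
move=> AB ee'; elim=> [/AB Bx|y' z _ IH /AB Bz h]; first exact: chain0.
by apply: chainS IH Bz _; exact: le_trans ee'.
Qed.

Lemma chain_trans A e x y z : chain A e x y -> chain A e y z -> chain A e x z.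
Proof. by move=> h; elim=> // y' z' _ IH Az dz; apply: chainS IH Az dz. Qed.

Lemma chain_sym A e x y : chain A e x y -> chain A e y x.
Proof.
elim=> [|y' z h IH Az dz]; first exact: chain0.
have Ay' := chain_r h.
by apply: chain_trans (chainS (chain0 _ Az) Ay' _) IH; rewrite dC.
Qed.

Lemma cc_trans A x y z : cc A x y -> cc A y z -> cc A x z.
Proof. by move=> h1 h2 e e0; apply: chain_trans (h1 _ e0) (h2 _ e0). Qed.

Lemma cc_sym A x y : cc A x y -> cc A y x.
Proof. by move=> h e e0; apply: chain_sym; exact: h. Qed.

Lemma chain_exit A (e t : R) p z : 0 <= t -> chain A e p z ->
  (exists x, chain (A `&` [set u | d p u <= t]) e p x /\ t - e <= d p x) \/
  chain (A `&` [set u | d p u <= t]) e p z.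
Proof.
move=> t0; elim=> [Ap|y' z' h IH Az dz]; first by right; apply: chain0; split; rewrite //= d0.
case: IH => [|IH]; first by left.
have [h1|h1] := leP (d p z') t; first by right; apply: chainS IH _ dz.
by left; exists y'; split=> //; have := dT p y' z'; lra.
Qed.

Lemma ucompact_closed A (P : set T) : ucompact U d A ->
  (forall u x, (forall n, A (u n) /\ P (u n)) -> A x -> ucvg U d u x -> P x) -> ucompact U d (A `&` P).
Proof.
move=> cA h u hu; have [|x Ax cx] := cA u; first by move=> n; case: (hu n).
by exists x => //; split=> //; apply: h cx.
Qed.

Lemma ucompact_ball A p (t : R) : ucompact U d A -> ucompact U d (A `&` [set u | d p u <= t]).
Proof.
move=> cA; apply: ucompact_closed => // u x hu Ax cx /=.
rewrite leNgt; apply/negP => hlt; have e0 : 0 < d p x - t by rewrite subr_gt0.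
have [n /= hn] := u_ex uU (cx _ e0); have [_ /= h2] := hu n.
by have := dT p (u n) x; lra.
Qed.

(* Boundary bumping: a chain-connected set leaving a ball contains a
   chain-connected part of the ball that reaches its boundary. *)
Lemma cc_cut A p z (t : R) : ucompact U d A -> cc A p z -> 0 <= t -> t <= d p z ->
  exists x, [/\ A x, d p x = t & cc (A `&` [set u | d p u <= t]) p x].
Proof.
move=> cA hc t0 tz.
have H n : exists x, chain (A `&` [set u | d p u <= t]) n.+1%:R^-1 p x /\ t - n.+1%:R^-1 <= d p x.
{ have n0 : (0 : R) < n.+1%:R^-1 by rewrite invr_gt0.
  have [//|h] := chain_exit t0 (hc _ n0); exists z; split=> //.
  by apply: le_trans tz; rewrite gerBl ltW.
}
have /choice[x hx] := H.
have hin n : (A `&` [set u | d p u <= t]) (x n) by have [h _] := hx n; exact: chain_r h.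
have [y [Ay /= py] cy] := ucompact_ball (p := p) (t := t) cA hin.
exists y; split=> //.
{ apply/eqP; rewrite eq_le py /= leNgt; apply/negP => hlt.
  have e0 : 0 < (t - d p y) / 2 by rewrite divr_gt0 // subr_gt0.
  have [n [/= h1 h2]] := u_ex uU (uI uU (cy _ e0) (u_inv uU e0)).
  have [_ h3] := hx n; have := dT p y (x n); rewrite (dC y).
  move: h2 h3; move: (n.+1%:R^-1 : R) => q; lra.
}
move=> e e0; have [n [/= h1 h2]] := u_ex uU (uI uU (cy _ e0) (u_inv uU e0)).
have [h3 _] := hx n; apply: (@chainS _ _ _ (x n)); [|by split|exact: ltW].
by apply: chain_sub h3 => //; exact: ltW.
Qed.

Definition qcomp (A : set T) p := [set x | cc A p x].

Lemma qcomp_sub A p : qcomp A p `<=` A.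
Proof. by move=> x /(_ 1 ltr01); exact: chain_r. Qed.

Lemma ucompact_qcomp A p : ucompact U d A -> ucompact U d (qcomp A p).
Proof.
move=> cA u hu; have [|x Ax cx] := cA u; first by move=> n; exact: (@qcomp_sub A p).
exists x => // e e0; have [n /= hn] := u_ex uU (cx _ e0).
by apply: chainS (hu n e e0) Ax _; exact: ltW.
Qed.

(** By compactness, chains of small mesh from [p] stay close to the quasi-component, so each of
    their points can be replaced by a nearby point of the quasi-component itself. *)
Lemma conn_qcomp A p : ucompact U d A -> A p -> conn (qcomp A p).
Proof.
move=> cA Ap.
have Qp : qcomp A p p by move=> e e0; exact: chain0.
suff h x : qcomp A p x -> cc (qcomp A p) p x.
  by move=> x y /h hx /h hy; apply: cc_trans hy; exact: cc_sym.
move=> Qx e e0; have e3 : 0 < e / 3 by rewrite divr_gt0.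
have [dl [dl0 hdl]] : exists dl : R, 0 < dl /\ forall y, chain A dl p y ->
    exists2 q, qcomp A p q & d y q < e / 3.
{ apply: contrapT => hn.
  have nx n : exists y, chain A n.+1%:R^-1 p y /\ forall q, qcomp A p q -> e / 3 <= d y q.
    apply: contrapT => h; apply: hn; exists n.+1%:R^-1; split; first by rewrite invr_gt0.
    move=> y hy; apply: contrapT => h2; apply: h; exists y; split=> // q Qq.
    by rewrite leNgt; apply/negP => h3; apply: h2; exists q.
  have /choice[y hy] := nx.
  have [|z Az cz] := cA y; first by move=> n; have [h _] := hy n; exact: chain_r h.
  have Qz : qcomp A p z.
    move=> e' e'0; have [n [/= h1 h2]] := u_ex uU (uI uU (cz _ e'0) (u_inv uU e'0)).
    apply: (@chainS _ _ _ (y n)) => //; last exact: ltW.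
    by have [h3 _] := hy n; apply: chain_sub h3 => //; exact: ltW.
  have [n /= h1] := u_ex uU (cz _ e3).
  by have [_ /(_ z Qz)] := hy n; lra.
}
pose e1 := Num.min dl (e / 3).
have e10 : 0 < e1 by rewrite lt_min dl0.
have key y : chain A e1 p y -> exists q, chain (qcomp A p) e p q /\ d y q <= e / 3.
{ elim=> [_|y' z h [q [hq dq]] Az dz].
    by exists p; split; [exact: chain0|rewrite d0 ltW].
  have [|q' Qq' dq'] := hdl z.
    apply: (@chain_sub A A e1 dl) => //; first by rewrite ge_min lexx.
    exact: chainS h Az dz.
  exists q'; split; last exact: ltW.
  apply: chainS hq Qq' _; have : e1 <= e / 3 by rewrite ge_min lexx orbT.
  by have := dT q y' q'; have := dT y' z q'; rewrite (dC q y'); lra.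
}
have [q [hq dq]] := key x (Qx _ e10).
by apply: chainS hq Qx _; rewrite dC; lra.
Qed.

(** The function [d x] is 1-Lipschitz and, by [cc_cut], takes on [A] all values between 0 and
    [d x y]; a cover of [A] thus yields a cover of that interval by intervals of the same
    lengths. *)
Lemma length_ge A x y (c : R) : ucompact U d A -> cc A x y -> c < d x y -> ~ Hle d 1 A c.
Proof.
move=> cA hc cxy hle.
pose e := (d x y - c) / 2.
have e0 : 0 < e by rewrite /e divr_gt0 // subr_gt0.
have [V [r [h1 h2 h3 h4]]] := hle 1 e ltr01 e0.
pose S i := [set d x z | z in V i `&` A].
have : d x y <= c + e.
{ apply: (@interval_cover R _ _ (fun i => inf (S i)) r) => //.
  - by move=> i; have /andP[] := h2 i.
  - move=> s /andP[s0 sD]; have [z [Az dz _]] := cc_cut cA hc s0 sD.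
    have [i _ Vz] := h1 z Az; exists i.
    have Si : has_lbound (S i) by exists 0 => _ [w _ <-]; exact: dge0.
    apply/andP; split; first by apply: ge_inf => //; exists z.
    rewrite -lerBlDr; apply: lb_le_inf; first by exists s; exists z.
    move=> _ [w [Vw Aw] <-]; have := h3 i _ _ Vz Vw; have := dT x w z; rewrite (dC w z).
    by rewrite -dz; lra.
}
by rewrite /e; lra.
Qed.

Lemma length_ball A a z (t c : R) : ucompact U d A -> conn A -> A a -> A z -> 0 <= t -> t <= d a z ->
  c < t -> ~ Hle d 1 (A `&` [set u | d a u <= t]) c.
Proof.
move=> cA hA Aa Az t0 taz ct.
have [x [Ax dx hc]] := cc_cut cA (hA _ _ Aa Az) t0 taz.
by apply: (length_ge (ucompact_ball cA) hc); rewrite dx.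
Qed.

(* Three balls around a, b, z with radii the Gromov products are disjoint. *)
Lemma length_excess A a b z (c : R) : ucompact U d A -> conn A -> A a -> A b -> A z ->
  d a b < d a z + d z b -> c < d a b + (d a z + d z b - d a b) / 2 -> 0 < d a b -> ~ Hle d 1 A c.
Proof.
move=> cA hA Aa Ab Az ex hc D0.
set D := d a b in ex hc D0 *; set x := d a z in ex hc *; set y := d z b in ex hc *.
have t1 : x <= D + y by rewrite /x /D /y; have := dT a b z; rewrite (dC b z).
have t2 : y <= x + D by rewrite /x /D /y; have := dT z a b; rewrite (dC z a).
have x0 : 0 < x by lra.
have y0 : 0 < y by lra.
pose S := D + (x + y - D) / 2; have S0 : 0 < S by rewrite /S; lra.
(* Shrinking the radii by the factor [1 - nu] separates the three balls, at a cost smaller than the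
   gap between [c] and [S]. *)
have [nu nu0 [nu1 hnu]] : exists2 nu : R, 0 < nu & nu < 1 /\ c < (1 - nu) * S.
{ have [c0|c0] := ltP c 0; first by exists (1 / 2); [lra|split; [lra|rewrite /S; lra]].
  exists ((S - c) / (2 * S)); first by rewrite divr_gt0 ?mulr_gt0 // subr_gt0.
  rewrite ltr_pdivrMr ?mulr_gt0 //; split; first by rewrite -/S in hc; lra.
  have -> : (1 - (S - c) / (2 * S)) * S = (S + c) / 2 by field; rewrite lt0r_neq0.
  by rewrite -/S in hc; lra.
}
pose ra := (x + D - y) / 2; pose rb := (y + D - x) / 2; pose rz := (x + y - D) / 2.
have ra0 : 0 <= ra by rewrite /ra; lra.
have rb0 : 0 <= rb by rewrite /rb; lra.
have rz0 : 0 <= rz by rewrite /rz; lra.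
pose ta := (1 - nu) * ra; pose tb := (1 - nu) * rb; pose tz := (1 - nu) * rz.
have le1 (r : R) : 0 <= r -> (1 - nu) * r <= r by move=> r0; nra.
have ge0 (r : R) : 0 <= r -> 0 <= (1 - nu) * r by move=> r0; rewrite mulr_ge0 // subr_ge0 ltW.
pose g := ((1 - nu) * S - c) / 3; have g0 : 0 < g by rewrite /g; lra.
have Ba : ~ Hle d 1 (A `&` [set u | d a u <= ta]) (ta - g).
{ apply: (@length_ball A a b ta) => //; [exact: ge0| |lra].
  by apply: le_trans (le1 _ ra0) _; rewrite -/D /ra; lra.
}
have Bb : ~ Hle d 1 (A `&` [set u | d b u <= tb]) (tb - g).
{ apply: (@length_ball A b a tb) => //; [exact: ge0| |lra].
  by apply: le_trans (le1 _ rb0) _; rewrite dC -/D /rb; lra.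
}
have Bz : ~ Hle d 1 (A `&` [set u | d z u <= tz]) (tz - g).
{ apply: (@length_ball A z a tz) => //; [exact: ge0| |lra].
  by apply: le_trans (le1 _ rz0) _; rewrite dC -/x /rz; lra.
}
have s1 : 0 < nu * D by exact: mulr_gt0.
have s2 : 0 < Num.min (nu * x) (nu * y) by rewrite lt_min !mulr_gt0.
have H1 := @Hle_superadd R T d 1 isT _ _ (ta - g) (tb - g) _ s1 _ Ba Bb.
have H1' : ~ Hle d 1 ((A `&` [set u | d a u <= ta]) `|` (A `&` [set u | d b u <= tb])) (ta - g + (tb - g)).
{ apply: H1 => u v [_ /= hu] [_ /= hv].
  have E : nu * D = D - ta - tb by rewrite /ta /tb /ra /rb; lra.
  rewrite E; have := dT a u b; have := dT u v b; rewrite (dC v b) -/D; lra.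
}
have H2 := @Hle_superadd R T d 1 isT _ _ _ (tz - g) _ s2 _ H1' Bz.
have {H2} : ~ Hle d 1 (((A `&` [set u | d a u <= ta]) `|` (A `&` [set u | d b u <= tb])) `|` (A `&` [set u | d z u <= tz])) (ta - g + (tb - g) + (tz - g)).
{ apply: H2 => u v [] [_ /= hu] [_ /= hv].
    have E : nu * x = x - ta - tz by rewrite /ta /tz /ra /rz; lra.
    apply: (@le_trans _ _ (nu * x)); first by rewrite ge_min lexx.
    by rewrite E; have := dT a u z; have := dT u v z; rewrite (dC v z) -/x; lra.
  have E : nu * y = y - tb - tz by rewrite /tb /tz /rb /rz; lra.
  apply: (@le_trans _ _ (nu * y)); first by rewrite ge_min lexx orbT.
  by rewrite E; have := dT z v b; have := dT v u b; rewrite (dC v u) (dC u b) -/y; lra.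
}
apply: contra_not; apply: Hle_sub.
  by move=> u [[[]|[]]|[]].
have -> : ta - g + (tb - g) + (tz - g) = (1 - nu) * S - 3 * g.
  by rewrite /ta /tb /tz /ra /rb /rz /S; lra.
by rewrite /g; lra.
Qed.

Lemma diam_attained A p : ucompact U d A -> A p -> exists a b, [/\ A a, A b &
  forall u v, A u -> A v -> d u v <= d a b].
Proof.
move=> cA Ap.
pose S : set R := [set r | exists u v, [/\ A u, A v & r = d u v]].
have S0 : S !=set0 by exists (d p p), p, p.
have Sb : has_ubound S.
{ apply: contrapT => hn.
  have nx n : exists u, A u /\ n%:R < d p u.
    apply: contrapT => h; apply: hn; exists (2 * n%:R) => _ [u [v [Au Av ->]]].
    have hle w : A w -> d p w <= n%:R by move=> Aw; rewrite leNgt; apply/negP => hw; apply: h; exists w.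
    by have := dT u p v; rewrite (dC u p); have := hle u Au; have := hle v Av; lra.
  have /choice[u hu] := nx.
  have [|x Ax cx] := cA u; first by move=> n; case: (hu n).
  have [n hn1 /= hn2] := u_ex_ge uU (Num.truncn (d p x + 1)).+1 (cx _ ltr01).
  have [_ h1] := hu n; have h2 := truncnS_gt (d p x + 1).
  have h3 : ((Num.truncn (d p x + 1)).+1%:R : R) <= n%:R by rewrite ler_nat.
  by have := dT p x (u n); rewrite (dC x); lra.
}
have nx n : exists uv, [/\ A uv.1, A uv.2 & sup S - n.+1%:R^-1 < d uv.1 uv.2].
{ have n0 : (0 : R) < n.+1%:R^-1 by rewrite invr_gt0.
  have : sup S - n.+1%:R^-1 < sup S by rewrite ltrBlDr ltrDl.
  by move=> /(sup_gt S0)[_ [u [v [Au Av ->]]] h]; exists (u, v).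
}
have /choice[w hw] := nx.
have [|a Aa ca] := cA (fun n => (w n).1); first by move=> n; case: (hw n).
have [|b Ab cb] := cA (fun n => (w n).2); first by move=> n; case: (hw n).
exists a, b; split=> // u v Au Av.
have : d u v <= sup S by apply: ub_le_sup => //; exists u, v.
move=> h; apply: (le_trans h); rewrite leNgt; apply/negP => hlt.
have e0 : 0 < (sup S - d a b) / 2 by rewrite divr_gt0 // subr_gt0.
have [n [/= h1 h2]] := u_ex uU (uI uU (ucvg_dist uU pd ca cb e0) (u_inv uU e0)).
have [_ _ h3] := hw n; move: h1; rewrite ltr_norml => /andP[_ h1].
by move: h2 h3 h1; move: (n.+1%:R^-1 : R) => q; lra.
Qed.

Lemma disjoint_sep A B : ucompact U d A -> ucompact U d B ->
  (forall x y, A x -> B y -> d x y <> 0) ->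
  exists2 s : R, 0 < s & forall x y, A x -> B y -> s <= d x y.
Proof.
move=> cA cB hd; apply: contrapT => hn.
have nx n : exists w, [/\ A w.1, B w.2 & d w.1 w.2 < n.+1%:R^-1].
{ apply: contrapT => h; apply: hn; exists n.+1%:R^-1; first by rewrite invr_gt0.
  by move=> x y Ax By; rewrite leNgt; apply/negP => hxy; apply: h; exists (x, y).
}
have /choice[w hw] := nx.
have [|a Aa ca] := cA (fun n => (w n).1); first by move=> n; case: (hw n).
have [|b Bb cb] := cB (fun n => (w n).2); first by move=> n; case: (hw n).
have dab : 0 < d a b by rewrite lt_neqAle dge0 andbT eq_sym; apply/eqP; exact: hd.
have e0 : 0 < d a b / 2 by rewrite divr_gt0.
have [n [/= h1 h2]] := u_ex uU (uI uU (ucvg_dist uU pd ca cb e0) (u_inv uU e0)).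
have [_ _ h3] := hw n; move: h1; rewrite ltr_norml => /andP[h1 _].
by move: h2 h3 h1; move: (n.+1%:R^-1 : R) => q; lra.
Qed.

(** The last clause is a small excess in the triangle inequality; in an inner product space it
    forces [W] to stay near the segment from [a] to [b], see [near_segment]. *)
Definition straight (W : set T) p a b (e : R) :=
  [/\ ucompact U d W, conn W, W p /\ (W a /\ W b), forall u v, W u -> W v -> d u v <= d a b
    & forall z, W z -> d a z + d z b <= (1 + e) * d a b].

(** If straight pieces were missing at all points outside [N], small continua with excess would form
    a Vitali family. By [length_excess] each of them has length at least [q] times its diameter, so
    a disjoint subfamily shows that the length [as_] is at most [as_ / q]. *)
Lemma straight_exists (ga N : set T) (e : R) p0 p1 : ucompact U d ga -> conn ga ->
  Hfin d 1 ga -> ga p0 -> ga p1 -> 0 < d p0 p1 -> Hnull d 1 N -> 0 < e ->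
  exists p, [/\ ga p, ~ N p & exists2 r0 : R, 0 < r0 & forall r : R, 0 < r -> r < r0 ->
    exists W a b, [/\ W `<=` ga, straight W p a b e, r <= d a b & forall u, W u -> d p u <= r]].
Proof.
move=> cg hg fg g0 g1 d01 nN e0; apply: contrapT => hno.
have [as_ hle hmin] := Hval fg.
have as0 : 0 < as_.
{ rewrite ltNge; apply/negP => h; apply: (length_ge (c := as_) cg (hg _ _ g0 g1)) => //.
  exact: le_lt_trans d01.
}
pose q := 1 + e / 2; have q1 : 1 < q by rewrite /q; lra.
have q0 : 0 < q by lra.
apply: (hmin (as_ / q)); first by rewrite ltr_pdivrMr // ltr_pMr.
move=> dl ee dl0 ee0.
pose F := [set i : T * set T * R | let: (p, W, D) := i in
  [/\ [/\ W p, W `<=` ga & ucompact U d W], 0 < D, 5 * D <= dl,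
      forall u v, W u -> W v -> d u v <= D
    & forall c : R, c < q * D -> ~ Hle d 1 W c]].
pose W_ (i : T * set T * R) := i.1.2.
pose sz (i : T * set T * R) := i.2.
pose cf (i j : T * set T * R) := exists x y, [/\ W_ i x, W_ j y & d x y = 0].
have item p (rmax : R) : ga p -> ~ N p -> 0 < rmax -> exists2 i, F i & i.1.1 = p /\ sz i < rmax.
{ move=> gp nNp rm0.
  (* Half of [d p0 p1] makes [ga] leave the ball about [p]; the other two bounds give a size below
     [rmax] and [5 * D <= dl]. *)
  pose r1 := Num.min (Num.min (rmax / 4) (dl / 10)) (d p0 p1 / 2).
  have r10 : 0 < r1 by rewrite !lt_min !divr_gt0.
  have [r [r0 rr1 hr]] : exists r : R, [/\ 0 < r, r < r1 & ~ exists W a b, [/\ W `<=` ga,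
      straight W p a b e, r <= d a b & forall u, W u -> d p u <= r]].
    apply: contrapT => h; apply: hno; exists p; split=> //; exists r1 => // r r0 rr1.
    by apply: contrapT => h2; apply: h; exists r.
  move: (rr1); rewrite !lt_min => /andP[/andP[b1 b2] b3].
  have [z gz pz] : exists2 z, ga z & r <= d p z.
    have [h|h] := leP r (d p p0); first by exists p0.
    by exists p1 => //; have := dT p0 p p1; rewrite (dC p0 p); lra.
  have [x [gx dx cx]] := cc_cut cg (hg _ _ gp gz) (ltW r0) pz.
  pose A := ga `&` [set u | d p u <= r].
  have cA : ucompact U d A by exact: ucompact_ball.
  have Ap : A p by split=> //=; rewrite d0 ltW.
  have cW := ucompact_qcomp (p := p) cA; have hW := conn_qcomp cA Ap.
  have Wp : qcomp A p p by move=> e' _; exact: chain0.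
  have [a [b [Wa Wb hab]]] := diam_attained cW Wp.
  have Wx : qcomp A p x by [].
  have rab : r <= d a b by rewrite -dx; exact: hab.
  have Wsub u : qcomp A p u -> ga u /\ d p u <= r by move=> /qcomp_sub.
  have [z' Wz' hz'] : exists2 z', qcomp A p z' & (1 + e) * d a b < d a z' + d z' b.
    apply: contrapT => h; apply: hr; exists (qcomp A p), a, b; split=> //.
    - by move=> u /Wsub[].
    - by split=> // w Ww; rewrite leNgt; apply/negP => h2; apply: h; exists w.
    - by move=> u /Wsub[].
  have D0 : 0 < d a b by exact: lt_le_trans rab.
  have D2 : d a b <= 2 * r.
    by have [_ h1] := Wsub _ Wa; have [_ h2] := Wsub _ Wb; have := dT a p b; rewrite (dC a p); lra.
  exists (p, qcomp A p, d a b); last by split=> //; rewrite /sz /=; lra.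
  split=> //.
  - by split=> // u /Wsub[].
  - lra.
  - move=> c hc; apply: (length_excess cW hW Wa Wb Wz') => //.
      by apply: lt_trans hz'; rewrite ltr_pMl // ltrDl.
    by apply: (lt_le_trans hc); rewrite /q; lra.
}
have sepn (u : nat -> T * set T * R) : (forall n, F (u n)) -> (forall m n, (m < n)%N -> ~ cf (u m) (u n)) ->
  forall n, exists2 s : R, 0 < s & forall i x y, (i < n)%N -> W_ (u i) x -> W_ (u n) y -> s <= d x y.
{ move=> uF unc n.
  suff H m : (m <= n)%N -> exists2 s : R, 0 < s & forall i x y, (i < m)%N -> W_ (u i) x -> W_ (u n) y -> s <= d x y.
    exact: (H n).
  elim: m => [|m IH] mn; first by exists 1.
  have [s1 s10 h1] := IH (ltnW mn).
  have cW j : ucompact U d (W_ (u j)).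
    by have := uF j; rewrite /W_; case: (u j) => [[p W] D] [[]].
  have [s2 s20 h2] := disjoint_sep (cW m) (cW n) (fun x y hx hy E => unc m n mn (ex_intro _ x (ex_intro _ y (And3 hx hy E)))).
  exists (Num.min s1 s2); first by rewrite lt_min s10.
  move=> i x y; rewrite ltnS leq_eqVlt => /orP[/eqP ->|im] hx hy.
    by rewrite ge_min (h2 x y) ?orbT.
  by rewrite ge_min (h1 i x y).
}
have [||s [sF sc sd]] := @greedy_selection R _ F sz cf dl.
{ case=> [[p W] D] [_ h1 h2 _ _]; rewrite /sz /= h1; lra.
}
{ move=> u uF unc e1 e10; apply: contrapT => hn.
  have hge n : e1 <= sz (u n) by rewrite leNgt; apply/negP => h; apply: hn; exists n.
  pose n := (Num.truncn (as_ / e1)).+1.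
  have hM : as_ < \sum_(i < n) e1.
    have -> : \sum_(i < n) e1 = n%:R * e1 by rewrite sumr_const card_ord mulr_natl.
    by rewrite -ltr_pdivrMr //; exact: truncnS_gt.
  apply: (@superadd_seq R T d 1 isT (fun n => W_ (u n)) (fun=> e1) (sepn u uF unc) _ n as_ hM).
    move=> m b hb; have := hge m; have := uF m; rewrite /sz /W_; case: (u m) => [[p W] D] [_ D0 _ _ h] /= he.
    by apply: h; apply: (lt_le_trans hb); apply: (le_trans he); rewrite ler_pMl // ltW.
  apply: Hle_sub hle => // x [i _]; have := uF i; rewrite /W_; case: (u i) => [[p W] D] [[_ h _] _ _ _ _].
  exact: h.
}
pose D_ n := if s n is Some i then sz i else 0.
pose Ws n := if s n is Some i then W_ i else set0.
have D0 n : 0 <= D_ n.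
{ by rewrite /D_; case E : (s n) => [[[p W] D]|] //; have [_ /ltW] := sF _ _ E.
}
have Dsum n : \sum_(i < n) D_ i <= as_ / q.
{ rewrite ler_pdivlMr // mulr_suml leNgt; apply/negP => hlt.
  apply: (@superadd_seq R T d 1 isT Ws (fun i => D_ i * q) _ _ n as_ hlt).
  - move=> m; rewrite /Ws; case E : (s m) => [j|]; last by exists 1.
    pose u i := if s i is Some i' then i' else j.
    suff H m' : (m' <= m)%N -> exists2 s0 : R, 0 < s0 & forall i x y, (i < m')%N ->
        Ws i x -> W_ j y -> s0 <= d x y by exact: (H m).
    elim: m' => [|m' IH] mm; first by exists 1.
    have [s1 s10 h1] := IH (ltnW mm).
    have [s2 s20 h2] : exists2 s2 : R, 0 < s2 & forall x y, Ws m' x -> W_ j y -> s2 <= d x y.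
      rewrite /Ws; case E' : (s m') => [j'|]; last by exists 1.
      apply: disjoint_sep.
      - by have := sF _ _ E'; rewrite /W_; case: (j') => [[p W] D] [[]].
      - by have := sF _ _ E; rewrite /W_; case: (j) => [[p W] D] [[]].
      - by move=> x y hx hy hxy; apply: (sc _ _ _ _ mm E' E); exists x, y.
    exists (Num.min s1 s2); first by rewrite lt_min s10.
    move=> i x y; rewrite ltnS leq_eqVlt => /orP[/eqP ->|im] hx hy.
      by rewrite ge_min (h2 x y) ?orbT.
    by rewrite ge_min (h1 i x y).
  - move=> m b; rewrite /D_ /Ws; case E : (s m) => [[[p W] D]|]; last by rewrite mul0r => b0 /Hle_ge0; lra.
    by have [_ _ _ _ h] := sF _ _ E; rewrite mulrC; exact: h.
  - apply: Hle_sub hle => // x [i _]; rewrite /Ws; case E : (s i) => [[[p W] D]|] //.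
    by have [[_ h _] _ _ _ _] := sF _ _ E; exact: h.
}
pose S n := \sum_(i < n) D_ i.
(* Vitali's device: the first [m] sets are used as they are, the later ones are enlarged 5 times,
   and the tail of the sum of diameters is small enough to pay for that. *)
have [m hm] : exists m, forall n, (m <= n)%N -> S n - S m <= ee / 20.
{ have S0 : (range S) !=set0 by exists (S 0%N), 0%N.
  have Sb : has_ubound (range S) by exists (as_ / q) => _ [n _ <-]; exact: Dsum.
  have : sup (range S) - ee / 20 < sup (range S) by rewrite ltrBlDr ltrDl divr_gt0.
  move=> /(sup_gt S0)[_ [m _ <-] h]; exists m => n mn.
  have : S n <= sup (range S) by apply: ub_le_sup => //; exists n.
  lra.
}
have e2 : 0 < ee / 2 by rewrite divr_gt0.
have covN := nN dl (ee / 2) dl0 e2; rewrite add0r in covN.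
have -> : as_ / q + ee = as_ / q + ee / 2 + ee / 2 by lra.
apply: (@cover_le_sub R T d 1 _ ((ga `\` N) `|` N) dl (as_ / q + ee / 2 + ee / 2)) => //.
  by move=> x gx; have [Nx|Nx] := pselect (N x); [right|left].
apply: cover_leU => //; first exact: ltW.
exists (fun n => if (n < m)%N then [set x | exists2 u, Ws n u & d x u = 0] else [set x | exists2 u, Ws n u & d x u <= 2 * D_ n]).
exists (fun n => if (n < m)%N then D_ n else 5 * D_ n).
have Wd n x y : Ws n x -> Ws n y -> d x y <= D_ n.
{ by rewrite /Ws /D_; case E : (s n) => [[[p W] D]|] //; have [_ _ _ h _] := sF _ _ E; exact: h.
}
split.
{ move=> p [gp nNp].
  have [[n nm Wn]|hout] := pselect (exists2 n, (n < m)%N & exists2 u, Ws n u & d p u = 0).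
    by exists n => //; rewrite nm.
  have [t t0 ht] : exists2 t : R, 0 < t & forall n u, (n < m)%N -> Ws n u -> t <= d p u.
    suff H m' : (m' <= m)%N -> exists2 t : R, 0 < t & forall n u, (n < m')%N -> Ws n u -> t <= d p u by exact: (H m).
    elim: m' => [|m' IH] mm; first by exists 1.
    have [s1 s10 h1] := IH (ltnW mm).
    have [s2 s20 h2] : exists2 s2 : R, 0 < s2 & forall x y, [set p] x -> Ws m' y -> s2 <= d x y.
      apply: disjoint_sep.
      - by move=> u hu; exists p => // e' e'0; apply: (uA uU) => n /=; rewrite hu d0.
      - rewrite /Ws; case E' : (s m') => [j'|]; last by move=> u /(_ 0%N).
        by have := sF _ _ E'; rewrite /W_; case: (j') => [[p' W] D] [[]].
      - by move=> x y -> hy E; apply: hout; exists m' => //; exists y.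
    exists (Num.min s1 s2); first by rewrite lt_min s10.
    move=> i u; rewrite ltnS leq_eqVlt => /orP[/eqP ->|im] hu.
      by rewrite ge_min (h2 p u) ?orbT.
    by rewrite ge_min (h1 i u).
  have [j Fj [pj szj]] := item p t gp nNp t0.
  have [n [i [sn [x [y [Wx Wy xy]]] si]]] := sd j Fj.
  have py : d p y <= sz j.
    have := Fj; rewrite /W_ /sz in Wy *; case: (j) pj Wy => [[p' W] D] /= -> Wy [[Wp _ _] _ _ h _].
    exact: h.
  have px : d p x <= sz j by have := dT p y x; rewrite (dC y x) xy addr0; lra.
  have Wnx : Ws n x by rewrite /Ws sn.
  exists n => //; case: ltnP => nm.
    by have := ht _ _ nm Wnx; lra.
  by exists x => //; apply: (le_trans px); rewrite /D_ sn.
}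
{ move=> n; have D5 : 5 * D_ n <= dl.
    rewrite /D_; case E : (s n) => [[[p W] D]|]; last by rewrite mulr0 ltW.
    by have [_ _ h _ _] := sF _ _ E.
  by have := D0 n; case: ifP => _ h; apply/andP; split; lra.
}
{ move=> n x y; case: ifP => _ [u Wu hu] [v Wv hv].
    by have := Wd _ _ _ Wu Wv; have := dT x u y; have := dT u v y; rewrite (dC v y); lra.
  by have := Wd _ _ _ Wu Wv; have := dT x u y; have := dT u v y; rewrite (dC v y); lra.
}
move=> n.
pose tl i := if (i < m)%N then 0 else D_ i.
have tlE n' : \sum_(i < n') tl i = S n' - S (minn n' m).
{ elim: n' => [|n' IH]; first by rewrite min0n big_ord0 subrr.
  rewrite big_ord_recr /= IH /tl /S; case: ltnP => h.
    by rewrite (minn_idPl h) !subrr addr0.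
  by rewrite (minn_idPr (leqW h)) [in RHS]big_ord_recr /=; lra.
}
have tl_le : \sum_(i < n) tl i <= ee / 20.
{ rewrite tlE; case: (leqP m n) => h; first exact: hm.
  by rewrite subrr divr_ge0 // ltW.
}
apply: (@le_trans _ _ (\sum_(i < n) D_ i + 4 * \sum_(i < n) tl i)).
{ rewrite mulr_sumr -big_split /=; apply: ler_sum => i _; rewrite /tl expr1.
  by case: ifP => _; lra.
}
by have := Dsum n; lra.
Qed.
End Chains.

(** * Covering dimension by slicing *)

Section CovDim.
Context {R : realType} (U : set (set nat)) (uU : free_ultra U).
Context (T : Type) (d : T -> T -> R) (pd : pmetric d).
Hypothesis dsep : forall x y, d x y = 0 -> x = y.
Let d0 x : d x x = 0. Proof. by case: pd. Qed.
Let dC x y : d x y = d y x. Proof. by case: pd. Qed.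
Let dT x y z : d x z <= d x y + d y z. Proof. by case: pd. Qed.
Let dge0 := pmetric_ge0 pd.

(** For compact sets this is total disconnectedness in a uniform form; with chains the union theorem
    becomes elementary. *)
Definition zdim (A : set T) := forall e : R, 0 < e -> exists2 dl : R, 0 < dl &
  forall x y, chain d A dl x y -> d x y <= e.

(** Take the scale for [B] much finer than the one for [A]: a chain in the union then makes only
    short excursions into [B], and an [A]-chain of the coarser mesh jumps over them. *)
Lemma zdimU A B : zdim A -> zdim B -> zdim (A `|` B).
Proof.
move=> hA hB e e0; have e3 : 0 < e / 3 by rewrite divr_gt0.
have [d1' d10' h1'] := hA _ e3.
pose d1 := Num.min d1' (e / 3); have d10 : 0 < d1 by rewrite lt_min d10'.
have h1 x y : chain d A d1 x y -> d x y <= e / 3.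
{ move=> hc; apply: h1'; apply: (chain_sub _ _ hc) => //; by rewrite ge_min lexx.
}
have d1e : d1 <= e / 3 by rewrite ge_min lexx orbT.
have d14 : 0 < d1 / 4 by rewrite divr_gt0.
have [d2 d20 h2] := hB _ d14.
pose dl := Num.min d2 (d1 / 4); have dl0 : 0 < dl by rewrite lt_min d20.
have dl2 : dl <= d2 by rewrite ge_min lexx.
have dl1 : dl <= d1 / 4 by rewrite ge_min lexx orbT.
have key x y : A x -> chain d (A `|` B) dl x y -> exists a, chain d A d1 x a /\
  (y = a \/ exists b, chain d B d2 b y /\ d a b <= d1 / 4).
{ move=> Ax; elim=> [_|y' z _ [a [ha [->|[b [hb ab]]]]] Az dz].
  - by exists x; split; [exact: chain0|left].
  - case: Az => Az.
      by exists z; split; [apply: chainS ha Az _; lra|left].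
    by exists a; split=> //; right; exists z; split; [exact: chain0|lra].
  - have := h2 _ _ hb => bd; case: Az => Az.
      exists z; split; last by left.
      apply: chainS ha Az _; have := dT a b z; have := dT b y' z; lra.
    by exists a; split=> //; right; exists b; split=> //; apply: chainS hb Az _; lra.
}
have bound x y : A x -> chain d (A `|` B) dl x y -> d x y <= e / 3 + d1 / 2.
{ move=> Ax hc; have [a [ha [->|[b [hb ab]]]]] := key x y Ax hc; first by have := h1 _ _ ha; lra.
  by have := h1 _ _ ha; have := h2 _ _ hb; have := dT x a y; have := dT a b y; lra.
}
exists dl => // x y hc; have : (A `|` B) x by apply: (chain_l hc).
case=> Ax; first by have := bound x y Ax hc; lra.
have : chain d B d2 x y \/ exists a, [/\ A a, d x a <= d1 / 2 & chain d (A `|` B) dl a y].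
{ elim: hc => [_|y' z _ [IH|[a [Aa xa ha]]] Az dz].
  - by left; exact: chain0.
  - case: Az => Az; last by left; apply: chainS IH Az _; lra.
    right; exists z; split=> //; last by apply: chain0; left.
    by have := h2 _ _ IH; have := dT x y' z; lra.
  - by right; exists a; split=> //; apply: chainS ha Az dz.
}
case=> [hb|[a [Aa xa ha]]]; first by have := h2 _ _ hb; lra.
by have := bound _ _ Aa ha; have := dT x a y; lra.
Qed.

Lemma not_zdim A : ucompact U d A -> ~ zdim A -> exists x y, [/\ A x, A y, 0 < d x y & cc d A x y].
Proof.
move=> cA /existsNP[e /not_implyP[e0 hn]].
have nx n : exists w, chain d A n.+1%:R^-1 w.1 w.2 /\ e < d w.1 w.2.
{ apply: contrapT => h; apply: hn; exists n.+1%:R^-1; first by rewrite invr_gt0.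
  by move=> x y hc; rewrite leNgt; apply/negP => hxy; apply: h; exists (x, y).
}
have /choice[w hw] := nx.
have [|x Ax cx] := cA (fun n => (w n).1); first by move=> n; have [h _] := hw n; exact: (chain_l h).
have [|y Ay cy] := cA (fun n => (w n).2); first by move=> n; have [h _] := hw n; exact: (chain_r h).
exists x, y; split=> //.
{ have e2 : 0 < e / 2 by rewrite divr_gt0.
  have [n /= h1] := u_ex uU (ucvg_dist uU pd cx cy e2).
  by have [_ h2] := hw n; move: h1; rewrite ltr_norml => /andP[? ?]; lra.
}
move=> e' e'0; have [n [[/= h1 h2] h3]] := u_ex uU (uI uU (uI uU (cx _ e'0) (cy _ e'0)) (u_inv uU e'0)).
have [h4 _] := hw n; apply: (@chainS _ _ _ _ _ _ (w n).2) => //; last exact: ltW.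
apply: (@chain_trans _ _ _ _ _ _ (w n).1); last by apply: (chain_sub _ _ h4) => //; exact: ltW.
apply: (@chainS _ _ _ _ _ _ x); [exact: chain0|exact: (chain_l h4)|].
by rewrite dC ltW.
Qed.

(** Covering dimension at most [n], in the form of finite closed covers by small sets in [n + 1]
    colours with disjoint sets in each colour. Such covers extend from boundaries to interiors at
    the price of one more colour. *)
Definition coloured (n : nat) (A : set T) := forall e : R, 0 < e ->
  exists (I : finType) (F : I -> set T) (col : I -> nat),
  [/\ forall i, F i `<=` A /\ ucompact U d (F i),
      forall i x y, F i x -> F i y -> d x y <= e,
      forall x, A x -> exists i, F i x
    & (forall i, (col i <= n)%N) /\
      forall i j x, i != j -> col i = col j -> F i x -> F j x -> False].

Lemma zdim_coloured A : ucompact U d A -> zdim A -> coloured 0 A.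
Proof.
move=> cA hA e e0; have [dl dl0 hdl] := hA e e0.
have [l [lA hl]] := finite_net uU pd cA dl0.
pose nn (i : nat) x0 := List.nth i l x0.
have [[x0 Ax0]|nA] := pselect (exists x, A x); last first.
{ exists 'I_0, (fun=> set0), (fun=> 0%N); split=> //; first by case.
  by move=> x Ax; case: nA; exists x.
}
pose z (i : 'I_(length l)) := List.nth i l x0.
pose F i := [set x | chain d A dl (z i) x /\ forall j : 'I_(length l), (j < i)%N -> ~ chain d A dl (z j) x].
exists 'I_(length l), F, (fun=> 0%N); split=> //.
{ move=> i; split; first by move=> x [h _]; exact: (chain_r h).
  move=> u hu; have [|x Ax cx] := cA u; first by move=> n; have [h _] := hu n; exact: (chain_r h).
  have [n /= hn] := u_ex uU (cx _ dl0); have [h1 h2] := hu n.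
  exists x => //; split; first by apply: chainS h1 Ax _; exact: ltW.
  move=> j ji hj; apply: (h2 j ji); apply: chainS hj (chain_r h1) _; by rewrite dC ltW.
}
{ move=> i x y [hx _] [hy _]; apply: hdl; apply: chain_trans hy; exact: (chain_sym pd hx).
}
{ move=> x Ax; have [y ly dy] := hl x Ax.
  have [i [il hi]] := List.In_nth _ _ x0 ly.
  have [i' hi'] : exists i : 'I_(length l), chain d A dl (z i) x.
    have il' : (i < length l)%N by apply/ssrnat.ltP.
    exists (Ordinal il'); rewrite /z /= hi; apply: chainS (chain0 _ _ (lA _ ly)) Ax _.
    by rewrite dC ltW.
  have [i'' h1 h2] := @arg_minnP _ i' (fun i => `[< chain d A dl (z i) x >]) (fun i : 'I_(length l) => i : nat) (asboolT hi').
  exists i''; split; first exact/asboolP.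
  by move=> j ji hj; have := h2 j (asboolT hj); rewrite leqNgt ji.
}
split=> // i j x ij _ [h1 h2] [h3 h4].
have : (i : nat) != j by [].
by rewrite neq_ltn => /orP[/h4|/h2]; apply.
Qed.

Lemma ucompactU A B : ucompact U d A -> ucompact U d B -> ucompact U d (A `|` B).
Proof.
move=> cA cB u hu.
have key (C : set T) : ucompact U d C -> U [set n | C (u n)] -> exists2 x, C x & ucvg U d u x.
{ move=> cC hC; have [n0 Cn0] := u_ex uU hC.
  pose v n := if `[< C (u n) >] then u n else u n0.
  have [|x Cx cx] := cC v; first by move=> n; rewrite /v; case: asboolP.
  exists x => // e e0; apply: (uS uU) (uI uU hC (cx _ e0)) => n [/= h1].
  by rewrite /v asboolT.
}
have [h|/(uC uU) h] := pselect (U [set n | A (u n)]).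
  by have [x Ax cx] := key A cA h; exists x => //; left.
have [|x Bx cx] := key B cB; last by exists x => //; right.
by apply: (uS uU) h => n /= nA; case: (hu n).
Qed.

Lemma ucompact0 : ucompact U d set0.
Proof. by move=> u /(_ 0%N). Qed.

Lemma lebesgue_number A (O : T -> set T) : ucompact U d A ->
  (forall x, A x -> exists2 e : R, 0 < e & forall y, A y -> d x y < e -> O x y) ->
  exists2 e : R, 0 < e & forall x, A x -> exists2 z, A z & forall y, A y -> d x y < e -> O z y.
Proof.
move=> cA hO; apply: contrapT => hn.
have nx n : exists x, A x /\ forall z, A z -> exists y, [/\ A y, d x y < n.+1%:R^-1 & ~ O z y].
{ apply: contrapT => h; apply: hn; exists n.+1%:R^-1; first by rewrite invr_gt0.
  move=> x Ax; apply: contrapT => h2; apply: h; exists x; split=> // z Az.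
  apply: contrapT => h3; apply: h2; exists z => // y Ay dxy; apply: contrapT => h4.
  by apply: h3; exists y.
}
have /choice[x hx] := nx.
have [|z Az cz] := cA x; first by move=> n; case: (hx n).
have [e e0 he] := hO z Az; have e2 : 0 < e / 2 by rewrite divr_gt0.
have [n [/= h1 h2]] := u_ex uU (uI uU (cz _ e2) (u_inv uU e2)).
have [_ /(_ z Az)[y [Ay dy]]] := hx n; apply; apply: he => //.
by move: h2 dy; have := dT z (x n) y; rewrite (dC z (x n)); move: (n.+1%:R^-1 : R) => q; lra.
Qed.

Lemma coloured_sep n A (I : finType) (F : I -> set T) (col : I -> nat) :
  (forall i, F i `<=` A /\ ucompact U d (F i)) ->
  (forall i, (col i <= n)%N) /\
      (forall i j x, i != j -> col i = col j -> F i x -> F j x -> False) ->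
  exists2 s : R, 0 < s & forall i j x y, i != j -> col i = col j -> F i x -> F j y -> s <= d x y.
Proof.
move=> hF [_ hd].
have one (i j : I) : exists s : R, 0 < s /\ (i != j -> col i = col j -> forall x y, F i x -> F j y -> s <= d x y).
{ have [ij|_] := boolP (i != j); last by exists 1.
  have [cij|ncij] := pselect (col i = col j); last by exists 1; split=> // _ /ncij.
  have [s s0 hs] := disjoint_sep uU pd (hF i).2 (hF j).2
    (fun x y hx hy E => hd i j x ij cij hx (eq_ind_r (F j) hy (dsep E))).
  by exists s.
}
have /choice[s hs] : forall ij : I * I, exists s : R, 0 < s /\ (ij.1 != ij.2 -> col ij.1 = col ij.2 ->
   forall x y, F ij.1 x -> F ij.2 y -> s <= d x y) by move=> [i j]; exact: one.
exists (\big[Num.min/1]_ij s ij); first by apply: lt_bigmin => // ij _; case: (hs ij).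
move=> i j x y ij cij hx hy; apply: (@le_trans _ _ (s (i, j))); first exact: bigmin_le_cond.
by have [_] := hs (i, j); apply.
Qed.

Section Slices.
Context (nullR : set R -> Prop) (S : nat -> R -> set T) (K : set T).
Hypothesis nullR_sub : forall A B, A `<=` B -> nullR B -> nullR A.
Hypothesis nullR0 : nullR set0.
Hypothesis nullRU : forall A B, nullR A -> nullR B -> nullR (A `|` B).
Hypothesis S_closed : forall i t A, A `<=` K -> ucompact U d A -> ucompact U d (A `&` S i t).
Hypothesis base : forall N : nat -> set R, (forall i, nullR (N i)) ->
  forall x (e : R), K x -> 0 < e -> exists (O : set T) (l : seq (nat * R)),
  [/\ O x, forall y, K y -> O y -> exists2 e' : R, 0 < e' & forall z, K z -> d y z < e' -> O z,
      forall y z, K y -> K z -> O y -> O z -> d y z <= e,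
      forall p, List.In p l -> ~ N p.1 p.2
    & forall y, K y -> ~ O y -> (forall e' : R, 0 < e' -> exists z, [/\ K z, O z & d y z < e']) ->
      exists2 p, List.In p l & S p.1 p.2 y].

(** An inductive dimension in which only almost every slice must have smaller dimension. Its failure
    gives a non-null set of bad parameters, and hence bad slices that also satisfy Eilenberg's
    inequality. *)
Fixpoint Dc (j : nat) (A : set T) : Prop := match j with
  | 0 => zdim A
  | j'.+1 => forall i, nullR [set t | ~ Dc j' (A `&` S i t)]
  end.

Lemma DcU j A B : Dc j A -> Dc j B -> Dc j (A `|` B).
Proof.
elim: j A B => [|j IH] A B /=; first exact: zdimU.
move=> hA hB i; apply: nullR_sub (nullRU (hA i) (hB i)) => t /= h.
apply: contrapT => /not_orP[/contrapT h1 /contrapT h2]; apply: h.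
by rewrite setIUl; exact: IH.
Qed.

Lemma Dc0 j : Dc j set0.
Proof.
elim: j => [|j IH] /=; first by move=> e e0; exists 1 => // x y hc; have := chain_l hc.
by move=> i; apply: nullR_sub nullR0 => t /=; rewrite set0I.
Qed.

(** The sets colouring the boundary are thickened by [tau], which keeps equal colours disjoint. What
    is left is away from all boundaries, so the atoms of the finite cover [O] are closed there;
    being disjoint, they share the one new colour. *)
Lemma coloured_step n A (Bd : set T) (e : R) (M : nat) (O : 'I_M -> set T) :
  A `<=` K -> ucompact U d A -> Bd `<=` A -> coloured n Bd -> 0 < e ->
  (forall x, A x -> exists a, O a x) ->
  (forall a y, K y -> O a y -> exists2 e' : R, 0 < e' & forall z, K z -> d y z < e' -> O a z) ->
  (forall a y z, K y -> K z -> O a y -> O a z -> d y z <= e) ->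
  (forall a y, A y -> ~ O a y -> (forall e' : R, 0 < e' -> exists z, [/\ K z, O a z & d y z < e']) -> Bd y) ->
  exists (I : finType) (F : I -> set T) (col : I -> nat),
  [/\ forall i, F i `<=` A /\ ucompact U d (F i),
      forall i x y, F i x -> F i y -> d x y <= e,
      forall x, A x -> exists i, F i x
    & (forall i, (col i <= n.+1)%N) /\
      forall i j x, i != j -> col i = col j -> F i x -> F j x -> False].
Proof.
move=> AK cA BdA hBd e0 Ocov Oopen Od Obd.
have e3 : 0 < e / 3 by rewrite divr_gt0.
have [I [F [col [h1 h2 h3 h4]]]] := hBd _ e3.
have [s s0 hs] := coloured_sep h1 h4.
pose tau := Num.min (s / 4) (e / 3); have tau0 : 0 < tau by rewrite lt_min !divr_gt0.
have tau1 : tau <= s / 4 by rewrite ge_min lexx.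
have tau2 : tau <= e / 3 by rewrite ge_min lexx orbT.
pose A' := [set x | A x /\ forall u, Bd u -> tau <= d x u].
pose G (w : I + {set 'I_M}) := match w with
  | inl i => [set x | A x /\ exists2 u, F i u & d x u <= tau]
  | inr P => [set x | A' x /\ forall a, O a x <-> a \in P] end.
exists (I + {set 'I_M})%type, G, (fun w => if w is inl i then col i else n.+1); split.
{ move=> [i|P]; split.
  - by move=> x [].
  - move=> u hu; have [|x Ax cx] := cA u; first by move=> m; case: (hu m).
    have /choice[v hv] : forall m, exists v, F i v /\ d (u m) v <= tau.
      by move=> m; have [_ [v Fv dv]] := hu m; exists v.
    have [|y Fy cy] := (h1 i).2 v; first by move=> m; case: (hv m).
    exists x => //; split=> //; exists y => //; rewrite leNgt; apply/negP => hlt.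
    have e' : 0 < d x y - tau by rewrite subr_gt0.
    have [m /= hm] := u_ex uU (ucvg_dist uU pd cx cy e').
    by have [_ h] := hv m; move: hm; rewrite ltr_norml => /andP[? ?]; lra.
  - by move=> x [[]].
  - move=> u hu; have [|x Ax cx] := cA u; first by move=> m; have [[]] := hu m.
    have A'x : A' x.
      split=> // w Bw; rewrite leNgt; apply/negP => hlt.
      have e' : 0 < tau - d x w by rewrite subr_gt0.
      have [m /= hm] := u_ex uU (cx _ e'); have [[_ /(_ w Bw) h] _] := hu m.
      by have := dT (u m) x w; lra.
    exists x => //; split=> // a; split=> ha.
      have [e' e'0 he'] := Oopen a x (AK _ Ax) ha.
      have [m /= hm] := u_ex uU (cx _ e'0); have [[Am _] hP] := hu m.
      by apply/hP; apply: he'; [exact: AK|rewrite dC].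
    apply: contrapT => nO; have : Bd x.
      apply: (Obd a) => // e' e'0; have [m /= hm] := u_ex uU (cx _ e'0).
      have [[Am _] hP] := hu m; exists (u m); split; [exact: AK|exact/hP|by rewrite dC].
    by have [_ h] := A'x; move/h; rewrite d0; lra.
}
{ move=> [i|P] x y.
    move=> [_ [u Fu du]] [_ [v Fv dv]]; have := h2 _ _ _ Fu Fv.
    by have := dT x u y; have := dT u v y; rewrite (dC v y); lra.
  move=> [[Ax _] hx] [[Ay _] hy]; have [a Oa] := Ocov x Ax.
  by apply: (Od a); [exact: AK|exact: AK|by []|apply/hy/hx].
}
{ move=> x Ax; have [A'x|nA'] := pselect (A' x).
    exists (inr [set a | `[< O a x >]]%SET); split=> // a; rewrite inE.
    by split=> [h|/asboolP]; [exact/asboolP|].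
  have [u [Bu du]] : exists u, Bd u /\ d x u < tau.
    apply: contrapT => h; apply: nA'; split=> // u Bu; rewrite leNgt; apply/negP => h'.
    by apply: h; exists u.
  have [i Fi] := h3 u Bu; exists (inl i); split=> //; exists u => //; exact: ltW.
}
split; first by move=> [i|P] //; apply: leqW; case: h4.
have [hc hdis] := h4.
move=> [i|P] [j|P'] x.
- move=> ij cij [_ [u Fu du]] [_ [v Fv dv]].
  have := hs i j u v ij cij Fu Fv; have := dT u x v; rewrite (dC u x); lra.
- by move=> _ E; have := hc i; rewrite E ltnn.
- by move=> _ E; have := hc j; rewrite -E ltnn.
- move=> PP' _ [_ h5] [_ h6]; move/eqP: PP'; apply; congr inr.
  by apply/setP => a; apply/idP/idP => [/h5/h6|/h6/h5].
Qed.

Lemma Dc_coloured j A : A `<=` K -> ucompact U d A -> Dc j A -> coloured j A.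
Proof.
elim: j A => [|j IH] A AK cA; first exact: zdim_coloured.
move=> hD e e0.
have H x : exists Ol : set T * seq (nat * R), A x ->
  [/\ Ol.1 x, forall y, K y -> Ol.1 y -> exists2 e' : R, 0 < e' & forall z, K z -> d y z < e' -> Ol.1 z,
      forall y z, K y -> K z -> Ol.1 y -> Ol.1 z -> d y z <= e,
      forall p, List.In p Ol.2 -> Dc j (A `&` S p.1 p.2)
    & forall y, K y -> ~ Ol.1 y -> (forall e' : R, 0 < e' -> exists z, [/\ K z, Ol.1 z & d y z < e']) ->
      exists2 p, List.In p Ol.2 & S p.1 p.2 y].
{ have [Ax|nA] := pselect (A x); last by exists (set0, [::]).
  (* The null sets to be avoided are the exceptional parameters provided by [hD], so every boundary
     slice satisfies [Dc j]. *)
  have [W [l [a1 a2 a3 a4 a5]]] := base hD (AK _ Ax) e0.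
  exists (W, l) => _; split=> //= p lp; apply: contrapT => h; exact: a4 lp h.
}
have /choice[Ol hOl] := H.
have [|lam lam0 hlam] := @lebesgue_number A (fun x => (Ol x).1) cA.
{ move=> x Ax; have [a1 a2 _ _ _] := hOl x Ax; have [e' e'0 he'] := a2 x (AK _ Ax) a1.
  by exists e' => // y Ay; apply: he'; exact: AK.
}
have [l [lA hl]] := finite_net uU pd cA lam0.
have hz y : exists z, A y -> A z /\ forall w, A w -> d y w < lam -> (Ol z).1 w.
{ have [Ay|nA] := pselect (A y); last by exists y.
  by have [z Az hz] := hlam y Ay; exists z.
}
have /choice[z hz'] := hz.
have [[x0 Ax0]|nA] := pselect (exists x, A x); last first.
{ exists 'I_0, (fun=> set0), (fun=> 0%N); split=> //; first by case.
  by move=> x Ax; case: nA; exists x.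
}
pose pt (a : 'I_(length l)) := z (List.nth a l x0).
have ptA a : A (pt a).
{ have la : List.In (List.nth a l x0) l by apply: List.nth_In; apply/ssrnat.ltP; exact: ltn_ord.
  by have [] := hz' _ (lA _ la).
}
pose bd (l' : seq (nat * R)) := [set y | A y /\ exists2 p, List.In p l' & S p.1 p.2 y].
have bdP l' : (forall p, List.In p l' -> Dc j (A `&` S p.1 p.2)) ->
  ucompact U d (bd l') /\ Dc j (bd l').
{ elim: l' => [|p l' IHl] hp.
    have E : bd [::] = set0 by apply/seteqP; split=> // y [_ []].
    by rewrite E; split; [exact: ucompact0|exact: Dc0].
  have [|c1 D1] := IHl; first by move=> p' lp'; apply: hp; right.
  have Dp : Dc j (A `&` S p.1 p.2) by apply: hp; left.
  have E : bd (p :: l') = (A `&` S p.1 p.2) `|` bd l'.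
    apply/seteqP; split=> y.
      by move=> [Ay [q [<-|lq] Sq]]; [left|right; split=> //; exists q].
    by move=> [[Ay Sy]|[Ay [q lq Sq]]]; split=> //; [exists p => //; left|exists q => //; right].
  rewrite E; split; last exact: DcU.
  by apply: ucompactU => //; exact: S_closed.
}
pose L := List.flat_map (fun y => (Ol (z y)).2) l.
have LP p : List.In p L -> Dc j (A `&` S p.1 p.2).
{ move=> /List.in_flat_map[y [ly hp]]; have [Az _] := hz' _ (lA _ ly).
  by have [_ _ _ h _] := hOl _ Az; exact: h.
}
have [cBd DBd] := bdP L LP.
have inl (a : 'I_(length l)) : List.In (List.nth a l x0) l.
{ by apply: List.nth_In; apply/ssrnat.ltP; exact: ltn_ord.
}
apply: (@coloured_step j A (bd L) e (length l) (fun a => (Ol (pt a)).1)) => //.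
- by move=> y [].
- by apply: IH => // y [/AK].
- move=> x Ax; have [y ly dy] := hl x Ax; have [i [il hi]] := List.In_nth _ _ x0 ly.
  have il' : (i < length l)%N by apply/ssrnat.ltP.
  exists (Ordinal il'); rewrite /pt /= hi; have [_ h] := hz' _ (lA _ ly).
  by apply: h => //; rewrite dC.
- by move=> a y; have [_ h _ _ _] := hOl _ (ptA a); exact: h.
- by move=> a y y'; have [_ _ h _ _] := hOl _ (ptA a); exact: h.
- move=> a y Ay nO hb; have [_ _ _ _ h] := hOl _ (ptA a).
  have [p lp Sp] := h y (AK _ Ay) nO hb; split=> //; exists p => //.
  by apply/List.in_flat_map; exists (List.nth a l x0); split.
Qed.

End Slices.

Definition rel_open (A V : set T) := V `<=` A /\ forall x, V x -> exists e : R, 0 < e /\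
    forall y, A y -> d x y < e -> V y.

(** Slightly thickened, the coloured sets become relatively open while equal colours stay disjoint;
    among [n + 2] of them two have the same colour. *)
Lemma coloured_covdim n A : ucompact U d A -> coloured n A ->
  forall (m : nat) (W : 'I_m -> set T),
    (forall i, rel_open A (W i)) -> A `<=` \bigcup_i W i ->
    exists (m' : nat) (V : 'I_m' -> set T),
      (forall j, rel_open A (V j)) /\ A `<=` \bigcup_j V j /\
      (forall j, exists i, V j `<=` W i) /\
      forall f : 'I_n.+2 -> 'I_m', injective f ->
        ~ (exists x, A x /\ forall t, V (f t) x).
Proof.
move=> cA hA m W Wo Wc.
have [[x0 Ax0]|nA] := pselect (exists x, A x); last first.
{ exists 0%N, (fun=> set0); split; first by case.
  split; first by move=> x Ax; case: nA; exists x.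
  split; first by case.
  by move=> f _ [x [Ax _]]; apply: nA; exists x.
}
have /choice[w hw] : forall x, exists i : 'I_m, A x -> W i x.
{ move=> x; have [Ax|nAx] := pselect (A x); first by have [i _ Wi] := Wc x Ax; exists i.
  by have [i _ _] := Wc x0 Ax0; exists i.
}
have [|lam lam0 hlam] := @lebesgue_number A (fun x => W (w x)) cA.
{ move=> x Ax; have [_ h] := Wo (w x); have [e [e0 he]] := h x (hw x Ax); by exists e.
}
have l4 : 0 < lam / 4 by rewrite divr_gt0.
have [I [F [col [h1 h2 h3 h4]]]] := hA _ l4.
have [s s0 hs] := coloured_sep h1 h4.
pose tau := Num.min (s / 4) (lam / 4); have tau0 : 0 < tau by rewrite lt_min !divr_gt0.
have tau1 : tau <= s / 4 by rewrite ge_min lexx.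
have tau2 : tau <= lam / 4 by rewrite ge_min lexx orbT.
pose V (j : 'I_#|I|) := [set x | A x /\ exists2 u, F (enum_val j) u & d x u < tau].
exists #|I|, V; split.
{ move=> j; split; first by move=> x [].
  move=> x [Ax [u Fu du]]; exists (tau - d x u); rewrite subr_gt0; split=> // y Ay dy.
  split=> //; exists u => //; have := dT y x u; rewrite (dC y x); lra.
}
split.
{ move=> x Ax; have [i Fi] := h3 x Ax; exists (enum_rank i) => //; split=> //.
  by exists x; rewrite ?enum_rankK ?d0.
}
split.
{ move=> j; have [[u0 Fu0]|nF] := pselect (exists u, F (enum_val j) u); last first.
    by exists (w x0) => x [_ [u Fu _]]; case: nF; exists u.
  have Au0 : A u0 by exact: (h1 _).1 Fu0.
  have [z Az hz] := hlam u0 Au0; exists (w z) => x [Ax [u Fu du]]; apply: hz => //.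
  have := h2 _ _ _ Fu0 Fu; have := dT u0 u x; rewrite (dC u x); lra.
}
move=> f finj [x [Ax hx]].
have [hc _] := h4.
pose c (t : 'I_n.+2) : 'I_n.+1 := inord (col (enum_val (f t))).
have : ~~ injectiveb c.
{ apply/negP => /injectiveP cinj; have := leq_card c cinj; by rewrite !card_ord ltnn.
}
move=> /injectivePn[t [t' tt' ctt']].
have E : col (enum_val (f t)) = col (enum_val (f t')).
{ by move/(congr1 val): ctt'; rewrite /c /= !inordK ?ltnS ?hc.
}
have ne : enum_val (f t) != enum_val (f t').
{ by apply: contra tt' => /eqP/enum_val_inj/finj ->.
}
have [_ [u Fu du]] := hx t; have [_ [v Fv dv]] := hx t'.
have := hs _ _ _ _ ne E Fu Fv; have := dT u x v; rewrite (dC u x); lra.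
Qed.

End CovDim.

(** * Eilenberg's inequality *)

Section Eilenberg.
Context {R : realType}.
Notation mu := (@lebesgue_measure R).

Lemma inv_natlt (e : R) : 0 < e -> exists n, n.+1%:R^-1 < e.
Proof.
move=> e0; exists (Num.truncn e^-1); rewrite invf_plt ?posrE //; exact: truncnS_gt.
Qed.

Definition nullR (E : set R) := mu.-negligible E.

Lemma nullR_sub (A B : set R) : A `<=` B -> nullR B -> nullR A.
Proof. by move=> AB; apply: negligibleS. Qed.

Lemma nullR0 : nullR set0.
Proof. exact: negligible_set0. Qed.

Lemma nullRU (A B : set R) : nullR A -> nullR B -> nullR (A `|` B).
Proof. exact: negligibleU. Qed.

Lemma nullR_bigcup (A : nat -> set R) : (forall n, nullR (A n)) -> nullR (\bigcup_n A n).
Proof. exact: negligible_bigcup. Qed.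

Lemma nullR_itv (a b : R) (A : set R) : a < b -> nullR A -> exists2 t, a < t < b & ~ A t.
Proof.
move=> ab nA; apply: contrapT => h.
have sA : `]a, b[%classic `<=` A.
{ move=> t /=; rewrite in_itv /= => tab; apply: contrapT => nAt; apply: h; by exists t.
}
have n1 : nullR `]a, b[%classic by exact: negligibleS nA.
have := (negligibleP mu (measurable_itv `]a, b[)).1 n1.
have := lebesgue_measure_itv `]a, b[; rewrite /= lte_fin ab -EFinB => -> [] h0; lra.
Qed.

Lemma step_integral (w c l : nat -> R) (B : R) :
  (forall i, 0 <= w i) -> (forall i, 0 <= l i) ->
  (forall n, \sum_(i < n) w i * (2 * l i) <= B) ->
  exists phi : R -> \bar R,
  [/\ measurable_fun setT phi, forall t, (0 <= phi t)%E, (\int[mu]_t phi t <= B%:E)%E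
   & forall (t : R) n, ((\sum_(i < n) (if c i - l i <= t <= c i + l i then w i else 0))%:E <= phi t)%E].
Proof.
move=> w0 l0 hB.
pose J i : set R := `[c i - l i, c i + l i]%classic.
have mJ i : measurable (J i) by exact: measurable_itv.
pose f i (t : R) : \bar R := ((w i)%:E * (\1_(J i) t)%:E)%E.
have f0 i t : (0 <= f i t)%E by apply: mule_ge0; rewrite lee_fin.
have m1 i : measurable_fun setT (fun t : R => (\1_(J i) t : R)%:E).
{ apply/measurable_EFinP; exact: measurable_indic.
}
have mf i : measurable_fun setT (f i) by apply: measurable_funeM.
  have E (i : nat) : (\int[mu]_t f i t = (w i * (2 * l i))%:E)%E.
  { rewrite (ge0_integralZl_EFin mu (@measurableT _ _) _ (m1 i) (w0 i)); last by move=> t _; rewrite lee_fin.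
    have -> : (\int[mu]_t (\1_(J i) t)%:E = mu (J i))%E.
    { by rewrite (integral_indic mu (@measurableT _ _) (mJ i)) setIT.
    }
    have -> := lebesgue_measure_itv `[c i - l i, c i + l i].
    rewrite /= lte_fin -EFinB.
    case: ifPn => h; first by rewrite -EFinM; congr (_%:E); ring.
    have -> : l i = 0 by have := l0 i; move: h; rewrite -leNgt; lra.
    by rewrite !mulr0 mule0.
  }
exists (fun t => (\sum_(0 <= i <oo) f i t)%E); split.
- apply: (@ge0_emeasurable_sum _ _ _ setT f xpredT) => //.
- by move=> t; apply: nneseries_ge0 => i _ _.
- rewrite (integral_nneseries mu (@measurableT _ _)) //.
  apply: lime_le; first by apply: is_cvg_nneseries => i _ _; apply: integral_ge0.
  near=> n; rewrite big_mkord.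
  under eq_bigr do rewrite E.
  by rewrite sumEFin lee_fin.
- move=> t n; apply: le_trans (nneseries_lim_ge n (fun i _ _ => f0 i t)).
  rewrite big_mkord -sumEFin; apply: lee_sum => i _.
  rewrite /f indicE /J; case: ifPn => h.
    by rewrite mem_set ?mule1 //= in_itv.
  exact: f0.
Unshelve. all: end_near.
Qed.

Lemma limn_einf_lt (u : nat -> \bar R) (x : \bar R) n :
  (limn_einf u < x)%E -> exists2 m, (n <= m)%N & (u m < x)%E.
Proof.
rewrite limn_einf_lim (cvg_lim _ (@cvg_einfs_sup R u)) // => h.
have : (einfs u n < x)%E.
{ apply: le_lt_trans h; apply: ereal_sup_ubound; by exists n.
}
rewrite /einfs => /ereal_inf_lt [y [m /= nm <-] yx]; by exists m.
Qed.

Section Slice.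
Context (T : Type) (d : T -> T -> R) (s : nat) (s0 : (0 < s)%N).
Context (A : set T) (f : T -> R) (L : R) (L0 : 0 < L).
Hypothesis fL : forall x y, A x -> A y -> `|f x - f y| <= L * d x y.

Lemma eilenberg_fun (M : R) : Hle d s.+1 A M -> exists F : R -> \bar R,
  [/\ measurable_fun setT F, forall t, (0 <= F t)%E, (\int[mu]_t F t <= (2 * L * M)%:E)%E
   & forall t (N : R), (F t < N%:E)%E -> Hle d s (A `&` [set x | f x = t]) N].
Proof.
move=> hM.
have e0 n : 0 < n.+1%:R^-1 :> R by rewrite invr_gt0 ltr0Sn.
have cv n : cover_le d s.+1 A n.+1%:R^-1 (M + n.+1%:R^-1) by apply: hM.
have [V hV] := choice cv; have {cv hV} [r hr] := choice hV.
pose good n i := exists x, A x /\ V n i x.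
have ex (p : nat * nat) : exists c : R, forall x, A x -> V p.1 p.2 x ->
   c - L * r p.1 p.2 <= f x <= c + L * r p.1 p.2.
{ have [[y [Ay Vy]]|no] := pselect (good p.1 p.2); last first.
    by exists 0 => x Ax Vx; exfalso; apply: no; exists x.
  exists (f y) => x Ax Vx; have [_ _ h3 _] := hr p.1.
  have h1 := fL Ax Ay; have h2 := h3 _ _ _ Vx Vy.
  have : `|f x - f y| <= L * r p.1 p.2 by apply: le_trans h1 _; rewrite ler_pM2l.
  by rewrite ler_norml; lra.
}
have {ex} [c hc] := choice ex.
have r0 n i : 0 <= r n i by have [_ /(_ i)/andP[]] := hr n.
have ph n : exists phi : R -> \bar R,
  [/\ measurable_fun setT phi, forall t, (0 <= phi t)%E,
     (\int[mu]_t phi t <= (2 * L * (M + n.+1%:R^-1))%:E)%E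
   & forall (t : R) m, ((\sum_(i < m) (if c (n, i : nat) - L * r n i <= t <= c (n, i : nat) + L * r n i
         then r n i ^+ s else 0))%:E <= phi t)%E].
{ apply: (@step_integral (fun i => r n i ^+ s) (fun i => c (n, i)) (fun i => L * r n i)).
  - by move=> i; apply: exprn_ge0.
  - by move=> i; apply: mulr_ge0 => //; apply: ltW.
  - move=> m; have [_ _ _ /(_ m) h] := hr n.
    have -> : \sum_(i < m) r n i ^+ s * (2 * (L * r n i)) = 2 * L * \sum_(i < m) r n i ^+ s.+1.
    { rewrite mulr_sumr; apply: eq_bigr => i _; rewrite exprSr; ring.
    }
    by rewrite ler_pM2l //; posit.
}
have {ph} [phi hphi] := choice ph.
have m_ n : measurable_fun setT (phi n) by case: (hphi n).
have p0 n t : (0 <= phi n t)%E by case: (hphi n).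
pose F t := limn_einf (phi^~ t).
have F0 t : (0 <= F t)%E.
{ rewrite leNgt; apply/negP => /(@limn_einf_lt _ _ 0)[m _]; by rewrite ltNge p0.
}
exists F; split => //.
- rewrite /F /limn_einf; apply: measurableT_comp => //.
  apply: measurable_realfun.measurable_fun_limn_esup => n; exact: measurableT_comp.
- apply: le_trans (fatou mu (@measurableT _ _) m_ (fun n x _ => p0 n x)) _.
  rewrite leNgt; apply/negP => h.
  have [q hq] : exists q : R, 2 * L * M < q /\ (q%:E < limn_einf (fun n => \int[mu]_x phi n x))%E.
  { move: h; case: (limn_einf _) => [a|//|//].
      rewrite lte_fin => h; exists ((2 * L * M + a) / 2); rewrite lte_fin; lra.
    move=> _; exists (2 * L * M + 1); rewrite ltry; split => //; lra.
  }
  have [n hn] : exists n, 2 * L * (M + n.+1%:R^-1) <= q.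
  { have L2 : 0 < 2 * L by posit.
    have h1 : 0 < (q - 2 * L * M) / (2 * L) by apply: divr_gt0 => //; lra.
    have [n hn] := inv_natlt h1.
    exists n; move: hn; move: (n.+1%:R^-1 : R) => y; rewrite ltr_pdivlMr // => hy; lra.
  }
  have [_ hq2] := hq.
  have hle m : (n <= m)%N -> (\int[mu]_x phi m x <= q%:E)%E.
  { move=> nm; have [_ _ h3 _] := hphi m; apply: le_trans h3 _; rewrite lee_fin.
    apply: le_trans hn; rewrite ler_pM2l; last by posit.
    rewrite lerD2l lef_pV2 ?posrE ?ltr0Sn // ler_nat //.
  }
  move: hq2; rewrite ltNge; apply/negP; rewrite negbK.
  rewrite limn_einf_lim (cvg_lim _ (@cvg_einfs_sup R _)) //.
  apply: ge_ereal_sup => _ [j _ <-].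
  apply: le_trans (hle (maxn n j) _); last exact: leq_maxl.
  rewrite /einfs; apply: ereal_inf_lbound; exists (maxn n j) => //=; exact: leq_maxr.
- move=> t N FN dl e dl0 e0'.
  have [n hn] := inv_natlt dl0.
  have [m nm hm] := @limn_einf_lt _ _ n FN.
  pose P i := c (m, i) - L * r m i <= t <= c (m, i) + L * r m i.
  have [h1 h2 h3 _] := hr m.
  exists (fun i => if P i then V m i else set0), (fun i => if P i then r m i else 0); split.
  + move=> x [Ax fx]; have [i _ Vi] := h1 _ Ax; exists i => //.
    by have /= := hc (m, i) x Ax Vi; rewrite fx /P => ->.
  + move=> i; case: ifP => _; last by rewrite lexx (ltW dl0).
    have /andP[-> h] := h2 i; apply: le_trans h _; apply: le_trans (ltW hn).
    by rewrite lef_pV2 ?posrE ?ltr0Sn // ler_nat.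
  + by move=> i x y; case: ifP => // _; apply: h3.
  + move=> j; have [_ _ _ /(_ t j) h] := hphi m.
    have E : \sum_(i < j) (if P i then r m i else 0) ^+ s =
       \sum_(i < j) (if P i then r m i ^+ s else 0).
    { apply: eq_bigr => i _; case: ifP => // _; by rewrite expr0n eqn0Ngt s0.
    }
    rewrite E; have := le_lt_trans h hm; rewrite lte_fin /P; lra.
Qed.

Lemma eilenberg_fin : Hfin d s.+1 A -> nullR [set t | ~ Hfin d s (A `&` [set x | f x = t])].
Proof.
move=> [M /eilenberg_fun [F [mF F0 iF hF]]].
have intF : mu.-integrable setT F.
{ apply/integrableP; split => //.
  under eq_integral do rewrite gee0_abs //.
  apply: le_lt_trans iF _; exact: ltry.
}
apply: negligibleS (integrable_ae (@measurableT _ _) intF) => t /= h1 h2; apply: h1.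
have := h2 I; have := F0 t; case E : (F t) => [a| |] // _ _.
exists (a + 1); apply: hF; rewrite E lte_fin; lra.
Qed.

Lemma eilenberg_null : Hnull d s.+1 A -> nullR [set t | ~ Hnull d s (A `&` [set x | f x = t])].
Proof.
move=> /eilenberg_fun [F [mF F0 iF hF]].
have I0 : (\int[mu]_t `|F t| = 0)%E.
{ apply/eqP; rewrite eq_le; apply/andP; split; last by apply: integral_ge0.
  under eq_integral do rewrite gee0_abs //.
  by rewrite mulr0 in iF.
}
have := (ae_eq_integral_abs mu (@measurableT _ _) mF).1 I0.
apply: negligibleS => t /= h1 h2; apply: h1; apply: Hle_lim => N N0.
by apply: hF; rewrite (h2 I) lte_fin.
Qed.

End Slice.
End Eilenberg.

(** * Inner product spaces and inversion *)

Structure ipspace (R : realType) := IPSpace {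
  ipV :> lmodType R;
  ip : ipV -> ipV -> R;
  ipC : forall x y, ip x y = ip y x;
  ipDl : forall x y z, ip (x + y) z = ip x z + ip y z;
  ipZl : forall a x y, ip (a *: x) y = a * ip x y;
  ip_ge0 : forall x, 0 <= ip x x;
  ip_eq0 : forall x, ip x x = 0 -> x = 0 }.

Arguments ip {R V} : rename.

Section InnerProduct.
Context {R : realType} (V : ipspace R).
Implicit Types x y z : V.

Lemma ipDr x y z : ip x (y + z) = ip x y + ip x z.
Proof. by rewrite ipC ipDl !(ipC _ x). Qed.

Lemma ipZr a x y : ip x (a *: y) = a * ip x y.
Proof. by rewrite ipC ipZl (ipC _ x). Qed.

Lemma ipNl x y : ip (- x) y = - ip x y.
Proof. by rewrite -scaleN1r ipZl mulN1r. Qed.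

Lemma ipNr x y : ip x (- y) = - ip x y.
Proof. by rewrite ipC ipNl ipC. Qed.

Lemma ip0l x : ip 0 x = 0.
Proof. by rewrite -(scale0r (0 : V)) ipZl mul0r. Qed.

Lemma ip0r x : ip x 0 = 0.
Proof. by rewrite ipC ip0l. Qed.

Lemma ip_suml (I : Type) (r : seq I) (P : pred I) (F : I -> V) x :
  ip (\sum_(i <- r | P i) F i) x = \sum_(i <- r | P i) ip (F i) x.
Proof.
by elim/big_rec2: _ => [|i y1 y2 _ IH]; [rewrite ip0l | rewrite ipDl IH].
Qed.

Lemma ip_sumr (I : Type) (r : seq I) (P : pred I) (F : I -> V) x :
  ip x (\sum_(i <- r | P i) F i) = \sum_(i <- r | P i) ip x (F i).
Proof. by rewrite ipC ip_suml; apply: eq_bigr => i _; rewrite ipC. Qed.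

Definition ipE := (ipDl, ipDr, ipZl, ipZr, ipNl, ipNr).

Definition nv x := Num.sqrt (ip x x).

Lemma nv_ge0 x : 0 <= nv x. Proof. exact: sqrtr_ge0. Qed.

Lemma nv_sq x : nv x ^+ 2 = ip x x.
Proof. by rewrite sqr_sqrtr // ip_ge0. Qed.

Lemma nv0 : nv 0 = 0. Proof. by rewrite /nv ip0l sqrtr0. Qed.

Lemma nv_eq0 x : nv x = 0 -> x = 0.
Proof. by move=> h; apply: ip_eq0; rewrite -nv_sq h expr0n. Qed.

Lemma nv_gt0 x : x <> 0 -> 0 < nv x.
Proof.
move=> x0; rewrite lt_neqAle nv_ge0 andbT; apply/eqP => h; apply: x0; exact: nv_eq0.
Qed.

Lemma nvZ a x : nv (a *: x) = `|a| * nv x.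
Proof. by rewrite /nv ipZl ipZr mulrA -expr2 sqrtrM ?sqr_ge0 // sqrtr_sqr. Qed.

Lemma nvN x : nv (- x) = nv x.
Proof. by rewrite /nv ipNl ipNr opprK. Qed.

Lemma nvB x y : nv (x - y) = nv (y - x).
Proof. by rewrite -nvN opprB. Qed.

Lemma cauchy x y : `|ip x y| <= nv x * nv y.
Proof.
rewrite -(ler_pXn2r (n := 2)) ?nnegrE ?mulr_ge0 ?nv_ge0 // exprMn !nv_sq real_normK ?num_real //.
have [y0|y0] := eqVneq (ip y y) 0.
  by rewrite (ip_eq0 y0) !ip0r mulr0 expr0n.
have yp : 0 < ip y y by rewrite lt_def y0 ip_ge0.
have := ip_ge0 (ip y y *: x - ip x y *: y).
rewrite !ipE (ipC y x).
set u := ip y y; set v := ip x x; set w := ip x y => h.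
have : 0 <= u * (v * u - w ^+ 2) by apply: le_trans h _; rewrite le_eqVlt; apply/orP; left; apply/eqP; ring.
by rewrite pmulr_rge0 // subr_ge0.
Qed.

Lemma nvD x y : nv (x + y) <= nv x + nv y.
Proof.
rewrite -(ler_pXn2r (n := 2)) ?nnegrE ?addr_ge0 ?nv_ge0 // sqrrD !nv_sq.
rewrite ipDl !ipDr (ipC y x).
have := cauchy x y; have := ler_norm (ip x y) => h1 h2.
have : ip x y <= nv x * nv y by apply: le_trans h2.
lra.
Qed.

Lemma nv_tri x y z : nv (x - z) <= nv (x - y) + nv (y - z).
Proof. by have := nvD (x - y) (y - z); rewrite addrA subrK. Qed.

Lemma nv_triB x y : `|nv x - nv y| <= nv (x - y).
Proof.
rewrite ler_norml; have := nvD (x - y) y; have := nvD (y - x) x.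
rewrite !subrK (nvB y x); lra.
Qed.

Lemma nv_sub_eq0 x y : nv (x - y) = 0 -> x = y.
Proof. by move/nv_eq0/eqP; rewrite subr_eq0 => /eqP. Qed.

Lemma nv_le_eq x y : (forall e : R, 0 < e -> nv (x - y) <= e) -> x = y.
Proof.
move=> h; apply: nv_sub_eq0; apply/eqP; rewrite eq_le nv_ge0 andbT leNgt; apply/negP => h0.
have := h (nv (x - y) / 2); lra.
Qed.

Lemma ip_nv x y : ip x y = (nv x ^+ 2 + nv y ^+ 2 - nv (x - y) ^+ 2) / 2.
Proof. by rewrite !nv_sq !ipE (ipC y x); field. Qed.

(** Inversion in the unit sphere about the origin, with default value 0 at 0. *)
Definition iv x := (ip x x)^-1 *: x.

Lemma iv_nv x : nv (iv x) = (nv x)^-1.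
Proof.
have [->|x0] := eqVneq x 0; first by rewrite /iv scaler0 nv0 invr0.
have := nv_gt0 (elimN eqP x0) => h; rewrite /iv nvZ -nv_sq ger0_norm ?invr_ge0 ?exprn_ge0 ?nv_ge0 //.
by field; rewrite gt_eqF.
Qed.

Lemma iv_dist x y : x <> 0 -> y <> 0 -> nv (iv x - iv y) = nv (x - y) / (nv x * nv y).
Proof.
move=> x0 y0; have X := nv_gt0 x0; have Y := nv_gt0 y0.
apply: (@pexpIrn _ 2) => //; rewrite ?nnegrE ?nv_ge0 ?divr_ge0 ?mulr_ge0 ?nv_ge0 //.
rewrite expr_div_n exprMn !nv_sq /iv !ipE (ipC y x).
by field; rewrite -!nv_sq !expf_eq0 /= !gt_eqF.
Qed.

End InnerProduct.

(** * Linear extension of a similarity *)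

Section Similarity.
Context {R : realType} (V V' : ipspace R) (I : Type) (P : I -> Prop).
Context (X : I -> V) (Y : I -> V') (lam : R) (i0 : I).
Hypothesis lam0 : 0 < lam.
Hypothesis P0 : P i0.
Hypothesis XY : forall i j, P i -> P j -> nv (Y i - Y j) = lam * nv (X i - X j).

Definition dspan (x : V) := exists l : seq (R * I), (forall p, List.In p l -> P p.2) /\
  x = \sum_(p <- l) p.1 *: (X p.2 - X i0).

Lemma dspan_lin a x y : dspan x -> dspan y -> dspan (a *: x + y).
Proof.
move=> [l [h1 ->]] [l' [h2 ->]]; exists ([seq (a * p.1, p.2) | p <- l] ++ l'); split.
  move=> p /(List.in_app_or _ _ _) [|]; last exact: h2.
  elim: l h1 => //= q l IH h1 [<-|]; first by apply: (h1 q); left.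
  by apply: IH => p' hp; apply: h1; right.
rewrite big_cat big_map scaler_sumr; congr (_ + _).
by apply: eq_bigr => p _; rewrite scalerA.
Qed.

Lemma dspan_diff i j : P i -> P j -> dspan (X i - X j).
Proof.
move=> Pi Pj; exists [:: (1, i); (-1, j)]; split; first by move=> p [<-|[<-|]].
by rewrite !big_cons big_nil addr0 /= scale1r scaleN1r opprB addrA subrK.
Qed.

Lemma dspan0 : dspan 0.
Proof. by exists [::]; rewrite big_nil. Qed.

Lemma diff_ip i j : P i -> P j ->
  ip (Y i - Y i0) (Y j - Y i0) = lam ^+ 2 * ip (X i - X i0) (X j - X i0).
Proof.
move=> Pi Pj; rewrite !ip_nv !XY // !opprB !addrA !subrK !XY //; by field.
Qed.

Lemma comb_ip (l l' : seq (R * I)) : (forall p, List.In p l -> P p.2) ->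
  (forall p, List.In p l' -> P p.2) ->
  ip (\sum_(p <- l) p.1 *: (Y p.2 - Y i0)) (\sum_(p <- l') p.1 *: (Y p.2 - Y i0)) =
  lam ^+ 2 * ip (\sum_(p <- l) p.1 *: (X p.2 - X i0)) (\sum_(p <- l') p.1 *: (X p.2 - X i0)).
Proof.
move=> h h'; elim: l h => [|p l IH] h; first by rewrite !big_nil !ip0l mulr0.
rewrite !big_cons !ipDl IH; last by move=> q hq; apply: h; right.
rewrite mulrDr; congr (_ + _); rewrite !ipZl mulrCA; congr (_ * _).
have Pp : P p.2 by apply: h; left.
move: {IH} h'; elim: l' => [|q l' IH'] h'; first by rewrite !big_nil !ip0r mulr0.
rewrite !big_cons !ipDr IH'; last by move=> r hr; apply: h'; right.
rewrite mulrDr; congr (_ + _); rewrite !ipZr mulrCA; congr (_ * _).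
by apply: diff_ip => //; apply: h'; left.
Qed.

(** Distances determine the inner products of differences by polarisation, hence the norms of all
    their finite linear combinations. So the linear extension is well defined and isometric on the
    span of the differences; outside [dspan] nothing is said about [A]. *)
Lemma similarity_ext : exists A : V -> V',
  [/\ forall i j, P i -> P j -> Y i - Y j = lam *: A (X i - X j),
      forall a x y, dspan x -> dspan y -> A (a *: x + y) = a *: A x + A y
    & forall x, dspan x -> nv (A x) = nv x].
Proof.
pose cX (l : seq (R * I)) := \sum_(p <- l) p.1 *: (X p.2 - X i0).
pose cY (l : seq (R * I)) := \sum_(p <- l) p.1 *: (Y p.2 - Y i0).
pose ok (l : seq (R * I)) := forall p, List.In p l -> P p.2.
have cY_cat l l' : cY (l ++ l') = cY l + cY l' by rewrite /cY big_cat.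
have cX_cat l l' : cX (l ++ l') = cX l + cX l' by rewrite /cX big_cat.
pose sc a (l : seq (R * I)) := [seq (a * p.1, p.2) | p <- l].
have cXs a l : cX (sc a l) = a *: cX l.
{ by rewrite /cX /sc big_map scaler_sumr; apply: eq_bigr => p _; rewrite scalerA.
}
have cYs a l : cY (sc a l) = a *: cY l.
{ by rewrite /cY /sc big_map scaler_sumr; apply: eq_bigr => p _; rewrite scalerA.
}
have oks a l : ok l -> ok (sc a l).
{ elim: l => //= q l IH h p [<-|]; first by apply: (h q); left.
  by apply: IH => p' hp; apply: h; right.
}
have okc l l' : ok l -> ok l' -> ok (l ++ l').
{ by move=> h h' p /(List.in_app_or _ _ _) [|]; [apply: h | apply: h'].
}
have nvc l : ok l -> nv (cY l) = lam * nv (cX l).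
{ move=> ol; apply: (@pexpIrn _ 2) => //; rewrite ?nnegrE ?nv_ge0 //.
    by apply: mulr_ge0; [apply: ltW | apply: nv_ge0].
  by rewrite exprMn !nv_sq comb_ip.
}
have wd l l' : ok l -> ok l' -> cX l = cX l' -> cY l = cY l'.
{ move=> ol ol' E; apply: nv_sub_eq0; have := nvc (l ++ sc (-1) l').
  rewrite cY_cat cX_cat cYs cXs !scaleN1r E subrr nv0 mulr0; apply.
  by apply: okc => //; apply: oks.
}
have ch x : exists l, dspan x -> ok l /\ x = cX l.
{ have [[l hl]|no] := pselect (dspan x); first by exists l.
  by exists [::].
}
have [L hL] := choice ch.
have AE x l : ok l -> x = cX l -> cY (L x) = cY l.
{ move=> ol E; have [oL EL] := hL x (ex_intro _ l (conj ol E)).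
  by apply: wd => //; rewrite -EL.
}
exists (fun x => lam^-1 *: cY (L x)); split.
- move=> i j Pi Pj; rewrite scalerA mulfV ?gt_eqF // scale1r.
  rewrite (AE _ [:: (1, i); (-1, j)]).
  + by rewrite /cY !big_cons big_nil addr0 /= scale1r scaleN1r opprB addrA subrK.
  + by move=> p [<-|[<-|]].
  + by rewrite /cX !big_cons big_nil addr0 /= scale1r scaleN1r opprB addrA subrK.
- move=> a x y hx hy; have [ox Ex] := hL x hx; have [oy Ey] := hL y hy.
  rewrite (AE _ (sc a (L x) ++ L y)).
  + by rewrite cY_cat cYs scalerDr !scalerA (mulrC a).
  + by apply: okc => //; apply: oks.
  + by rewrite cX_cat cXs -Ex -Ey.
- move=> x hx; have [ox Ex] := hL x hx.
  rewrite nvZ nvc // -Ex gtr0_norm ?invr_gt0 //; field; by rewrite gt_eqF.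
Qed.

End Similarity.

(** * Limit sets seen from infinity *)

Section Pictures.
Context {R : realType} (U : set (set nat)) (uU : free_ultra U) (V : ipspace R).
Context (T : Type) (d : T -> T -> R) (Phi : T -> V).
Hypothesis dsep : forall x y, d x y = 0 -> x = y.
Hypothesis dPhi : forall x y, d x y = nv (Phi x - Phi y).

(** The inversion at [xi], which becomes the point at infinity. [pic xi xi] has the default value 0,
    so statements exclude [u = xi]. *)
Definition pic (xi u : T) : V := iv (Phi u - Phi xi).

Lemma Phi_neq u v : u <> v -> Phi u - Phi v <> 0.
Proof. by move=> uv h; apply: uv; apply: dsep; rewrite dPhi h nv0. Qed.

Lemma Phi_pd : pmetric d.
Proof.
split=> [x|x y|x y z]; rewrite !dPhi; first by rewrite subrr nv0.
  exact: nvB.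
exact: nv_tri.
Qed.

Lemma Phi_gt0 u v : u <> v -> 0 < d u v.
Proof. by move=> uv; rewrite dPhi; apply: nv_gt0; apply: Phi_neq. Qed.

Lemma pic_dist xi u v : u <> xi -> v <> xi ->
  nv (pic xi u - pic xi v) = d u v / (d u xi * d v xi).
Proof.
move=> h1 h2; rewrite iv_dist; [|exact: Phi_neq..].
by rewrite opprB addrA subrK !dPhi.
Qed.

Lemma pic_nv xi u : nv (pic xi u) = (d u xi)^-1.
Proof. by rewrite iv_nv dPhi. Qed.

Lemma pic_inj xi u v : u <> xi -> v <> xi -> pic xi u = pic xi v -> u = v.
Proof.
move=> h1 h2 h; apply: dsep; have := pic_dist h1 h2.
rewrite h subrr nv0 => /esym/eqP; rewrite mulf_eq0 invr_eq0 mulf_eq0.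
by rewrite (gt_eqF (Phi_gt0 h1)) (gt_eqF (Phi_gt0 h2)) !orbF => /eqP.
Qed.

Definition vcvg (x : nat -> V) (y : V) := forall e : R, 0 < e -> U [set n | nv (x n - y) < e].

Lemma vcvg_cst y : vcvg (fun=> y) y.
Proof. by move=> e e0; apply: (uA uU) => n /=; rewrite subrr nv0. Qed.

Lemma vcvg_lip (W : set nat) (x : nat -> V) y (f : nat -> R) (C : R) : 0 < C ->
  (forall e : R, 0 < e -> U [set n | f n < e]) ->
  U W -> (forall n, W n -> nv (x n - y) <= C * f n) -> vcvg x y.
Proof.
move=> C0 h UW H e e0; have eC : 0 < e / C by posit.
apply: (uS uU) (uI uU UW (h _ eC)) => n /= [Wn]; rewrite ltr_pdivlMr // => h1.
by apply: le_lt_trans (H _ Wn) _; rewrite mulrC.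
Qed.

Lemma vcvg_ext (x y : nat -> V) z : U [set n | x n = y n] -> vcvg x z -> vcvg y z.
Proof. by move=> h c e e0; apply: (uS uU) (uI uU h (c e e0)) => n /= [<-]. Qed.

Lemma vcvgD x x' y y' : vcvg x y -> vcvg x' y' -> vcvg (fun n => x n + x' n) (y + y').
Proof.
move=> h h' e e0; have e2 : 0 < e / 2 by lra.
apply: (uS uU) (uI uU (h _ e2) (h' _ e2)) => n /= [h1 h2].
have := nvD (x n - y) (x' n - y'); rewrite addrACA -opprD; lra.
Qed.

Lemma vcvgZ a x y : vcvg x y -> vcvg (fun n => a *: x n) (a *: y).
Proof.
move=> h; have C0 : 0 < `|a| + 1 by have := normr_ge0 a; lra.
apply: (vcvg_lip C0 h (uT uU)) => n _; rewrite -scalerBr nvZ.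
by apply: ler_wpM2r; [exact: nv_ge0 | lra].
Qed.

Lemma vcvgN x y : vcvg x y -> vcvg (fun n => - x n) (- y).
Proof.
by move=> h e e0; apply: (uS uU) (h _ e0) => n /=; rewrite -opprD nvN.
Qed.

Lemma vcvgB x x' y y' : vcvg x y -> vcvg x' y' -> vcvg (fun n => x n - x' n) (y - y').
Proof. by move=> h h'; apply: vcvgD => //; apply: vcvgN. Qed.

Lemma vcvg_sum (J : finType) (x : J -> nat -> V) (y : J -> V) :
  (forall j, vcvg (x j) (y j)) -> vcvg (fun n => \sum_j x j n) (\sum_j y j).
Proof.
move=> h; elim: (index_enum J) => [|j l IH].
  by apply: (vcvg_ext _ (vcvg_cst _)); apply: (uA uU) => n /=; rewrite !big_nil.
rewrite big_cons; apply: (vcvg_ext _ (vcvgD (h j) IH)).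
by apply: (uA uU) => n /=; rewrite big_cons.
Qed.

Lemma vcvg_le x y (c : R) : vcvg x y -> (forall e : R, 0 < e -> U [set n | nv (x n) <= c + e]) -> nv y <= c.
Proof.
move=> h h'; rewrite leNgt; apply/negP => cy.
pose e := (nv y - c) / 3; have e0 : 0 < e by rewrite /e; lra.
have [n [/= h1 h2]] := u_ex uU (uI uU (h _ e0) (h' _ e0)).
have := nv_triB (x n) y; rewrite ler_norml /e in h1 h2 *; lra.
Qed.

Lemma vcvg_ge x y (c : R) : vcvg x y -> (forall e : R, 0 < e -> U [set n | c - e <= nv (x n)]) -> c <= nv y.
Proof.
move=> h h'; rewrite leNgt; apply/negP => cy.
pose e := (c - nv y) / 3; have e0 : 0 < e by rewrite /e; lra.
have [n [/= h1 h2]] := u_ex uU (uI uU (h _ e0) (h' _ e0)).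
have := nv_triB (x n) y; rewrite ler_norml /e in h1 h2 *; lra.
Qed.

Lemma vcvg_uniq x y z : vcvg x y -> vcvg x z -> y = z.
Proof.
move=> h h'; apply: nv_le_eq => e e0; have e2 : 0 < e / 2 by lra.
have [n [/= h1 h2]] := u_ex uU (uI uU (h _ e2) (h' _ e2)).
have := nv_tri y (x n) z; rewrite (nvB y (x n)); lra.
Qed.

Lemma vcvg_ip x x' y y' (c : R) : vcvg x y -> vcvg x' y' -> (forall n, ip (x n) (x' n) = c) -> ip y y' = c.
Proof.
move=> h h' hc.
have B (z : nat -> V) w : vcvg z w -> U [set n | nv (z n) <= nv w + 1].
{ move=> hz; apply: (uS uU) (hz 1 ltr01) => n /= h1; have := nv_triB (z n) w; rewrite ler_norml; lra.
}
apply/eqP; rewrite -subr_eq0 -normr_eq0 eq_le normr_ge0 andbT leNgt; apply/negP => e0.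
pose C := nv y + 1 + (nv y' + 1).
have C0 : 0 < C by rewrite /C; have := nv_ge0 y; have := nv_ge0 y'; lra.
pose e := `|ip y y' - c| / (2 * C); have ep : 0 < e by rewrite /e; posit.
have [n [/= [h1 h2] h3]] := u_ex uU (uI uU (uI uU (h _ ep) (h' _ ep)) (B _ _ h)).
have E : ip y y' - c = ip (y - x n) y' + ip (x n) (y' - x' n).
{ rewrite -(hc n) !ipE; ring.
}
have a1 := cauchy (y - x n) y'; have a2 := cauchy (x n) (y' - x' n).
have a3 : nv (y - x n) * nv y' <= e * nv y' by apply: ler_wpM2r; [exact: nv_ge0 | rewrite nvB; lra].
have a4 : nv (x n) * nv (y' - x' n) <= (nv y + 1) * e.
{ by apply: ler_pM => //; [exact: nv_ge0 | exact: nv_ge0 | rewrite nvB; lra].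
}
have : `|ip y y' - c| <= e * C.
{ rewrite E; apply: le_trans (ler_normD _ _) _; rewrite /C.
  have : 0 <= e by lra. move=> ?; nra.
}
have -> : e * C = `|ip y y' - c| / 2 by rewrite /e; field; rewrite gt_eqF.
lra.
Qed.

Lemma pic_cvg xs xi x v : ucvg U d xs xi -> ucvg U d x v -> v <> xi ->
  U [set n | x n <> xs n] /\ vcvg (fun n => pic (xs n) (x n)) (pic xi v).
Proof.
move=> h1 h2 vx; have D0 := Phi_gt0 vx; pose D := d v xi.
have pd := Phi_pd; have [d0 dC dt] := pd.
have e0 : 0 < D / 4 by rewrite /D; lra.
have near : U [set n | D / 2 <= d (x n) (xs n)].
{ apply: (uS uU) (uI uU (h1 _ e0) (h2 _ e0)) => n /= [a b].
  have := dt v (x n) xi; have := dt (x n) (xs n) xi; rewrite (dC v (x n)) -/D; lra.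
}
split.
  by apply: (uS uU) near => n /= h E; move: h; rewrite E d0 /D; lra.
have C0 : 0 < 2 / D ^+ 2 by posit.
apply: (vcvg_lip C0 (f := fun n => d (x n) v + d (xs n) xi) _ near).
{ move=> e ep; have e2 : 0 < e / 2 by lra.
  by apply: (uS uU) (uI uU (h1 _ e2) (h2 _ e2)) => n /= [a b]; lra.
}
move=> n /= hn; have xn : x n <> xs n by move=> E; move: hn; rewrite E d0 /D; lra.
rewrite /pic iv_dist; [|exact: Phi_neq..].
rewrite -(dPhi (x n) (xs n)) -(dPhi v xi) -/D.
have a1 : nv (Phi (x n) - Phi (xs n) - (Phi v - Phi xi)) <= d (x n) v + d (xs n) xi.
{ have -> : Phi (x n) - Phi (xs n) - (Phi v - Phi xi) = (Phi (x n) - Phi v) - (Phi (xs n) - Phi xi).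
    by rewrite !opprB [RHS]addrACA [in RHS](addrC (- Phi v)) addrACA (addrC (- Phi (xs n))) -!addrA.
  by apply: le_trans (nvD _ _) _; rewrite nvN -!dPhi.
}
apply: (@le_trans _ _ ((d (x n) v + d (xs n) xi) / (D / 2 * D))); last first.
  rewrite le_eqVlt; apply/orP; left; apply/eqP; field; by rewrite gt_eqF.
have D2 : 0 < D / 2 * D by rewrite /D; posit.
apply: ler_pM => //; first exact: nv_ge0.
  by rewrite invr_ge0 mulr_ge0 // (pmetric_ge0 pd).
rewrite lef_pV2 ?posrE //; last by apply: mulr_gt0 => //; lra.
by rewrite ler_pM2r.
Qed.

Context (K : set T) (cK : ucompact U d K).

(** If the limit of [y] were [xi], the pictures would be unbounded. This is how bounded sequences of
    pictures acquire limits in a space whose balls need not be compact. *)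
Lemma pic_bdd xs xi y (B : R) : ucvg U d xs xi -> K xi -> U [set n | K (y n) /\ y n <> xs n] ->
  U [set n | nv (pic (xs n) (y n)) <= B] ->
  exists v, [/\ K v, v <> xi, ucvg U d y v & vcvg (fun n => pic (xs n) (y n)) (pic xi v)].
Proof.
move=> h Kxi hy hB; have [d0 dC dt] := Phi_pd.
pose y' n := if pselect (K (y n)) then y n else xi.
have Ky' n : K (y' n) by rewrite /y'; case: pselect.
have yy' : U [set n | y' n = y n] by apply: (uS uU) hy => n /= [Kn _]; rewrite /y'; case: pselect.
have [v Kv hv'] := cK Ky'.
have hv : ucvg U d y v.
{ by move=> e e0; apply: (uS uU) (uI uU yy' (hv' e e0)) => n /= [->].
}
have vx : v <> xi.
{ move=> E; rewrite {}E in hv; pose C := `|B| + 1.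
  have C0 : 0 < C by rewrite /C; have := normr_ge0 B; lra.
  have e0 : 0 < C^-1 / 2 by posit.
  have [n [[/= a b] [[Kn yn] c]]] := u_ex uU (uI uU (uI uU (hv _ e0) (h _ e0)) (uI uU hy hB)).
  have dn := Phi_gt0 yn.
  have : d (y n) (xs n) < C^-1 by have := dt (y n) xi (xs n); rewrite (dC xi); lra.
  rewrite -ltf_pV2 ?posrE ?invr_gt0 // invrK -pic_nv => h1.
  have := ler_norm B; rewrite /C in h1; move: c => /= c; lra.
}
by have [_ hc] := pic_cvg h hv vx; exists v.
Qed.

(** For each [n] an almost minimiser of [f n] on [P n] is taken; a single sequence then serves all
    [e]. *)
Lemma u_diag (X : Type) (x0 : X) (P : nat -> X -> Prop) (f : nat -> X -> R) :
  (forall n x, 0 <= f n x) ->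
  (forall e : R, 0 < e -> U [set n | exists x, P n x /\ f n x <= e]) ->
  exists z : nat -> X, forall e : R, 0 < e -> U [set n | P n (z n) /\ f n (z n) <= e].
Proof.
move=> f0 h.
have ch n : exists z, forall x, P n x -> P n z /\ f n z <= f n x + n.+1%:R^-1.
{ have [[x Px]|no] := pselect (exists x, P n x); last by exists x0 => x Px; exfalso; apply: no; exists x.
  pose S : set R := [set f n x | x in P n].
  have Si : has_inf S by split; [exists (f n x); exists x | exists 0 => _ [z _ <-]].
  have q0 : 0 < n.+1%:R^-1 :> R by rewrite invr_gt0 ltr0Sn.
  have : inf S < inf S + n.+1%:R^-1 by rewrite ltrDl.
  move=> /(inf_lt Si.1) [_ [z Pz <-] hz]; exists z => w Pw; split => //.
  apply: le_trans (ltW hz) _; rewrite lerD2r; apply: ge_inf; first by case: Si.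
  by exists w.
}
have [z hz] := choice ch; exists z => e e0; have e2 : 0 < e / 2 by lra.
apply: (uS uU) (uI uU (h _ e2) (u_inv uU e2)) => n /= [[x [Px fx]] hn].
have [Pz fz] := hz n x Px; split => //; move: hn fz; move: (n.+1%:R^-1 : R) => q; lra.
Qed.

End Pictures.

(** * Blow-up at density points *)

Section ZoomSeq.
Context {R : realType} (U : set (set nat)) (uU : free_ultra U) (V : ipspace R).
Context (T : Type) (d : T -> T -> R) (Phi : T -> V).
Hypothesis dsep : forall x y, d x y = 0 -> x = y.
Hypothesis dPhi : forall x y, d x y = nv (Phi x - Phi y).
Hypothesis d2 : forall x y, d x y <= 2.
Context (K : set T) (cK : ucompact U d K) (c0 : R) (c00 : 0 < c0).
Context (Z : (T -> T) -> (T -> T) -> R -> (T -> R) -> Prop).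
Hypothesis Zok : forall g h kap m, Z g h kap m -> zmap d K c0 g h kap m.
Hypothesis Zlim : forall x (e : R), K x -> 0 < e ->
  exists g h kap m, [/\ Z g h kap m, kap < e & m x < e].
Context (k : nat) (k0 : (0 < k)%N).
Let pd : pmetric d := Phi_pd dPhi.

Lemma zm_hlip g h kap m : zmap d K c0 g h kap m -> forall u v, K u -> K v ->
  d (h u) (h v) <= c0 ^+ 2 / kap * d u v.
Proof.
move=> z u v Ku Kv; have := zm_lowlip pd c00 z (zm_h z Ku) (zm_h z Kv).
rewrite !(zm_gh z) // => h1; have kp := zm_kap z.
have -> : d (h u) (h v) = c0 ^+ 2 / kap * (kap / c0 ^+ 2 * d (h u) (h v)).
  by field; rewrite !gt_eqF.
by rewrite ler_pM2l //; posit.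
Qed.

Lemma zoom_Hle g h kap m (A B : set T) (M : R) : zmap d K c0 g h kap m -> A `<=` K ->
  (forall u, A u -> B (g u)) -> B `<=` K -> Hle d k B M ->
  Hle d k A ((c0 ^+ 2 / kap) ^+ k * M).
Proof.
move=> z AK gA BK hB; have kp := zm_kap z.
have L0 : 0 < c0 ^+ 2 / kap by posit.
have := Hle_image (d' := d) (f := h) L0 (fun x y Bx By => zm_hlip z (BK _ Bx) (BK _ By)) hB.
apply: Hle_sub => // u Au; exists (g u); first exact: gA.
by rewrite (zm_hg z) //; exact: AK.
Qed.

(** If K is not null, it is non-null near two points, and [gamma_exists] carries a ball about one of
    them into the given ball. As the inverse of a zoom is Lipschitz, the given ball cannot be
    null. *)
Lemma ball_nonnull : ~ Hnull d k K -> forall v (e : R), K v -> 0 < e ->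
  ~ Hnull d k (K `&` [set x | d x v < e]).
Proof.
move=> nK v e Kv e0; have [d0 dC dt] := pd.
have [||||[x0 Kx0 h]|] := ideal_dichotomy uU pd cK (J := Hnull d k) (A := K) Kv.
- exact: (Hle0 _ k0).
- by move=> B C; apply: Hnull_sub.
- by move=> B C; apply: (HnullU k0).
- by [].
- exfalso; apply: nK.
  apply: (@Hnull_sub _ _ _ _ _ ([set x0] `|` \bigcup_n (K `&` [set x | n.+1%:R^-1 <= d x x0]))).
    move=> x Kx; have [->|xx] := pselect (x = x0); first by left.
    right; have [n hn] := inv_lt uU (Phi_gt0 dsep dPhi xx); exists n => //; split => //=; exact: ltW.
  apply: (HnullU k0); first exact: (Hnull1 k0).
  by apply: (Hnull_bigcup k0) => n; apply: h; rewrite invr_gt0 ltr0Sn.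
- move=> [x1 [x2 [K1 K2 x12 h1 h2]]] nB.
  pose D := d x1 x2; have D4 : 0 < D / 4 by rewrite /D; lra.
  have [q Kq vq] : exists2 q, K q & v <> q.
  { have [vx|vx] := pselect (v = x1); last by exists x1.
    by exists x2 => // E; move: x12; rewrite -vx -E d0 ltxx.
  }
  pose B b := K `&` [set x | d x (if b : bool then x1 else x2) <= D / 4].
  have [|u w [Ku du] [Kw dw]|b [g [h [kap [m [z hg]]]]]] :=
    gamma_exists pd dsep d2 c00 Zok Zlim (B := B) Kv Kq vq e0 D4.
  + by move=> b x [].
  + move: du dw => /= du dw; have := dt x1 u x2; have := dt u w x2.
    rewrite (dC x1 u) -/D; lra.
  + have nb : ~ Hnull d k (B b) by case: b {hg}; [apply: h1 | apply: h2].
    apply: nb; have := zoom_Hle (Zok z) (A := B b) _ _ _ nB.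
    rewrite mulr0; apply => [x []//|x Bx|x []//].
    by split; [apply: (zm_g (Zok z)); case: Bx | apply: hg].
Qed.

Lemma zoom_pic_neq g h kap m xi u : zmap d K c0 g h kap m -> K xi -> K u -> u <> xi -> h u <> h xi.
Proof. by move=> z Kxi Ku ux E; apply: ux; rewrite -(zm_gh z Ku) E (zm_gh z). Qed.

(** The factors [m u] and [m v] of [zm_eq] cancel against those of the inversions at [xi] and
    [h xi]; only [m xi] remains. *)
Lemma zoom_pic g h kap m xi u v : zmap d K c0 g h kap m -> K xi -> K u -> K v ->
  u <> xi -> v <> xi -> nv (pic Phi (h xi) (h u) - pic Phi (h xi) (h v)) =
  m xi ^+ 2 / kap * nv (pic Phi xi u - pic Phi xi v).
Proof.
move=> z Kx Ku Kv ux vx; have hu := zoom_pic_neq z Kx Ku ux; have hv := zoom_pic_neq z Kx Kv vx.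
rewrite !(pic_dist dsep dPhi) //.
have kp := zm_kap z; have mx := zm_gt0 c00 z Kx; have mu := zm_gt0 c00 z Ku.
have mv := zm_gt0 c00 z Kv.
have E a b : K a -> K b -> d (h a) (h b) = kap * d a b / (m a * m b).
{ move=> Ka Kb; rewrite -(zm_eq z Ka Kb); field.
  by rewrite !(gt_eqF (zm_gt0 c00 z _)).
}
rewrite !E //; have := Phi_gt0 dsep dPhi ux; have := Phi_gt0 dsep dPhi vx => a1 a2.
by field; rewrite !gt_eqF.
Qed.

Context (xo : T) (Kxo : K xo).
Hypothesis Kfin : forall e : R, 0 < e -> Hfin d k (K `&` [set x | e <= d x xo]).
Hypothesis Lnull : Hnull d k (K `\` Lr K Z).

(** If the images of [Q i] kept missing a ball about [v], then carrying this non-null ball by [g n]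
    would give mass of positive density at [p] that stays away from [Q i], which [density] allows
    only on a null set. Countably many sets [Q i] are handled by one choice of [p]. *)
Lemma zoom_seq xi (X : set T) (Q : nat -> set T) : K xi -> X `<=` K -> ~ Hnull d k X ->
  (forall i, Q i `<=` K) ->
  exists p g h kap m xi',
  [/\ X p /\ p <> xi, forall n, Z (g n) (h n) (kap n) (m n),
      K xi' /\ ucvg U d (fun n => h n xi) xi', forall M : R, U [set n | M < m n xi ^+ 2 / kap n]
    & forall i, Q i p -> forall v, K v -> v <> xi' -> exists x : nat -> T,
      U [set n | Q i (x n)] /\ ucvg U d (fun n => h n (x n)) v].
Proof.
move=> Kxi XK nX QK; have [d0 dC dt] := pd.
have nK : ~ Hnull d k K by move=> h; apply: nX; apply: Hnull_sub h.
have i0 n : 0 < n.+1%:R^-1 :> R by rewrite invr_gt0 ltr0Sn.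
(* The index [s] keeps [Bs] away from [xo], near which the measure may be infinite. *)
pose Bs (i s : nat) := (K `&` [set x | s.+1%:R^-1 <= d x xo]) `&`
   [set x | exists2 t : R, 0 < t & forall q, Q i q -> t <= d x q].
pose bad (i s j : nat) := [set p | Q i p /\ forall r0 : R, 0 < r0 -> exists r : R,
    [/\ 0 < r, r < r0 & ~ Hle d k (Bs i s `&` [set x | d x p <= r]) (j.+1%:R^-1 * r ^+ k)]].
have badn i s j : Hnull d k (bad i s j).
{ apply: (density uU pd cK k0 (Bs := Bs i s) (i0 j)) => //.
    by apply: Hfin_sub (Kfin (i0 s)) => x [].
  by move=> x [].
}
pose N := (\bigcup_i \bigcup_s \bigcup_j bad i s j) `|` ([set xo] `|` ([set xi] `|` (K `\` Lr K Z))).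
have nN : Hnull d k N.
{ apply: (HnullU k0).
    by do 3!(apply: (Hnull_bigcup k0) => ?).
  by do 2!(apply: (HnullU k0); first exact: (Hnull1 k0)).
}
have [p [Xp Np]] := Hnull_nonempty k0 (Hnull_diff k0 nX nN).
have Kp : K p := XK _ Xp.
have pxo : p <> xo by move=> E; apply: Np; right; left.
have pxi : p <> xi by move=> E; apply: Np; right; right; left.
have [C1 hC1] : Lr K Z p by apply: contrapT => h; apply: Np; right; right; right.
have Do := Phi_gt0 dsep dPhi pxo; have Dx := Phi_gt0 dsep dPhi pxi.
have [C C0 [_ hC]] : exists2 C : R, 0 < C & LC K Z C p.
{ exists (`|C1| + 1); first by have := normr_ge0 C1; lra.
  by apply: (LC_mono Zok _ hC1); have := ler_norm C1; lra.
}
have ch n : exists q : (T -> T) * (T -> T) * R * (T -> R),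
  [/\ Z q.1.1.1 q.1.1.2 q.1.2 q.2, q.1.2 < n.+1%:R^-1 & q.2 p < C * q.1.2].
{ by have [g [h [kap [m H]]]] := hC _ (i0 n); exists (g, h, kap, m).
}
have {ch} [q hq] := choice ch.
pose g n := (q n).1.1.1; pose h n := (q n).1.1.2; pose kap n := (q n).1.2; pose m n := (q n).2.
have Zn n : Z (g n) (h n) (kap n) (m n) by case: (hq n).
have zn n := Zok (Zn n).
have kap0 n : 0 < kap n := zm_kap (zn n).
have kapn n : kap n < n.+1%:R^-1 by case: (hq n).
have mp n : m n p < C * kap n by case: (hq n).
have kapU (e : R) : 0 < e -> U [set n | kap n < e].
{ by move=> e0; apply: (uS uU) (u_inv uU e0) => n /= hn; apply: lt_trans hn.
}
have [xi' Kxi' hxi'] := cK (fun n => zm_h (zn n) Kxi).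
have mpU (e : R) : 0 < e -> U [set n | m n p < e].
{ move=> e0; have eC : 0 < e / C by posit.
  apply: (uS uU) (kapU _ eC) => n /=; rewrite ltr_pdivlMr // => hn; have := mp n; lra.
}
pose D := d p xi.
exists p, g, h, kap, m, xi'; split => //.
- move=> M; have D2 : 0 < D / 2 by rewrite /D; lra.
  have e0 : 0 < (D / 2) ^+ 2 / (`|M| + 1).
  { apply: divr_gt0; first by apply: exprn_gt0. by have := normr_ge0 M; lra.
  }
  apply: (uS uU) (uI uU (mpU _ D2) (kapU _ e0)) => n /= [h1].
  have M1 : 0 < `|M| + 1 by have := normr_ge0 M; lra.
  rewrite ltr_pdivlMr // ltr_pdivlMr // => h2.
  have h3 : D / 2 <= m n xi by have := zm_sum (zn n) Kp Kxi; rewrite -/D; lra.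
  have h4 : (D / 2) ^+ 2 <= m n xi ^+ 2 by rewrite ler_pXn2r ?nnegrE //; lra.
  have h5 : M * kap n <= kap n * (`|M| + 1).
  { rewrite mulrC ler_pM2l //; have := ler_norm M; lra.
  }
  lra.
- move=> i Qp v Kv vx.
  suff cl (e : R) : 0 < e -> U [set n | exists x, Q i x /\ d (h n x) v <= e].
  { have [x hx] := u_diag uU v (P := fun n x => Q i x) (f := fun n x => d (h n x) v)
      (fun n x => pmetric_ge0 pd _ _) cl.
    exists x; split; first by apply: (uS uU) (hx 1 ltr01) => n [].
    move=> e e0; have e2 : 0 < e / 2 by lra.
    by apply: (uS uU) (hx _ e2) => n /= [_]; lra.
  }
  move=> e0; apply: contrapT => /(uC uU) nS.
  have Ev := Phi_gt0 dsep dPhi vx; pose E := d v xi'.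
  pose e' := Num.min (e / 2) (E / 4).
  have e'0 : 0 < e' by rewrite lt_min /E; apply/andP; split; lra.
  have e'1 : e' <= e / 2 by rewrite ge_min lexx.
  have e'2 : e' <= E / 4 by rewrite ge_min lexx orbT.
  pose B := K `&` [set x | d x v < e'].
  have nB : ~ Hnull d k B by apply: ball_nonnull.
  have [a a0 na] : exists2 a : R, 0 < a & ~ Hle d k B a.
  { apply: contrapT => H; apply: nB; apply: Hle_lim => a a0; apply: contrapT => na.
    by apply: H; exists a.
  }
  (* Bound for [d (g n u) p / kap n] on the ball, from [pole_bound] at distance [E / 2] from the
     pole [h n xi] together with [m n p < C * kap n]. *)
  pose rho := 8 * C / (E / 2 * D).
  have rho0 : 0 < rho by rewrite /rho /E /D; posit.
  have b0 : 0 < (c0 ^+ 2 * rho) ^+ k by posit.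
  have [j hj] : exists j : nat, j.+1%:R^-1 < a / (c0 ^+ 2 * rho) ^+ k.
  { by apply: (inv_lt uU); posit.
  }
  have [s hs] : exists s : nat, s.+1%:R^-1 < d p xo / 2 by apply: (inv_lt uU); lra.
  apply: Np; left; exists i => //; exists s => //; exists j => //; split => // r0 r00.
  have t0 : 0 < Num.min r0 (d p xo / 2) / rho.
  { apply: divr_gt0 => //; rewrite lt_min r00 /=; lra.
  }
  have D2 : 0 < D / 2 by rewrite /D; lra.
  have E4 : 0 < E / 4 by rewrite /E; lra.
  have [n [/= [h1 h2] [h3 h4]]] := u_ex uU (uI uU (uI uU nS (hxi' _ E4)) (uI uU (kapU _ t0) (mpU _ D2))).
  exists (rho * kap n); split.
  + by apply: mulr_gt0.
  + move: h3; rewrite ltr_pdivlMr // mulrC lt_min => /andP[]; by rewrite mulrC.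
  move=> hle; apply: na.
  have rs : rho * kap n < d p xo / 2.
  { by move: h3; rewrite ltr_pdivlMr // mulrC lt_min => /andP[].
  }
  have gB u : B u -> (Bs i s `&` [set x | d x p <= rho * kap n]) (g n u).
  { move=> [Ku /= du]; have Kgu := zm_g (zn n) Ku.
    have uh : E / 2 <= d u (h n xi).
    { have := dt v u xi'; have := dt u (h n xi) xi'; rewrite (dC v u) -/E; lra.
    }
    have E2 : 0 < E / 2 by lra.
    have dp : d (g n u) p <= rho * kap n.
    { have q1 : 2 * m n p <= d xi p by rewrite (dC xi p) -/D; lra.
      have q2 : 0 < d xi p by rewrite (dC xi p).
      have := pole_bound d2 c00 (zn n) Kp Kxi E2 q1 q2 Ku uh.
      rewrite (dC xi p) -/D => q3.
      have := zm_eq (zn n) Kgu Kp; rewrite (zm_hg (zn n)) // => q4.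
      rewrite -(ler_pM2l (kap0 n)) -q4.
      have mg0 := zm_gt0 c00 (zn n) Kgu; have mp0 := zm_gt0 c00 (zn n) Kp.
      apply: (@le_trans _ _ (2 * (4 * kap n / (E / 2 * D) * (C * kap n)))).
        apply: ler_pM => //; first exact: (pmetric_ge0 pd).
          by rewrite mulr_ge0 // ltW.
        by apply: ler_pM => //; rewrite ltW.
      rewrite le_eqVlt; apply/orP; left; apply/eqP; rewrite /rho; field.
      by rewrite !gt_eqF // /D.
    }
    split => //; split; first split => //=.
    - have := dt p (g n u) xo; rewrite (dC p (g n u)); move: hs; move: (s.+1%:R^-1 : R) => s1; lra.
    - have L0 : 0 < c0 ^+ 2 / kap n by posit.
      exists (e / 2 / (c0 ^+ 2 / kap n)); first by posit.
      move=> x Qx; rewrite leNgt; apply/negP; rewrite ltr_pdivlMr // => hx.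
      apply: h1; exists x; split => //.
      have := zm_hlip (zn n) Kgu (QK _ _ Qx); rewrite (zm_hg (zn n)) // => q5.
      have := dt (h n x) u v; rewrite (dC (h n x) u); lra.
  }
  have BK : B `<=` K by move=> x [].
  have BK' : Bs i s `&` [set x | d x p <= rho * kap n] `<=` K by move=> x [[[]]].
  have := zoom_Hle (zn n) BK gB BK' hle.
  apply: Hle_sub => //.
  have -> : (c0 ^+ 2 / kap n) ^+ k * (j.+1%:R^-1 * (rho * kap n) ^+ k) =
    j.+1%:R^-1 * (c0 ^+ 2 * rho) ^+ k.
  { have -> : c0 ^+ 2 * rho = c0 ^+ 2 / kap n * (rho * kap n) by field; rewrite gt_eqF.
    by rewrite [in RHS]exprMn mulrCA.
  }
  by rewrite ltW // -ltr_pdivlMr.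
Qed.

End ZoomSeq.

(** * Functionals transverse to a frame *)

Lemma vandermonde_inv (R : realType) (j : nat) (e : 'I_j -> nat) : injective e ->
  exists B : 'I_j -> 'I_j -> R, forall t : 'I_j -> R, forall l,
    t l = \sum_i B i l * \sum_(m < j) t m * (e i)%:R ^+ m.
Proof.
move=> einj; pose M : 'M[R]_j := Vandermonde j (\row_i (e i)%:R).
have uM : M \in unitmx.
{ rewrite unitmxE det_Vandermonde unitfE; apply/prodf_neq0 => i _; apply/prodf_neq0 => i' ii'.
  rewrite !mxE subr_eq0 eqr_nat; apply/eqP => /einj E; by rewrite E ltnn in ii'.
}
exists (fun i l => invmx M i l) => t l; pose v : 'rV[R]_j := \row_m t m.
have : v = v *m M *m invmx M by rewrite mulmxK.
move=> /rowP/(_ l); rewrite !mxE => ->; apply: eq_bigr => i _; rewrite mxE mulrC; congr (_ * _).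
by apply: eq_bigr => m _; rewrite !mxE.
Qed.

Section IPAux.
Context {R : realType} (V : ipspace R).

Lemma nv_sum (J : Type) (r : seq J) (F : J -> V) : nv (\sum_(i <- r) F i) <= \sum_(i <- r) nv (F i).
Proof.
elim: r => [|i r IH]; first by rewrite !big_nil nv0.
by rewrite !big_cons; apply: le_trans (nvD _ _) _; rewrite lerD2l.
Qed.

(** The squared distance from [z] to the point of the segment at the same distance [t] from [a] is
    [t / D] times the product of [s + t - D] and [s + D - t]; the excess bounds the former by
    [e * D], and the latter is at most [2 * D]. *)
Lemma near_segment (a b z : V) (e q : R) : 0 <= e -> 0 <= q -> 2 * e <= q ^+ 2 ->
  0 < nv (a - b) -> nv (a - z) <= nv (a - b) ->
  nv (a - z) + nv (z - b) <= (1 + e) * nv (a - b) ->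
  nv (z - a - (nv (a - z) / nv (a - b)) *: (b - a)) <= q * nv (a - b).
Proof.
move=> e0 q0 eq D0 tD ts.
set D := nv (a - b) in D0 tD ts *; set t := nv (a - z) in tD ts *; set s := nv (z - b) in ts.
have t0 : 0 <= t := nv_ge0 _; have s0 : 0 <= s := nv_ge0 _.
rewrite -(ler_pXn2r (n := 2)) ?nnegrE ?nv_ge0 ?mulr_ge0 ?(ltW D0) // nv_sq.
have E1 : ip (z - a) (z - a) = t ^+ 2 by rewrite -nv_sq nvB.
have E2 : ip (b - a) (b - a) = D ^+ 2 by rewrite -nv_sq nvB.
have E3 : ip (z - a) (b - a) = (t ^+ 2 + D ^+ 2 - s ^+ 2) / 2.
{ rewrite ip_nv (nvB z a) (nvB b a) -/t -/D; congr ((_ - _ ^+ 2) / _).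
  by rewrite opprB addrA subrK.
}
have -> : ip (z - a - (t / D) *: (b - a)) (z - a - (t / D) *: (b - a)) =
  ip (z - a) (z - a) - 2 * (t / D) * ip (z - a) (b - a) + (t / D) ^+ 2 * ip (b - a) (b - a).
{ move: (z - a) (b - a) => x y; rewrite !ipE (ipC y x); ring.
}
rewrite E1 E2 E3.
have -> : t ^+ 2 - 2 * (t / D) * ((t ^+ 2 + D ^+ 2 - s ^+ 2) / 2) + (t / D) ^+ 2 * D ^+ 2 =
  t / D * ((s + t - D) * (s + D - t)) by field; rewrite gt_eqF.
have st : s <= D + t by have := nv_tri z a b; rewrite (nvB z a) -/s -/t -/D; lra.
have h0 : D <= t + s by have := nv_tri a z b; rewrite -/s -/t -/D.
have h1 : t / D <= 1 by rewrite ler_pdivrMr // mul1r.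
have h2 : (s + t - D) * (s + D - t) <= (e * D) * (2 * D) by apply: ler_pM; lra.
have h3 : t / D * ((s + t - D) * (s + D - t)) <= 1 * ((e * D) * (2 * D)).
{ apply: ler_pM => //; first by apply: divr_ge0 => //; apply: ltW.
  by apply: mulr_ge0; lra.
}
apply: le_trans h3 _; rewrite exprMn mul1r.
have -> : e * D * (2 * D) = 2 * e * D ^+ 2 by ring.
by apply: ler_wpM2r => //; apply: exprn_ge0; apply: ltW.
Qed.

Context (j : nat) (w : 'I_j -> V).
Hypothesis worth : forall i i', ip (w i) (w i') = (i == i')%:R.

Lemma ip_wsum (t : 'I_j -> R) l : ip (\sum_i t i *: w i) (w l) = t l.
Proof.
rewrite ip_suml (bigD1 l) //= ipZl worth eqxx mulr1 big1 ?addr0 // => i il.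
by rewrite ipZl worth (negbTE il) mulr0.
Qed.

Lemma nv_w i : nv (w i) = 1.
Proof. by rewrite /nv worth eqxx sqrtr1. Qed.

Context (a : nat -> V).

(* On the span of the frame the functionals [ip _ (ffun n)] form a Vandermonde
   family, so that any [j] of them are independent there. *)
Definition ffun n : V :=
  (if (n < j)%N then 0 else a (n - j) - \sum_(l < j) ip (a (n - j)) (w l) *: w l)
  + \sum_(l < j) (n%:R ^+ l) *: w l.

Lemma ip_ffun n l : ip (w l) (ffun n) = n%:R ^+ l.
Proof.
rewrite ipC /ffun ipDl ip_wsum; case: ifP => _; first by rewrite ip0l add0r.
by rewrite ipDl ipNl ip_wsum subrr add0r.
Qed.

(** On the span of the frame the first [j] functionals form an invertible Vandermonde system, so [x]
    is orthogonal to the frame; the later functionals then reduce to the pairings with the [a m]. *)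
Lemma ffun_sep x : (forall n, ip x (ffun n) = 0) -> forall m, ip x (a m) = 0.
Proof.
move=> h; have w0 l : ip x (w l) = 0.
{ have [B hB] := @vandermonde_inv R j (fun i => i) (@ord_inj j).
  rewrite (hB (fun l => ip x (w l)) l) big1 // => i _.
  have -> : \sum_(m < j) ip x (w m) * i%:R ^+ m = ip x (ffun i).
  { rewrite /ffun ltn_ord add0r ip_sumr; apply: eq_bigr => m _; by rewrite ipZr mulrC.
  }
  by rewrite h mulr0.
}
move=> m; have := h (m + j)%N; rewrite /ffun ltnNge leq_addl /= addnK ipDr ipDr ipNr !ip_sumr.
rewrite [X in _ - X + _]big1 ?subr0; last by move=> l _; rewrite ipZr w0 mulr0.
by rewrite big1 ?addr0 // => l _; rewrite ipZr w0 mulr0.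
Qed.

(** As [x] pairs to 0 with the chosen functionals, the Vandermonde system recovers the coefficients
    [t] from the pairings of [x - \sum_i t i *: w i]. So [nv x] is at most [1 + C] times the norm of
    that difference. *)
Lemma ffun_angle (e : 'I_j -> nat) : injective e -> exists2 eta : R, 0 < eta &
  forall x, (forall i, ip x (ffun (e i)) = 0) ->
  forall t : 'I_j -> R, eta * nv x <= nv (x - \sum_i t i *: w i).
Proof.
move=> einj; have [B hB] := vandermonde_inv R einj.
pose F := \sum_i nv (ffun (e i)); pose C := \sum_l \sum_i `|B i l| * F.
have F0 : 0 <= F by apply: sumr_ge0 => i _; apply: nv_ge0.
have C0 : 0 <= C.
{ by apply: sumr_ge0 => l _; apply: sumr_ge0 => i _; apply: mulr_ge0.
}
exists (1 + C)^-1; first by rewrite invr_gt0; lra.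
move=> x hx t; rewrite mulrC ler_pdivrMr; last lra.
set z := x - _.
have tE i : \sum_(m < j) t m * (e i)%:R ^+ m = - ip z (ffun (e i)).
{ rewrite /z ipDl ipNl hx sub0r opprK ip_suml.
  by apply: eq_bigr => m _; rewrite ipZl ip_ffun.
}
have tl l : `|t l| <= (\sum_i `|B i l| * F) * nv z.
{ rewrite (hB t l); apply: le_trans (ler_norm_sum _ _ _) _; rewrite mulr_suml.
  apply: ler_sum => i _; rewrite normrM tE normrN -mulrA; apply: ler_wpM2l => //.
  apply: le_trans (cauchy _ _) _; rewrite mulrC; apply: ler_wpM2r; first exact: nv_ge0.
  rewrite /F (bigD1 i) //= lerDl; apply: sumr_ge0 => i' _; exact: nv_ge0.
}
have h1 : nv (\sum_i t i *: w i) <= C * nv z.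
{ apply: le_trans (nv_sum _ _) _; rewrite /C mulr_suml; apply: ler_sum => i _.
  by rewrite nvZ nv_w mulr1.
}
have h2 := nvD z (\sum_i t i *: w i); rewrite /z subrK -/z in h2; lra.
Qed.

End IPAux.

(** * Generic slices *)

Section Slicing.
Context {R : realType} (U : set (set nat)) (uU : free_ultra U) (V : ipspace R).
Context (T : Type) (d : T -> T -> R) (Phi : T -> V).
Hypothesis dsep : forall x y, d x y = 0 -> x = y.
Hypothesis dPhi : forall x y, d x y = nv (Phi x - Phi y).
Context (K : set T) (cK : ucompact U d K) (xi : T).
Let pd : pmetric d := Phi_pd dPhi.
Notation c := (pic Phi xi).
Context (f : nat -> V).
Hypothesis fsep : forall u v, K u -> K v -> u <> xi -> v <> xi ->
  (forall n, ip (c u - c v) (f n) = 0) -> u = v.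

Definition fv i u := ip (c u) (f i).
(** The point [xi] belongs to every slice: it is the limit of points whose pictures go to infinity,
    and with it slices are closed. *)
Definition Sl (i : nat) (t : R) : set T := [set u | u = xi \/ (u <> xi /\ fv i u = t)].

Lemma fv_cvg i x v : ucvg U d x v -> v <> xi -> forall e : R, 0 < e ->
  U [set n | x n <> xi /\ `|fv i (x n) - fv i v| < e].
Proof.
move=> h vx e e0; have [h1 h2] := pic_cvg uU dsep dPhi (ucvg_cst uU pd xi) h vx.
have C0 : 0 < nv (f i) + 1 by have := nv_ge0 (f i); lra.
have e1 : 0 < e / (nv (f i) + 1) by posit.
apply: (uS uU) (uI uU h1 (h2 _ e1)) => n /= [a b]; split => //.
rewrite ltr_pdivlMr // in b.
have := cauchy (c (x n) - c v) (f i); rewrite ipDl ipNl => h3; apply: le_lt_trans h3 _.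
apply: le_lt_trans b; apply: ler_wpM2l; [exact: nv_ge0 | lra].
Qed.

Lemma fv_lip i (r : R) u v : 0 < r -> r <= d u xi -> r <= d v xi ->
  `|fv i u - fv i v| <= (nv (f i) + 1) / r ^+ 2 * d u v.
Proof.
move=> r0 hu hv; have [d0 _ _] := pd.
have ux : u <> xi by move=> E; move: hu; rewrite E d0; lra.
have vx : v <> xi by move=> E; move: hv; rewrite E d0; lra.
have := cauchy (c u - c v) (f i); rewrite ipDl ipNl => h3; apply: le_trans h3 _.
rewrite (pic_dist dsep dPhi ux vx).
have -> : (nv (f i) + 1) / r ^+ 2 * d u v = d u v / (r * r) * (nv (f i) + 1).
  by field; rewrite gt_eqF.
have D := pmetric_ge0 pd u v.
apply: ler_pM; [|exact: nv_ge0| |lra].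
  by apply: divr_ge0 => //; apply: mulr_ge0; lra.
apply: ler_wpM2l => //; rewrite lef_pV2 ?posrE; [|apply: mulr_gt0; lra|exact: mulr_gt0].
by apply: ler_pM => //; lra.
Qed.

Lemma Sl_closed i t A : A `<=` K -> ucompact U d A -> ucompact U d (A `&` Sl i t).
Proof.
move=> AK cA; apply: ucompact_closed => // u x hu Ax ux.
have [->|xx] := pselect (x = xi); [by left | right; split => //].
apply/eqP; rewrite -subr_eq0 -normr_eq0; apply/eqP.
apply: contrapT => /eqP h; have e0 : 0 < `|fv i x - t| by rewrite lt_neqAle eq_sym h normr_ge0.
have [n [/= a b]] := u_ex uU (fv_cvg i ux xx e0).
have [_ [//|[_ E]]] := hu n; rewrite E distrC in b; move: b; by rewrite ltxx.
Qed.

Lemma u_list (X : Type) (l : seq X) (P : X -> nat -> Prop) :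
  U [set n | exists2 z, List.In z l & P z n] -> exists2 z, List.In z l & U [set n | P z n].
Proof.
elim: l => [|x l IH] h; first by have [n [z []]] := u_ex uU h.
have : U ([set n | P x n] `|` [set n | exists2 z, List.In z l & P z n]).
  apply: (uS uU) h => n [z /= [<-|hz] Pz]; [by left | by right; exists z].
move=> /(u_or uU) [hx|/IH [z hz Pz]]; first by exists x => //; left.
by exists z => //; right.
Qed.

Lemma u_all M (P : nat -> nat -> Prop) : (forall i, (i < M)%N -> U [set n | P i n]) ->
  U [set n | forall i, (i < M)%N -> P i n].
Proof.
elim: M => [|M IH] h; first by apply: (uA uU) => n /= i; rewrite ltn0.
apply: (uS uU) (uI uU (IH (fun i iM => h i (ltnW iM))) (h M (ltnSn M))) => n /= [h1 h2] i.
by rewrite ltnS leq_eqVlt => /orP[/eqP->//|]; apply: h1.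
Qed.

Lemma limit_seq (P : set T) y : (forall e : R, 0 < e -> exists z, [/\ K z, P z & d y z < e]) ->
  exists z : nat -> T, (forall n, K (z n) /\ P (z n)) /\ ucvg U d z y.
Proof.
have [_ dC _] := pd.
move=> h; have ch (n : nat) : exists z, (K z /\ P z) /\ d y z < n.+1%:R^-1.
  by have [|z [a b e]] := h n.+1%:R^-1; [rewrite invr_gt0 ltr0Sn | exists z].
have [z hz] := choice ch; exists z; split => [n|e e0]; first by case: (hz n).
apply: (uS uU) (u_inv uU e0) => n /= hn; rewrite (dC (z n) y); have [_ h2] := hz n.
exact: lt_trans hn.
Qed.

Lemma ucvg_le z y x (e : R) : ucvg U d z y -> U [set n | d (z n) x <= e] -> d y x <= e.
Proof.
move=> h h'; have [_ dC dt] := pd; rewrite leNgt; apply/negP => lt.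
have e0 : 0 < d y x - e by lra.
have [n [/= a b]] := u_ex uU (uI uU (h _ e0) h').
have := dt y (z n) x; rewrite (dC y (z n)); lra.
Qed.

Lemma ucvg_ge z y x (e : R) : ucvg U d z y -> U [set n | e <= d (z n) x] -> e <= d y x.
Proof.
move=> h h'; have [_ dC dt] := pd; rewrite leNgt; apply/negP => lt.
have e0 : 0 < e - d y x by lra.
have [n [/= a b]] := u_ex uU (uI uU (h _ e0) h').
have := dt (z n) y x; lra.
Qed.

Lemma shell_sep x (F : set T) : K x -> x <> xi -> ucompact U d F -> F `<=` K ->
  (forall u, F u -> u <> x /\ u <> xi) ->
  exists M : nat, exists2 e : R, 0 < e &
    forall u, F u -> exists2 i, (i < M)%N & e < `|fv i u - fv i x|.
Proof.
move=> Kx xx cF FK hF; apply: contrapT => no.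
have ch M : exists u, F u /\ forall i, (i < M)%N -> `|fv i u - fv i x| <= M.+1%:R^-1.
{ apply: contrapT => no'; apply: no; exists M, M.+1%:R^-1; first by rewrite invr_gt0 ltr0Sn.
  move=> u Fu; apply: contrapT => no2; apply: no'; exists u; split => // i iM.
  by rewrite leNgt; apply/negP => lt; apply: no2; exists i.
}
have [u hu] := choice ch.
have [v Fv uv] := cF u (fun n => (hu n).1).
have [vx vxi] := hF v Fv; apply: vx; apply: fsep => //; first exact: FK.
move=> i; rewrite ipDl ipNl -/(fv i v) -/(fv i x).
apply/eqP; rewrite -normr_eq0 eq_le normr_ge0 andbT leNgt; apply/negP => e0.
have e2 : 0 < `|fv i v - fv i x| / 2 by lra.
have [n [/= [h1 h2] [h3 h4]]] := u_ex uU (uI uU (fv_cvg i uv vxi e2) (uI uU (u_inv uU e2) (u_ge uU i.+1))).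
have h5 := (hu n).2 i h4.
have := ler_distD (fv i (u n)) (fv i v) (fv i x); rewrite (distrC (fv i v) (fv i (u n))).
move: h3 h5; move: (n.+1%:R^-1 : R) => q; lra.
Qed.

Definition goodO (N : nat -> set R) (O : set T) (l : seq (nat * R)) (e : R) :=
  [/\ forall y, K y -> O y -> exists2 e' : R, 0 < e' & forall z, K z -> d y z < e' -> O z,
      forall y z, K y -> K z -> O y -> O z -> d y z <= e,
      forall p, List.In p l -> ~ N p.1 p.2
    & forall y, K y -> ~ O y -> (forall e' : R, 0 < e' -> exists z, [/\ K z, O z & d y z < e']) ->
      exists2 p, List.In p l & Sl p.1 p.2 y].

Lemma in_map_iota (M : nat) (g : nat -> nat * R) i : (i < M)%N ->
  List.In (g i) [seq g i | i <- iota 0 M].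
Proof.
move=> iM; have : i \in iota 0 M by rewrite mem_iota.
elim: (iota 0 M) => //= a l IH; rewrite inE => /orP[/eqP->|/IH]; [by left | by right].
Qed.

Lemma in_map_inv (l : seq nat) (g : nat -> nat * R) p : List.In p [seq g i | i <- l] ->
  exists i, p = g i.
Proof. by elim: l => //= a l IH [<-|/IH]; [exists a|]. Qed.

(** Finitely many functionals separate [x] from the shell between the radii [e1] and [2 * e1]. The
    box that they cut out near [x] therefore stops inside radius [e1], so its boundary lies on its
    faces, whose parameters are chosen outside the null sets. *)
Lemma slice_box (N : nat -> set R) : (forall i, nullR (N i)) ->
  forall x (e : R), K x -> x <> xi -> 0 < e -> exists O l, O x /\ goodO N O l e.
Proof.
move=> nN x e Kx xx e0; have [d0 dC dt] := pd.
have D0 := Phi_gt0 dsep dPhi xx; pose D := d x xi.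
pose e1 := Num.min (e / 2) (D / 4).
have e10 : 0 < e1 by rewrite lt_min /D; apply/andP; split; lra.
have e1e : e1 <= e / 2 by rewrite ge_min lexx.
have e1D : e1 <= D / 4 by rewrite ge_min lexx orbT.
have far u : d u x <= 2 * e1 -> u <> xi.
{ move=> h E; rewrite E (dC xi x) -/D in h; have := D0; rewrite -/D; lra.
}
pose F := K `&` [set u | e1 <= d u x /\ d u x <= 2 * e1].
have cF : ucompact U d F.
{ apply: ucompact_closed => // u v hu Kv uv; split.
    by apply: (ucvg_ge uv); apply: (uA uU) => n /=; case: (hu n) => _ [].
  by apply: (ucvg_le uv); apply: (uA uU) => n /=; case: (hu n) => _ [].
}
have [M [de de0 hM]] : exists M : nat, exists2 e : R, 0 < e &
    forall u, F u -> exists2 i, (i < M)%N & e < `|fv i u - fv i x|.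
{ apply: shell_sep => //; first by move=> u [].
  move=> u [Ku [h1 h2]]; split; last exact: far.
  by move=> E; move: h1; rewrite E d0; lra.
}
have ch (i : nat) : exists ab : R * R, [/\ fv i x - de < ab.1, ab.1 < fv i x, fv i x < ab.2,
   ab.2 < fv i x + de & ~ N i ab.1 /\ ~ N i ab.2].
{ have [|a /andP[a1 a2] a3] := @nullR_itv R (fv i x - de) (fv i x) _ _ (nN i); first lra.
  have [|b /andP[b1 b2] b3] := @nullR_itv R (fv i x) (fv i x + de) _ _ (nN i); first lra.
  by exists (a, b).
}
have [ab hab] := choice ch.
pose O := [set u | d u x < 2 * e1 /\ forall i, (i < M)%N -> (ab i).1 < fv i u < (ab i).2].
have Osm u : K u -> O u -> d u x < e1.
{ move=> Ku [h1 h2]; rewrite ltNge; apply/negP => h3.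
  have [|i iM] := hM u; first by split => //; split => //; apply: ltW.
  have [a1 a2 a3 a4 _] := hab i; have /andP[b1 b2] := h2 i iM.
  rewrite ltNge => /negP; apply; rewrite ler_norml; apply/andP; split; lra.
}
exists O, ([seq (i, (ab i).1) | i <- iota 0 M] ++ [seq (i, (ab i).2) | i <- iota 0 M]).
split; last split.
- split; first by rewrite d0; lra.
  by move=> i _; have [a1 a2 a3 a4 _] := hab i; rewrite a2 a3.
- move=> y Ky Oy; apply: contrapT => no.
  have [z [hz zy]] : exists z : nat -> T, (forall n, K (z n) /\ ~ O (z n)) /\ ucvg U d z y.
  { apply: (@limit_seq (fun z => ~ O z)) => e' e'0; apply: contrapT => no'; apply: no; exists e' => // z Kz dz.
    by apply: contrapT => nO; apply: no'; exists z.
  }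
  have Oy1 := Osm y Ky Oy.
  have yx : y <> xi by apply: far; lra.
  have [n [/= h1 h2]] : exists n, d (z n) y < e1 /\
     forall i, (i < M)%N -> (ab i).1 < fv i (z n) < (ab i).2.
  { apply: (u_ex uU); apply: (uI uU); first exact: zy.
    apply: u_all => i iM; have /andP[b1 b2] := Oy.2 i iM.
    pose q := Num.min (fv i y - (ab i).1) ((ab i).2 - fv i y).
    have q0 : 0 < q by rewrite lt_min; apply/andP; split; lra.
    apply: (uS uU) (fv_cvg i zy yx q0) => n /= [_].
    rewrite lt_min !ltr_norml => /andP[/andP[? ?] /andP[? ?]]; apply/andP; split; lra.
  }
  apply: (hz n).2; split => //; have := dt (z n) y x; lra.
- move=> y z Ky Kz Oy Oz; have := Osm y Ky Oy; have := Osm z Kz Oz; have := dt y x z.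
  rewrite (dC x z); lra.
- move=> p /(List.in_app_or _ _ _) [] /in_map_inv [i ->] /=; by have [_ _ _ _ []] := hab i.
- move=> y Ky nO /limit_seq [z [hz zy]].
  have yx1 : d y x <= e1.
  { by apply: (ucvg_le zy); apply: (uA uU) => n /=; apply: ltW; apply: Osm; case: (hz n).
  }
  have yx : y <> xi by apply: far; lra.
  have [i iM ni] : exists2 i, (i < M)%N & ~ ((ab i).1 < fv i y < (ab i).2).
  { apply: contrapT => no; apply: nO; split; first lra.
    by move=> i iM; apply: contrapT => ni; apply: no; exists i.
  }
  have h1 : (ab i).1 <= fv i y.
  { rewrite leNgt; apply/negP => lt; have q0 : 0 < (ab i).1 - fv i y by lra.
    have [n [/= _]] := u_ex uU (fv_cvg i zy yx q0).
    have /andP[b1 b2] := (hz n).2.2 i iM; rewrite ltr_norml; lra.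
  }
  have h2 : fv i y <= (ab i).2.
  { rewrite leNgt; apply/negP => lt; have q0 : 0 < fv i y - (ab i).2 by lra.
    have [n [/= _]] := u_ex uU (fv_cvg i zy yx q0).
    have /andP[b1 b2] := (hz n).2.2 i iM; rewrite ltr_norml; lra.
  }
  have [E|ne] := eqVneq (fv i y) (ab i).1.
    exists (i, (ab i).1); last by right.
    by apply: List.in_or_app; left; apply: (@in_map_iota M (fun i => (i, (ab i).1))).
  have [E|ne'] := eqVneq (fv i y) (ab i).2.
    exists (i, (ab i).2); last by right.
    by apply: List.in_or_app; right; apply: (@in_map_iota M (fun i => (i, (ab i).2))).
  by exfalso; apply: ni; rewrite !lt_neqAle h1 h2 eq_sym ne ne'.
Qed.

Lemma in_flatten (X Y : Type) (zs : seq X) (L : X -> seq Y) p :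
  List.In p (flatten [seq L z | z <- zs]) <-> exists2 z, List.In z zs & List.In p (L z).
Proof.
elim: zs => [|z zs IH] /=; first by split => // -[].
split.
  move=> /(List.in_app_or _ _ _)[h|/IH [z' h1 h2]]; first by exists z => //; left.
  by exists z' => //; right.
move=> [z' [<-|h1] h2]; apply: List.in_or_app; first by left.
by right; apply/IH; exists z'.
Qed.

(** At [xi] the functionals are not continuous. The neighbourhood used there is a ball enlarged by
    finitely many boxes covering its boundary sphere, so that only faces of boxes remain on the
    boundary. *)
Lemma slice_base (N : nat -> set R) : (forall i, nullR (N i)) ->
  forall x (e : R), K x -> 0 < e -> exists O l, O x /\ goodO N O l e.
Proof.
move=> nN x e Kx e0; have [d0 dC dt] := pd.
have [E|xx] := pselect (x = xi); last exact: slice_box.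
subst x; pose e1 := e / 4; have e10 : 0 < e1 by rewrite /e1; lra.
pose F := K `&` [set u | e1 <= d u xi /\ d u xi <= e1].
have cF : ucompact U d F.
{ apply: ucompact_closed => // u v hu Kv uv; split.
    by apply: (ucvg_ge uv); apply: (uA uU) => n /=; case: (hu n) => _ [].
  by apply: (ucvg_le uv); apply: (uA uU) => n /=; case: (hu n) => _ [].
}
have Fx u : F u -> u <> xi by move=> [_ [h _]] E; move: h; rewrite E d0; lra.
have ch u : exists Ol : set T * seq (nat * R), F u -> Ol.1 u /\ goodO N Ol.1 Ol.2 (e1 / 2).
{ have [Fu|] := pselect (F u); last by exists (set0, [::]).
  have e12 : 0 < e1 / 2 by lra.
  have [Ox [l h]] := slice_box nN Fu.1 (Fx _ Fu) e12.
  by exists (Ox, l).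
}
have [Ol hOl] := choice ch.
have [zs [zsF hzs]] : exists zs, (forall z, List.In z zs -> F z) /\
   forall u, F u -> exists2 z, List.In z zs & (Ol z).1 u.
{ have [q q0 hq] : exists2 q : R, 0 < q & forall x, F x -> exists2 z, F z & forall y, F y -> d x y < q -> (Ol z).1 y.
  { apply: (lebesgue_number uU pd cF (O := fun z => (Ol z).1)) => x Fx'.
    have [h1 [h2 _ _ _]] := hOl x Fx'; have [e' e'0 he'] := h2 x Fx'.1 h1.
    by exists e' => // y [Ky _]; apply: he'.
  }
  have [ys [ysF hys]] := finite_net uU pd cF q0.
  have chz y : exists z, F y -> F z /\ forall u, F u -> d y u < q -> (Ol z).1 u.
  { have [Fy|] := pselect (F y); last by exists y.
    by have [z Fz hz] := hq y Fy; exists z.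
  }
  have [zf hzf] := choice chz.
  exists (map zf ys); split.
    move=> z; elim: ys ysF {hys} => //= y ys IH h [<-|].
      by apply: (hzf y _).1; apply: h; left.
    by apply: IH => y' hy'; apply: h; right.
  move=> u Fu; have [y hy uy] := hys u Fu; exists (zf y); first exact: List.in_map.
  by apply: (hzf y (ysF y hy)).2 => //; rewrite (dC y u).
}
pose O := [set u | d u xi < e1 \/ exists2 z, List.In z zs & (Ol z).1 u].
have Osm u : K u -> O u -> d u xi <= 3 / 2 * e1.
{ move=> Ku [h|[z hz Oz]]; first lra.
  have [h1 [_ h2 _ _]] := hOl z (zsF z hz); have [Kz [_ h3]] := zsF z hz.
  have := h2 u z Ku Kz Oz h1; have := dt u z xi; lra.
}
exists O, (flatten [seq (Ol z).2 | z <- zs]); split; last split.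
- by left; rewrite d0.
- move=> y Ky [h|[z hz Oz]].
    exists (e1 - d y xi); first lra.
    move=> z Kz dz; left; have := dt z y xi; rewrite (dC z y); lra.
  have [h1 [h2 _ _ _]] := hOl z (zsF z hz); have [e' e'0 he'] := h2 y Ky Oz.
  by exists e' => // u Ku du; right; exists z => //; apply: he'.
- move=> y z Ky Kz Oy Oz; have := Osm y Ky Oy; have := Osm z Kz Oz; have := dt y xi z.
  rewrite (dC xi z) /e1; lra.
- move=> p /in_flatten [z hz]; have [h1 [_ _ h2 _]] := hOl z (zsF z hz); exact: h2.
- move=> y Ky nO /limit_seq [z [hz zy]].
  have ye : e1 <= d y xi by rewrite leNgt; apply/negP => h; apply: nO; left.
  have : U ([set n | d (z n) xi < e1] `|` [set n | exists2 w, List.In w zs & (Ol w).1 (z n)]).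
    by apply: (uA uU) => n; case: (hz n).
  move=> /(u_or uU)[h|/u_list [w hw hU]].
    exfalso; apply: nO; right; apply: hzs; split => //; split => //.
    by apply: (ucvg_le zy); apply: (uS uU) h => n /=; apply: ltW.
  have [h1 [_ _ _ h2]] := hOl w (zsF w hw).
  have [|e' e'0|p hp Sp] := h2 y Ky.
  + by move=> Ow; apply: nO; right; exists w.
  + have [n [/= a b]] := u_ex uU (uI uU hU (zy _ e'0)).
    by exists (z n); split => //; [case: (hz n) | rewrite (dC y (z n))].
  + by exists p => //; apply/in_flatten; exists w.
Qed.

Context (xo : T) (E : set T).
Hypothesis Exi : ~ E xi.
Notation iv n := (n.+1%:R^-1 : R).
(** Away from [xo] the measure is finite, and away from [xi] the functionals are Lipschitz. *)
Definition away (n : nat) := [set u | iv n <= d u xo /\ iv n <= d u xi].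
Definition hfin (n : nat) (A : set T) := forall N, Hfin d n (A `&` away N).

Lemma iv_gt0 n : 0 < iv n. Proof. by rewrite invr_gt0 ltr0Sn. Qed.

(** Eilenberg's inequality lowers the dimension by one on each region where the functional is
    Lipschitz; there are countably many regions, so the exceptional parameters stay null. *)
Lemma slice_null n A i : A `<=` K -> hfin n.+2 A -> Hnull d n.+2 (E `&` A) ->
  nullR [set t | ~ (hfin n.+1 (A `&` Sl i t) /\ Hnull d n.+1 (E `&` (A `&` Sl i t)))].
Proof.
move=> AK hA hE.
pose N1 N := [set t | ~ Hfin d n.+1 ((A `&` away N) `&` [set x | fv i x = t])].
pose N2 N := [set t | ~ Hnull d n.+1 ((E `&` A `&` [set u | iv N <= d u xi]) `&` [set x | fv i x = t])].
have n1 N : nullR (N1 N).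
{ have r0 := iv_gt0 N; have L0 : 0 < (nv (f i) + 1) / (iv N) ^+ 2.
    by apply: divr_gt0; [have := nv_ge0 (f i); lra | exact: exprn_gt0].
  apply: (@eilenberg_fin _ _ _ n.+1 _ _ _ ((nv (f i) + 1) / (iv N) ^+ 2)) => //.
  by move=> x y [_ [_ hx]] [_ [_ hy]]; apply: fv_lip.
}
have n2 N : nullR (N2 N).
{ have r0 := iv_gt0 N; have L0 : 0 < (nv (f i) + 1) / (iv N) ^+ 2.
    by apply: divr_gt0; [have := nv_ge0 (f i); lra | exact: exprn_gt0].
  apply: (@eilenberg_null _ _ _ n.+1 _ _ _ ((nv (f i) + 1) / (iv N) ^+ 2)) => //.
    by move=> x y [_ hx] [_ hy]; apply: fv_lip.
  by apply: Hnull_sub hE => x [].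
}
apply: nullR_sub (nullRU (nullR_bigcup n1) (nullR_bigcup n2)) => t /= h.
apply: contrapT => no; apply: h; have [d0 _ _] := pd.
have nx u N : iv N <= d u xi -> u <> xi.
  by move=> h E'; move: h; rewrite E' d0 leNgt iv_gt0.
split.
- move=> N; apply: contrapT => nf; apply: no; left; exists N => // hf; apply: nf.
  apply: Hfin_sub hf => u [[Au Su] [h1 h2]]; split => //.
  by case: Su => [E'|[//]]; case: (nx u N h2).
- apply: (@Hnull_sub _ _ _ _ _ (\bigcup_N ((E `&` A `&` [set u | iv N <= d u xi]) `&` [set x | fv i x = t]))).
    move=> u [Eu [Au Su]].
    have ux : u <> xi by move=> E'; apply: Exi; rewrite -E'.
    have [N hN] := inv_lt uU (Phi_gt0 dsep dPhi ux); exists N => //; split; last by case: Su => [//|[]].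
    by split => //=; apply: ltW.
  apply: Hnull_bigcup => // N; apply: contrapT => nf; apply: no; right; by exists N.
Qed.

Notation DD := (Dc d nullR Sl).

Lemma Dc_xi n A : A `<=` [set xi] -> DD n A.
Proof.
have [d0 _ _] := pd.
elim: n A => [|n IH] A h /=.
  move=> e e0; exists 1 => // x y hc; have /h -> := chain_l hc; have /h -> := chain_r hc.
  by rewrite d0; apply: ltW.
move=> i; apply: (@nullR_sub _ _ set0) (nullR0) => t /= nd; apply: nd; apply: IH => u []; by move=> /h.
Qed.

Lemma nullR1 (t : R) : nullR [set t].
Proof.
apply/negligibleP; [exact: measurable_set1 | exact: lebesgue_measure_set1].
Qed.

(** Each step picks a direction with a non-null set of bad parameters, and among these one for which
    [slice_null] holds. The direction is always new: along an old one the functional is constant off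
    [xi], so all slices but one contain at most [xi]. *)
Lemma descent n : forall A (l : seq nat) (tl : nat -> R), A `<=` K -> ucompact U d A ->
  (forall i u, i \in l -> A u -> u <> xi -> fv i u = tl i) -> uniq l ->
  hfin n.+1 A -> Hnull d n.+1 (E `&` A) -> ~ DD n A ->
  exists A' l' tl', [/\ A' `<=` K, ucompact U d A' /\ ~ zdim d A',
    (forall i u, i \in l' -> A' u -> u <> xi -> fv i u = tl' i),
    uniq l' /\ size l' = (size l + n)%N & hfin 1 A' /\ Hnull d 1 (E `&` A')].
Proof.
elim: n => [|n IH] A l tl AK cA hl ul hf hn nD.
  by exists A, l, tl; split => //; rewrite addn0.
have [i ni] : exists i, ~ nullR [set t | ~ DD n (A `&` Sl i t)].
  apply: contrapT => no; apply: nD => i; apply: contrapT => ni; apply: no; by exists i.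
have il : i \notin l.
{ apply/negP => il; apply: ni; apply: nullR_sub (nullR1 (tl i)) => t /= nd; apply: contrapT => tt.
  apply: nd; apply: Dc_xi => u [Au [//|[ux ft]]]; exfalso; apply: tt; by rewrite -ft (hl i).
}
have [t [nt [h1 h2]]] : exists t, ~ DD n (A `&` Sl i t) /\
   (hfin n.+1 (A `&` Sl i t) /\ Hnull d n.+1 (E `&` (A `&` Sl i t))).
{ apply: contrapT => no; apply: ni; apply: nullR_sub (slice_null i AK hf hn) => t /= nt gt.
  by apply: no; exists t.
}
have [||||A' [l' [tl' [q1 q2 q3 q4 q5]]]] :=
  IH (A `&` Sl i t) (i :: l) (fun i' => if i' == i then t else tl i') _ _ _ _ h1 h2 nt.
- by move=> u [/AK].
- exact: Sl_closed.
- move=> i' u; rewrite inE => /orP[/eqP->|i'l] [Au Su] ux.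
    by rewrite eqxx; case: Su => [//|[]].
  case: eqP => [E'|_]; last exact: hl.
  by rewrite E' (negbTE il) in i'l.
- by rewrite /= il.
- by exists A', l', tl'; split => //; rewrite /= addSnnS in q4.
Qed.

End Slicing.

(** Turns identities between vectors into identities between real numbers; through it [vring]
    settles linear identities by [ring]. *)
Lemma ip_ext (R : realType) (V : ipspace R) (x y : V) : (forall v, ip x v = ip y v) -> x = y.
Proof.
move=> h; apply: nv_sub_eq0; rewrite /nv ipDl ipNl h subrr; exact: sqrtr0.
Qed.

Ltac vring := apply: ip_ext => ?; rewrite ?(ipDl, ipZl, ipNl, ip0l); ring.
(** * Approximate segments *)

Section Tangent.
Context {R : realType} (U : set (set nat)) (uU : free_ultra U) (V : ipspace R).
Context (T : Type) (d : T -> T -> R) (Phi : T -> V).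
Hypothesis dsep : forall x y, d x y = 0 -> x = y.
Hypothesis dPhi : forall x y, d x y = nv (Phi x - Phi y).
Hypothesis d2 : forall x y, d x y <= 2.
Context (K : set T) (cK : ucompact U d K).
Let pd : pmetric d := Phi_pd dPhi.

(** The second clause is the translation invariance of P(xi) along the span of [w]. *)
Definition frame (xi : T) (j : nat) (w : 'I_j -> V) :=
  (forall i i', ip (w i) (w i') = (i == i')%:R) /\
  forall u (t : 'I_j -> R), K u -> u <> xi -> exists v,
    [/\ K v, v <> xi & pic Phi xi v = pic Phi xi u + \sum_i t i *: w i].

(* Seen from [xi], [K] contains an [e r]-approximate segment of length
   comparable to [r] starting at [u] and transverse to the frame. *)
Definition seg (xi : T) (j : nat) (w : 'I_j -> V) (u : T) (r e eta : R) :=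
  exists b, [/\ K b /\ b <> xi,
    r / 2 <= nv (pic Phi xi b - pic Phi xi u) <= r,
    forall s : R, 0 <= s <= 1 -> exists z, [/\ K z, z <> xi
      & nv (pic Phi xi z - pic Phi xi u - s *: (pic Phi xi b - pic Phi xi u)) <= e * r]
  & forall t : 'I_j -> R, eta * nv (pic Phi xi b - pic Phi xi u) <=
      nv (pic Phi xi b - pic Phi xi u - \sum_i t i *: w i)].

(** A slice may pass through [xo] and [xi], near which the measure and the picture are out of
    control; a subcontinuum avoiding both is enough. *)
Lemma continuum_away A x1 x2 : ucompact U d A -> ~ zdim d A ->
  exists ga p0 p1, exists2 rho : R, 0 < rho &
  [/\ ga `<=` A, ucompact U d ga /\ conn d ga, ga p0 /\ ga p1, 0 < d p0 p1
    & forall u, ga u -> rho <= d u x1 /\ rho <= d u x2].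
Proof.
move=> cA nz; have [d0 dC dt] := pd.
have [x [y [Ax Ay xy cxy]]] := not_zdim uU pd cA nz.
pose A1 := qcomp d A x; have cA1 : ucompact U d A1 := ucompact_qcomp uU cA.
have coA1 : conn d A1 := conn_qcomp uU pd cA Ax.
have A1x : A1 x by move=> e e0; apply: chain0.
have A1y : A1 y by [].
pose D := d x y.
have cut (t : R) : 0 <= t -> t <= D -> exists z, A1 z /\ d x z = t.
{ move=> t0 tD; have [z [h1 h2 _]] := cc_cut uU pd cA1 (coA1 x y A1x A1y) t0 tD.
  by exists z.
}
have xyD : 0 < D by [].
(* Three points at distances [D / 3], [D / 2] and [D] from [x] are distinct, so one of them is
   neither [x1] nor [x2]. *)
have [z1 [Az1 dz1]] : exists z, A1 z /\ d x z = D / 3 by apply: cut; lra.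
have [z2 [Az2 dz2]] : exists z, A1 z /\ d x z = D / 2 by apply: cut; lra.
have [p [Ap px1 px2 xp]] : exists p, [/\ A1 p, p <> x1, p <> x2 & 0 < d p x].
{ have [e1|n1] := pselect (z1 = x1 \/ z1 = x2); last first.
    exists z1; split => //; [by move=> E; apply: n1; left|by move=> E; apply: n1; right|].
    by rewrite (dC z1 x) dz1; lra.
  have [e2|n2] := pselect (z2 = x1 \/ z2 = x2); last first.
    exists z2; split => //; [by move=> E; apply: n2; left|by move=> E; apply: n2; right|].
    by rewrite (dC z2 x) dz2; lra.
  exists y; split => //; last by rewrite (dC y x).
    move=> E; have dy : d x y = D by []; rewrite E in dy.
    case: e1 e2 => [E1|E1] [E2|E2]; rewrite ?E1 ?E2 in dz1 dz2; lra.
  move=> E; have dy : d x y = D by []; rewrite E in dy.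
  case: e1 e2 => [E1|E1] [E2|E2]; rewrite ?E1 ?E2 in dz1 dz2; lra.
}
pose rho : R := Num.min (d p x1) (d p x2) / 2.
have rho0 : 0 < rho.
{ have h1 := Phi_gt0 dsep dPhi px1; have h2 := Phi_gt0 dsep dPhi px2.
  have : 0 < Num.min (d p x1) (d p x2) by rewrite lt_min h1 h2.
  rewrite /rho; lra.
}
have r1 : 2 * rho <= d p x1.
{ have : Num.min (d p x1) (d p x2) <= d p x1 by rewrite ge_min lexx. rewrite /rho; lra.
}
have r2 : 2 * rho <= d p x2.
{ have : Num.min (d p x1) (d p x2) <= d p x2 by rewrite ge_min lexx orbT. rewrite /rho; lra.
}
pose t := Num.min rho (d p x).
have t0 : 0 < t by rewrite lt_min rho0.
have tr : t <= rho by rewrite ge_min lexx.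
have tx : t <= d p x by rewrite ge_min lexx orbT.
have [p1 [Ap1 dp1 cp1]] := cc_cut uU pd cA1 (coA1 p x Ap A1x) (ltW t0) tx.
have cB : ucompact U d (A1 `&` [set u | d p u <= t]) by exact: (ucompact_ball uU pd).
have Bp : (A1 `&` [set u | d p u <= t]) p by split => //=; rewrite d0 ltW.
exists (qcomp d (A1 `&` [set u | d p u <= t]) p), p, p1, rho => //; split.
- move=> u hu; have [hu1 _] : (A1 `&` [set u | d p u <= t]) u := qcomp_sub hu.
  exact: qcomp_sub hu1.
- by split; [apply: (ucompact_qcomp uU) | apply: (conn_qcomp uU pd)].
- by split; [move=> e e0; apply: chain0 | ].
- by rewrite dp1.
- move=> u hu0; have [_ /= hu] : (A1 `&` [set u | d p u <= t]) u := qcomp_sub hu0.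
  have := dt p u x1; have := dt p u x2; lra.
Qed.

Notation Dd xi := (fun u v => nv (pic Phi xi u - pic Phi xi v)).

Lemma Dd_pm xi : pmetric (Dd xi).
Proof.
by split => [x|x y|x y z]; [rewrite subrr nv0 | rewrite nvB | exact: nv_tri].
Qed.

Lemma straight_sym xi W p a b e : straight U (Dd xi) W p a b e -> straight U (Dd xi) W p b a e.
Proof.
case=> h1 h2 [h3 [h4 h5]] h6 h7; split => // [u v Wu Wv|z Wz].
  by rewrite (nvB (pic Phi xi b)); apply: h6.
rewrite (nvB (pic Phi xi b) (pic Phi xi a)) addrC (nvB (pic Phi xi z)) (nvB (pic Phi xi b)).
exact: h7.
Qed.

(** Each point of [W] is near the point of the segment from [a] to [b] at the same distance from
    [a]. As [W] is connected all these distances occur, so [W] follows the segment from [p] to [b]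
    up to the error [4 * q * r]. *)
Lemma straight_half xi W p a b (e q r : R) : straight U (Dd xi) W p a b e ->
  0 <= e -> 0 <= q -> 2 * e <= q ^+ 2 -> 0 < r -> r <= Dd xi a b ->
  (forall u, W u -> Dd xi p u <= r) -> r / 2 <= Dd xi p b ->
  exists b', [/\ W b', r / 2 <= Dd xi b' p <= r & forall s : R, 0 <= s <= 1 ->
   exists2 z, W z & nv (pic Phi xi z - pic Phi xi p - s *: (pic Phi xi b' - pic Phi xi p)) <= 4 * q * r].
Proof.
move=> [cW coW [Wp [Wa Wb]] diam st] e0 q0 eq r0 rD hr rb.
set c := pic Phi xi in rD hr rb diam st *.
pose D := nv (c a - c b); have D0 : 0 < D by rewrite /D; lra.
have D2r : D <= 2 * r.
{ have := nv_tri (c a) (c p) (c b); have := hr a Wa; have := hr b Wb.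
  rewrite (nvB (c p) (c a)) /D; lra.
}
exists b; split => //; first by rewrite (nvB (c b)) rb hr.
move=> s s01; pose t := nv (c a - c p).
have t0 : 0 <= t := nv_ge0 _; have tD : t <= D := diam a p Wa Wp.
(* Position between [a] and [b], in units of [D], of the point a fraction [s] of the way from [p] to
   [b]. *)
pose th := (1 - s) * (t / D) + s.
have tD1 : 0 <= t / D <= 1 by rewrite divr_ge0 ?(ltW D0) //= ler_pdivrMr // mul1r.
have th01 : 0 <= th <= 1 by rewrite /th; move: tD1 s01; move: (t / D) => y; nra.
have thD0 : 0 <= th * D by apply: mulr_ge0; [lra | apply: ltW].
have thD1 : th * D <= Dd xi a b by rewrite -[X in _ <= X]mul1r; apply: ler_wpM2r; [exact: nv_ge0 | lra].
have [z [Wz /= dz _]] := cc_cut uU (Dd_pm xi) cW (coW a b Wa Wb) thD0 thD1.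
exists z => //.
have n1 := near_segment e0 q0 eq D0 (diam a z Wa Wz) (st z Wz).
have n2 := near_segment e0 q0 eq D0 tD (st p Wp).
rewrite -/D -/t in n1 n2; rewrite dz mulfK ?gt_eqF // in n1.
have -> : c z - c p - s *: (c b - c p) = (c z - c a - th *: (c b - c a)) -
   (1 - s) *: (c p - c a - (t / D) *: (c b - c a)) by rewrite /th; vring.
apply: le_trans (nvD _ _) _; rewrite nvN nvZ ger0_norm; last lra.
have h1 : (1 - s) * nv (c p - c a - (t / D) *: (c b - c a)) <= 1 * (q * D).
{ apply: ler_pM => //; [lra | exact: nv_ge0 | lra].
}
have h2 : q * D <= q * (2 * r) by apply: ler_wpM2l.
lra.
Qed.

(** One of [a], [b] is at distance at least [r / 2] from [p], and the two are interchangeable. *)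
Lemma straight_seg xi W p a b (e q r : R) : straight U (Dd xi) W p a b e ->
  0 <= e -> 0 <= q -> 2 * e <= q ^+ 2 -> 0 < r -> r <= Dd xi a b ->
  (forall u, W u -> Dd xi p u <= r) ->
  exists b', [/\ W b', r / 2 <= Dd xi b' p <= r & forall s : R, 0 <= s <= 1 ->
   exists2 z, W z & nv (pic Phi xi z - pic Phi xi p - s *: (pic Phi xi b' - pic Phi xi p)) <= 4 * q * r].
Proof.
move=> st e0 q0 eq r0 rD hr; have [h|h] := leP (r / 2) (Dd xi p b).
  exact: (straight_half st).
apply: (straight_half (straight_sym st)) => //; first by rewrite nvB.
have := nv_tri (pic Phi xi a) (pic Phi xi p) (pic Phi xi b).
rewrite (nvB (pic Phi xi a) (pic Phi xi p)); move: rD => /=; lra.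
Qed.

Lemma chain_metric (d' : T -> T -> R) (C : R) A (e : R) x y : 0 < C ->
  (forall u v, A u -> A v -> d' u v <= C * d u v) ->
  chain d A e x y -> chain d' A (C * e) x y.
Proof.
move=> C0 h; elim=> [Ax|y' z hc IH Az dz]; first exact: chain0.
apply: chainS IH _ _ => //; apply: le_trans (h _ _ _ _) _ => //; first exact: chain_r hc.
by rewrite ler_pM2l.
Qed.

Context (k : nat) (k0 : (0 < k)%N) (xo : T).
Hypothesis Kfin : forall e : R, 0 < e -> Hfin d k (K `&` [set x | e <= d x xo]).
Hypothesis ncol : ~ coloured U d k.-1 K.

(** If this failed, one null set [E] would contain, for each [eta] of the form [q.+1%:R^-1], all
    points with segments of some precision [ee q]. Slicing by [k - 1] functionals of [ffun] leaves a
    continuum of finite length on which [E] has length 0. A straight piece based outside [E] lies in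
    the kernel of those functionals, so [ffun_angle] makes it transverse to the frame, and that puts
    its base point in [E]. *)
Lemma tangent xi j (w : 'I_j -> V) : K xi -> (j < k)%N -> frame xi w ->
  exists2 eta : R, 0 < eta & forall e : R, 0 < e -> ~ Hnull d k
    [set u | [/\ K u, u <> xi & exists2 r0 : R, 0 < r0 & forall r : R, 0 < r -> r < r0 ->
      seg xi w u r e eta]].
Proof.
move=> Kxi jk [worth winv]; apply: contrapT => no; have [d0 dC dt] := pd.
set c := pic Phi xi in winv.
pose Es (e eta : R) := [set u | [/\ K u, u <> xi & exists2 r0 : R, 0 < r0 &
   forall r : R, 0 < r -> r < r0 -> seg xi w u r e eta]].
have ch (q : nat) : exists e : R, 0 < e /\ Hnull d k (Es e q.+1%:R^-1).
{ apply: contrapT => no'; apply: no; exists q.+1%:R^-1; first by rewrite invr_gt0 ltr0Sn.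
  by move=> e e0 hn; apply: no'; exists e.
}
have [ee hee] := choice ch.
pose E := \bigcup_q Es (ee q) q.+1%:R^-1.
have nE : Hnull d k E by apply: (Hnull_bigcup k0) => q; case: (hee q).
have Exi : ~ E xi by move=> [q _ []].
have [Ds [DK Dd_]] := dense_seq uU pd cK Kxi.
pose f := ffun w (fun m => c (Ds m)).
have fsep u v : K u -> K v -> u <> xi -> v <> xi ->
  (forall n, ip (c u - c v) (f n) = 0) -> u = v.
{ move=> Ku Kv ux vx /ffun_sep h.
  have H y : K y -> y <> xi -> ip (c u - c v) (c y) = 0.
  { move=> Ky yx.
    have [m hm] : exists m : nat -> nat, ucvg U d (fun n => Ds (m n)) y.
    { have chm (n : nat) : exists m, d y (Ds m) < n.+1%:R^-1.
        by apply: Dd_ => //; rewrite invr_gt0 ltr0Sn.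
      have [m hm] := choice chm; exists m => e e0.
      by apply: (uS uU) (u_inv uU e0) => n /=; rewrite (dC _ y); apply: lt_trans.
    }
    have [_ cv] := pic_cvg uU dsep dPhi (ucvg_cst uU pd xi) hm yx.
    by apply: (vcvg_ip uU (vcvg_cst uU (c u - c v)) cv) => n; exact: h.
  }
  apply: (pic_inj dsep dPhi ux vx); apply: nv_sub_eq0.
  by rewrite /nv ipDr ipNr !H // subrr sqrtr0.
}
(* Otherwise [Dc_coloured] would colour K in [k] colours, against [ncol]. *)
have nD : ~ Dc d nullR (Sl Phi xi f) k.-1 K.
{ move=> hD; apply: ncol.
  apply: (@Dc_coloured _ _ uU _ _ pd dsep _ _ K (@nullR_sub R) (@nullR0 R) (@nullRU R) _ _ _ K _ cK hD) => //.
    by move=> i t A; apply: (Sl_closed uU dsep dPhi).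
  move=> N nN x e Kx e0.
  have [Ox [l [h1 [h2 h3 h4 h5]]]] := slice_base uU dsep dPhi cK fsep nN Kx e0.
  by exists Ox, l; split.
}
have kE : k.-1.+1 = k by rewrite prednK.
have hf : hfin d xi xo k.-1.+1 K.
{ move=> N; rewrite kE; have iv0 : 0 < N.+1%:R^-1 :> R by rewrite invr_gt0 ltr0Sn.
  by apply: Hfin_sub (Kfin iv0) => u [Ku []].
}
have hn : Hnull d k.-1.+1 (E `&` K) by rewrite kE; apply: Hnull_sub nE => u [].
have [//|//|A [l [tl [AK [cA nzA] hl [ul sl] [hf1 hn1]]]]] :=
  descent uU dsep dPhi Exi (l := [::]) (tl := fun=> 0) (fun u (Ku : K u) => Ku) cK _ _ hf hn nD.
rewrite /= add0n in sl.
have [ga [p0 [p1 [rho rho0 [gA [cg cog] [g0 g1] p01 gaw]]]]] := continuum_away xi xo cA nzA.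
have gx u : ga u -> u <> xi.
  by move=> /gaw [h _] E'; move: h; rewrite E' d0; lra.
have up u v : ga u -> ga v -> Dd xi u v <= (rho ^+ 2)^-1 * d u v.
{ move=> gu gv; have [hu _] := gaw u gu; have [hv _] := gaw v gv.
  rewrite /= (pic_dist dsep dPhi (gx _ gu) (gx _ gv)) mulrC.
  apply: ler_wpM2r; first exact: (pmetric_ge0 pd).
  rewrite lef_pV2 ?posrE; [|apply: mulr_gt0; lra|exact: exprn_gt0].
  by rewrite expr2; apply: ler_pM; lra.
}
have C0 : 0 < (rho ^+ 2)^-1 by posit.
have cg' : ucompact U (Dd xi) ga.
{ move=> u hu; have [x gx' ux] := cg u hu; exists x => // e e0.
  have e1 : 0 < e / (rho ^+ 2)^-1 by posit.
  apply: (uS uU) (ux _ e1) => n /=; rewrite ltr_pdivlMr // mulrC; apply: le_lt_trans; exact: up.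
}
have cog' : conn (Dd xi) ga.
{ move=> x y gx' gy e e0; have e1 : 0 < e / (rho ^+ 2)^-1 by posit.
  have := chain_metric C0 up (cog x y gx' gy _ e1).
  by rewrite mulrC divfK // gt_eqF.
}
have fin' : Hfin (Dd xi) 1 ga.
{ have [N hN] := inv_lt uU rho0.
  have fg : Hfin d 1 ga.
    apply: Hfin_sub (hf1 N) => u gu; split; first exact: gA.
    by have [a b] := gaw u gu; split; apply: ltW; apply: lt_le_trans hN _.
  have := Hfin_image (d' := Dd xi) (f := id) C0 up fg.
  by apply: Hfin_sub => u gu; exists u.
}
have null' : Hnull (Dd xi) 1 (E `&` ga).
{ have ng : Hnull d 1 (E `&` ga) by apply: Hnull_sub hn1 => u [? /gA].
  have up' u v : (E `&` ga) u -> (E `&` ga) v -> Dd xi u v <= (rho ^+ 2)^-1 * d u v.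
    by move=> [_ gu] [_ gv]; apply: up.
  have := Hnull_image (d' := Dd xi) (f := id) C0 up' ng.
  by apply: Hnull_sub => u gu; exists u.
}
have p01' : 0 < Dd xi p0 p1.
{ rewrite /= (pic_dist dsep dPhi (gx _ g0) (gx _ g1)); apply: divr_gt0 => //.
  by apply: mulr_gt0; apply: (Phi_gt0 dsep dPhi); apply: gx.
}
(* The slices fixed [k - 1] functionals, which is at least [j]; any [j] of them give an angle with
   the frame. *)
have jl : (j <= size l)%N by rewrite sl -ltnS kE.
pose ei (i : 'I_j) := nth 0%N l i.
have il (i : 'I_j) : (i < size l)%N by apply: leq_trans jl.
have eiI : injective ei.
{ move=> i i' /eqP; rewrite nth_uniq // => /eqP; exact: ord_inj.
}
have [eta eta0 heta] := ffun_angle worth (fun m => c (Ds m)) eiI.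
have [q hq] := inv_lt uU eta0.
(* [straight_seg] turns an excess [e1] with [2 * e1 = q0 ^+ 2] into the precision [4 * q0], which is
   [ee q]. *)
have [e0 _] := hee q; pose q0 := ee q / 4; pose e1 := q0 ^+ 2 / 2.
have q00 : 0 < q0 by rewrite /q0; lra.
have e10 : 0 < e1 by rewrite /e1; posit.
have [p [gp Np [r0 r00 hr0]]] := straight_exists uU (Dd_pm xi) cg' cog' fin' g0 g1 p01' null' e10.
apply: Np; split => //; exists q => //; split; [by apply: AK; apply: gA | exact: gx |].
exists r0 => // r rp rr; have [W [a [b [Wg st rD Wr]]]] := hr0 r rp rr.
have [|b' [Wb' hb' hs]] := straight_seg st (ltW e10) (ltW q00) _ rp rD Wr.
  by rewrite /e1 mulrC divfK.
have gb' := Wg _ Wb'.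
exists b'; split.
- by split; [apply: AK; apply: gA | apply: gx].
- exact: hb'.
- move=> s /hs [z Wz hz]; have gz := Wg _ Wz; exists z; split; [by apply: AK; apply: gA | exact: gx |].
  by apply: le_trans hz _; rewrite /q0; lra.
- move=> t; apply: le_trans (heta _ _ t); last first.
    move=> i; rewrite ipDl ipNl -[ip (pic _ _ b') _]/(fv Phi xi f (ei i) b') -[ip (pic _ _ p) _]/(fv Phi xi f (ei i) p).
    by rewrite !(hl (ei i)) ?subrr //; [apply: mem_nth | apply: gA | apply: gx | apply: mem_nth | apply: gA | apply: gx].
  by apply: ler_wpM2r; [exact: nv_ge0 | apply: ltW].
Qed.

End Tangent.

(** * Isometries that are linear on a subspace *)

Section LinIso.
Context {R : realType} (V V' : ipspace R) (DS : V -> Prop) (A : V -> V').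
Hypothesis DS0 : DS 0.
Hypothesis DSlin : forall a x y, DS x -> DS y -> DS (a *: x + y).
Hypothesis Alin : forall a x y, DS x -> DS y -> A (a *: x + y) = a *: A x + A y.
Hypothesis Aiso : forall x, DS x -> nv (A x) = nv x.

Lemma liso0 : A 0 = 0.
Proof. by apply: nv_eq0; rewrite Aiso // nv0. Qed.

Lemma lisoZ a x : DS x -> A (a *: x) = a *: A x.
Proof. by move=> h; rewrite -[a *: x]addr0 Alin // liso0 addr0. Qed.

Lemma DSZ a x : DS x -> DS (a *: x).
Proof. by move=> h; rewrite -[a *: x]addr0; apply: DSlin. Qed.

Lemma lisoD x y : DS x -> DS y -> A (x + y) = A x + A y.
Proof. by move=> h h'; rewrite -[x]scale1r Alin // !scale1r. Qed.

Lemma DSD x y : DS x -> DS y -> DS (x + y).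
Proof. by move=> h h'; rewrite -[x]scale1r; apply: DSlin. Qed.

Lemma lisoB x y : DS x -> DS y -> A (x - y) = A x - A y.
Proof.
move=> h h'; rewrite -[- y]scaleN1r lisoD //; last exact: DSZ.
by rewrite lisoZ // scaleN1r.
Qed.

Lemma DSB x y : DS x -> DS y -> DS (x - y).
Proof. by move=> h h'; rewrite -[- y]scaleN1r; apply: DSD => //; apply: DSZ. Qed.

Lemma DS_sum j (t : 'I_j -> R) (w : 'I_j -> V) : (forall i, DS (w i)) -> DS (\sum_i t i *: w i).
Proof.
move=> h; elim: (index_enum _) => [|i l IH]; first by rewrite big_nil.
by rewrite big_cons; apply: DSlin.
Qed.

Lemma liso_sum j (t : 'I_j -> R) (w : 'I_j -> V) : (forall i, DS (w i)) ->
  A (\sum_i t i *: w i) = \sum_i t i *: A (w i).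
Proof.
move=> h; elim: (index_enum _) => [|i l IH]; first by rewrite !big_nil liso0.
rewrite !big_cons Alin ?IH //; elim: l {IH} => [|i' l IH]; first by rewrite big_nil.
by rewrite big_cons; apply: DSlin.
Qed.

Lemma liso_ip x y : DS x -> DS y -> ip (A x) (A y) = ip x y.
Proof. by move=> h h'; rewrite !ip_nv -lisoB // !Aiso //; apply: DSB. Qed.

End LinIso.

(** * Flatness by zooming *)

Section Steps.
Context {R : realType} (U : set (set nat)) (uU : free_ultra U) (V : ipspace R).
Context (T : Type) (d : T -> T -> R) (Phi : T -> V).
Hypothesis dsep : forall x y, d x y = 0 -> x = y.
Hypothesis dPhi : forall x y, d x y = nv (Phi x - Phi y).
Hypothesis d2 : forall x y, d x y <= 2.
Context (K : set T) (cK : ucompact U d K).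
Let pd : pmetric d := Phi_pd dPhi.
Notation pic := (pic Phi).

Definition DS xi i0 := dspan (fun u => K u /\ u <> xi) (pic xi) i0.

Lemma DS_diff xi i0 u v : K u -> u <> xi -> K v -> v <> xi -> DS xi i0 (pic xi u - pic xi v).
Proof. by move=> *; apply: dspan_diff. Qed.

Lemma DS_lin xi i0 a x y : DS xi i0 x -> DS xi i0 y -> DS xi i0 (a *: x + y).
Proof. exact: dspan_lin. Qed.

Lemma DS_0 xi i0 : DS xi i0 0. Proof. exact: dspan0. Qed.

Definition liniso xi i0 (A : V -> V) :=
  (forall a x y, DS xi i0 x -> DS xi i0 y -> A (a *: x + y) = a *: A x + A y) /\
  (forall x, DS xi i0 x -> nv (A x) = nv x).

(* [h] maps [K] onto itself and acts on the pictures as a similarity with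
   linear part [lam A]. *)
Definition similar xi i0 (h : T -> T) (lam : R) (A : V -> V) :=
  [/\ liniso xi i0 A, forall u, K u -> K (h u),
      forall u, K u -> u <> xi -> h u <> h xi,
      forall u, K u -> u <> h xi -> exists v, [/\ K v, v <> xi & h v = u]
    & forall u v, K u -> u <> xi -> K v -> v <> xi ->
      pic (h xi) (h u) - pic (h xi) (h v) = lam *: A (pic xi u - pic xi v)].

Lemma frame_DS xi i0 j (w : 'I_j -> V) : K i0 -> i0 <> xi -> frame Phi K xi w ->
  forall i, DS xi i0 (w i).
Proof.
move=> K0 i0x [_ winv] i; have [v [Kv vx E]] := winv i0 (fun i' => (i' == i)%:R) K0 i0x.
have -> : w i = pic xi v - pic xi i0.
{ rewrite E addrAC subrr add0r (bigD1 i) //= eqxx scale1r big1 ?addr0 // => i' i'i.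
  by rewrite (negbTE i'i) scale0r.
}
exact: DS_diff.
Qed.

Lemma frame_similar xi i0 h lam A j (w : 'I_j -> V) : K i0 -> i0 <> xi -> 0 < lam ->
  similar xi i0 h lam A -> frame Phi K xi w -> frame Phi K (h xi) (fun i => A (w i)).
Proof.
move=> K0 i0x lam0 [[Al Ai] hK hn honto hs] fr; have wD := frame_DS K0 i0x fr.
have [worth winv] := fr; split.
  by move=> i i'; rewrite (liso_ip (@DS_0 _ _) (@DS_lin _ _) Al Ai) // worth.
move=> u t Ku ux; have [u0 [Ku0 u0x Eu]] := honto u Ku ux.
have [v0 [Kv0 v0x Ev]] := winv u0 (fun i => t i / lam) Ku0 u0x.
exists (h v0); split; [exact: hK | exact: hn |].
have := hs v0 u0 Kv0 v0x Ku0 u0x; rewrite Ev addrAC subrr add0r Eu.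
rewrite (liso_sum (@DS_0 _ _) (@DS_lin _ _) Al Ai) // scaler_sumr => E.
rewrite -[LHS](subrK (pic (h xi) u)) E addrC; congr (_ + _); apply: eq_bigr => i _.
by rewrite scalerA mulrCA divff ?gt_eqF // mulr1.
Qed.

Lemma seg_similar xi i0 h lam A j (w : 'I_j -> V) u r e eta : K i0 -> i0 <> xi -> 0 < lam ->
  similar xi i0 h lam A -> frame Phi K xi w -> K u -> u <> xi ->
  seg Phi K xi w u r e eta -> seg Phi K (h xi) (fun i => A (w i)) (h u) (lam * r) e eta.
Proof.
move=> K0 i0x lam0 [[Al Ai] hK hn honto hs] fr Ku ux [b [[Kb bx] br bs ba]].
have wD := frame_DS K0 i0x fr.
have Db : DS xi i0 (pic xi b - pic xi u) by apply: DS_diff.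
exists (h b); split.
- by split; [apply: hK | apply: hn].
- rewrite hs // nvZ Ai // gtr0_norm //; move: br => /andP[b1 b2].
  by rewrite -mulrA !ler_pM2l // b1.
- move=> s /bs [z [Kz zx hz]]; exists (h z); split; [exact: hK | exact: hn |].
  have Dz : DS xi i0 (pic xi z - pic xi u) by apply: DS_diff.
  rewrite !hs // scalerA mulrC -scalerA -scalerBr nvZ gtr0_norm //.
  rewrite -(lisoZ (@DS_0 _ _) Al Ai) // -(lisoB (@DS_0 _ _) (@DS_lin _ _) Al Ai) //; last first.
    by apply: (DSZ (@DS_0 _ _) (@DS_lin _ _)).
  rewrite Ai; first by rewrite mulrCA ler_pM2l.
  by apply: (DSB (@DS_0 _ _) (@DS_lin _ _)) => //; apply: (DSZ (@DS_0 _ _) (@DS_lin _ _)).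
- move=> t; rewrite hs // nvZ gtr0_norm // Ai //.
  have -> : \sum_i t i *: A (w i) = lam *: A (\sum_i (t i / lam) *: w i).
  { rewrite (liso_sum (@DS_0 _ _) (@DS_lin _ _) Al Ai) // scaler_sumr; apply: eq_bigr => i _.
    by rewrite scalerA mulrCA divff ?gt_eqF // mulr1.
  }
  have Ds : DS xi i0 (\sum_i (t i / lam) *: w i) by apply: (DS_sum (@DS_0 _ _) (@DS_lin _ _)).
  rewrite -scalerBr -(lisoB (@DS_0 _ _) (@DS_lin _ _) Al Ai) // nvZ gtr0_norm // Ai.
    by rewrite mulrCA ler_pM2l.
  by apply: (DSB (@DS_0 _ _) (@DS_lin _ _)).
Qed.

Lemma u_choose (P : nat -> T -> Prop) (x0 : T) : U [set n | exists z, P n z] ->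
  exists z : nat -> T, U [set n | P n (z n)].
Proof.
move=> h; have ch n : exists z, (exists z, P n z) -> P n z.
  have [[z hz]|no] := pselect (exists z, P n z); by [exists z | exists x0].
have [z hz] := choice ch; exists z; apply: (uS uU) h => n; exact: hz.
Qed.

Lemma vcvg_bdd (x : nat -> V) y : vcvg U x y -> U [set n | nv (x n) <= nv y + 1].
Proof.
move=> h; apply: (uS uU) (h 1 ltr01) => n /= h1; have := nv_triB (x n) y; rewrite ler_norml; lra.
Qed.

Lemma vcvg_ip_lim (x x' : nat -> V) y y' : vcvg U x y -> vcvg U x' y' -> forall e : R, 0 < e ->
  U [set n | `|ip (x n) (x' n) - ip y y'| < e].
Proof.
move=> h h' e e0; pose C := nv y + 1 + (nv y' + 1).
have C0 : 0 < C by rewrite /C; have := nv_ge0 y; have := nv_ge0 y'; lra.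
have ep : 0 < e / C by posit.
apply: (uS uU) (uI uU (uI uU (h _ ep) (h' _ ep)) (vcvg_bdd h)) => n /= [[h1 h2] h3].
have -> : ip (x n) (x' n) - ip y y' = ip (x n - y) y' + ip (x n) (x' n - y').
  by rewrite !ipE; ring.
apply: le_lt_trans (ler_normD _ _) _.
have a1 := cauchy (x n - y) y'; have a2 := cauchy (x n) (x' n - y').
have a3 : nv (x n - y) * nv y' <= e / C * nv y' by apply: ler_wpM2r; [exact: nv_ge0 | exact: ltW].
have a4 : nv (x n) * nv (x' n - y') <= (nv y + 1) * (e / C).
  by apply: ler_pM => //; [exact: nv_ge0 | exact: nv_ge0 | exact: ltW].
have E : e = e / C * (nv y + 1 + (nv y' + 1)) by rewrite -/C divfK // gt_eqF.
rewrite [X in _ < X]E; lra.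
Qed.

(** The vectors [sg n] lead, up to errors tending to 0, from a convergent sequence to points of the
    pictures. If they are bounded, so are those points, which then converge by [pic_bdd]; hence the
    vectors converge as well. *)
Lemma dir_limit xs xi (P : nat -> V) p (y : nat -> T) (sg : nat -> V) (B : R) :
  ucvg U d xs xi -> K xi -> vcvg U P p -> U [set n | K (y n) /\ y n <> xs n] ->
  U [set n | nv (sg n) <= B] -> vcvg U (fun n => pic (xs n) (y n) - (P n + sg n)) 0 ->
  exists v, [/\ K v, v <> xi & vcvg U sg (pic xi v - p)].
Proof.
move=> hx Kxi hP hy hB hc.
have hB' : U [set n | nv (pic (xs n) (y n)) <= nv p + 1 + B + 1].
{ apply: (uS uU) (uI uU (uI uU (vcvg_bdd hP) hB) (vcvg_bdd hc)) => n /= [[h1 h2]].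
  rewrite nv0 add0r => h3.
  have -> : pic (xs n) (y n) = pic (xs n) (y n) - (P n + sg n) + (P n + sg n) by rewrite subrK.
  apply: le_trans (nvD _ _) _; have := nvD (P n) (sg n); lra.
}
have [v [Kv vx _ hv]] := pic_bdd uU dsep dPhi cK hx Kxi hy hB'.
exists v; split => //.
have := vcvgB uU (vcvgB uU hv hP) hc; rewrite subr0.
apply: vcvg_ext => //; apply: (uA uU) => n /=; vring.
Qed.

Lemma pic_cst xs xi u : ucvg U d xs xi -> u <> xi ->
  U [set n | u <> xs n] /\ vcvg U (fun n => pic (xs n) u) (pic xi u).
Proof. by move=> h ux; apply: (pic_cvg uU dsep dPhi h (ucvg_cst uU pd u)). Qed.

(** Each [w n i] moves a fixed point of the picture to another point of the picture, so [dir_limit]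
    makes the vectors [w n i] converge; boundedness alone would not give this in infinite
    dimension. *)
Lemma frame_limit xs xi j (w : nat -> 'I_j -> V) : (forall n, frame Phi K (xs n) (w n)) ->
  ucvg U d xs xi -> K xi -> (exists v0, K v0 /\ v0 <> xi) ->
  exists w', (forall i, vcvg U (w^~ i) (w' i)) /\ frame Phi K xi w'.
Proof.
move=> fr hx Kxi [v0 [K0 v0x]].
have move_ u (t : 'I_j -> R) : K u -> u <> xi -> exists v, [/\ K v, v <> xi &
   vcvg U (fun n => \sum_i t i *: w n i) (pic xi v - pic xi u)].
{ move=> Ku ux; have [h1 h2] := pic_cst hx ux.
  have [y hy] : exists y : nat -> T, U [set n | [/\ K (y n), y n <> xs n
     & pic (xs n) (y n) = pic (xs n) u + \sum_i t i *: w n i]].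
  { apply: (u_choose (P := fun n z => [/\ K z, z <> xs n
     & pic (xs n) z = pic (xs n) u + \sum_i t i *: w n i]) u).
    by apply: (uS uU) h1 => n /= un; exact: ((fr n).2 u t Ku un).
  }
  apply: (@dir_limit xs xi _ _ y _ (\sum_i `|t i|) hx Kxi h2).
  - by apply: (uS uU) hy => n [].
  - apply: (uA uU) => n /=; apply: le_trans (nv_sum _ _) _; apply: ler_sum => i _.
    by rewrite nvZ (nv_w (fr n).1) mulr1.
  - apply: (vcvg_ext uU _ (vcvg_cst uU 0)); apply: (uS uU) hy => n /= [_ _ ->].
    by rewrite subrr.
}
have ch i : exists wi, vcvg U (w^~ i) wi.
{ have [v [_ _ hv]] := move_ v0 (fun i' => (i' == i)%:R) K0 v0x.
  exists (pic xi v - pic xi v0); apply: (vcvg_ext uU _ hv); apply: (uA uU) => n /=.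
  rewrite (bigD1 i) //= eqxx scale1r big1 ?addr0 // => i' i'i.
  by rewrite (negbTE i'i) scale0r.
}
have [w' hw'] := choice ch; exists w'; split => //; split.
  by move=> i i'; apply: (vcvg_ip uU (hw' i) (hw' i')) => n; exact: (fr n).1.
move=> u t Ku ux; have [v [Kv vx hv]] := move_ u t Ku ux; exists v; split => //.
have h2 : vcvg U (fun n => \sum_i t i *: w n i) (\sum_i t i *: w' i).
  by apply: (vcvg_sum uU (x := fun i n => t i *: w n i)) => i; apply: (vcvgZ uU).
by rewrite -(vcvg_uniq uU hv h2) addrC subrK.
Qed.

Lemma seg_limit xs xi j (w : nat -> 'I_j -> V) w' (x : nat -> T) v (en : nat -> R) e eta :
  ucvg U d xs xi -> K xi -> (forall i, vcvg U (w^~ i) (w' i)) ->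
  vcvg U (fun n => pic (xs n) (x n)) (pic xi v) -> 0 < eta ->
  (forall q : R, 0 < q -> U [set n | en n <= e + q]) ->
  U [set n | seg Phi K (xs n) (w n) (x n) 1 (en n) eta] -> seg Phi K xi w' v 1 e eta.
Proof.
move=> hx Kxi hw hxv eta0 hen /(u_choose v) [b hb].
pose sg n := pic (xs n) (b n) - pic (xs n) (x n).
have [b' [Kb' b'x hb']] : exists b', [/\ K b', b' <> xi & vcvg U sg (pic xi b' - pic xi v)].
{ apply: (@dir_limit xs xi _ _ b _ 1 hx Kxi hxv).
  - by apply: (uS uU) hb => n [].
  - by apply: (uS uU) hb => n [_ /andP[]].
  - apply: (vcvg_ext uU _ (vcvg_cst uU 0)); apply: (uA uU) => n /=; rewrite /sg; vring.
}
exists b'; split => //.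
- apply/andP; split.
    apply: (vcvg_ge uU hb') => q q0; apply: (uS uU) hb => n [_ /andP[h1 _] _ _] /=; rewrite /sg; lra.
  apply: (vcvg_le uU hb') => q q0; apply: (uS uU) hb => n [_ /andP[_ h1] _ _] /=; rewrite /sg; lra.
- move=> s s01.
  have [z hz] : exists z : nat -> T, U [set n | [/\ K (z n), z n <> xs n
      & nv (pic (xs n) (z n) - pic (xs n) (x n) - s *: sg n) <= en n * 1]].
  { apply: (u_choose (P := fun n z => [/\ K z, z <> xs n
      & nv (pic (xs n) z - pic (xs n) (x n) - s *: sg n) <= en n * 1]) v).
    by apply: (uS uU) hb => n [_ _ h _]; exact: h.
  }
  have bd : U [set n | nv (pic (xs n) (z n)) <= e + 1 + (nv (pic xi v) + 1) + 1].
  { apply: (uS uU) (uI uU (uI uU hz hb) (uI uU (vcvg_bdd hxv) (hen 1 ltr01))).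
    move=> n /= [[[_ _ h1] [_ /andP[_ h2] _ _]] [h3 h4]].
    have -> : pic (xs n) (z n) = (pic (xs n) (z n) - pic (xs n) (x n) - s *: sg n) +
       (pic (xs n) (x n) + s *: sg n) by vring.
    apply: le_trans (nvD _ _) _; have := nvD (pic (xs n) (x n)) (s *: sg n).
    rewrite (nvZ s) ger0_norm; last by case/andP: s01.
    have : s * nv (sg n) <= 1 * 1 by apply: ler_pM; [lra | exact: nv_ge0 | lra | exact: h2].
    lra.
  }
  have hz' : U [set n | K (z n) /\ z n <> xs n] by apply: (uS uU) hz => n [].
  have [z' [Kz' z'x _ hz'']] := pic_bdd uU dsep dPhi cK hx Kxi hz' bd.
  exists z'; split => //; rewrite mulr1.
  apply: (vcvg_le uU (vcvgB uU (vcvgB uU hz'' hxv) (vcvgZ uU s hb'))) => q q0.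
  by apply: (uS uU) (uI uU hz (hen q q0)) => n /= [[_ _ h1] h2]; lra.
- move=> t.
  have hs : vcvg U (fun n => \sum_i t i *: w n i) (\sum_i t i *: w' i).
    by apply: (vcvg_sum uU (x := fun i n => t i *: w n i)) => i; apply: (vcvgZ uU).
  apply: (vcvg_ge uU (vcvgB uU hb' hs)) => q q0.
  have q1 : 0 < q / eta by posit.
  apply: (uS uU) (uI uU hb (hb' _ q1)) => n /= [[_ _ _ ha] h1].
  have := ha t; rewrite -/(sg n); move=> h2; apply: le_trans h2.
  have := nv_triB (sg n) (pic xi b' - pic xi v); rewrite ler_norml => /andP[h3 _].
  have h4 : nv (pic xi b' - pic xi v) - q / eta <= nv (sg n) by lra.
  have := ler_wpM2l (ltW eta0) h4; rewrite mulrBr mulrCA divff ?gt_eqF // mulr1; exact.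
Qed.

Context (c0 : R) (c00 : 0 < c0).
Context (Z : (T -> T) -> (T -> T) -> R -> (T -> R) -> Prop).
Hypothesis Zok : forall g h kap m, Z g h kap m -> zmap d K c0 g h kap m.
Hypothesis Zlim : forall x (e : R), K x -> 0 < e ->
  exists g h kap m, [/\ Z g h kap m, kap < e & m x < e].
Context (k : nat) (k0 : (0 < k)%N).
Context (xo : T) (Kxo : K xo).
Hypothesis Kfin : forall e : R, 0 < e -> Hfin d k (K `&` [set x | e <= d x xo]).
Hypothesis Lnull : Hnull d k (K `\` Lr K Z).
Hypothesis nK : ~ Hnull d k K.

Lemma other_point xi : exists v0, K v0 /\ v0 <> xi.
Proof.
have [d0 _ _] := pd; have h := Hnull_diff k0 nK (Hnull1 k0 (d0 xi)).
have [v [Kv vx]] := Hnull_nonempty k0 h; by exists v.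
Qed.

Lemma zoom_similar g h kap m xi i0 : zmap d K c0 g h kap m -> K xi -> K i0 -> i0 <> xi ->
  exists A, similar xi i0 h (m xi ^+ 2 / kap) A.
Proof.
move=> z Kxi K0 i0x; have l0 : 0 < m xi ^+ 2 / kap.
  by apply: divr_gt0; [apply: exprn_gt0; exact: (zm_gt0 c00 z) | exact: (zm_kap z)].
have [A [h1 h2 h3]] := @similarity_ext R V V T (fun u => K u /\ u <> xi) (pic xi)
  (fun u => pic (h xi) (h u)) _ i0 l0 (conj K0 i0x)
  (fun i j Pi Pj => zoom_pic dsep dPhi c00 z Kxi Pi.1 Pj.1 Pi.2 Pj.2).
exists A; split => //.
- exact: (zm_h z).
- by move=> u Ku ux; apply: (zoom_pic_neq z).
- move=> u Ku ux; exists (g u); split; [exact: (zm_g z) | | exact: (zm_hg z)].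
  by move=> E; apply: ux; rewrite -E (zm_hg z).
- by move=> u v Ku ux Kv vx; apply: h1.
Qed.

(** [zoom_seq] in terms of pictures: the zooms become similarities whose ratios tend to infinity. *)
Lemma zoom_pack xi (X : set T) (Q : nat -> set T) : K xi -> X `<=` K -> ~ Hnull d k X ->
  (forall i, Q i `<=` K) ->
  exists p xi' (h : nat -> T -> T) (lam : nat -> R) (A : nat -> V -> V),
  [/\ [/\ X p, K p & p <> xi], K xi' /\ ucvg U d (fun n => h n xi) xi',
      (forall n, 0 < lam n) /\ forall M : R, U [set n | M < lam n],
      forall n, similar xi p (h n) (lam n) (A n)
    & forall i, Q i p -> forall v, K v -> v <> xi' -> exists x : nat -> T,
      U [set n | Q i (x n) /\ x n <> xi] /\
      vcvg U (fun n => pic (h n xi) (h n (x n))) (pic xi' v)].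
Proof.
move=> Kxi XK nX QK.
have [p [g [h [kap [m [xi' [[Xp pxi] hZ [Kxi' hxi'] hlam hQ]]]]]]] :=
  zoom_seq uU dsep dPhi d2 cK c00 Zok Zlim k0 Kfin Lnull Kxi XK nX QK.
have Kp := XK _ Xp.
have [A hA] := choice (fun n => zoom_similar (Zok (hZ n)) Kxi Kp pxi).
exists p, xi', h, (fun n => m n xi ^+ 2 / kap n), A; split => //.
- split => // n; have z := Zok (hZ n).
  by apply: divr_gt0; [apply: exprn_gt0; exact: (zm_gt0 c00 z) | exact: (zm_kap z)].
- move=> i Qp v Kv vx; have [x [h1 h2]] := hQ i Qp v Kv vx; exists x.
  have [h3 h4] := pic_cvg uU dsep dPhi hxi' h2 vx; split => //.
  by apply: (uS uU) (uI uU h1 h3) => n /= [q1 q2]; split => // E; apply: q2; rewrite E.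
Qed.

(** For some [N] the set [X N], on which segments exist at all scales below [N.+1%:R^-1], is not
    null. Zooming at it turns the scale [(lam n)^-1] into 1, and every point of the limit is
    approached by images of points of [X N]. *)
Lemma blowup_seg xi j (w : 'I_j -> V) (e eta : R) : K xi -> frame Phi K xi w -> 0 < e -> 0 < eta ->
  ~ Hnull d k [set u | [/\ K u, u <> xi & exists2 r0 : R, 0 < r0 & forall r : R, 0 < r -> r < r0 ->
      seg Phi K xi w u r e eta]] ->
  exists xi' (w' : 'I_j -> V), [/\ K xi', frame Phi K xi' w'
    & forall v, K v -> v <> xi' -> seg Phi K xi' w' v 1 e eta].
Proof.
move=> Kxi fr e0 eta0 nn.
pose X (N : nat) := [set u | [/\ K u, u <> xi & forall r : R, 0 < r -> r < N.+1%:R^-1 ->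
      seg Phi K xi w u r e eta]].
have [N nX] : exists N, ~ Hnull d k (X N).
{ apply: contrapT => no; apply: nn.
  apply: (@Hnull_sub _ _ _ _ _ (\bigcup_N X N)).
    move=> u [Ku ux [r0 r00 h]]; have [N hN] := inv_lt uU r00; exists N => //; split => // r rp rN.
    by apply: h => //; apply: lt_trans hN.
  apply: (Hnull_bigcup k0) => N; apply: contrapT => nX; apply: no; by exists N.
}
have XK : X N `<=` K by move=> u [].
have [p [xi' [h [lam [A [[Xp Kp pxi] [Kxi' hxi'] [l0 hl] hs hQ]]]]]] :=
  zoom_pack (X := X N) (Q := fun=> X N) Kxi XK nX (fun=> XK).
have frn n : frame Phi K (h n xi) (fun i => A n (w i)) := frame_similar Kp pxi (l0 n) (hs n) fr.
have [w' [hw' fr']] := frame_limit frn hxi' Kxi' (other_point xi').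
exists xi', w'; split => // v Kv vx.
have [x [hx1 hx2]] := hQ 0%N Xp v Kv vx.
apply: (@seg_limit (fun n => h n xi) xi' j (fun n i => A n (w i)) w' (fun n => h n (x n)) v (fun=> e)) => //.
  by move=> q q0; apply: (uA uU) => n /=; lra.
apply: (uS uU) (uI uU hx1 (hl N.+1%:R)) => n /= [[[Kx xx hx] _] hln].
have q0 : 0 < (lam n)^-1 by rewrite invr_gt0.
have := seg_similar Kp pxi (l0 n) (hs n) fr Kx xx (hx _ q0 _).
rewrite divff ?gt_eqF //; apply; rewrite ltf_pV2 ?posrE // ltr0Sn //.
Qed.

Hypothesis ncol : ~ coloured U d k.-1 K.

(** [tangent] gives one [eta] for all precisions, so blow-ups for precisions tending to 0 have a
    limit whose segments are exact and still transverse. *)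
Lemma exact_seg xi j (w : 'I_j -> V) : K xi -> (j < k)%N -> frame Phi K xi w ->
  exists xi' (w' : 'I_j -> V), exists2 eta : R, 0 < eta & [/\ K xi', frame Phi K xi' w'
    & forall v, K v -> v <> xi' -> seg Phi K xi' w' v 1 0 eta].
Proof.
move=> Kxi jk fr; have [eta eta0 ht] := tangent uU dsep dPhi cK k0 Kfin ncol Kxi jk fr.
have iv0 n : 0 < n.+1%:R^-1 :> R by rewrite invr_gt0 ltr0Sn.
have ch n : exists q : T * ('I_j -> V), [/\ K q.1, frame Phi K q.1 q.2
    & forall v, K v -> v <> q.1 -> seg Phi K q.1 q.2 v 1 n.+1%:R^-1 eta].
{ have [x1 [w1 h1]] := blowup_seg Kxi fr (iv0 n) eta0 (ht _ (iv0 n)); by exists (x1, w1).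
}
have [q hq] := choice ch.
have Kq n : K (q n).1 by case: (hq n).
have [xi' Kxi' hxi'] := cK Kq.
have frn n : frame Phi K (q n).1 (q n).2 by case: (hq n).
have [w' [hw' fr']] := frame_limit frn hxi' Kxi' (other_point xi').
exists xi', w', eta => //; split => // v Kv vx.
have [h1 h2] := pic_cst hxi' vx.
apply: (@seg_limit _ _ _ _ _ (fun=> v) v (fun n => n.+1%:R^-1) 0 eta hxi' Kxi' hw' h2) => //.
  by move=> e e0; rewrite add0r; apply: (uS uU) (u_inv uU e0) => n /=; apply: ltW.
by apply: (uS uU) h1 => n /= vn; case: (hq n) => _ _; apply.
Qed.

Definition ray xi (sg : V) := forall u (s : R), K u -> u <> xi -> 0 <= s ->
  exists v, [/\ K v, v <> xi & pic xi v = pic xi u + s *: sg].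

Lemma pic_dense (Ds : nat -> T) : (forall x (e : R), K x -> 0 < e -> exists n, d x (Ds n) < e) ->
  forall xi u (e : R), K u -> u <> xi -> 0 < e -> exists n, nv (pic xi (Ds n) - pic xi u) < e.
Proof.
move=> dn xi u e Ku ux e0; have [_ dC _] := pd.
have chm (n : nat) : exists m, d u (Ds m) < n.+1%:R^-1 by apply: dn => //; rewrite invr_gt0 ltr0Sn.
have [m hm] := choice chm.
have hu : ucvg U d (fun n => Ds (m n)) u.
  by move=> q q0; apply: (uS uU) (u_inv uU q0) => n /=; rewrite (dC _ u); apply: lt_trans.
have [_ cv] := pic_cvg uU dsep dPhi (ucvg_cst uU pd xi) hu ux.
by have [n hn] := u_ex uU (cv e e0); exists (m n).
Qed.

(* Directions are made asymptotically constant by zooming at a density point of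
   sets on which the direction is nearly constant. *)
Lemma ray_exists xi j (w : 'I_j -> V) (eta : R) : K xi -> frame Phi K xi w -> 0 < eta ->
  (forall v, K v -> v <> xi -> seg Phi K xi w v 1 0 eta) ->
  exists xi' (w' : 'I_j -> V) sg, [/\ K xi', frame Phi K xi' w', ray xi' sg
    & forall t : 'I_j -> R, eta / 2 <= nv (sg - \sum_i t i *: w' i)].
Proof.
move=> Kxi fr eta0 hseg; have [d0 dC dt] := pd.
have [Ds [DK Dd]] := dense_seq uU pd cK Kxi.
pose good u b := [/\ K b, b <> xi & forall s : R, 0 <= s <= 1 -> exists z, [/\ K z, z <> xi
      & pic xi z = pic xi u + s *: (pic xi b - pic xi u)]].
(* Countably many conditions: [i] codes two points of the dense sequence and a precision, and [u]
   satisfies it if some exact segment at [u] differs from the difference of their pictures by at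
   most that precision. *)
pose Q (i : nat) : set T := [set u | [/\ K u, u <> xi & exists a b N b0,
   [/\ unpickle i = Some (a, b, N) :> option (nat * nat * nat), good u b0
     & nv ((pic xi b0 - pic xi u) - (pic xi (Ds a) - pic xi (Ds b))) <= N.+1%:R^-1]]].
pose X := K `\` [set xi].
have nX : ~ Hnull d k X by apply: (Hnull_diff k0 nK (Hnull1 k0 (d0 xi))).
have XK : X `<=` K by move=> u [].
have [p [xi' [h [lam [A [[_ Kp pxi] [Kxi' hxi'] [l0 hl] hs hQ]]]]]] :=
  zoom_pack (X := X) (Q := Q) Kxi XK nX (fun i u hu => let: And3 a _ _ := hu in a).
have frn n : frame Phi K (h n xi) (fun i => A n (w i)) := frame_similar Kp pxi (l0 n) (hs n) fr.
have [w' [hw' fr']] := frame_limit frn hxi' Kxi' (other_point xi').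
have toG u b : K b /\ b <> xi -> (forall s : R, 0 <= s <= 1 -> exists z, [/\ K z, z <> xi
      & nv (pic xi z - pic xi u - s *: (pic xi b - pic xi u)) <= 0 * 1]) -> good u b.
{ move=> [Kb bx] hb; split => // s /hb [z [Kz zx hz]]; exists z; split => //.
  have h0 : nv (pic xi z - pic xi u - s *: (pic xi b - pic xi u)) = 0.
    by apply/eqP; rewrite eq_le nv_ge0 andbT; move: hz; rewrite mul0r.
  by rewrite -(nv_sub_eq0 h0) addrC subrK.
}
have [bp [[Kbp bpx] bpr bps bpa]] := hseg p Kp pxi.
pose s0 := pic xi bp - pic xi p.
have Ds0 : DS xi p s0 by apply: DS_diff.
pose sg n := A n s0.
(* For each precision, [p] satisfies a condition that forces all points satisfying it to have a
   segment close to [s0]. *)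
have hQp (N : nat) : exists i, Q i p /\ forall u, Q i u -> exists b0, good u b0 /\
   nv ((pic xi b0 - pic xi u) - s0) <= 2 * N.+1%:R^-1.
{ have iv0 : 0 < N.+1%:R^-1 :> R by rewrite invr_gt0 ltr0Sn.
  have e0 : 0 < N.+1%:R^-1 / 2 :> R by posit.
  have [a ha] := pic_dense Dd Kbp bpx e0; have [b hb] := pic_dense Dd Kp pxi e0.
  have near : nv (s0 - (pic xi (Ds a) - pic xi (Ds b))) <= N.+1%:R^-1.
  { have -> : s0 - (pic xi (Ds a) - pic xi (Ds b)) =
      (pic xi bp - pic xi (Ds a)) + (pic xi (Ds b) - pic xi p) by rewrite /s0; vring.
    apply: le_trans (nvD _ _) _; rewrite (nvB (pic xi bp)).
    move: ha hb; move: (N.+1%:R^-1 : R) => y; lra.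
  }
  exists (pickle (a, b, N)); split.
    split => //; exists a, b, N, bp; split => //; first by rewrite pickleK.
    exact: toG.
  move=> u [Ku ux [a' [b' [N' [b0 [E gb hb0]]]]]]; exists b0; split => //.
  rewrite pickleK in E; case: E hb0 => <- <- <- hb0.
  have -> : pic xi b0 - pic xi u - s0 = (pic xi b0 - pic xi u - (pic xi (Ds a) - pic xi (Ds b)))
     - (s0 - (pic xi (Ds a) - pic xi (Ds b))) by vring.
  apply: le_trans (nvD _ _) _; rewrite nvN; move: hb0 near; move: (N.+1%:R^-1 : R) => y; lra.
}
have sgn n : nv (sg n) <= 1.
{ have [[_ Ai] _ _ _ _] := hs n; rewrite /sg Ai //; by case/andP: bpr.
}
(* Once [lam n] exceeds [s], the fraction [s / lam n] of a segment is blown up to [s] times its full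
   length: segments become rays. *)
have step v (s : R) : K v -> v <> xi' -> 0 <= s -> exists v', [/\ K v', v' <> xi'
   & vcvg U (fun n => s *: sg n) (pic xi' v' - pic xi' v)].
{ move=> Kv vx s_ge0.
  have cl (e : R) : 0 < e -> U [set n | exists z, (K z /\ z <> h n xi) /\
     nv (pic (h n xi) z - (pic xi' v + s *: sg n)) <= e].
  { move=> e0; have q0 : 0 < e / (4 * (s + 1)) by apply: divr_gt0 => //; lra.
    have [N hN] := inv_lt uU q0; have [i [Qp hi]] := hQp N.
    have [x [hx1 hx2]] := hQ i Qp v Kv vx; have e2 : 0 < e / 2 by lra.
    apply: (uS uU) (uI uU (uI uU hx1 (hx2 _ e2)) (hl s)) => n /= [[[Qx xx] hx] sl].
    have [Kx _ _] := Qx; have [b0 [[Kb0 b0x gb] hb0]] := hi _ Qx.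
    have [|z [Kz zx Ez]] := gb (s / lam n).
      by rewrite divr_ge0 ?(ltW (l0 n)) //= ler_pdivrMr // mul1r ltW.
    have [[Al Ai] hK hne _ hsm] := hs n.
    exists (h n z); split; first by split; [apply: hK | apply: hne].
    have Db : DS xi p (pic xi b0 - pic xi (x n)) by apply: DS_diff.
    have E1 : pic (h n xi) (h n z) = pic (h n xi) (h n (x n)) + s *: A n (pic xi b0 - pic xi (x n)).
    { rewrite -[LHS](subrK (pic (h n xi) (h n (x n)))) hsm // Ez addrAC subrr add0r addrC.
      rewrite (lisoZ (@DS_0 _ _) Al Ai) // scalerA mulrCA divff ?gt_eqF // mulr1 //.
    }
    have -> : pic (h n xi) (h n z) - (pic xi' v + s *: sg n) = (pic (h n xi) (h n (x n)) - pic xi' v)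
      + s *: (A n (pic xi b0 - pic xi (x n)) - A n s0) by rewrite E1 /sg; vring.
    apply: le_trans (nvD _ _) _; rewrite nvZ ger0_norm //.
    rewrite -(lisoB (@DS_0 _ _) (@DS_lin _ _) Al Ai) // Ai; last exact: (DSB (@DS_0 _ _) (@DS_lin _ _)).
    have h1 : s * nv (pic xi b0 - pic xi (x n) - s0) <= (s + 1) * (2 * (e / (4 * (s + 1)))).
    { apply: ler_pM => //; [exact: nv_ge0 | lra |].
      apply: le_trans hb0 _; rewrite ler_pM2l //; exact: ltW.
    }
    have E2 : (s + 1) * (2 * (e / (4 * (s + 1)))) = e / 2 by field; lra.
    rewrite E2 in h1; lra.
  }
  have [z hz] := u_diag uU v (P := fun n z => K z /\ z <> h n xi)
    (f := fun n z => nv (pic (h n xi) z - (pic xi' v + s *: sg n))) (fun n x => nv_ge0 _) cl.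
  apply: (@dir_limit (fun n => h n xi) xi' (fun=> pic xi' v) (pic xi' v) z _ s hxi' Kxi').
  - exact: (vcvg_cst uU).
  - by apply: (uS uU) (hz 1 ltr01) => n [].
  - apply: (uA uU) => n /=; rewrite nvZ ger0_norm // -[X in _ <= X]mulr1; exact: ler_wpM2l.
  - move=> e e0; have e2 : 0 < e / 2 by lra.
    by apply: (uS uU) (hz _ e2) => n /= [_]; rewrite subr0; lra.
}
have [v0 [K0 v0x]] := other_point xi'.
have [v1 [_ _ h1]] := step v0 1 K0 v0x ler01.
pose sg' := pic xi' v1 - pic xi' v0.
have hsg : vcvg U sg sg' by apply: (vcvg_ext uU _ h1); apply: (uA uU) => n /=; rewrite scale1r.
exists xi', w', sg'; split => //.
- move=> u s Ku ux s_ge0; have [v' [Kv' v'x hv']] := step u s Ku ux s_ge0; exists v'; split => //.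
  by rewrite -(vcvg_uniq uU hv' (vcvgZ uU s hsg)) addrC subrK.
- move=> t.
  have hsum : vcvg U (fun n => \sum_i t i *: A n (w i)) (\sum_i t i *: w' i).
    by apply: (vcvg_sum uU (x := fun i n => t i *: A n (w i))) => i; apply: (vcvgZ uU).
  apply: (vcvg_ge uU (vcvgB uU hsg hsum)) => q q0; apply: (uA uU) => n /=.
  have [[Al Ai] _ _ _ _] := hs n; have wD := frame_DS Kp pxi fr.
  rewrite /sg -(liso_sum (@DS_0 _ _) (@DS_lin _ _) Al Ai) // -(lisoB (@DS_0 _ _) (@DS_lin _ _) Al Ai) //.
    rewrite Ai; last by apply: (DSB (@DS_0 _ _) (@DS_lin _ _)) => //; apply: (DS_sum (@DS_0 _ _) (@DS_lin _ _)).
    have := bpa t; rewrite -/s0; case/andP: bpr => b1 _ h2.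
    have : eta * (1 / 2) <= eta * nv s0 by rewrite ler_pM2l.
    lra.
  exact: (DS_sum (@DS_0 _ _) (@DS_lin _ _)).
Qed.

(** Undoing the translation by [sg] is Lipschitz for [d] as long as the result stays at a definite
    distance from [xi], so if the translated set were null, K would be null. *)
Lemma translate_nonnull xi sg : K xi -> ray xi sg ->
  ~ Hnull d k [set v | [/\ K v, v <> xi & exists u, [/\ K u, u <> xi & pic xi v = pic xi u + sg]]].
Proof.
move=> Kxi hr; have [d0 dC dt] := pd; set X := [set v | _] => nX; apply: nK.
pose Y (n : nat) := [set u | K u /\ n.+1%:R^-1 <= d u xi].
apply: (@Hnull_sub _ _ _ _ _ ([set xi] `|` \bigcup_n Y n)).
  move=> u Ku; have [->|ux] := pselect (u = xi); [by left | right].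
  have [n hn] := inv_lt uU (Phi_gt0 dsep dPhi ux); exists n => //; split => //; exact: ltW.
apply: (HnullU k0); first exact: (Hnull1 k0).
apply: (Hnull_bigcup k0) => n.
have iv0 : 0 < n.+1%:R^-1 :> R by rewrite invr_gt0 ltr0Sn.
(* The norm of a picture is the reciprocal of the distance to [xi], so [B] bounds the translated
   pictures and [B^-1] bounds the distances of the translated points to [xi] from below. *)
pose B := n.+1%:R + nv sg; have B0 : 0 < B by rewrite /B; apply: ltr_wpDr; [exact: nv_ge0 | exact: ltr0Sn].
pose X' := [set v | [/\ K v, v <> xi & exists u, [/\ Y n u, u <> xi & pic xi v = pic xi u + sg]]].
have ch v : exists u, X' v -> [/\ Y n u, u <> xi & pic xi v = pic xi u + sg].
{ have [[_ _ [u hu]]|no] := pselect (X' v); by [exists u | exists v].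
}
have [f hf] := choice ch.
have nX' : Hnull d k X' by apply: Hnull_sub nX => v [Kv vx [u [[Ku _] ux E]]]; split => //; exists u.
have C0 : 0 < 4 * B ^+ 2 by posit.
have lip v v' : X' v -> X' v' -> d (f v) (f v') <= 4 * B ^+ 2 * d v v'.
{ move=> hv hv'; have [Yu ux E] := hf v hv; have [Yu' ux' E'] := hf v' hv'.
  have [Kv vx _] := hv; have [Kv' vx' _] := hv'.
  have low z y : y <> xi -> Y n z -> pic xi y = pic xi z + sg -> B^-1 <= d y xi.
  { move=> yx [Kz hz] Ez; have dy := Phi_gt0 dsep dPhi yx.
    rewrite -(invrK (d y xi)) lef_pV2 ?posrE ?invr_gt0 // -(pic_nv dPhi) Ez.
    apply: le_trans (nvD _ _) _; rewrite /B lerD2r (pic_nv dPhi).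
    by rewrite -(invrK (n.+1%:R)) lef_pV2 ?posrE //; apply: lt_le_trans hz.
  }
  have l1 := low _ _ vx Yu E; have l2 := low _ _ vx' Yu' E'.
  have := pic_dist dsep dPhi ux ux'; have := pic_dist dsep dPhi vx vx'.
  have -> : pic xi v - pic xi v' = pic xi (f v) - pic xi (f v') by rewrite {1}E {1}E'; vring.
  move=> e1 e2; have E3 : d v v' / (d v xi * d v' xi) = d (f v) (f v') / (d (f v) xi * d (f v') xi).
    by rewrite -e1 -e2.
  have p1 := Phi_gt0 dsep dPhi ux; have p2 := Phi_gt0 dsep dPhi ux'.
  have -> : d (f v) (f v') = d v v' / (d v xi * d v' xi) * (d (f v) xi * d (f v') xi).
    by rewrite E3 divfK // gt_eqF // mulr_gt0.
  have D0 := pmetric_ge0 pd v v'.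
  have q1 : d v v' / (d v xi * d v' xi) <= d v v' * B ^+ 2.
  { apply: ler_wpM2l => //; rewrite -(invrK (B ^+ 2)) lef_pV2 ?posrE ?invr_gt0 ?exprn_gt0 //.
      by rewrite -exprVn expr2; apply: ler_pM => //; rewrite invr_ge0 ltW.
    by apply: mulr_gt0; apply: (Phi_gt0 dsep dPhi).
  }
  have q2 : d (f v) xi * d (f v') xi <= 2 * 2 by apply: ler_pM => //; apply: ltW.
  have -> : 4 * B ^+ 2 * d v v' = (d v v' * B ^+ 2) * (2 * 2) by ring.
  apply: ler_pM => //; last by apply: mulr_ge0; apply: ltW.
  by apply: divr_ge0 => //; apply: mulr_ge0; exact: (pmetric_ge0 pd).
}
have := Hnull_image (d' := d) (f := f) C0 lip nX'.
apply: Hnull_sub => u [Ku hu].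
have ux : u <> xi by move=> E; move: hu; rewrite E d0 leNgt iv0.
have [v [Kv vx E]] := hr u 1 Ku ux ler01; rewrite scale1r in E.
have Xv : X' v by split => //; exists u.
exists v => //; have [Yu' ux' E'] := hf v Xv.
by apply: (pic_inj dsep dPhi ux' ux); apply: (addIr sg); rewrite -E' -E.
Qed.

Definition line xi (sg : V) := forall u (s : R), K u -> u <> xi ->
  exists v, [/\ K v, v <> xi & pic xi v = pic xi u + s *: sg].

(** A point of P(xi) translated by [sg] has room of one translation behind it on the ray it came
    from. Zooming at the non-null set of such points makes this room infinite. *)
Lemma line_exists xi j (w : 'I_j -> V) sg (eta : R) : K xi -> frame Phi K xi w -> ray xi sg ->
  (forall t : 'I_j -> R, eta <= nv (sg - \sum_i t i *: w i)) ->
  exists xi' (w' : 'I_j -> V) sg', [/\ K xi', frame Phi K xi' w', line xi' sg'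
    & forall t : 'I_j -> R, eta <= nv (sg' - \sum_i t i *: w' i)].
Proof.
move=> Kxi fr hr ht.
pose X := [set v | [/\ K v, v <> xi & exists u, [/\ K u, u <> xi & pic xi v = pic xi u + sg]]].
have nX : ~ Hnull d k X by exact: translate_nonnull.
have XK : X `<=` K by move=> u [].
have [p [xi' [h [lam [A [[Xp Kp pxi] [Kxi' hxi'] [l0 hl] hs hQ]]]]]] :=
  zoom_pack (X := X) (Q := fun=> X) Kxi XK nX (fun=> XK).
have frn n : frame Phi K (h n xi) (fun i => A n (w i)) := frame_similar Kp pxi (l0 n) (hs n) fr.
have [w' [hw' fr']] := frame_limit frn hxi' Kxi' (other_point xi').
have Dsg : DS xi p sg.
{ have [v [Kv vx E]] := hr p 1 Kp pxi ler01.
  have -> : sg = pic xi v - pic xi p by rewrite E scale1r addrAC subrr add0r.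
  exact: DS_diff.
}
have step v (s : R) : K v -> v <> xi' -> exists v', [/\ K v', v' <> xi'
   & vcvg U (fun n => s *: A n sg) (pic xi' v' - pic xi' v)].
{ move=> Kv vx; have [x [hx1 hx2]] := hQ 0%N Xp v Kv vx.
  have [y hy] : exists y : nat -> T, U [set n | [/\ K (y n), y n <> h n xi
      & pic (h n xi) (y n) = pic (h n xi) (h n (x n)) + s *: A n sg]].
  { apply: (u_choose (P := fun n z => [/\ K z, z <> h n xi
      & pic (h n xi) z = pic (h n xi) (h n (x n)) + s *: A n sg]) v).
    apply: (uS uU) (uI uU hx1 (hl `|s|)) => n /= [[[Kx _ [u [Ku ux Ex]]] xx] ls].
    have [|z [Kz zx Ez]] := hr u (1 + s / lam n) Ku ux.
      have : `|s / lam n| <= 1 by rewrite normrM normfV (gtr0_norm (l0 n)) ler_pdivrMr // mul1r ltW.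
      rewrite ler_norml; lra.
    have [[Al Ai] hK hne _ hsm] := hs n.
    exists (h n z); split; [exact: hK | exact: hne |].
    rewrite -[LHS](subrK (pic (h n xi) (h n (x n)))) hsm // Ez Ex addrC; congr (_ + _).
    have -> : pic xi u + (1 + s / lam n) *: sg - (pic xi u + sg) = (s / lam n) *: sg by vring.
    by rewrite (lisoZ (@DS_0 _ _) Al Ai) // scalerA mulrCA divff ?gt_eqF // mulr1.
  }
  apply: (@dir_limit (fun n => h n xi) xi' _ _ y _ (`|s| * nv sg) hxi' Kxi' hx2).
  - by apply: (uS uU) hy => n [].
  - by apply: (uA uU) => n /=; have [[_ Ai] _ _ _ _] := hs n; rewrite nvZ Ai.
  - apply: (vcvg_ext uU _ (vcvg_cst uU 0)); apply: (uS uU) hy => n /= [_ _ ->]; by rewrite subrr.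
}
have [v0 [K0 v0x]] := other_point xi'.
have [v1 [_ _ h1]] := step v0 1 K0 v0x.
pose sg' := pic xi' v1 - pic xi' v0.
have hsg : vcvg U (fun n => A n sg) sg'.
  by apply: (vcvg_ext uU _ h1); apply: (uA uU) => n /=; rewrite scale1r.
exists xi', w', sg'; split => //.
- move=> u s Ku ux; have [v' [Kv' v'x hv']] := step u s Ku ux; exists v'; split => //.
  by rewrite -(vcvg_uniq uU hv' (vcvgZ uU s hsg)) addrC subrK.
- move=> t.
  have hsum : vcvg U (fun n => \sum_i t i *: A n (w i)) (\sum_i t i *: w' i).
    by apply: (vcvg_sum uU (x := fun i n => t i *: A n (w i))) => i; apply: (vcvgZ uU).
  apply: (vcvg_ge uU (vcvgB uU hsg hsum)) => q q0; apply: (uA uU) => n /=.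
  have [[Al Ai] _ _ _ _] := hs n; have wD := frame_DS Kp pxi fr.
  rewrite -(liso_sum (@DS_0 _ _) (@DS_lin _ _) Al Ai) // -(lisoB (@DS_0 _ _) (@DS_lin _ _) Al Ai) //.
    rewrite Ai; last by apply: (DSB (@DS_0 _ _) (@DS_lin _ _)) => //; apply: (DS_sum (@DS_0 _ _) (@DS_lin _ _)).
    by have := ht t; lra.
  exact: (DS_sum (@DS_0 _ _) (@DS_lin _ _)).
Qed.

(** One step of Gram-Schmidt; the distance [eta] from the span keeps the new vector non-zero. *)
Lemma frame_line xi j (w : 'I_j -> V) sg (eta : R) : frame Phi K xi w -> line xi sg -> 0 < eta ->
  (forall t : 'I_j -> R, eta <= nv (sg - \sum_i t i *: w i)) ->
  exists w' : 'I_j.+1 -> V, frame Phi K xi w'.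
Proof.
move=> [worth winv] hl eta0 ht; pose tt i := ip sg (w i); pose ta := sg - \sum_i tt i *: w i.
have ta0 : 0 < nv ta by apply: lt_le_trans (ht tt).
have taw i : ip ta (w i) = 0 by rewrite /ta ipDl ipNl (ip_wsum worth) subrr.
pose wn := (nv ta)^-1 *: ta.
pose w' (i : 'I_j.+1) := if (insub (val i) : option 'I_j) is Some i0 then w i0 else wn.
have E1 (i : 'I_j) : w' (widen_ord (leqnSn j) i) = w i by rewrite /w' /= valK.
have E2 : w' ord_max = wn by rewrite /w' /= insubF // ltnn.
have ww i : ip wn (w i) = 0 by rewrite /wn ipZl taw mulr0.
have wnn : ip wn wn = 1.
{ rewrite /wn ipZl ipZr -nv_sq; field; by rewrite gt_eqF.
}
have cs (i : 'I_j.+1) : (exists i0, i = widen_ord (leqnSn j) i0) \/ i = ord_max.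
{ have [lt|ge] := ltnP i j; first by left; exists (Ordinal lt); apply: val_inj.
  by right; apply: val_inj => /=; apply/eqP; rewrite eqn_leq ge -ltnS ltn_ord.
}
exists w'; split.
- move=> i i'; have [[i0 ->]|->] := cs i; have [[i0' ->]|->] := cs i'; rewrite ?E1 ?E2.
  + by rewrite worth.
  + by rewrite ipC ww; case: eqP => // /(congr1 val) /= E; have := ltn_ord i0; rewrite E ltnn.
  + by rewrite ww; case: eqP => // /(congr1 val) /= E; have := ltn_ord i0'; rewrite -E ltnn.
  + by rewrite wnn eqxx.
- move=> u t Ku ux; pose s := t ord_max / nv ta.
  have [v1 [Kv1 v1x Ev1]] := hl u s Ku ux.
  have [v2 [Kv2 v2x Ev2]] := winv v1 (fun i => t (widen_ord (leqnSn j) i) - s * tt i) Kv1 v1x.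
  exists v2; split => //; rewrite Ev2 Ev1 big_ord_recr /= E2 /wn scalerA -/s /ta -addrA; congr (_ + _).
  rewrite scalerBr scaler_sumr addrCA; congr (_ + _); rewrite -sumrB; apply: eq_bigr => i _.
  by rewrite E1 scalerBl scalerA.
Qed.

Lemma frame_exists j : (j <= k)%N -> exists xi (w : 'I_j -> V), K xi /\ frame Phi K xi w.
Proof.
elim: j => [|j IH] jk.
  exists xo, (fun=> 0); split => //; split => [[]//|u t Ku ux]; exists u; split => //.
  by rewrite big_ord0 addr0.
have [xi [w [Kxi fr]]] := IH (ltnW jk).
have [x1 [w1 [eta eta0 [K1 fr1 h1]]]] := exact_seg Kxi jk fr.
have [x2 [w2 [sg2 [K2 fr2 h2 t2]]]] := ray_exists K1 fr1 eta0 h1.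
have [x3 [w3 [sg3 [K3 fr3 h3 t3]]]] := line_exists K2 fr2 h2 t2.
have e2 : 0 < eta / 2 by lra.
have [w4 fr4] := frame_line fr3 h3 e2 t3; by exists x3, w4.
Qed.

(** Induction over faces: slicing a null cube by its last coordinate would, by Eilenberg's
    inequality, give a null face of one dimension less. The edge is handled by [interval_cover]. *)
Lemma cube_nonnull xi (w : 'I_k -> V) n : K xi -> frame Phi K xi w -> (0 < n)%N -> (n <= k)%N ->
  forall b, K b -> b <> xi -> ~ Hnull d n [set u | [/\ K u, u <> xi & exists2 t : 'I_k -> R,
    pic xi u = pic xi b + \sum_i t i *: w i &
    forall i : 'I_k, if (i < n)%N then is_true (0 <= t i <= 1) else t i = 0]].
Proof.
move=> Kxi [worth winv] n0; elim: n n0 => // n IH _ nk b Kb bx.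
pose C m b := [set u | [/\ K u, u <> xi & exists2 t : 'I_k -> R,
    pic xi u = pic xi b + \sum_i t i *: w i &
    forall i : 'I_k, if (i < m)%N then is_true (0 <= t i <= 1) else t i = 0]].
rewrite -/(C n.+1 b) => nC.
pose i0 := Ordinal nk; pose f u := ip (pic xi u) (w i0).
pose B := nv (pic xi b) + k%:R + 1.
have B0 : 0 < B.
{ by rewrite /B; have := nv_ge0 (pic xi b); have : 0 <= k%:R :> R by []; lra. }
have low u : C n.+1 b u -> B^-1 <= d u xi.
{ move=> [Ku ux [t Et ht]]; have du := Phi_gt0 dsep dPhi ux.
  rewrite -(invrK (d u xi)) lef_pV2 ?posrE ?invr_gt0 // -(pic_nv dPhi) Et.
  apply: le_trans (nvD _ _) _; rewrite /B -addrA lerD2l.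
  apply: le_trans (nv_sum _ _) _; apply: (@le_trans _ _ (\sum_(i < k) 1)).
    apply: ler_sum => i _; rewrite nvZ (nv_w worth) mulr1.
    by have := ht i; case: ifP => _ => [/andP[q1 q2]|->]; rewrite ?normr0 // ger0_norm.
  by rewrite sumr_const card_ord lerDl.
}
have iB0 : 0 < B^-1 by rewrite invr_gt0.
pose L := (nv (w i0) + 1) / B^-1 ^+ 2.
have L0 : 0 < L by apply: divr_gt0; [have := nv_ge0 (w i0); lra | exact: exprn_gt0].
have lip u v : C n.+1 b u -> C n.+1 b v -> `|f u - f v| <= L * d u v.
{ by move=> /low hu /low hv; exact: (fv_lip dsep dPhi (fun=> w i0) 0 iB0 hu hv).
}
pose t0 := f b.
have mv (s : R) : exists v, [/\ K v, v <> xi & pic xi v = pic xi b + s *: w i0].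
{ have [v [Kv vx E]] := winv b (fun i => if i == i0 then s else 0) Kb bx; exists v; split => //.
  rewrite E (bigD1 i0) //= eqxx big1 ?addr0 // => i ii; by rewrite (negbTE ii) scale0r.
}
have [n0|n0] := posnP n.
- subst n.
  have nI : Hnull (fun x y : R => `|x - y|) 1 (f @` C 1 b) := Hnull_image L0 lip nC.
  have [|Vs [r [h1 h2 h3 h4]]] := nI 1 (1 / 8) ltr01; first lra.
  have ch (i : nat) : exists y, forall x, Vs i x -> `|x - y| <= r i.
  { have [[y Vy]|no] := pselect (exists y, Vs i y); last by exists 0 => x Vx; exfalso; apply: no; exists x.
    by exists y => x Vx; apply: h3.
  }
  have [y hy] := choice ch.
  have : 1 <= 1 / 2 :> R.
  { apply: (@interval_cover R 1 (1 / 2) (fun i => y i - r i - t0) (fun i => 2 * r i)) => //.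
    - by move=> i; have /andP[q _] := h2 i; lra.
    - move=> s /andP[s0 s1]; have [v [Kv vx E]] := mv s.
      have Cv : C 1 b v.
      { split => //; exists (fun i => if i == i0 then s else 0).
          rewrite E (bigD1 i0) // eqxx big1 /= ?addr0 // => i ii; by rewrite (negbTE ii) scale0r.
        move=> i; have -> : (i < 1)%N = (i == i0) by rewrite ltnS leqn0.
        by case: (i == i0); rewrite ?s0.
      }
      have [i _ Vi] := h1 (f v) (ex_intro2 _ _ v Cv erefl); exists i.
      have := hy i _ Vi; rewrite /f E ipDl (ipZl s) worth eqxx mulr1 -/(f b) -/t0 ler_norml; lra.
    - move=> m; rewrite -mulr_sumr; have := h4 m.
      under eq_bigr do rewrite expr1; lra.
  }
  lra.
- have := eilenberg_null n0 L0 lip nC => hE.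
  have [|t /andP[t1 t2]] := @nullR_itv R t0 (t0 + 1) _ _ hE; first lra.
  move=> /contrapT ht; have [b' [Kb' b'x Eb']] := mv (t - t0).
  apply: (IH n0 (ltnW nk) b' Kb' b'x); apply: Hnull_sub ht => u [Ku ux [tu Eu htu]].
  have tu0 : tu i0 = 0 by have := htu i0; rewrite ltnn.
  split.
  + split => //; exists (fun i => if i == i0 then t - t0 else tu i).
      rewrite Eu Eb' -addrA; congr (_ + _); rewrite [in LHS](bigD1 i0) // [in RHS](bigD1 i0) //= eqxx tu0 scale0r add0r.
      by congr (_ + _); apply: eq_bigr => i /negbTE ->.
    move=> i; case: eqP => [->|ne]; first by rewrite ltnSn; apply/andP; split; lra.
    have -> : (i < n.+1)%N = (i < n)%N by rewrite ltnS leq_eqVlt; case: eqP => // E; case: ne; exact: val_inj.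
    exact: htu.
  + by rewrite /= /f Eu ipDl (ip_wsum worth) tu0 addr0 Eb' ipDl (ipZl (t - t0)) worth eqxx mulr1 -/(f b) -/t0; ring.
Qed.

(** The part of P(xi) in one coset of the span of a full frame is not null, so one can zoom at it;
    then the whole limiting picture consists of limits of points of the blown-up coset. *)
Lemma flat_limit : exists xi (w : 'I_k -> V), [/\ K xi, frame Phi K xi w
  & forall u v, K u -> u <> xi -> K v -> v <> xi -> exists t : 'I_k -> R,
    pic xi u = pic xi v + \sum_i t i *: w i].
Proof.
have [xi [w [Kxi fr]]] := frame_exists (leqnn k).
have [b [Kb bx]] := other_point xi.
pose X := [set u | [/\ K u, u <> xi & exists t : 'I_k -> R, pic xi u = pic xi b + \sum_i t i *: w i]].
have nX : ~ Hnull d k X.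
{ move=> hX; apply: (cube_nonnull Kxi fr k0 (leqnn k) Kb bx); apply: Hnull_sub hX.
  by move=> u [Ku ux [t Et _]]; split => //; exists t.
}
have XK : X `<=` K by move=> u [].
have [p [xi' [h [lam [A [[Xp Kp pxi] [Kxi' hxi'] [l0 hl] hs hQ]]]]]] :=
  zoom_pack (X := X) (Q := fun=> X) Kxi XK nX (fun=> XK).
have frn n : frame Phi K (h n xi) (fun i => A n (w i)) := frame_similar Kp pxi (l0 n) (hs n) fr.
have [w' [hw' fr']] := frame_limit frn hxi' Kxi' (other_point xi').
have wD := frame_DS Kp pxi fr.
exists xi', w'; split => // u v Ku ux Kv vx.
have [x [hx1 hx2]] := hQ 0%N Xp u Ku ux; have [y [hy1 hy2]] := hQ 0%N Xp v Kv vx.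
have hL := vcvgB uU hx2 hy2; set L := pic xi' u - pic xi' v in hL.
(* The difference of two points of the blown-up coset equals its projection to the frame, and the
   coordinates of this projection converge. *)
pose t i := ip L (w' i); exists t.
have hsum : vcvg U (fun n => \sum_i t i *: A n (w i)) (\sum_i t i *: w' i).
  by apply: (vcvg_sum uU (x := fun i n => t i *: A n (w i))) => i; apply: (vcvgZ uU).
suff : nv (L - \sum_i t i *: w' i) <= 0.
{ move=> h0; have h1 : nv (L - \sum_i t i *: w' i) = 0 by apply/eqP; rewrite eq_le nv_ge0 andbT.
  by rewrite -(nv_sub_eq0 h1) /L addrC subrK.
}
apply: (vcvg_le uU (vcvgB uU hL hsum)) => e e0.
have q0 : 0 < e / k.+1%:R by apply: divr_gt0 => //; exact: ltr0Sn.
have hU : U [set n | forall i : nat, (i < k)%N -> forall ii : 'I_k, val ii = i ->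
   `|ip (pic (h n xi) (h n (x n)) - pic (h n xi) (h n (y n))) (A n (w ii)) - t ii| < e / k.+1%:R].
{ apply: (u_all uU) => i ik; apply: (uS uU) (vcvg_ip_lim hL (hw' (Ordinal ik)) q0) => n /= hn ii E.
  by have -> : ii = Ordinal ik by apply: val_inj.
}
apply: (uS uU) (uI uU hU (uI uU hx1 hy1)) => n /= [hn [[Xx xx] [Xy yx]]].
have [Kx _ [tx Ex]] := Xx; have [Ky _ [ty Ey]] := Xy.
have [[Al Ai] _ _ _ hsm] := hs n; have [worth _] := frn n.
set Ln := pic (h n xi) (h n (x n)) - _ in hn *.
have ELn : Ln = \sum_i (lam n * (tx i - ty i)) *: A n (w i).
{ rewrite /Ln hsm // Ex Ey.
  have -> : pic xi b + \sum_i tx i *: w i - (pic xi b + \sum_i ty i *: w i) = \sum_i (tx i - ty i) *: w i.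
  { rewrite opprD addrACA subrr add0r -sumrB; apply: eq_bigr => i _; by rewrite scalerBl.
  }
  rewrite (liso_sum (@DS_0 _ _) (@DS_lin _ _) Al Ai) // scaler_sumr.
  by apply: eq_bigr => i _; rewrite scalerA.
}
have ci i : ip Ln (A n (w i)) = lam n * (tx i - ty i) by rewrite ELn (ip_wsum worth).
have -> : Ln - \sum_i t i *: A n (w i) = \sum_i (ip Ln (A n (w i)) - t i) *: A n (w i).
{ rewrite {1}ELn -sumrB; apply: eq_bigr => i _; by rewrite ci scalerBl.
}
apply: le_trans (nv_sum _ _) _; apply: (@le_trans _ _ (\sum_(i < k) e / k.+1%:R)).
  apply: ler_sum => i _; rewrite nvZ (nv_w worth) mulr1; apply: ltW; exact: (hn i (ltn_ord i) i).
rewrite sumr_const card_ord add0r -[_ *+ k]mulr_natr -mulrA ler_piMr ?(ltW e0) //.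
by rewrite mulrC ler_pdivrMr ?ltr0Sn // mul1r ler_nat.
Qed.

End Steps.

(** * Square-summable sequences *)

Section L2.
Context {R : realType}.
Implicit Types x y : nat -> R.

Lemma sqn_ge x n : ((\sum_(i < n) x i ^+ 2)%:E <= sqn x)%E.
Proof.
apply: le_trans (nneseries_lim_ge n _); last by move=> i _ _; rewrite lee_fin sqr_ge0.
by rewrite big_mkord sumEFin.
Qed.

Lemma sqn_le x (M : R) : (forall n, \sum_(i < n) x i ^+ 2 <= M) -> (sqn x <= M%:E)%E.
Proof.
move=> h; apply: lime_le; first by apply: is_cvg_nneseries => i _ _; rewrite lee_fin sqr_ge0.
by apply: nearW => n; rewrite big_mkord sumEFin lee_fin.
Qed.

Lemma sqn_ge0 x : (0 <= sqn x)%E.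
Proof. by apply: nneseries_ge0 => i _ _; rewrite lee_fin sqr_ge0. Qed.

Lemma sqn_finP x : (sqn x < +oo)%E <-> exists M : R, forall n, \sum_(i < n) x i ^+ 2 <= M.
Proof.
split=> [h|[M h]]; last by apply: le_lt_trans (sqn_le h) (ltry _).
exists (fine (sqn x)) => n; rewrite -lee_fin fineK; first exact: sqn_ge.
by rewrite ge0_fin_numE // sqn_ge0.
Qed.

Definition l2pred : {pred nat -> R} := [pred x | `[< (sqn x < +oo)%E >]].

Lemma l2_submod : submod_closed l2pred.
Proof.
split=> [|a x y]; rewrite !inE.
  by apply/sqn_finP; exists 0 => n; rewrite big1 // => i _; rewrite expr0n.
move=> /sqn_finP [M hM] /sqn_finP [N hN]; apply/sqn_finP.
exists (2 * a ^+ 2 * M + 2 * N) => n.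
apply: (@le_trans _ _ (\sum_(i < n) (2 * a ^+ 2 * x i ^+ 2 + 2 * y i ^+ 2))).
  apply: ler_sum => i _; rewrite -[(a *: x + y) i]/(a * x i + y i).
  have := sqr_ge0 (a * x i - y i); move: (x i : R) (y i : R) => p q; nra.
rewrite big_split /= -!mulr_sumr; apply: lerD.
  by apply: ler_wpM2l; [rewrite mulr_ge0 // sqr_ge0 | exact: hM].
by apply: ler_wpM2l => //; exact: hN.
Qed.

HB.instance Definition _ := GRing.isSubmodClosed.Build R (nat -> R) l2pred l2_submod.

(** One space serves all dimensions: the points of [Hpt d] embed by [hv], and the support condition
    is restored by [supp_Hpt]. *)
Record l2 := L2 { l2v :> nat -> R; l2P : l2v \in l2pred }.
HB.instance Definition _ := [isSub for l2v].
HB.instance Definition _ := [Choice of l2 by <:].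
HB.instance Definition _ := [SubChoice_isSubLmodule of l2 by <:].

Lemma l2DE (x y : l2) i : (x + y) i = x i + y i. Proof. by []. Qed.
Lemma l2ZE a (x : l2) i : (a *: x) i = a * x i. Proof. by []. Qed.
Lemma l2NE (x : l2) i : (- x) i = - x i. Proof. by []. Qed.
Lemma l2_bound (x : l2) : exists M : R, forall n, \sum_(i < n) x i ^+ 2 <= M.
Proof. by apply/sqn_finP; have := l2P x; rewrite inE. Qed.

Definition psum (x y : l2) (n : nat) : R := \sum_(i < n) x i * y i.

(** Polarisation reduces this to sums of squares, which are monotone and bounded. *)
Lemma psum_cvg (x y : l2) : cvgn (psum x y).
Proof.
have sq (z : l2) : cvgn (psum z z).
{ apply: nondecreasing_is_cvgn.
    apply/nondecreasing_seqP => n; rewrite /psum big_ord_recr /= lerDl -expr2; exact: sqr_ge0.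
  have [M hM] := l2_bound z; exists M => _ [n _ <-].
  by apply: le_trans (hM n); apply: ler_sum => i _; rewrite expr2.
}
have -> : psum x y = (fun n => 4^-1 * (psum (x + y) (x + y) n - psum (x - y) (x - y) n)).
{ apply/funext => n; rewrite /psum -sumrB mulr_sumr; apply: eq_bigr => i _.
  rewrite !l2DE l2NE; by field.
}
by apply: is_cvgM; [exact: is_cvg_cst | apply: is_cvgB].
Qed.

Definition l2ip (x y : l2) : R := limn (psum x y).

Lemma l2ipC (x y : l2) : l2ip x y = l2ip y x.
Proof.
by congr (limn _); apply/funext => n; apply: eq_bigr => i _; rewrite mulrC.
Qed.

Lemma l2ipDl (x y z : l2) : l2ip (x + y) z = l2ip x z + l2ip y z.
Proof.
have -> : l2ip (x + y) z = limn (fun n => psum x z n + psum y z n).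
{ congr (limn _); apply/funext => n; rewrite /psum -big_split /=.
  by apply: eq_bigr => i _; rewrite mulrDl.
}
by apply: cvg_lim => //; apply: cvgD; exact: psum_cvg.
Qed.

Lemma l2ipZl a (x y : l2) : l2ip (a *: x) y = a * l2ip x y.
Proof.
have -> : l2ip (a *: x) y = limn (fun n => a * psum x y n).
{ congr (limn _); apply/funext => n; rewrite /psum mulr_sumr.
  by apply: eq_bigr => i _; rewrite mulrA.
}
by apply: cvg_lim => //; apply: cvgM; [exact: cvg_cst | exact: psum_cvg].
Qed.

Lemma l2ip_ge (x : l2) n : \sum_(i < n) x i ^+ 2 <= l2ip x x.
Proof.
have -> : \sum_(i < n) x i ^+ 2 = psum x x n by apply: eq_bigr => i _; rewrite expr2.
apply: nondecreasing_cvgn_le; last exact: psum_cvg.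
by apply/nondecreasing_seqP => m; rewrite /psum big_ord_recr /= lerDl -expr2; exact: sqr_ge0.
Qed.

Lemma l2ip_ge0 (x : l2) : 0 <= l2ip x x.
Proof. by have := l2ip_ge x 0; rewrite big_ord0. Qed.

Lemma l2ip_coord (x : l2) i : x i ^+ 2 <= l2ip x x.
Proof.
apply: le_trans (l2ip_ge x i.+1); rewrite big_ord_recr /= lerDr.
by apply: sumr_ge0 => m _; exact: sqr_ge0.
Qed.

Lemma l2_ext (x y : l2) : (forall i, x i = y i) -> x = y.
Proof. by move=> h; apply: val_inj; apply/funext. Qed.

Lemma l2ip_eq0 (x : l2) : l2ip x x = 0 -> x = 0.
Proof.
move=> h; apply: l2_ext => i; apply/eqP; rewrite -sqrf_eq0 eq_le sqr_ge0 andbT -h.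
exact: l2ip_coord.
Qed.

Definition l2space : ipspace R := IPSpace l2ipC l2ipDl l2ipZl l2ip_ge0 l2ip_eq0.

Lemma l2_sqn (x : l2) : sqn x = (l2ip x x)%:E.
Proof.
apply/eqP; rewrite eq_le; apply/andP; split; first by apply: sqn_le => n; exact: l2ip_ge.
have fx : sqn x \is a fin_num.
  by rewrite ge0_fin_numE ?sqn_ge0 //; have := l2P x; rewrite inE.
rewrite -(fineK fx) lee_fin; apply: limr_le; first exact: psum_cvg.
apply: nearW => n; rewrite -lee_fin (fineK fx); apply: le_trans (sqn_ge x n).
by rewrite lee_fin; apply: ler_sum => i _; rewrite expr2.
Qed.

Lemma nrm_l2 (x : l2space) : nrm (x : l2) = nv x.
Proof. by rewrite /nrm l2_sqn. Qed.

End L2.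

(** * Adjoining the height coordinate *)

Definition scons (R : Type) (a : R) (x : nat -> R) : nat -> R := fun i => if i is j.+1 then x j else a.

(** The difference of the two sides is the square of [t ^+ 2 + ip a b] plus the defect in the Cauchy
    inequality for [a] and [b]. *)
Lemma ip_height (R : realType) (V : ipspace R) (t : R) (a b : V) :
  t ^+ 2 * nv (a - b) ^+ 2 <= (t ^+ 2 + nv a ^+ 2) * (t ^+ 2 + nv b ^+ 2).
Proof.
have := cauchy a b; rewrite -(ler_pXn2r (n := 2)) ?nnegrE ?mulr_ge0 ?nv_ge0 //.
rewrite exprMn !nv_sq real_normK ?num_real // ipDl !ipDr !ipNr !ipNl (ipC b a).
have := sqr_ge0 (t ^+ 2 + ip a b).
move: (ip a b) (ip a a) (ip b b) (t ^+ 2) => m n l s; nra.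
Qed.

Section Cons.
Context {R : realType}.
Notation V := (l2space (R := R)).

Lemma scons_fin a (x : nat -> R) : (sqn x < +oo)%E -> (sqn (scons a x) < +oo)%E.
Proof.
move=> /sqn_finP [M hM]; apply/sqn_finP; exists (a ^+ 2 + M) => -[|n].
  by rewrite big_ord0 addr_ge0 ?sqr_ge0 //; have := hM 0%N; rewrite big_ord0.
rewrite big_ord_recl /= lerD2l; exact: hM.
Qed.

Lemma tail_fin (x : nat -> R) : (sqn x < +oo)%E -> (sqn (fun i => x i.+1) < +oo)%E.
Proof.
move=> /sqn_finP [M hM]; apply/sqn_finP; exists M => n.
by apply: le_trans (hM n.+1); rewrite big_ord_recl /= lerDr sqr_ge0.
Qed.

Lemma ip_coord0 (x y : l2 (R := R)) (x' y' : l2 (R := R)) :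
  (forall i, x' i = x i.+1) -> (forall i, y' i = y i.+1) ->
  l2ip x y = x 0%N * y 0%N + l2ip x' y'.
Proof.
move=> hx hy; rewrite /l2ip.
have <- : limn (fun n => psum x y n.+1) = limn (psum x y).
{ apply: cvg_lim => //; have := @psum_cvg R x y; by rewrite -(cvg_shiftS (psum x y)).
}
apply: cvg_lim => //.
have -> : (fun n => psum x y n.+1) = (fun n => x 0%N * y 0%N + psum x' y' n).
{ apply/funext => n; rewrite /psum big_ord_recl /=; congr (_ + _).
  by apply: eq_bigr => i _; rewrite hx hy.
}
by apply: cvgD; [exact: cvg_cst | exact: psum_cvg].
Qed.

End Cons.

(** * The chordal model *)

Section Model.
Context {R : realType} (d : option nat).
Notation V := (l2space (R := R)).
Implicit Types (p q : @hat R d) (x y : @Hpt R d).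

Lemma hv_proof x : sval x \in @l2pred R.
Proof. by rewrite inE; have [h _] := proj2_sig x. Qed.

Definition hv x : V := L2 (hv_proof x).

Lemma hv_inj x y : hv x = hv y -> x = y.
Proof.
case: x y => x px [y py] /(congr1 (@l2v R)) /= E; move: px py; rewrite /= in E.
by case: _ / E => px py; congr exist; exact: Prop_irrelevance.
Qed.

Lemma nrm_sub x y : nrm (vsub (sval x) (sval y)) = nv (hv x - hv y).
Proof. by rewrite -nrm_l2. Qed.

Lemma nrm_hv x : nrm (sval x) = nv (hv x).
Proof. by rewrite -nrm_l2. Qed.

Definition Wt p : R := if p is Some x then Num.sqrt (1 + nv (hv x) ^+ 2) else 1.
(** Euclidean distance, with the distance to infinity normalised to 1. Together with the weights
    [Wt] it yields the chordal metric by one formula, infinity included. *)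
Definition Nd p q : R := match p, q with
  | Some x, Some y => nv (hv x - hv y)
  | None, None => 0
  | _, _ => 1 end.

Lemma Wt_gt0 p : 0 < Wt p.
Proof.
case: p => [x|] //=; rewrite sqrtr_gt0; have := sqr_ge0 (nv (hv x)); lra.
Qed.

Lemma Wt_ge1 p : 1 <= Wt p.
Proof.
case: p => [x|] //=; rewrite -[X in X <= _]sqrtr1 ler_sqrt; have := sqr_ge0 (nv (hv x)); lra.
Qed.

Lemma Wt_sq x : Wt (Some x) ^+ 2 = 1 + nv (hv x) ^+ 2.
Proof. by rewrite /= sqr_sqrtr //; have := sqr_ge0 (nv (hv x)); lra. Qed.

Lemma Nd_ge0 p q : 0 <= Nd p q.
Proof. by case: p q => [x|] [y|] //=; exact: nv_ge0. Qed.

Lemma Nd_eq0 p q : Nd p q = 0 -> p = q.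
Proof.
case: p q => [x|] [y|] //=; first by move/nv_sub_eq0/hv_inj => ->.
  by move/eqP; rewrite oner_eq0.
by move/eqP; rewrite oner_eq0.
Qed.

Lemma chordalE p q : chordal p q = 2 * Nd p q / (Wt p * Wt q).
Proof.
case: p q => [x|] [y|] /=; rewrite ?nrm_sub ?nrm_hv ?mulr1 ?mul1r //.
by rewrite mulr0 mul0r.
Qed.

Lemma Nd_le p q : Nd p q <= Wt p * Wt q.
Proof.
case: p q => [x|] [y|]; last by rewrite /= mulr1.
- rewrite -(ler_pXn2r (n := 2)) ?nnegrE ?Nd_ge0 ?mulr_ge0 ?(ltW (Wt_gt0 _)) // exprMn !Wt_sq.
  by have := ip_height 1 (hv x) (hv y); rewrite expr1n mul1r.
- by have := Wt_ge1 (Some x); rewrite /= mulr1.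
- by have := Wt_ge1 (Some y); rewrite /= mul1r.
Qed.

Lemma chordal_le2 p q : chordal p q <= 2.
Proof.
rewrite chordalE ler_pdivrMr ?mulr_gt0 ?Wt_gt0 // ler_pM2l //; exact: Nd_le.
Qed.

Lemma chordal_sep p q : chordal p q = 0 -> p = q.
Proof.
rewrite chordalE => /eqP; rewrite mulf_eq0 invr_eq0 mulf_eq0 mulf_eq0 !(gt_eqF (Wt_gt0 _)) orbF orbF.
by rewrite (@pnatr_eq0 R 2) /= => /eqP; exact: Nd_eq0.
Qed.

Lemma hcons_proof (x : @Hpt R d) (a : R) : in_H (dsucc d) (scons a (sval x)).
Proof.
case: x => x [h1 h2]; split; first exact: scons_fin.
by case: d h2 => [n|] //= h2 _ [<-] [|i] //= ni; apply: (h2 n).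
Qed.

Definition hcons (a : R) (x : @Hpt R d) : @Hpt R (dsucc d) := exist _ _ (hcons_proof x a).

Lemma htail_proof (y : @Hpt R (dsucc d)) : in_H d (fun i => sval y i.+1).
Proof.
case: y => y [h1 h2]; split; first exact: tail_fin.
by move=> n E i ni; apply: (h2 n.+1) => //; rewrite E.
Qed.

Definition htail (y : @Hpt R (dsucc d)) : @Hpt R d := exist _ _ (htail_proof y).

End Model.

Section Model2.
Context {R : realType} (d : option nat).
Notation V := (l2space (R := R)).
Implicit Types (p q : @hat R d) (x y : @Hpt R d).

Lemma hcons_htail (y : @Hpt R (dsucc d)) : hcons (sval y 0%N) (htail y) = y.
Proof. by apply: hv_inj; apply: l2_ext => -[|i]. Qed.

Lemma nv_hcons (a b : R) x y :
  nv (hv (hcons a x) - hv (hcons b y)) ^+ 2 = (a - b) ^+ 2 + nv (hv x - hv y) ^+ 2.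
Proof. by rewrite !nv_sq /ip /= (@ip_coord0 _ _ _ (hv x - hv y) (hv x - hv y)) // expr2. Qed.

Lemma nv_hcons1 (a : R) x : nv (hv (hcons a x)) ^+ 2 = a ^+ 2 + nv (hv x) ^+ 2.
Proof. by rewrite !nv_sq /ip /= (@ip_coord0 _ _ _ (hv x) (hv x)) // expr2. Qed.

Lemma nv_hconsB (a : R) x y : nv (hv (hcons a x) - hv (hcons a y)) = nv (hv x - hv y).
Proof.
apply: (@pexpIrn _ 2) => //; rewrite ?nnegrE ?nv_ge0 //.
by rewrite (nv_hcons a a x y) subrr expr0n add0r.
Qed.

Definition emb p : @hat R (dsucc d) := omap (hcons 0) p.

Lemma embedsP p (q : @hat R (dsucc d)) : embeds p q <-> q = emb p.
Proof.
case: p q => [x|] [y|] //=; split=> //.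
  by move=> [h1 h2]; congr Some; apply: hv_inj; apply: l2_ext => -[|i] /=.
by case=> ->.
Qed.

Lemma Nd_emb p q : Nd (emb p) (emb q) = Nd p q.
Proof.
by case: p q => [x|] [y|] //=; exact: nv_hconsB.
Qed.

Lemma Wt_emb p : Wt (emb p) = Wt p.
Proof. by case: p => [x|] //=; rewrite nv_hcons1 expr0n add0r. Qed.

Lemma chordal_emb p q : chordal (emb p) (emb q) = chordal p q.
Proof. by rewrite !chordalE Nd_emb !Wt_emb. Qed.

Lemma in_H0 : in_H d (fun=> 0 : R).
Proof.
split=> //; apply/sqn_finP; exists 0 => n; by rewrite big1 // => i _; rewrite expr0n.
Qed.

Definition h0 : @Hpt R d := exist _ _ in_H0.

Lemma hv0 : hv h0 = 0.
Proof. exact: l2_ext. Qed.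

Definition org : @hat R (dsucc d) := Some (hcons 1 h0).

Lemma originP (q : @hat R (dsucc d)) : origin q <-> q = org.
Proof.
split=> [[y [-> [h1 h2]]]|->]; last by exists (hcons 1 h0).
by congr Some; apply: hv_inj; apply: l2_ext => -[|i] /=.
Qed.

Lemma Wt_org : Wt org = Num.sqrt 2.
Proof. by rewrite /= nv_hcons1 hv0 nv0 expr0n addr0 expr1n. Qed.

Lemma Nd_org p : Nd org (emb p) = Wt p.
Proof.
case: p => [x|] //=; apply: (@pexpIrn _ 2) => //; rewrite ?nnegrE ?nv_ge0 ?sqrtr_ge0 //.
by rewrite -[Num.sqrt _]/(Wt (Some x)) Wt_sq nv_hcons hv0 sub0r nvN subr0 expr1n.
Qed.

(** The base point is equidistant from the whole boundary. Hence its distance to the boundary after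
    an extended Moebius map reads off the conformal factor. *)
Lemma chordal_org p : chordal org (emb p) = Num.sqrt 2.
Proof.
rewrite chordalE Nd_org Wt_org Wt_emb; have h2 : 0 < Num.sqrt 2 :> R by rewrite sqrtr_gt0.
have := Wt_gt0 p => hp; have E : Num.sqrt 2 ^+ 2 = 2 :> R by rewrite sqr_sqrtr.
rewrite -{1}E; field; by rewrite !gt_eqF.
Qed.

(** In the triangle with vertices [y], [p], [q], base times height is at most the product of the two
    other sides, and the height is at least the distance of [y] from the boundary. *)
Lemma Nd_height (y : @Hpt R (dsucc d)) p q :
  0 <= sval y 0%N -> sval y 0%N * Nd p q <= Nd (Some y) (emb p) * Nd (Some y) (emb q).
Proof.
set t := sval y 0%N; move=> t0; pose z := htail y.
have Ny x : Nd (Some y) (emb (Some x)) ^+ 2 = t ^+ 2 + nv (hv z - hv x) ^+ 2.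
  by rewrite /= -[y in LHS]hcons_htail nv_hcons subr0.
have Nt x : t <= Nd (Some y) (emb (Some x)).
  rewrite -(ler_pXn2r (n := 2)) ?nnegrE ?Nd_ge0 // Ny lerDl; exact: sqr_ge0.
case: p q => [u|] [v|] /=; rewrite ?mulr1 ?mul1r ?mulr0 //; [|exact: Nt..].
have n0 := nv_ge0 (hv u - hv v).
have N1 := Nd_ge0 (Some y) (emb (Some u)); have N2 := Nd_ge0 (Some y) (emb (Some v)).
have := ip_height t (hv z - hv v) (hv z - hv u).
have -> : hv z - hv v - (hv z - hv u) = hv u - hv v by vring.
rewrite -!Ny -!exprMn; move: n0 N1 N2; rewrite /=.
move: (nv (hv u - hv v)) (nv (hv y - hv (hcons 0 u))) (nv (hv y - hv (hcons 0 v))) => a b c a0 b0 c0.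
by rewrite ler_pXn2r ?nnegrE ?mulr_ge0 // (mulrC c).
Qed.

Lemma Nd_foot (y : @Hpt R (dsucc d)) : 0 <= sval y 0%N ->
  Nd (Some y) (emb (Some (htail y))) = sval y 0%N.
Proof.
move=> t0; apply: (@pexpIrn _ 2) => //; rewrite ?nnegrE ?Nd_ge0 //.
by rewrite /= -{1}[y]hcons_htail nv_hcons subr0 subrr nv0 expr0n addr0.
Qed.

End Model2.

Section Phi.
Context {R : realType} (d : option nat).
Notation V := (l2space (R := R)).

Definition one_hv (x : @Hpt R d) : V := hv (hcons 1 x).

Lemma one_hv_neq0 x : one_hv x <> 0.
Proof.
move=> E; have : (one_hv x : l2) 0%N = 0 by rewrite E.
by move/eqP; rewrite /= oner_eq0.
Qed.

Lemma nv_one_hv x : nv (one_hv x) = Wt (Some x).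
Proof.
apply: (@pexpIrn _ 2) => //; rewrite ?nnegrE ?nv_ge0 ?(ltW (Wt_gt0 _)) //.
by rewrite nv_hcons1 Wt_sq expr1n.
Qed.

(* Stereographic projection onto a sphere of diameter 2, based at [0]. *)
Definition Phi (p : @hat R d) : V := if p is Some x then 2 *: iv (one_hv x) else 0.

Lemma chordal_Phi p q : chordal p q = nv (Phi p - Phi q).
Proof.
have n2 : `|2| = 2 :> R by rewrite ger0_norm.
rewrite chordalE; case: p q => [x|] [y|] /=.
- rewrite -scalerBr nvZ n2 iv_dist; [|exact: one_hv_neq0..].
  by rewrite !nv_one_hv mulrA (nv_hconsB 1 x y).
- by rewrite subr0 nvZ n2 iv_nv nv_one_hv !mulr1.
- by rewrite sub0r nvN nvZ n2 iv_nv nv_one_hv mulr1 mul1r.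
- by rewrite subrr nv0 mulr0 mul0r.
Qed.

Lemma chordal_pd : pmetric (@chordal R d).
Proof. exact: (Phi_pd chordal_Phi). Qed.

(** Similarities and inversions both multiply [Nd] by a product of one factor per point, at infinity
    too, and this form is stable under composition. *)
Lemma Nd_mobius (f : @hat R d -> @hat R d) : mobius f ->
  exists nu : @hat R d -> R, (forall p, 0 < nu p) /\ forall p q, Nd (f p) (f q) = nu p * nu q * Nd p q.
Proof.
elim=> {f} [f [f0 [fS [_ [lam [lam0 hf]]]]] | f [a [r [r0 [f0 [fa hf]]]]] | f g _ [nf [nf0 hf]] _ [ng [ng0 hg]]].
- have [F hF] := choice fS; have s0 : 0 < Num.sqrt lam by rewrite sqrtr_gt0.
  have ss : Num.sqrt lam * Num.sqrt lam = lam by rewrite -expr2 sqr_sqrtr // ltW.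
  exists (fun p => if p is Some _ then Num.sqrt lam else (Num.sqrt lam)^-1); split.
    by case=> [x|] //; rewrite invr_gt0.
  case=> [x|] [y|]; rewrite ?f0 ?hF /=.
  + by rewrite ss -!nrm_sub; apply: hf.
  + by rewrite mulfV ?gt_eqF // mul1r.
  + by rewrite mulVf ?gt_eqF // mul1r.
  + by rewrite mulr0.
- have ch (x : @Hpt R d) : exists y, x <> a -> f (Some x) = Some y /\
     hv y - hv a = r ^+ 2 *: iv (hv x - hv a).
  { have [->|xa] := pselect (x = a); first by exists a.
    have [|y [h1 h2]] := hf x; first by move=> E; apply: xa; apply: hv_inj; apply: l2_ext => i; rewrite /= E.
    exists y => _; split => //; apply: l2_ext => i.
    have := h2 i; rewrite nrm_sub nv_sq => E.
    rewrite l2ZE /iv l2ZE !l2DE !l2NE /= E /ip /=; ring.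
  }
  have [F hF] := choice ch.
  have Fa x : x <> a -> nv (hv (F x) - hv a) = r ^+ 2 / nv (hv x - hv a).
  { move=> xa; have [_ ->] := hF x xa; by rewrite nvZ iv_nv ger0_norm // exprn_ge0 // ltW.
  }
  have na x : x <> a -> 0 < nv (hv x - hv a).
  { move=> xa; apply: nv_gt0 => /eqP; rewrite subr_eq0 => /eqP /hv_inj; exact: xa.
  }
  have FF x y : x <> a -> y <> a -> nv (hv (F x) - hv (F y)) =
    r / nv (hv x - hv a) * (r / nv (hv y - hv a)) * nv (hv x - hv y).
  { move=> xa ya; have [_ E1] := hF x xa; have [_ E2] := hF y ya.
    have -> : hv (F x) - hv (F y) = r ^+ 2 *: (iv (hv x - hv a) - iv (hv y - hv a)).
      by rewrite scalerBr -E1 -E2; vring.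
    have x0 := na x xa; have y0 := na y ya.
    rewrite nvZ ger0_norm ?exprn_ge0 ?(ltW r0) // iv_dist.
    - have -> : hv x - hv a - (hv y - hv a) = hv x - hv y by vring.
      move: x0 y0; move: (nv (hv x - hv a)) (nv (hv y - hv a)) (nv (hv x - hv y)) => A B C A0 B0.
      by field; rewrite !gt_eqF.
    - by move=> E; move: x0; rewrite E nv0 ltxx.
    - by move=> E; move: y0; rewrite E nv0 ltxx.
  }
  exists (fun p => if p is Some x then (if pselect (x = a) then r^-1 else r / nv (hv x - hv a)) else r).
  split.
    move=> [x|] //; case: pselect => xa; [by rewrite invr_gt0 | by apply: divr_gt0 => //; apply: na].
  have rr : r * r^-1 = 1 by rewrite mulfV // gt_eqF.
  have hFx x (xa : x <> a) : f (Some x) = Some (F x) by case: (hF x xa).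
  case=> [x|] [y|]; rewrite ?f0.
  + case: pselect => [xa|xa] /=; case: pselect => [ya|ya] /=.
    * by rewrite xa ya fa /= subrr nv0 mulr0.
    * rewrite xa fa hFx //= (nvB (hv a)); move: (na y ya); move: (nv (hv y - hv a)) => B B0.
      by field; rewrite !gt_eqF.
    * rewrite ya fa hFx //=; move: (na x xa); move: (nv (hv x - hv a)) => B B0.
      by field; rewrite !gt_eqF.
    * by rewrite !hFx //= FF.
  + case: pselect => [xa|xa] /=; first by rewrite xa fa /= mulr1 mulrC rr.
    rewrite hFx //= Fa //; move: (na x xa); move: (nv (hv x - hv a)) => B B0.
    by field; rewrite !gt_eqF.
  + case: pselect => [xa|xa] /=; first by rewrite xa fa /= mulr1 rr.
    rewrite hFx //= (nvB (hv a)) Fa //; move: (na y xa); move: (nv (hv y - hv a)) => B B0.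
    by field; rewrite !gt_eqF.
  + by rewrite /= subrr nv0 mulr0.
- exists (fun p => nf (g p) * ng p); split; first by move=> p; apply: mulr_gt0.
  by move=> p q; rewrite /= hf hg; ring.
Qed.

Lemma chordal_mobius (f : @hat R d -> @hat R d) : mobius f ->
  exists mu : @hat R d -> R, (forall p, 0 < mu p) /\
    forall p q, chordal (f p) (f q) = mu p * mu q * chordal p q.
Proof.
move=> /Nd_mobius [nu [nu0 h]]; exists (fun p => nu p * Wt p / Wt (f p)); split.
  by move=> p; rewrite !mulr_gt0 ?invr_gt0 ?Wt_gt0.
move=> p q; rewrite !chordalE h; have := Wt_gt0 p; have := Wt_gt0 q.
have := Wt_gt0 (f p); have := Wt_gt0 (f q) => *; field; by rewrite !gt_eqF.
Qed.

End Phi.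

(** * Inverses and continuity of Moebius maps *)

Section MobiusInv.
Context {R : realType} (d : option nat).
Notation V := (l2space (R := R)).

Lemma ivZ (W : ipspace R) (a : R) (v : W) : iv (a *: v) = a^-1 *: iv v.
Proof.
have [->|a0] := eqVneq a 0; first by rewrite scale0r invr0 scale0r /iv scaler0.
have [v0|v0] := eqVneq (ip v v) 0; first by rewrite (ip_eq0 v0) scaler0 /iv scaler0 scaler0.
rewrite /iv ipZl ipZr !scalerA; congr (_ *: _); field; by rewrite a0 v0.
Qed.

Lemma ivK (W : ipspace R) (v : W) : iv (iv v) = v.
Proof.
have [v0|v0] := eqVneq (ip v v) 0; first by rewrite (ip_eq0 v0) /iv !scaler0.
have {1}-> : iv v = (ip v v)^-1 *: v by [].
by rewrite ivZ invrK /iv scalerA mulfV // scale1r.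
Qed.

(** [mobius] is generated by composition only, so inverses must be found for the generators; an
    inversion is its own inverse. *)
Lemma mobius_inv (f : @hat R d -> @hat R d) : mobius f ->
  exists f', [/\ mobius f', forall p, f (f' p) = p & forall p, f' (f p) = p].
Proof.
elim=> {f} [f [f0 [fS [fO [lam [lam0 hf]]]]] | f [a [r [r0 [f0 [fa hf]]]]] | f g _ [f' [mf hf1 hf2]] _ [g' [mg hg1 hg2]]].
- have [F hF] := choice fO; have [F2 hF2] := choice fS.
  have finj x x' : f (Some x) = f (Some x') -> x = x'.
  { move=> E; rewrite !hF2 in E; case: E => E.
    have := hf _ _ _ _ (hF2 x) (hF2 x'); rewrite E !nrm_sub subrr nv0 => /esym/eqP.
    by rewrite mulf_eq0 gt_eqF //= => /eqP /nv_sub_eq0 /hv_inj.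
  }
  pose f' (p : @hat R d) : @hat R d := if p is Some y then Some (F y) else None.
  have h1 p : f (f' p) = p by case: p => [y|] //=; rewrite hF.
  have h2 p : f' (f p) = p.
  { case: p => [x|]; last by rewrite f0.
    by rewrite hF2 /=; congr Some; apply: finj; rewrite hF hF2.
  }
  exists f'; split => //; apply: mob_sim; split => //; split; first by move=> x; exists (F x).
  split; first by move=> y; exists (F2 y); rewrite -hF2 h2.
  exists lam^-1; split; first by rewrite invr_gt0.
  move=> x y x' y' [<-] [<-]; have := hf _ _ _ _ (hF x) (hF y); rewrite !nrm_sub.
  move: (nv _) (nv _) => A B ->; by rewrite mulKf // gt_eqF.
- have ff p : f (f p) = p.
  { case: p => [x|]; last by rewrite f0.
    have [->|xa] := pselect (x = a); first by rewrite fa.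
    have key u : u <> a -> exists v, f (Some u) = Some v /\ hv v - hv a = r ^+ 2 *: iv (hv u - hv a).
    { move=> ua; have [|v [h1 h2]] := hf u.
        by move=> E; apply: ua; apply: hv_inj; apply: l2_ext => i; rewrite /= E.
      exists v; split => //; apply: l2_ext => i.
      have := h2 i; rewrite nrm_sub nv_sq => E.
      rewrite l2ZE /iv l2ZE !l2DE !l2NE /= E /ip /=; ring.
    }
    have rn : r ^+ 2 != 0 by rewrite expf_neq0 // gt_eqF.
    have [y [-> Ey]] := key x xa.
    have ya : y <> a.
    { move=> E; move: Ey; rewrite E subrr => E0; apply: xa; apply: hv_inj.
      apply/eqP; rewrite -subr_eq0; apply/eqP; rewrite -[hv x - hv a]ivK.
      have -> : iv (hv x - hv a) = 0.
        by rewrite -[iv _]scale1r -(mulVf rn) -scalerA -E0 scaler0.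
      by rewrite /iv scaler0.
    }
    have [z [-> Ez]] := key y ya; congr Some; apply: hv_inj.
    move: Ez; rewrite Ey ivZ ivK scalerA mulfV // scale1r => E.
    by rewrite -[hv z](subrK (hv a)) E subrK.
  }
  by exists f; split => //; apply: mob_inv; exists a, r.
- exists (g' \o f'); split; first exact: mob_comp.
    by move=> p /=; rewrite hg1 hf1.
  by move=> p /=; rewrite hf2 hg2.
Qed.

Lemma mobius_cont (f : @hat R d -> @hat R d) u p : mobius f -> hconv u p -> hconv (f \o u) (f p).
Proof.
move=> /chordal_mobius [mu [mu0 h]] hu e e0; have [d0 dC dt] := @chordal_pd R d.
have [a pa] : exists a, p <> a.
{ case: p {hu} => [x|]; [by exists None | by exists (Some (h0 d))].
}
have D0 : 0 < chordal p a by apply: (Phi_gt0 (@chordal_sep R d) (@chordal_Phi R d)).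
set D := chordal p a in D0.
(* Comparison with a fixed point [a] bounds the factors [mu (u n)], since chordal distances are at
   most 2. *)
pose B := 4 / (mu a * D); have B0 : 0 < B by rewrite /B; apply: divr_gt0 => //; apply: mulr_gt0.
have C0 : 0 < B * mu p by apply: mulr_gt0.
have [|N hN] := hu (Num.min (D / 2) (e / (B * mu p))).
  by rewrite lt_min; apply/andP; split; [lra | apply: divr_gt0].
exists N => n /hN; rewrite lt_min => /andP[h1 h2] /=.
have far : D / 2 <= chordal (u n) a by have := dt p (u n) a; rewrite (dC p (u n)) -/D; lra.
have mB : mu (u n) <= B.
{ have := chordal_le2 (f (u n)) (f a); rewrite h => h3.
  rewrite /B ler_pdivlMr; last by apply: mulr_gt0.
  have h4 : mu (u n) * mu a * (D / 2) <= 2.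
    by apply: le_trans h3; rewrite ler_pM2l //; apply: mulr_gt0.
  move: h4; move: (mu (u n)) (mu a) => x y; lra.
}
rewrite h -mulrA; move: h2; rewrite ltr_pdivlMr // => h2.
apply: (@le_lt_trans _ _ (B * (mu p * chordal (u n) p))).
  by apply: ler_wpM2r => //; apply: mulr_ge0; [exact: ltW | exact: (pmetric_ge0 (@chordal_pd R d))].
by rewrite mulrA mulrC.
Qed.

End MobiusInv.

(** * Moebius groups as systems of zooms *)

Section Group.
Context {R : realType} (d : option nat) (G : set (@hat R d -> @hat R d)).
Hypothesis hG : mobius_group G.
Notation K := (limit_set G).
Notation T := (@hat R d).
Notation org := (@org R d).

(** The height in chordal normalisation; [zoom_identity] shows that it is the exact conformal
    constant of a zoom. *)
Definition kapf (q : @hat R (dsucc d)) : R :=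
  if q is Some y then 4 * sval y 0%N / Wt q ^+ 2 else 0.

Definition Zm (g h : T -> T) (kap : R) (m : T -> R) := [/\ G g /\ G h,
  (forall u, h (g u) = u) /\ (forall u, g (h u) = u)
  & exists gh, [/\ poincare_ext g gh, m = (fun u => chordal (gh org) (emb u)) & kap = kapf (gh org)]].

Lemma ext_emb g gh u : @poincare_ext R d g gh -> gh (emb u) = emb (g u).
Proof. by move=> [_ [_ h]]; apply/embedsP; apply: h; apply/embedsP. Qed.

Lemma ext_upper g gh : @poincare_ext R d g gh -> exists2 y, gh org = Some y & 0 < sval y 0%N.
Proof.
move=> [_ [h _]]; have : upper (gh org) by apply: (h org).1; rewrite /=; exact: ltr01.
by case: (gh org) => // y hy; exists y.
Qed.

Lemma ext_comp g gh g' gh' : @poincare_ext R d g gh -> @poincare_ext R d g' gh' ->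
  poincare_ext (g \o g') (gh \o gh').
Proof.
move=> [m1 [u1 e1]] [m2 [u2 e2]]; split; first exact: mob_comp.
split=> [q|p q /e2 /e1 //]; apply: (iff_trans (u2 q)); exact: u1.
Qed.

Lemma ext_inv g gh h : @poincare_ext R d g gh -> (forall u, g (h u) = u) ->
  exists hh, poincare_ext h hh.
Proof.
move=> pe gK; have [m1 [u1 e1]] := pe; have [hh [mh h1 h2]] := mobius_inv m1.
exists hh; split => //; split.
  by move=> q; rewrite (u1 (hh q)) h1.
move=> p q /embedsP ->; apply/embedsP.
by rewrite -{1}(gK p) -(ext_emb _ pe) h2.
Qed.

(** The extension multiplies chordal distances by the factors [mu], and the origin is at distance
    [Num.sqrt 2] from the boundary, so the identity holds with the constant [2 * mu org ^+ 2]. Two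
    pairs of points identify it with [kapf]: the images of the antipodal points 0 and infinity give
    one inequality, the foot of [gh org] paired with infinity gives the other. *)
Lemma zoom_identity g gh h : @poincare_ext R d g gh -> (forall u, h (g u) = u) ->
  (forall u, g (h u) = u) ->
  [/\ 0 < kapf (gh org), forall u, 0 < chordal (gh org) (emb u) & forall u v,
  chordal (h u) (h v) * (chordal (gh org) (emb u) * chordal (gh org) (emb v)) =
  kapf (gh org) * chordal u v].
Proof.
move=> pe hK gK; have [mg _] := pe; have [mu [mu0 hmu]] := chordal_mobius mg.
have [y Ey t0] := ext_upper pe; set t := sval y 0%N in t0.
have s2 : 0 < Num.sqrt 2 :> R by rewrite sqrtr_gt0.
have ss : Num.sqrt 2 * Num.sqrt 2 = 2 :> R by rewrite -expr2 sqr_sqrtr.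
pose m u := chordal (gh org) (emb u).
have mE u : m u = Num.sqrt 2 * mu org * mu (emb (h u)).
{ by rewrite /m -{1}(gK u) -(ext_emb _ pe) hmu chordal_org; ring.
}
pose k0 := 2 * mu org ^+ 2.
have eq0 u v : chordal (h u) (h v) * (m u * m v) = k0 * chordal u v.
{ have -> : chordal u v = mu (emb (h u)) * mu (emb (h v)) * chordal (h u) (h v).
    by rewrite -(chordal_emb (h u) (h v)) -hmu !(ext_emb _ pe) !gK chordal_emb.
  rewrite !mE /k0; move: (mu (emb _)) (mu (emb _)) (chordal _ _) (mu org) => b a c e.
  have -> : c * (Num.sqrt 2 * e * a * (Num.sqrt 2 * e * b)) = (Num.sqrt 2 * Num.sqrt 2) * (e ^+ 2 * a * b * c) by ring.
  by rewrite ss; ring.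
}
have m0 u : 0 < m u by rewrite mE !mulr_gt0.
have k00 : 0 < k0 by rewrite /k0 mulr_gt0 // exprn_gt0.
have W0 := Wt_gt0 (Some y).
have mN u : m u = 2 * Nd (Some y) (emb u) / (Wt (Some y) * Wt u) by rewrite /m Ey chordalE Wt_emb.
have kE : kapf (gh org) = k0.
{ rewrite Ey /kapf -/t; apply/eqP; rewrite eq_le; apply/andP; split.
  - pose u := g (Some (h0 d)); pose v := g None.
    have := eq0 u v; rewrite !hK.
    have -> : chordal (Some (h0 d)) None = 2 :> R.
      by rewrite chordalE /= hv0 nv0 expr0n addr0 sqrtr1 !mulr1 divr1.
    rewrite !mN chordalE => E.
    have hN := Nd_height u v (ltW t0); rewrite -/t in hN.
    have Wu := Wt_gt0 u; have Wv := Wt_gt0 v.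
    have E2 : 4 * (Nd (Some y) (emb u) * Nd (Some y) (emb v)) = k0 * Nd u v * Wt (Some y) ^+ 2.
    { move: E Wu Wv W0; move: (Nd (Some y) (emb u)) (Nd (Some y) (emb v)) (Nd u v) (Wt u) (Wt v) (Wt (Some y)).
      move=> a b c p q w E p0 q0 w0.
      have := congr1 (fun z => z * (p * q * w ^+ 2) / 2) E.
      have -> : 2 * (2 * a / (w * p) * (2 * b / (w * q))) * (p * q * w ^+ 2) / 2 = 4 * (a * b).
        by field; rewrite !gt_eqF.
      have -> : k0 * (2 * c / (p * q)) * (p * q * w ^+ 2) / 2 = k0 * c * w ^+ 2.
        by field; rewrite !gt_eqF.
      exact.
    }
    have N0 : 0 < Nd u v.
    { rewrite lt_neqAle Nd_ge0 andbT eq_sym; apply/eqP => E0.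
      have := eq0 u v; rewrite (chordalE u v) E0 mulr0 mul0r mulr0 => /eqP.
      rewrite mulf_eq0 mulf_eq0 !(gt_eqF (m0 _)) !orbF !hK.
      by move/eqP/chordal_sep.
    }
    rewrite ler_pdivrMr ?exprn_gt0 // -(ler_pM2r N0).
    have -> : k0 * Wt (Some y) ^+ 2 * Nd u v = k0 * Nd u v * Wt (Some y) ^+ 2 by ring.
    by rewrite -E2 -mulrA ler_pM2l.
  - pose u : T := Some (htail y); have := eq0 u None.
    rewrite !mN (Nd_foot (ltW t0)) -/t (chordalE u None) => E.
    have c2 := chordal_le2 (h u) (h None).
    have Wu := Wt_gt0 u; rewrite ler_pdivlMr ?exprn_gt0 //.
    have -> : k0 * Wt (Some y) ^+ 2 = k0 * (2 * Nd u None / (Wt u * Wt (None : T))) * (Wt u * Wt (Some y) ^+ 2 / 2).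
      move: Wu; rewrite /= mulr1; move: (Num.sqrt (1 + nv (hv (htail y)) ^+ 2)) (Num.sqrt _) => p q p0.
      by field; rewrite gt_eqF.
    rewrite -E.
    have -> : Nd (Some y) (emb (None : T)) = 1 by [].
    have -> : Wt (None : T) = 1 by [].
    move: c2 Wu W0; move: (chordal _ _) (Wt u) (Wt (Some y)) => a p q a2 p0 q0.
    have -> : a * (2 * t / (q * p) * (2 * 1 / (q * 1))) * (p * q ^+ 2 / 2) = 2 * t * a.
      by field; rewrite !gt_eqF.
    have -> : 4 * t = 2 * t * 2 by ring.
    by rewrite ler_pM2l // mulr_gt0.
}
by rewrite kE; split.
Qed.

Lemma G_inv_ext g : G g -> exists h, [/\ G h, forall u, h (g u) = u & forall u, g (h u) = u].
Proof.
have [_ [_ [_ hI]]] := hG; move=> /hI [h [Gh [h1 h2]]]; exists h; split => // u.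
  by have := congr1 (fun f => f u) h1.
by have := congr1 (fun f => f u) h2.
Qed.

Lemma limit_seqP p : K p <-> exists gs ghs, (forall n, G (gs n) /\ poincare_ext (gs n) (ghs n)) /\
  hconv (fun n => ghs n org) (emb p).
Proof.
split=> [[gs [ghs [bo [q [/originP -> [/embedsP -> [h1 h2]]]]]]]|[gs [ghs [h1 h2]]]].
  by exists gs, ghs.
by exists gs, ghs, org, (emb p); split; [apply/originP | split; [apply/embedsP | ]].
Qed.

Lemma limit_set_inv g gh p : G g -> poincare_ext g gh -> K p -> K (g p).
Proof.
move=> Gg pe /limit_seqP [gs [ghs [h1 h2]]]; apply/limit_seqP.
have [_ [_ [hC _]]] := hG.
exists (fun n => g \o gs n), (fun n => gh \o ghs n); split.
  by move=> n; have [Gn pn] := h1 n; split; [apply: hC | apply: ext_comp].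
by rewrite -(ext_emb _ pe); have [mg _] := pe; exact: (mobius_cont mg h2).
Qed.

(** The constant [4 / D] comes from [zoom_identity] for [u] and a point at distance at least [D]
    from it, the other chordal distances being at most 2. *)
Lemma Zm_zmap (D : R) : 0 < D -> (forall u, K u -> exists2 v, K v & D <= chordal u v) ->
  forall g h kap m, Zm g h kap m -> zmap (@chordal R d) K (4 / D) g h kap m.
Proof.
move=> D0 hD g h kap m [[Gg Gh] [hg gh_] [gh [pe -> ->]]].
have [k0 m0 eq0] := zoom_identity pe hg gh_; have [hh peh] := ext_inv pe gh_.
have [_ dC dt] := @chordal_pd R (dsucc d).
split => //.
- by move=> u; apply: limit_set_inv pe.
- by move=> u; apply: limit_set_inv peh.
- by move=> u _; exact: chordal_le2.
- move=> u Ku; have [v Kv Dv] := hD u Ku.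
  have := eq0 u v; have := chordal_le2 (h u) (h v).
  have := chordal_le2 (gh org) (emb v); have := m0 u; have := m0 v.
  have := pmetric_ge0 (@chordal_pd R d) (h u) (h v).
  rewrite mulrAC ler_pdivlMr //; move: Dv k0.
  move: (chordal u v) (chordal (h u) (h v)) (chordal (gh org) (emb u)) (chordal (gh org) (emb v)) (kapf _).
  move=> a b x y k Da k0 b0 y0 x0 y2 b2 E.
  apply: (@le_trans _ _ (k * a)); first by rewrite ler_pM2l.
  rewrite -E; have : b * (x * y) <= 2 * (x * 2).
    by apply: ler_pM => //; [apply: mulr_ge0; exact: ltW | rewrite ler_pM2l].
  lra.
- move=> u v _ _; rewrite -(chordal_emb u v).
  have := dt (emb u) (gh org) (emb v); rewrite (dC (emb u) (gh org)) //.
- move=> u v _ _; rewrite -(chordal_emb u v).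
  have := dt (gh org) (emb v) (emb u); rewrite (dC (emb v) (emb u)) //.
Qed.

Lemma Zm_comp g h kap m g' h' kap' m' : Zm g h kap m -> Zm g' h' kap' m' ->
  exists kap'' m'', Zm (g \o g') (h' \o h) kap'' m''.
Proof.
move=> [[Gg Gh] [hg gh_] [gh [pe _ _]]] [[Gg' Gh'] [hg' gh'_] [gh' [pe' _ _]]].
have [_ [_ [hC _]]] := hG.
exists (kapf ((gh \o gh') org)), (fun u => chordal ((gh \o gh') org) (emb u)); split.
- by split; apply: hC.
- by split=> u /=; rewrite ?hg ?hg' ?gh'_ ?gh_.
- by exists (gh \o gh'); split => //; apply: ext_comp.
Qed.

Lemma Zm_of g gh : G g -> poincare_ext g gh -> exists h, Zm g h (kapf (gh org)) (fun u => chordal (gh org) (emb u)).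
Proof.
move=> Gg pe; have [h [Gh h1 h2]] := G_inv_ext Gg; exists h; split => //; by exists gh.
Qed.

Lemma Zm_lim (D : R) : 0 < D -> (forall u, K u -> exists2 v, K v & D <= chordal u v) ->
  forall x (e : R), K x -> 0 < e -> exists g h kap m, [/\ Zm g h kap m, kap < e & m x < e].
Proof.
move=> D0 hD x e Kx e0; have c0 : 0 < 4 / D by apply: divr_gt0.
have /limit_seqP [gs [ghs [h1 h2]]] := Kx.
have [|N hN] := h2 (Num.min e (e / (4 / D))); first by rewrite lt_min e0 /=; apply: divr_gt0.
have := hN N (leqnn N); rewrite lt_min => /andP[a b].
have [h hz] := Zm_of (h1 N).1 (h1 N).2; do 4!eexists; split; [exact: hz | | exact: a].
apply: le_lt_trans (zm_low (Zm_zmap D0 hD hz) Kx) _.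
by rewrite mulrC -ltr_pdivlMr.
Qed.

(** Near the finite point [p] the chordal and Euclidean metrics are comparable, so the cone
    condition of [radial_set] becomes one for [m p] and [kap]. *)
Lemma radial_Lr (D : R) : 0 < D -> (forall u, K u -> exists2 v, K v & D <= chordal u v) ->
  radial_set G `<=` Lr K Zm.
Proof.
move=> D0 hD p [Kp [x [Ep [gs [ghs [bo [q [C [/originP -> [/embedsP -> [h1 [h2 h3]]]]]]]]]]]].
have [_ dC dt] := @chordal_pd R (dsucc d).
have c0 : 0 < 4 / D by apply: divr_gt0.
have Wp := Wt_gt0 p.
exists (`|C| + 1); split => // e e0.
have [|N hN] := h2 (Num.min (e / (4 / D)) (Wt p)^-1).
  by rewrite lt_min; apply/andP; split; [apply: divr_gt0 | rewrite invr_gt0].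
have := hN N (leqnn N); rewrite lt_min => /andP[a b].
have [Gn pn] := h1 N; have [h hz] := Zm_of Gn pn; do 4!eexists; split; first exact: hz.
  apply: le_lt_trans (zm_low (Zm_zmap D0 hD hz) Kp) _.
  by rewrite mulrC -ltr_pdivlMr.
have [y Ey t0] := ext_upper pn; have [y' [z [Ey' [Ez hC]]]] := h3 N.
rewrite Ey in Ey' hC b *; case: Ey' => Ey'; subst y'; rewrite /= in hC.
have W0 := Wt_gt0 (Some y).
have Wy : Wt (Some y) <= 2 * Wt p.
{ have := dt (emb p) (Some y) None; rewrite (dC (emb p) (Some y)) => h4.
  have E1 : chordal (emb p) None = 2 / Wt p.
    rewrite chordalE Wt_emb; have -> : Nd (emb p) None = 1 by rewrite Ep.
    by rewrite -[Wt None]/(1 : R) !mulr1.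
  have E2 : chordal (Some y) None = 2 / Wt (Some y) by rewrite chordalE /= !mulr1.
  rewrite E1 E2 in h4.
  have : (Wt p)^-1 <= 2 / Wt (Some y) by move: h4 b; move: (chordal _ _) => s; lra.
  by rewrite ler_pdivlMr // mulrC ler_pdivrMr.
}
have hN' : Nd (Some y) (emb p) <= C * sval y 0%N.
  by move: hC; rewrite Ez nrm_sub.
rewrite chordalE Wt_emb /kapf.
move: hN' Wy W0 Wp t0; move: (Nd _ _) (Wt (Some y)) (Wt p) (sval y 0%N) => n w v t hn wv w0 v0 t0.
rewrite ltr_pdivrMr ?mulr_gt0 //.
have -> : (`|C| + 1) * (4 * t / w ^+ 2) * (w * v) = 4 * (`|C| + 1) * t * v / w by field; rewrite gt_eqF.
rewrite ltr_pdivlMr //.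
have hC1 : C <= `|C| := ler_norm C; have hC0 := normr_ge0 C.
have q1 : 2 * n * w <= 2 * (`|C| * t) * (2 * v).
{ apply: (@le_trans _ _ (2 * (`|C| * t) * w)).
    apply: ler_wpM2r; first exact: ltW.
    rewrite ler_pM2l //; apply: le_trans hn _; apply: ler_wpM2r => //; exact: ltW.
  by apply: ler_wpM2l => //; rewrite !mulr_ge0 // ltW.
}
apply: le_lt_trans q1 _.
have : 0 < t * v by apply: mulr_gt0.
move: (`|C|) hC0 => c hc0 tv; nra.
Qed.

(** The chordal cone condition makes sense at infinity, whereas [radial_set] contains only finite
    points; hence the first alternative. *)
Lemma Lr_radial p : Lr K Zm p -> p = None \/ radial_set G p.
Proof.
move=> [C [Kp hC]]; case Ep : p => [x|]; [right | by left]; rewrite -Ep; split => //.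
have iv0 (n : nat) : 0 < n.+1%:R^-1 :> R by rewrite invr_gt0 ltr0Sn.
have ch (n : nat) : exists q : (T -> T) * (@hat R (dsucc d) -> @hat R (dsucc d)),
   [/\ G q.1, poincare_ext q.1 q.2, kapf (q.2 org) < n.+1%:R^-1
     & [/\ 0 < kapf (q.2 org), 0 < chordal (q.2 org) (emb p) & chordal (q.2 org) (emb p) < C * kapf (q.2 org)]].
{ have [g [h [kap [m [hz hk hm]]]]] := hC _ (iv0 n).
  have [[Gg Gh] [hg gh_] [gh [pe Em Ek]]] := hz; subst kap m.
  by have [k0 m0 _] := zoom_identity pe hg gh_; exists (g, gh).
}
have [q hq] := choice ch.
have C0 : 0 < C.
{ have [_ _ _ [k0 m0 mk]] := hq 0%N; rewrite -(pmulr_lgt0 C k0); exact: lt_trans mk.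
}
exists x; split => //.
exists (fun n => (q n).1), (fun n => (q n).2), org, (emb p), (2 * C * Wt p); split; first by apply/originP.
split; first by apply/embedsP.
split; first by move=> n; case: (hq n).
split.
  move=> e e0; have eC : 0 < e / C by apply: divr_gt0.
  have [N hN] : exists N : nat, N.+1%:R^-1 < e / C.
    exists (Num.truncn (e / C)^-1); rewrite invf_plt ?posrE //; exact: truncnS_gt.
  exists N => n Nn; have [_ _ k1 [k0 m0 mk]] := hq n; apply: lt_trans mk _.
  rewrite mulrC -ltr_pdivlMr //; apply: lt_trans k1 _; apply: le_lt_trans hN.
  by rewrite lef_pV2 ?posrE ?ltr0Sn // ler_nat.
move=> n; have [_ pn _ [_ _ mk]] := hq n.
have [y Ey t0] := ext_upper pn.
exists y, (hcons 0 x); split => //; split; first by rewrite Ep.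
move: mk; rewrite Ey nrm_sub -[nv _]/(Nd (Some y) (emb (Some x))) -Ep chordalE Wt_emb /kapf /ht.
have W1 := Wt_ge1 (Some y); have W0 := Wt_gt0 (Some y); have Wp := Wt_gt0 p.
move: W1 W0 Wp t0; move: (Nd _ _) (Wt (Some y)) (Wt p) (sval y 0%N) => m w v t w1 w0 v0 t0.
rewrite ltr_pdivrMr ?mulr_gt0 //.
have -> : C * (4 * t / w ^+ 2) * (w * v) = 4 * C * t * v / w by field; rewrite gt_eqF.
move=> h; have : 4 * C * t * v / w <= 4 * C * t * v.
  by rewrite ler_pdivrMr // ler_peMr // !mulr_ge0 // ltW.
move=> h'; have : 2 * m <= 4 * C * t * v by lra.
move=> h''; have -> : 2 * C * v * t = 4 * C * t * v / 2 by field.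
by rewrite ler_pdivlMr // mulrC.
Qed.

Context (U : set (set nat)) (uU : free_ultra U).

Lemma limit_set_closed u p : (forall n, K (u n)) -> ucvg U (@chordal R d) u p -> K p.
Proof.
move=> Ku hu; apply/limit_seqP; have [_ dC dt] := @chordal_pd R (dsucc d).
have iv0 (n : nat) : 0 < n.+1%:R^-1 :> R by rewrite invr_gt0 ltr0Sn.
have ch (n : nat) : exists q : (T -> T) * (@hat R (dsucc d) -> @hat R (dsucc d)),
   (G q.1 /\ poincare_ext q.1 q.2) /\ chordal (q.2 org) (emb p) < 2 * n.+1%:R^-1.
{ have [m /= hm] := u_ex uU (hu _ (iv0 n)).
  have /limit_seqP [gs [ghs [h1 h2]]] := Ku m; have [N hN] := h2 _ (iv0 n).
  exists (gs N, ghs N); split => //=.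
  have := hN N (leqnn N); have := dt (ghs N org) (emb (u m)) (emb p).
  rewrite (chordal_emb (u m) p); move: hm; move: (n.+1%:R^-1 : R) => y; lra.
}
have [q hq] := choice ch; exists (fun n => (q n).1), (fun n => (q n).2); split.
  by move=> n; case: (hq n).
move=> e e0; have e2 : 0 < e / 2 by lra.
have [N hN] := inv_lt uU e2; exists N => n Nn; have [_ h] := hq n; apply: lt_trans h _.
have : n.+1%:R^-1 <= N.+1%:R^-1 :> R by rewrite lef_pV2 ?posrE ?ltr0Sn // ler_nat.
move: hN; move: (n.+1%:R^-1 : R) (N.+1%:R^-1 : R) => y z; lra.
Qed.

(** If no point of [A] were a limit of the sequence, each would have a neighbourhood missed by it
    along [U]; finitely many of these would cover [A]. *)
Lemma hcompact_ucompact (A : set T) : hcompact A -> ucompact U (@chordal R d) A.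
Proof.
move=> hA u Au; apply: contrapT => no; have [_ dC dt] := @chordal_pd R d.
have ch x : exists e : R, 0 < e /\ (A x -> ~ U [set n | chordal (u n) x < e]).
{ have [Ax|] := pselect (A x); last by exists 1.
  apply: contrapT => no'; apply: no; exists x => // e e0; apply: contrapT => nU; apply: no'.
  by exists e.
}
have [e he] := choice ch.
pose W (a : {x | A x}) : set T := [set y | chordal y (sval a) < e (sval a)].
have [||m [f hf]] := hA _ W.
- move=> a y hy; exists (e (sval a) - chordal y (sval a)); split; first by rewrite subr_gt0.
  move=> z hz; rewrite /W /=; have := dt z y (sval a); rewrite (dC z y) /W /= in hy *; lra.
- move=> x Ax; exists (exist _ x Ax) => //; rewrite /W /=.
  have [d0 _ _] := @chordal_pd R d; rewrite d0; by case: (he x).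
have : U [set n | exists j : 'I_m, W (f j) (u n)] by apply: (uA uU) => n; exact: (hf _ (Au n)).
move=> /(u_fin uU) [j hj]; have [_ h] := he (sval (f j)); exact: (h (proj2_sig (f j))).
Qed.

Lemma real_ulim (x : nat -> R) (B : R) : U [set n | `|x n| <= B] -> exists a : R,
  forall e : R, 0 < e -> U [set n | `|x n - a| < e].
Proof.
move=> hB; pose S : set R := [set a | U [set n | a <= x n]].
have S1 : S (- B) by apply: (uS uU) hB => n /=; rewrite ler_norml => /andP[].
have S2 : ubound S B.
{ move=> a Sa; have [n [/= h1 h2]] := u_ex uU (uI uU Sa hB).
  by move: h2; rewrite ler_norml => /andP[_ h2]; apply: le_trans h2.
}
have hS : has_sup S by split; [exists (- B) | exists B].
exists (sup S) => e e0.
have h1 : U [set n | sup S - e < x n].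
{ have : sup S - e < sup S by lra.
  move=> /(sup_gt hS.1) [a Sa ha]; apply: (uS uU) Sa => n /=; exact: lt_le_trans.
}
have h2 : U [set n | x n < sup S + e / 2].
{ apply: (uS uU) (uC uU (_ : ~ U [set n | sup S + e / 2 <= x n])) => [n /= /negP|h].
    by rewrite -ltNge.
  have : sup S + e / 2 <= sup S by apply: sup_upper_bound => //.
  lra.
}
by apply: (uS uU) (uI uU h1 h2) => n /= [a b]; rewrite ltr_norml; lra.
Qed.

End Group.

(** * Compactness in finite dimension *)

Section FiniteDim.
Context {R : realType} (n : nat) (U : set (set nat)) (uU : free_ultra U).
Notation T := (@hat R (Some n)).

Lemma fin_supp_sum (z : nat -> R) : (forall i, (n <= i)%N -> z i = 0) ->
  forall N, \sum_(i < N) z i ^+ 2 <= \sum_(i < n) z i ^+ 2.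
Proof.
move=> hz N; have [Nn|nN] := leqP N n.
  rewrite (big_ord_widen n (fun i => z i ^+ 2) Nn) [X in _ <= X](bigID (fun i : 'I_n => (i < N)%N)) /=.
  by rewrite lerDl; apply: sumr_ge0 => i _; apply: sqr_ge0.
rewrite [X in _ <= X](big_ord_widen N (fun i => z i ^+ 2) (ltnW nN)).
rewrite [X in X <= _](bigID (fun i : 'I_N => (i < n)%N)) /= [X in _ + X]big1 ?addr0 //.
by move=> i; rewrite -leqNgt => ni; rewrite hz // expr0n.
Qed.

Lemma hat_ucompact : ucompact U (@chordal R (Some n)) setT.
Proof.
move=> u _.
have [h|h] := pselect (forall e : R, 0 < e -> U [set m | chordal (u m) None < e]).
  by exists None.
have [e e0 he] : exists2 e : R, 0 < e & U [set m | e <= chordal (u m) None].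
{ apply: contrapT => no; apply: h => e e0; apply: contrapT => nU; apply: no; exists e => //.
  by apply: (uS uU) (uC uU nU) => m /= /negP; rewrite -leNgt.
}
(* [h0] stands in where [u m] is infinite; the complement of those indices belongs to [U]. *)
pose x m : @Hpt R (Some n) := if u m is Some z then z else h0 (Some n).
have ux : U [set m | u m = Some (x m) /\ nv (hv (x m)) <= 2 / e].
{ apply: (uS uU) he => m /=; rewrite /x chordalE; case: (u m) => [z|] /=; last first.
    by rewrite mulr0 mul0r => ?; exfalso; move: e0; lra.
  rewrite !mulr1 => hz; split => //.
  have W0 := Wt_gt0 (Some z : T); rewrite -[Num.sqrt _]/(Wt (Some z : T)) in hz.
  have : nv (hv z) <= Wt (Some z : T).
    rewrite -(ler_pXn2r (n := 2)) ?nnegrE ?nv_ge0 ?(ltW W0) // Wt_sq lerDr //.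
  move=> h1; apply: le_trans h1 _; rewrite ler_pdivlMr // mulrC -ler_pdivlMr //.
}
have ch i : exists a : R, forall q : R, 0 < q -> U [set m | `|sval (x m) i - a| < q].
{ apply: (@real_ulim R U uU _ (2 / e)); apply: (uS uU) ux => m /= [_ hx].
  apply: le_trans hx; rewrite -(ler_pXn2r (n := 2)) ?nnegrE ?normr_ge0 ?nv_ge0 // real_normK ?num_real //.
  by rewrite nv_sq; exact: (l2ip_coord (hv (x m))).
}
have [a0 ha0] := choice ch; pose a i := if (i < n)%N then a0 i else 0.
have supp i : (n <= i)%N -> a i = 0 by rewrite /a ltnNge => ->.
have inH : in_H (Some n) a.
{ split; last by move=> _ [<-].
  by apply/sqn_finP; exists (\sum_(i < n) a i ^+ 2); exact: fin_supp_sum.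
}
pose z : @Hpt R (Some n) := exist _ a inH.
exists (Some z) => // q q0; pose q1 := q / 2 / n.+1%:R.
have q10 : 0 < q1 by rewrite /q1; apply: divr_gt0; [lra | exact: ltr0Sn].
have hU : U [set m | forall i, (i < n)%N -> `|sval (x m) i - a0 i| < q1].
  by apply: (u_all uU) => i _; exact: ha0.
apply: (uS uU) (uI uU ux hU) => m /= [[Eu _] hm]; rewrite Eu.
have h1 : nv (hv (x m) - hv z) ^+ 2 <= \sum_(i < n) (sval (x m) i - a i) ^+ 2.
{ rewrite nv_sq -lee_fin -(l2_sqn (hv (x m) - hv z)); apply: sqn_le => N.
  apply: (fin_supp_sum (z := fun i => sval (x m) i - a i)) => i ni.
  have [_ hs] := proj2_sig (x m); by rewrite (hs n) // supp // subrr.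
}
have h2 : \sum_(i < n) (sval (x m) i - a i) ^+ 2 <= \sum_(i < n) q1 ^+ 2.
{ apply: ler_sum => i _; have := hm i (ltn_ord i); rewrite /a ltn_ord => h3.
  by rewrite -real_normK ?num_real // ler_pXn2r ?nnegrE ?normr_ge0 ?(ltW q10) // ltW.
}
have h4 : nv (hv (x m) - hv z) < q / 2.
{ have q2 : 0 < q / 2 by lra.
  rewrite -(ltr_pXn2r (n := 2)) ?nnegrE ?nv_ge0 ?(ltW q2) //.
  apply: le_lt_trans h1 _; apply: le_lt_trans h2 _.
  have E : q / 2 = q1 * n.+1%:R by rewrite /q1 divfK // pnatr_eq0.
  have -> : \sum_(i < n) q1 ^+ 2 = q1 ^+ 2 * n%:R by rewrite sumr_const card_ord mulr_natr.
  have -> : (q / 2) ^+ 2 = q1 ^+ 2 * n.+1%:R ^+ 2 by rewrite E exprMn.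
  rewrite ltr_pM2l ?exprn_gt0 //.
  rewrite -natrX ltr_nat; apply: (@leq_trans n.+1) => //; by rewrite -{1}(expn1 n.+1) leq_pexp2l.
}
rewrite chordalE /Nd; have W1 := Wt_ge1 (Some (x m) : T); have W2 := Wt_ge1 (Some z : T).
have W0 := nv_ge0 (hv (x m) - hv z).
move: h4 W0 W1 W2; move: (nv _) (Wt _) (Wt _) => y w v h4 y0 w1 v1.
have wv : 1 <= w * v by rewrite -[1]mulr1; apply: ler_pM.
rewrite ltr_pdivrMr; last lra.
apply: (@lt_le_trans _ _ q); first lra.
by rewrite ler_peMr ?(ltW q0) // mulrC.
Qed.

End FiniteDim.

(** * Proof of the theorem *)

Section HausdorffLinks.
Context {R : realType} (d : option nat).
Notation T := (@hat R d).

Lemma powR_le_exp (r s t : R) : 0 <= r <= 1 -> s <= t -> 0 < t -> r `^ t <= r `^ s.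
Proof.
move=> /andP[r0 r1] st t0; have [->|rn] := eqVneq r 0.
  by rewrite powR0 ?gt_eqF //; exact: powR_ge0.
have -> : t = s + (t - s) by ring.
rewrite powRD; last by rewrite rn implybT.
have h : r `^ (t - s) <= 1 `^ (t - s) by apply: ge0_ler_powR; rewrite ?nnegrE ?subr_ge0.
rewrite powR1 in h.
by rewrite -[X in _ <= X]mulr1; apply: ler_wpM2l => //; exact: powR_ge0.
Qed.

(** The covers have mesh at most 1, so raising the exponent from [s] to [t] only lowers their cost;
    as [t] is positive, empty sets cost nothing. *)
Lemma hmeasure0_cover (s t : R) (A : set T) : hmeasure s A = 0%E -> s <= t -> 0 < t ->
  forall e : R, 0 < e -> exists (V : nat -> set T) (r : nat -> R), [/\ A `<=` \bigcup_i V i,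
    forall i, 0 <= r i <= 1, forall i x y, V i x -> V i y -> chordal x y <= r i
    & forall n, \sum_(i < n) r i `^ t <= e].
Proof.
move=> h0 st t0 e e0.
have : (hcontent s 1 A < e%:E)%E.
{ apply: (@le_lt_trans _ _ 0%E); last by rewrite lte_fin.
  by rewrite -h0; apply: ereal_sup_ubound; exists 1 => //=; exact: ltr01.
}
move=> /ereal_inf_lt [_ [V [cov [dV ->]]] hS].
pose r i : R := if pselect (V i = set0) then 0 else fine (diam (V i)).
have ne i : V i <> set0 -> [/\ 0 <= fine (diam (V i)) <= 1 & forall x y, V i x -> V i y ->
    chordal x y <= fine (diam (V i))].
{ move=> /eqP/set0P [x0 Vx0].
  have dge x y : V i x -> V i y -> ((chordal x y)%:E <= diam (V i))%E.
    by move=> Vx Vy; apply: ereal_sup_ubound; exists x, y.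
  have d0 : (0 <= diam (V i))%E.
    by have := dge x0 x0 Vx0 Vx0; have [-> _ _] := @chordal_pd R d.
  have fd : diam (V i) \is a fin_num.
    by rewrite ge0_fin_numE //; apply: le_lt_trans (dV i) (ltry _).
  split; first by rewrite -!lee_fin (fineK fd) d0 dV.
  by move=> x y Vx Vy; rewrite -lee_fin (fineK fd); apply: dge.
}
have r01 i : 0 <= r i <= 1.
{ rewrite /r; case: pselect => hV; first by rewrite lexx ler01.
  by case: (ne i hV).
}
have term i : ((r i `^ t)%:E <= hterm s (V i))%E.
{ rewrite /hterm /r; case: pselect => hV; case: asboolP => hV' //.
    by rewrite powR0 ?gt_eqF.
  by rewrite lee_fin; apply: powR_le_exp => //; case: (ne i hV).
}
exists V, r; split => //.
- move=> i x y Vx Vy; rewrite /r; case: pselect => hV /=; first by move: Vx; rewrite hV.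
  by case: (ne i hV) => _; apply.
- move=> n; rewrite -lee_fin -sumEFin; apply: ltW; apply: le_lt_trans hS.
  have pos i : (0 <= hterm s (V i))%E.
    by apply: le_trans (term i); rewrite lee_fin powR_ge0.
  apply: le_trans (nneseries_lim_ge n (fun i _ _ => pos i)).
  by rewrite big_mkord; apply: lee_sum => i _.
Qed.

Lemma hmeasure0_Hnull (s : R) (k : nat) (A : set T) : (0 < k)%N -> s <= k%:R ->
  hmeasure s A = 0%E -> Hnull (@chordal R d) k A.
Proof.
move=> k0 sk h0; apply/(HnullP _ k0) => e e0.
have kp : 0 < k%:R :> R by rewrite ltr0n.
have [V [r [h1 h2 h3 h4]]] := hmeasure0_cover h0 sk kp e0.
exists 1, V, r; split => // n; apply: le_trans (h4 n).
by apply: ler_sum => i _; rewrite powR_mulrn //; case/andP: (h2 i).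
Qed.

Lemma HD_dim_le (G : set (T -> T)) (k : nat) :
  (HD (radial_set G) <= k%:R%:E)%E -> dim_le (@chordal R d) (limit_set G) (Zm G) k.
Proof.
move=> hHD s ks e e0.
have : (HD (radial_set G) < s%:E)%E by apply: le_lt_trans hHD _; rewrite lte_fin.
move=> /ereal_inf_lt [_ [s' [s'0 hs'] <-]]; rewrite lte_fin => s's.
have s0 : 0 < s by apply: le_lt_trans ks; rewrite ler0n.
have [V [r [h1 h2 h3 h4]]] := hmeasure0_cover hs' (ltW s's) s0 e0.
(* [Lr] may contain the point at infinity, which [radial_set] does not; the set of index 0 covers it
   at no cost. *)
exists (fun i => if i is j.+1 then V j else [set None]), (fun i => if i is j.+1 then r j else 0).
split.
- move=> p /Lr_radial [->|/h1 [i _ Vi]]; [by exists 0%N | by exists i.+1].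
- by case=> // i; case/andP: (h2 i).
- case=> [x y -> ->|i]; last exact: h3.
  by have [-> _ _] := @chordal_pd R d.
- case=> [|n]; first by rewrite big_ord0 ltW.
  by rewrite big_ord_recl /= powR0 ?gt_eqF // add0r; exact: h4.
Qed.

End HausdorffLinks.

Local Arguments ip {R V} _ _ : simpl never.

(** * From flat pictures back to generalized spheres *)

Section FlatSphere.
Context {R : realType} (d : option nat).
Notation T := (@hat R d).
Notation V := (l2space (R := R)).

Lemma l2_sum (n : nat) (t : 'I_n -> R) (v : 'I_n -> V) i :
  (\sum_j t j *: v j : l2) i = \sum_j t j * (v j : l2) i.
Proof.
elim: (index_enum _) => [|j l IH]; first by rewrite !big_nil.
by rewrite !big_cons l2DE IH.
Qed.

Definition supp (z : V) := forall n, d = Some n -> forall i, (n <= i)%N -> (z : l2) i = 0.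

Lemma supp_hv (x : @Hpt R d) : supp (hv x).
Proof. by move=> n E i ni; have [_ h] := proj2_sig x; exact: (h n). Qed.

Lemma supp_lin a y z : supp y -> supp z -> supp (a *: y + z).
Proof.
by move=> hy hz n E i ni; rewrite l2DE l2ZE (hy n) // (hz n) // mulr0 addr0.
Qed.

Lemma supp0 : supp 0. Proof. by []. Qed.

Lemma suppZ a y : supp y -> supp (a *: y).
Proof. by move=> hy; rewrite -[_ *: _]addr0; apply: supp_lin. Qed.

Lemma suppD y z : supp y -> supp z -> supp (y + z).
Proof. by move=> hy hz; rewrite -[y]scale1r; apply: supp_lin. Qed.

Lemma suppB y z : supp y -> supp z -> supp (y - z).
Proof. by move=> hy hz; rewrite -[- z]scaleN1r addrC; apply: supp_lin. Qed.

Lemma supp_sum n (t : 'I_n -> R) (v : 'I_n -> V) : (forall i, supp (v i)) -> supp (\sum_i t i *: v i).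
Proof.
move=> h; elim: (index_enum _) => [|i l IH]; first by rewrite big_nil.
by rewrite big_cons; apply: supp_lin.
Qed.

Lemma supp_Hpt z : supp z -> exists x : @Hpt R d, hv x = z.
Proof.
move=> hz; have hH : in_H d (z : l2) by split => //; have := l2P (z : l2); rewrite inE.
exists (exist _ _ hH); exact: l2_ext.
Qed.

Lemma in_affineP n (b : @Hpt R d) (v : 'I_n -> Hpt d) x :
  in_affine b v x <-> exists t : 'I_n -> R, hv x = hv b + \sum_j t j *: hv (v j).
Proof.
split=> -[t h]; exists t.
  by apply: l2_ext => i; rewrite l2DE l2_sum; exact: h.
by move=> i; have := congr1 (fun z : l2 => z i) h; rewrite l2DE l2_sum.
Qed.

Lemma lin_indep_orth n (v : 'I_n -> @Hpt R d) :
  (forall i j, i != j -> ip (hv (v i)) (hv (v j)) = 0) -> (forall i, hv (v i) <> 0) -> lin_indep v.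
Proof.
move=> ho hn t h j.
have h0 : \sum_i t i *: hv (v i) = 0 by apply: l2_ext => i; rewrite l2_sum; exact: h.
have := ip_suml (index_enum _) xpredT (fun i => t i *: hv (v i)) (hv (v j)).
rewrite h0 ip0l (bigD1 j) //= big1 => [|i ij]; last by rewrite (ipZl (t i)) ho // mulr0.
rewrite addr0 (ipZl (t j)) => /esym/eqP; rewrite mulf_eq0 => /orP[/eqP//|/eqP h1].
by case: (hn j); apply: ip_eq0.
Qed.

Context (K : set T) (k : nat) (xi : T) (w : 'I_k -> V) (v0 : T).
Hypothesis Kxi : K xi.
Hypothesis fr : frame (@Phi R d) K xi w.
Hypothesis coset : forall u v, K u -> u <> xi -> K v -> v <> xi -> exists t : 'I_k -> R,
    pic (@Phi R d) xi u = pic (@Phi R d) xi v + \sum_i t i *: w i.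
Hypothesis K0 : K v0.
Hypothesis v0x : v0 <> xi.

(** Pictures live in the space of [Phi], which has an extra coordinate. [Y] is a similar copy inside
    the copy of H, and [similarity_ext] transports the frame to it. *)
Lemma affine_image (Y : T -> V) (lam : R) : 0 < lam ->
  (forall u v, K u -> u <> xi -> K v -> v <> xi ->
     nv (Y u - Y v) = lam * nv (pic (@Phi R d) xi u - pic (@Phi R d) xi v)) ->
  (forall u, K u -> u <> xi -> supp (Y u)) ->
  exists wh : 'I_k -> V, [/\ forall i i', ip (wh i) (wh i') = (i == i')%:R,
    forall i, supp (wh i),
    forall u, K u -> u <> xi -> exists t : 'I_k -> R, Y u = Y v0 + \sum_i t i *: wh i
  & forall t : 'I_k -> R, exists u, [/\ K u, u <> xi & Y u = Y v0 + \sum_i t i *: wh i]].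
Proof.
move=> lam0 hY sY; have [A [h1 h2 h3]] := @similarity_ext R V V T (fun u => K u /\ u <> xi)
  (pic (@Phi R d) xi) Y lam v0 lam0 (conj K0 v0x)
  (fun i j Pi Pj => hY i j Pi.1 Pi.2 Pj.1 Pj.2).
have wD := frame_DS K0 v0x fr; have [worth winv] := fr.
have D0 := @DS_0 _ _ _ (@Phi R d) K xi v0; have DL := @DS_lin _ _ _ (@Phi R d) K xi v0.
have hh u v : K u -> u <> xi -> K v -> v <> xi ->
  Y u - Y v = lam *: A (pic (@Phi R d) xi u - pic (@Phi R d) xi v).
  by move=> *; apply: h1.
have As := @liso_sum _ _ _ _ _ D0 DL h2 h3 k.
exists (fun i => A (w i)); split.
- by move=> i i'; rewrite (liso_ip D0 DL h2 h3) // worth.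
- move=> i; have [v [Kv vx E]] := winv v0 (fun i' => (i' == i)%:R) K0 v0x.
  have Ew : \sum_i' (i' == i)%:R *: w i' = w i.
  { rewrite (bigD1 i) //= eqxx scale1r big1 ?addr0 // => i' i'i.
    by rewrite (negbTE i'i) scale0r.
  }
  have := hh v v0 Kv vx K0 v0x; rewrite E Ew addrAC subrr add0r => E2.
  have -> : A (w i) = lam^-1 *: (Y v - Y v0) by rewrite E2 scalerA mulVf ?gt_eqF // scale1r.
  by apply: suppZ; apply: suppB; exact: sY.
- move=> u Ku ux; have [t Et] := coset Ku ux K0 v0x; exists (fun i => lam * t i).
  have := hh u v0 Ku ux K0 v0x; rewrite Et addrAC subrr add0r As // scaler_sumr => E.
  rewrite -[LHS](subrK (Y v0)) E addrC; congr (_ + _); apply: eq_bigr => i _; by rewrite scalerA.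
- move=> t; have [v [Kv vx E]] := winv v0 (fun i => t i / lam) K0 v0x; exists v; split => //.
  have := hh v v0 Kv vx K0 v0x; rewrite E addrAC subrr add0r As // scaler_sumr => E2.
  rewrite -[LHS](subrK (Y v0)) E2 addrC; congr (_ + _); apply: eq_bigr => i _.
  by rewrite scalerA mulrCA divff ?gt_eqF // mulr1.
Qed.

Lemma pic_dist_Nd u v : u <> xi -> v <> xi ->
  nv (pic (@Phi R d) xi u - pic (@Phi R d) xi v) = Wt xi ^+ 2 * Nd u v / (2 * Nd u xi * Nd v xi).
Proof.
move=> ux vx; rewrite (pic_dist (@chordal_sep R d) (@chordal_Phi R d) ux vx) !chordalE.
have N1 : 0 < Nd u xi by rewrite lt_neqAle Nd_ge0 andbT eq_sym; apply/eqP => /Nd_eq0.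
have N2 : 0 < Nd v xi by rewrite lt_neqAle Nd_ge0 andbT eq_sym; apply/eqP => /Nd_eq0.
move: N1 N2 (Wt_gt0 u) (Wt_gt0 v) (Wt_gt0 xi).
move: (Nd u xi) (Nd v xi) (Nd u v) (Wt u) (Wt v) (Wt xi) => a b c p q r a0 b0 p0 q0 r0.
by field; rewrite !gt_eqF.
Qed.

Lemma orth_indep (wh : 'I_k -> V) (v : 'I_k -> @Hpt R d) :
  (forall i i', ip (wh i) (wh i') = (i == i')%:R) -> (forall i, hv (v i) = wh i) -> lin_indep v.
Proof.
move=> worth hv_; apply: lin_indep_orth => [i j ij|i]; rewrite !hv_.
  by rewrite worth (negbTE ij).
by move=> E; have := worth i i; rewrite E ip0l eqxx => /eqP; rewrite eq_sym oner_eq0.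
Qed.

(** K without infinity is its own picture enlarged by the factor 2, hence an affine subspace. *)
Lemma flat_sphere_infty : xi = None -> gen_sphere K k.
Proof.
move=> E; left; pose Y (u : T) : V := if u is Some x then hv x else 0.
have nx x : Some x <> xi :> T by rewrite E.
have hY u v : K u -> u <> xi -> K v -> v <> xi ->
     nv (Y u - Y v) = 2 * nv (pic (@Phi R d) xi u - pic (@Phi R d) xi v).
{ move=> _ ux _ vx; rewrite pic_dist_Nd //; case: u v ux vx => [u|] [v|] ux vx; try by rewrite E in ux vx.
  rewrite E /=; move: (nv _) => a; by field.
}
have sY u : K u -> u <> xi -> supp (Y u).
{ by case: u => [u|] _ ux; [exact: supp_hv | exact: supp0].
}
have [wh [worth ws h1 h2]] := affine_image (ltr0Sn _ _) hY sY.
have [v hv_] := choice (fun i => supp_Hpt (ws i)).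
have [x0 E0] : exists x0, v0 = Some x0.
{ by have := v0x; rewrite E; case: v0 => [x0|//] _; exists x0.
}
have hsum t : \sum_i t i *: hv (v i) = \sum_i t i *: wh i by apply: eq_bigr => i _; rewrite hv_.
have EY : Y v0 = hv x0 by rewrite E0.
exists x0, v; split; first exact: orth_indep hv_.
apply/seteqP; split=> [[x|] Kp /=|_ [->|[x [-> /in_affineP [t Et]]]]].
- right; exists x; split => //; apply/in_affineP; have [t Et] := h1 (Some x) Kp (nx x).
  by exists t; rewrite hsum -EY.
- by left.
- by rewrite -E.
- have [u [Ku ux Eu]] := h2 t; rewrite EY -hsum -Et in Eu.
  case: u Ku ux Eu => [x'|] Ku ux Eu; last by rewrite E in ux.
  by rewrite -(hv_inj Eu).
Qed.

Lemma ip_shift (y z : V) (c : R) :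
  ip (y - c *: z) (y - c *: z) = ip y y - 2 * c * ip y z + c ^+ 2 * ip z z.
Proof. rewrite ipDl !ipDr !ipNl !ipNr !(ipZl c) !(ipZr c) (ipC z y); ring. Qed.

(** The inversion at [a] turns K into an affine subspace of dimension [k]. If it passes through the
    origin, the inversion preserves it and K is an affine subspace; otherwise K is a sphere through
    [a]. *)
Lemma flat_sphere_fin a : xi = Some a -> gen_sphere K k.
Proof.
move=> E; pose Y (u : T) : V := if u is Some x then iv (hv x - hv a) else 0.
have W0 := Wt_gt0 xi.
have nz x : Some x <> xi :> T -> hv x - hv a <> 0.
{ move=> h0 /eqP; rewrite subr_eq0 => /eqP /hv_inj Ex; apply: h0; by rewrite E Ex.
}
have hY u v : K u -> u <> xi -> K v -> v <> xi ->
     nv (Y u - Y v) = 2 / Wt xi ^+ 2 * nv (pic (@Phi R d) xi u - pic (@Phi R d) xi v).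
{ move=> _ ux _ vx; rewrite pic_dist_Nd //.
  have key : nv (Y u - Y v) = Nd u v / (Nd u xi * Nd v xi).
  { case: u v ux vx => [u|] [v|] ux vx; rewrite E /Y /Nd.
    - rewrite iv_dist; [|exact: nz..].
      by have -> : hv u - hv a - (hv v - hv a) = hv u - hv v by vring.
    - by rewrite subr0 iv_nv mulr1 mul1r.
    - by rewrite sub0r nvN iv_nv !mul1r.
    - by rewrite subrr nv0 mul0r.
  }
  have N1 : 0 < Nd u xi by rewrite lt_neqAle Nd_ge0 andbT eq_sym; apply/eqP => /Nd_eq0.
  have N2 : 0 < Nd v xi by rewrite lt_neqAle Nd_ge0 andbT eq_sym; apply/eqP => /Nd_eq0.
  rewrite key; move: N1 N2 W0; move: (Nd u xi) (Nd v xi) (Nd u v) (Wt xi) => p q r s p0 q0 s0.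
  by field; rewrite !gt_eqF.
}
have sB (x : @Hpt R d) : supp (hv x - hv a) by apply: suppB; exact: supp_hv.
have sY u : K u -> u <> xi -> supp (Y u).
{ case: u => [u|] _ ux; [by apply: suppZ | exact: supp0].
}
have l0 : 0 < 2 / Wt xi ^+ 2 by apply: divr_gt0 => //; apply: exprn_gt0.
have [wh [worth ws h1 h2]] := affine_image l0 hY sY.
(* Foot of the perpendicular from the origin to the affine subspace. *)
pose z0 := Y v0 - \sum_i ip (Y v0) (wh i) *: wh i.
have z0w i : ip z0 (wh i) = 0 by rewrite /z0 ipDl ipNl (ip_wsum worth) subrr.
have sumD t t' : \sum_i (t i + t' i) *: wh i = \sum_i t i *: wh i + \sum_i t' i *: wh i.
  by rewrite -big_split; apply: eq_bigr => i _; rewrite scalerDl.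
have sumZ (c : R) t : \sum_i (c * t i) *: wh i = c *: \sum_i t i *: wh i.
  by rewrite scaler_sumr; apply: eq_bigr => i _; rewrite scalerA.
have E1 u : K u -> u <> xi -> exists t : 'I_k -> R, Y u = z0 + \sum_i t i *: wh i.
{ move=> Ku ux; have [t ->] := h1 u Ku ux; exists (fun i => ip (Y v0) (wh i) + t i).
  by rewrite sumD addrA /z0 subrK.
}
have E2 (t : 'I_k -> R) : exists u, [/\ K u, u <> xi & Y u = z0 + \sum_i t i *: wh i].
{ have [u [Ku ux Eu]] := h2 (fun i => - ip (Y v0) (wh i) + t i); exists u; split => //.
  rewrite Eu sumD addrA; congr (_ + _); rewrite /z0; congr (_ + _).
  by rewrite -[RHS]sumrN; apply: eq_bigr => i _; rewrite scaleNr.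
}
have sz0 : supp z0.
{ apply: suppB; [exact: sY | exact: supp_sum].
}
have Yn x : Some x <> xi :> T -> Y (Some x) <> 0.
{ move=> xx Y0; apply: (nz _ xx); by rewrite -[hv x - hv a]ivK -/(Y (Some x)) Y0 /iv scaler0.
}
have [v hv_] := choice (fun i => supp_Hpt (ws i)).
have hsum t : \sum_i t i *: hv (v i) = \sum_i t i *: wh i by apply: eq_bigr => i _; rewrite hv_.
have back x z : Some x <> xi :> T -> Y (Some x) = z -> hv x = hv a + iv z.
  by move=> _ <-; rewrite /Y ivK addrC subrK.
have [z00|zn] := pselect (z0 = 0).
- left; exists a, v; split; first exact: orth_indep hv_.
  apply/seteqP; split=> [[x|] Kp /=|_ [->|[x [-> /in_affineP [t Et]]]]]; [right|by left|..].
  + exists x; split => //; apply/in_affineP.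
    have [xx|xx] := pselect (Some x = xi :> T).
      exists (fun=> 0); rewrite big1 ?addr0; last by move=> i _; rewrite scale0r.
      by move: xx; rewrite E => -[->].
    have [t Et] := E1 _ Kp xx; rewrite z00 add0r in Et.
    exists (fun i => (ip (\sum_i t i *: wh i) (\sum_i t i *: wh i))^-1 * t i).
    by rewrite hsum sumZ (back x _ xx Et).
  + have [u [Ku ux Eu]] := E2 (fun=> 0).
    rewrite z00 add0r big1 in Eu; last by move=> i _; rewrite scale0r.
    by case: u Ku ux Eu => [x|] // Ku ux Eu; case: (Yn x ux).
  + have [xx|xx] := pselect (Some x = xi :> T); first by rewrite xx.
    rewrite hsum in Et; pose s := \sum_i t i *: wh i.
    have Es : hv x - hv a = s by rewrite Et addrAC subrr add0r.
    have [u [Ku ux Eu]] := E2 (fun i => (ip s s)^-1 * t i).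
    rewrite z00 add0r sumZ -/s -Es in Eu.
    case: u Ku ux Eu => [x'|] Ku ux Eu; last first.
      by case: (Yn x xx); exact: (esym Eu).
    have Ex : hv x' = hv x by rewrite (back x' _ ux Eu) -[_ *: _]/(iv (hv x - hv a)) ivK addrC subrK.
    by rewrite -(hv_inj Ex).
- right; pose rho := ip z0 z0.
  have nz0 := nv_gt0 zn; have rE : rho = nv z0 ^+ 2 by rewrite nv_sq.
  have rho0 : 0 < rho by rewrite rE exprn_gt0.
  (* Relative to [a], the inversion sends [z0] to [rho^-1 *: z0], the antipode of [a] on the sphere;
     so the centre is halfway and the radius is [(2 * nv z0)^-1]. *)
  have [c Ec] : exists c : @Hpt R d, hv c = hv a + (2 * rho)^-1 *: z0.
    by apply: supp_Hpt; apply: suppD; [exact: supp_hv | exact: suppZ].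
  have [zz Ezz] := supp_Hpt sz0.
  pose v' (i : 'I_k.+1) := if (insub (val i) : option 'I_k) is Some i0 then v i0 else zz.
  have V1 (i : 'I_k) : v' (widen_ord (leqnSn k) i) = v i by rewrite /v' /= valK.
  have V2 : v' ord_max = zz by rewrite /v' /= insubF // ltnn.
  have sum' t : \sum_i t i *: hv (v' i) = \sum_(i < k) t (widen_ord (leqnSn k) i) *: wh i + t ord_max *: z0.
  { rewrite big_ord_recr /= V2 Ezz; congr (_ + _); apply: eq_bigr => i _; by rewrite V1 hv_.
  }
  have cs (i : 'I_k.+1) : (exists i0, i = widen_ord (leqnSn k) i0) \/ i = ord_max.
  { have [lt|ge] := ltnP i k; first by left; exists (Ordinal lt); apply: val_inj.
    by right; apply: val_inj => /=; apply/eqP; rewrite eqn_leq ge -ltnS ltn_ord.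
  }
  pose mk (t : 'I_k -> R) (s : R) (i : 'I_k.+1) := if (insub (val i) : option 'I_k) is Some i0 then t i0 else s.
  have mk1 t s (i : 'I_k) : mk t s (widen_ord (leqnSn k) i) = t i by rewrite /mk /= valK.
  have mk2 t s : mk t s ord_max = s by rewrite /mk /= insubF // ltnn.
  have aff x (t : 'I_k -> R) (s : R) : hv x = hv a + \sum_i t i *: wh i + s *: z0 -> in_affine c v' x.
  { move=> Ex; apply/in_affineP; exists (mk t (s - (2 * rho)^-1)).
    rewrite sum' mk2 Ec Ex; have -> : \sum_(i < k) mk t (s - (2 * rho)^-1) (widen_ord (leqnSn k) i) *: wh i = \sum_i t i *: wh i.
      by apply: eq_bigr => i _; rewrite mk1.
    move: (\sum_i _) => S; vring.
  }
  have dist (x : @Hpt R d) : nv (hv x - hv c) ^+ 2 = ip (hv x - hv a) (hv x - hv a) - ip (hv x - hv a) z0 / rho + (4 * rho)^-1.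
  { have -> : hv x - hv c = (hv x - hv a) - (2 * rho)^-1 *: z0 by rewrite Ec; vring.
    rewrite nv_sq ip_shift -/rho; move: (ip _ _) (ip _ _) => p q.
    by field; rewrite gt_eqF.
  }
  have rad : (2 * nv z0)^-1 ^+ 2 = (4 * rho)^-1.
  { by rewrite rE; field; rewrite gt_eqF.
  }
  have r0 : 0 < (2 * nv z0)^-1 by rewrite invr_gt0 mulr_gt0.
  exists c, v', (2 * nv z0)^-1; split; last split => //.
  + apply: lin_indep_orth => [i j ij|i].
      have [[i0 Ei]|Ei] := cs i; have [[j0 Ej]|Ej] := cs j; rewrite Ei Ej ?V1 ?V2 ?hv_ ?Ezz.
      * rewrite worth; case: eqP => // Eij; by rewrite Ei Ej Eij eqxx in ij.
      * by rewrite ipC z0w.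
      * by rewrite z0w.
      * by rewrite Ei Ej eqxx in ij.
    have [[i0 ->]|->] := cs i; rewrite ?V1 ?V2 ?hv_ ?Ezz //.
    by move=> Ew; have := worth i0 i0; rewrite Ew ip0l eqxx => /eqP; rewrite eq_sym oner_eq0.
  + apply/seteqP; split=> [p Kp|p [x [-> [/in_affineP [t Et] hd]]]] /=.
    * have [x Ep] : exists x, p = Some x.
      { case: p Kp => [x|] Kp; first by exists x.
        have px : None <> xi :> T by rewrite E.
        have [t Et] := E1 _ Kp px; exfalso.
        have : ip (Y None) z0 = rho.
          by rewrite Et ipDl ip_suml big1 ?addr0 // => i _; rewrite (ipZl (t i)) ipC z0w mulr0.
        by rewrite /Y ip0l => h; move: rho0; rewrite -h ltxx.
      }
      rewrite Ep in Kp; exists x; split => //.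
      have [xx|xx] := pselect (Some x = xi :> T).
        have Ex : x = a by move: xx; rewrite E => -[].
        split; first by apply: (aff _ (fun=> 0) 0); rewrite Ex scale0r addr0 big1 ?addr0 // => i _; rewrite scale0r.
        rewrite nrm_sub; apply: (@pexpIrn _ 2) => //; rewrite ?nnegrE ?nv_ge0 ?(ltW r0) // dist rad Ex subrr !ip0l.
        by rewrite mul0r subrr add0r.
      have [t Et] := E1 _ Kp xx; set z := z0 + _ in Et.
      have zz0 : ip z z0 = rho.
        by rewrite /z ipDl ip_suml big1 ?addr0 // => i _; rewrite (ipZl (t i)) ipC z0w mulr0.
      have Ex := back x _ xx Et; pose q := (ip z z)^-1.
      have zn0 : ip z z != 0.
      { by apply/eqP => /ip_eq0 h; rewrite h in Et; case: (Yn x xx).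
      }
      split.
        apply: (aff _ (fun i => q * t i) q); rewrite Ex sumZ /iv -/q /z.
        move: (\sum_i _) => S; vring.
      rewrite nrm_sub; apply: (@pexpIrn _ 2) => //; rewrite ?nnegrE ?nv_ge0 ?(ltW r0) // dist rad.
      have -> : hv x - hv a = q *: z by rewrite Ex addrAC subrr add0r.
      rewrite (ipZl q) (ipZr q) (ipZl q) zz0 /q; field; by rewrite zn0 gt_eqF.
    * have [xx|xx] := pselect (Some x = xi :> T); first by rewrite xx.
      rewrite sum' in Et; set S := \sum_(i < k) _ in Et.
      (* On the sphere the squared norm of [hv x - hv a] equals its coefficient [al] along [z0];
         after inversion this coefficient becomes 1, so the image lies in the affine subspace. *)
      pose al := (2 * rho)^-1 + t ord_max.
      have Ey : hv x - hv a = al *: z0 + S by rewrite Et Ec /al; vring.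
      have Sz : ip S z0 = 0.
        by rewrite /S ip_suml big1 // => i _; rewrite (ipZl (t _)) ipC z0w mulr0.
      have hy : ip (hv x - hv a) z0 = al * rho by rewrite Ey ipDl (ipZl al) Sz addr0.
      have hal : ip (hv x - hv a) (hv x - hv a) = al.
      { have := dist x; rewrite -nrm_sub hd rad hy mulfK ?gt_eqF // => h; lra.
      }
      have yn := nz x xx.
      have al0 : al != 0 by rewrite -hal; apply/eqP => /ip_eq0.
      have [u [Ku ux Eu]] := E2 (fun i => al^-1 * t (widen_ord (leqnSn k) i)).
      have Ez : Y u = iv (hv x - hv a).
      { by rewrite Eu sumZ -/S /iv hal Ey scalerDr scalerA mulVf // scale1r.
      }
      case: u Ku ux Eu Ez => [x'|] Ku ux Eu Ez; last by case: (Yn x xx); exact: (esym Ez).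
      have Ex : hv x' = hv x by rewrite (back x' _ ux Ez) ivK addrC subrK.
      by rewrite -(hv_inj Ex).
Qed.

End FlatSphere.

(** With at most one point, K covers itself in a single colour at every scale. *)
Lemma two_points (R : realType) (U : set (set nat)) (T : Type) (d : T -> T -> R) (K : set T) n :
  (forall x, d x x = 0) -> ucompact U d K -> ~ coloured U d n K ->
  exists x1 x2, [/\ K x1, K x2 & x1 <> x2].
Proof.
move=> d0 cK nc; apply: contrapT => no; apply: nc => e e0.
exists unit, (fun=> K), (fun=> 0%N); split.
- by move=> _; split.
- move=> _ x y Kx Ky; have -> : x = y; last by rewrite d0 ltW.
  by apply: contrapT => xy; apply: no; exists x, y.
- by move=> x Kx; exists tt.
- by split => // -[] [].
Qed.

Lemma limit_set_ucompact (R : realType) (d : option nat) (G : set (@hat R d -> @hat R d))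
  (U : set (set nat)) : free_ultra U -> (d = None -> hcompact (limit_set G)) ->
  ucompact U (@chordal R d) (limit_set G).
Proof.
case: d G => [n|] G uU hcomp; last by apply: hcompact_ucompact => //; exact: hcomp.
move=> u Ku; have [x _ ux] := @hat_ucompact R n U uU u (fun=> I).
by exists x => //; exact: (limit_set_closed uU Ku ux).
Qed.

Theorem theorem1 (R : realType) (d : option nat) (G : set (@hat R d -> @hat R d)) :
  mobius_group G ->
  (d = None -> hcompact (limit_set G)) ->
  forall k : nat, (1 <= k)%N -> top_dim_eq (limit_set G) k ->
  (forall s : R, HD (radial_set G) = s%:E ->
     hmeasure s (limit_set G `\` radial_set G) = 0%E) ->
  ((k%:R)%:E < HD (radial_set G))%E \/ gen_sphere (limit_set G) k.
Proof.
move=> hG hcomp k k0 [_ ntd] hmeas.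
have [hlt|hle] := ltP (k%:R)%:E (HD (radial_set G)); [by left | right].
have [U uU] := free_ultra_exists.
have pd := @chordal_pd R d; have [d0 dC dt] := pd.
set K := limit_set G in ntd hmeas *.
have cK : ucompact U (@chordal R d) K by exact: limit_set_ucompact.
have ncol : ~ coloured U (@chordal R d) k.-1 K.
{ move=> hc; apply: (ntd k.-1); first by rewrite prednK.
  exact: (coloured_covdim uU pd (@chordal_sep R d) cK hc).
}
have [x1 [x2 [K1 K2 x12]]] := two_points d0 cK ncol.
have D0 : 0 < chordal x1 x2 / 2.
{ apply: divr_gt0 => //; exact: (Phi_gt0 (@chordal_sep R d) (@chordal_Phi R d)).
}
have hD u : K u -> exists2 v, K v & chordal x1 x2 / 2 <= chordal u v.
{ move=> Ku; have [h|h] := leP (chordal x1 x2 / 2) (chordal u x1); first by exists x1.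
  exists x2 => //; have := dt x1 u x2; rewrite (dC x1 u); lra.
}
have Zok := Zm_zmap hG D0 hD; have Zlim := Zm_lim hG D0 hD.
have c0 : 0 < 4 / (chordal x1 x2 / 2) by apply: divr_gt0.
(* The dimension is a real number because it is at most [k]; this gives access to [hmeas]. *)
have [s Es] : exists s : R, HD (radial_set G) = s%:E.
{ have h0 : (0 <= HD (radial_set G))%E.
    rewrite leNgt; apply/negP => /ereal_inf_lt [_ [s [s0 _] <-]]; by rewrite lte_fin ltNge s0.
  exists (fine (HD (radial_set G))); rewrite fineK // ge0_fin_numE //.
  exact: le_lt_trans hle (ltry _).
}
have Lnull : Hnull (@chordal R d) k (K `\` Lr K (Zm G)).
(* Null at the exponent [s] implies null at the larger exponent [k]. *)
{ have sk : s <= k%:R by rewrite -lee_fin -Es.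
  apply: Hnull_sub (hmeasure0_Hnull k0 sk (hmeas s Es)) => p [Kp np]; split => // rp.
  by apply: np; exact: (radial_Lr hG D0 hD).
}
have dimL := HD_dim_le hle.
have sep := @chordal_sep R d; have dP := @chordal_Phi R d; have le2 := @chordal_le2 R d.
have [xo Kxo Kfin] := Hfin_away uU pd sep le2 cK c0 Zok (@Zm_comp R d G hG) Zlim k0 dimL Lnull
  (ex_intro _ x1 K1).
have nK : ~ Hnull (@chordal R d) k K.
(* [tangent] for the empty frame produces a non-null subset of K. *)
{ move=> hn; have fr0 : frame (@Phi R d) K xo (fun _ : 'I_0 => 0).
    split => [[]//|u t Ku ux]; exists u; split => //; by rewrite big_ord0 addr0.
  have [eta eta0 ht] := tangent uU sep dP cK k0 Kfin ncol Kxo k0 fr0.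
  by apply: (ht 1 ltr01); apply: Hnull_sub hn => u [].
}
have [xi [w [Kxi fr coset]]] := flat_limit uU sep dP le2 cK c0 Zok Zlim k0 Kxo Kfin Lnull nK ncol.
have [v0 [Kv0 v0x]] : exists v0, K v0 /\ v0 <> xi.
{ have [E|E] := pselect (x1 = xi); last by exists x1.
  by exists x2; split => // E2; apply: x12; rewrite E E2.
}
case Exi : xi => [a|].
  exact: (flat_sphere_fin Kxi fr coset Kv0 v0x Exi).
exact: (flat_sphere_infty Kxi fr coset Kv0 v0x Exi).
Qed.
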